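(* Let $\Omega\subset\mathbb{R}^2$ be a bounded open connected set with Lipschitz connected boundary $\Gamma=\partial\Omega$. Suppose $\rho\in L^\infty(\Gamma)$ and $\rho_n=\mathbf{1}_{S_n}$ for measurable sets $S_n\subset\Gamma$, $n\ge1$, such that $$\lim_{n\to\infty}|A\cap S_n|=\int_A\rho(s)\,ds\qquad\text{for every measurable set }A\subset\Gamma,$$ where none of the weights $\rho$, $\rho_n$ is a.e. zero. Then $\rho_n\to\rho$ weak-$*$ in $L^\infty(\Gamma)$, and for each fixed integer $k\ge0$, $\lambda_k(\rho_n)\to\lambda_k(\rho)$ as $n\to\infty$. Consequently, for every integer $k\ge1$ and every $\alpha\in(0,1]$, $$\inf_{\rho\in\mathcal{A}_\alpha}\lambda_k(\rho)=\inf_{\substack{\Gamma_S\subset\Gamma\\|\Gamma_S|=\alpha|\Gamma|}}\sigma_k(\Gamma_S)\qquad\text{and}\qquad \sup_{\substack{\Gamma_S\subset\Gamma\\|\Gamma_S|=\alpha|\Gamma|}}\sigma_k(\Gamma_S)=\sup_{\rho\in\mathcal{A}_\alpha}\lambda_k(\rho),$$ where $\Gamma_S$ ranges over measurable subsets of $\Gamma$.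
   Context: Here $|\cdot|$ denotes arc-length measure on $\Gamma$, $ds$ integration with respect to it, and $\mathbf{1}_S$ the indicator function of $S$. For $\rho\in L^\infty(\Gamma)$ with $\rho\ge 0$ a.e. and $\rho$ not a.e. zero, the weighted Steklov eigenproblem is: $\Delta u=0$ in $\Omega$, $\partial_n u=\lambda\rho u$ on $\Gamma$ (understood weakly). Its eigenvalues, enumerated with multiplicity, are $0=\lambda_0(\rho)<\lambda_1(\rho)\le\lambda_2(\rho)\le\cdots\nearrow\infty$, and satisfy $$\lambda_k(\rho)=\min_{E_k\subset H^1(\Omega)}\ \max_{u\in E_k\setminus\{0\}}\frac{\int_\Omega|\nabla u|^2dx}{\int_\Gamma\rho u^2\,ds},$$ where $E_k$ ranges over $(k+1)$-dimensional subspaces of $H^1(\Omega)$ (and the quotient is $+\infty$ when the denominator vanishes). For a measurable $\Gamma_S\subset\Gamma$ of positive measure, with $\Gamma_N=\Gamma\setminus\Gamma_S$, the Steklov–Neumann eigenproblem is: $\Delta u=0$ in $\Omega$, $\partial_nu=\sigma u$ on $\Gamma_S$, $\partial_nu=0$ on $\Gamma_N$; its eigenvalues $0=\sigma_0<\sigma_1\le\sigma_2\le\cdots$, counted with multiplicity, are $\sigma_k(\Gamma_S)=\lambda_k(\mathbf{1}_{\Gamma_S})$. For $\alpha\in(0,1]$ the admissible set is $$\mathcal{A}_\alpha=\Big\{\rho\in L^\infty(\Gamma):\ 0\le\rho(s)\le1\text{ for a.e. }s\in\Gamma,\ \int_\Gamma\rho\,ds=\alpha|\Gamma|\Big\}.$$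 *)

(* Defs.v *)
From HB Require Import structures.
From mathcomp Require Import all_boot all_order all_algebra.
From mathcomp Require Import all_classical all_reals all_analysis.

Set Implicit Arguments.
Unset Strict Implicit.
Unset Printing Implicit Defensive.

Import Order.TTheory GRing.Theory Num.Theory.
Import numFieldNormedType.Exports.

Local Open Scope classical_set_scope.
Local Open Scope ring_scope.

Section Plane.
Context {R : realType}.
Implicit Types (p q : R * R) (A Omega : set (R * R)).

(* The library norm on R * R is the max norm, hence the explicit formula. *)
Definition edist p q : R :=
  Num.sqrt ((p.1 - q.1) ^+ 2 + (p.2 - q.2) ^+ 2).

(* The maximum with 0 makes the diameter of the empty set 0 instead of -oo. *)
Definition diam A : \bar R :=
  maxe 0%E (ereal_sup [set (edist pq.1 pq.2)%:E | pq in A `*` A]).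

Definition small_diam (delta : R) A : \bar R :=
  if (diam A <= delta%:E)%E then diam A else +oo%E.

Lemma small_diam_ge0 delta A : (0 <= small_diam delta A)%E.
Proof. by rewrite /small_diam; case: ifPn => _ //; rewrite /diam le_max lexx. Qed.

Lemma diam0 : diam set0 = 0%E.
Proof.
rewrite /diam setX0 image_set0 ereal_sup0; exact/max_idPl.
Qed.

Lemma small_diam0 delta : 0 < delta -> small_diam delta set0 = 0%E.
Proof. by move=> d0; rewrite /small_diam diam0 lee_fin ltW. Qed.

(* One-dimensional Hausdorff outer measure, normalised so that a segment has
   its length.  [mu_ext] takes countable covers by Borel sets; this changes
   nothing, since a set and its closure have the same diameter. *)
Definition hausdorff1 A : \bar R :=
  ereal_sup [set mu_ext (small_diam delta) A | delta in [set d : R | 0 < d]].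

Lemma hausdorff1_ge0 A : (0 <= hausdorff1 A)%E.
Proof.
apply: (@le_trans _ _ (mu_ext (small_diam 1) A)).
  by apply: mu_ext_ge0 => X; exact: small_diam_ge0.
by apply: ereal_sup_ubound; exists 1 => /=.
Qed.

Lemma hausdorff1_set0 : hausdorff1 set0 = 0%E.
Proof.
apply/eqP; rewrite eq_le hausdorff1_ge0 andbT.
apply: ge_ereal_sup => _ [d /= d0 <-].
rewrite mu_ext0 //; first exact: small_diam0.
by move=> X; exact: small_diam_ge0.
Qed.

Lemma le_hausdorff1 : {homo hausdorff1 : A B / A `<=` B >-> (A <= B)%E}.
Proof.
move=> A B AB; apply: ge_ereal_sup => _ [d /= d0 <-].
apply: (le_trans (le_mu_ext _ AB)).
by apply: ereal_sup_ubound; exists d.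
Qed.

Lemma hausdorff1_sigma_subadditive : sigma_subadditive hausdorff1.
Proof.
move=> F; apply: ge_ereal_sup => _ [d /= d0 <-].
have ge0 X : (0 <= small_diam d X)%E by exact: small_diam_ge0.
apply: (le_trans (mu_ext_sigma_subadditive ge0 F)).
apply: lee_nneseries => [i _ _|i _ ]; first exact: mu_ext_ge0.
by apply: ereal_sup_ubound; exists d.
Qed.

HB.instance Definition _ := isOuterMeasure.Build R (R * R)%type hausdorff1
  hausdorff1_set0 hausdorff1_ge0 le_hausdorff1 hausdorff1_sigma_subadditive.

Definition hausdorff1_outer : {outer_measure set (R * R) -> \bar R} :=
  hausdorff1.

(* The plane with the sigma-algebra of sets that are Caratheodory-measurable
   for the one-dimensional Hausdorff outer measure.  Since arcT also unfolds to
   R * R, sets need the type ascription [set arcT] for [measurable] to refer to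
   this sigma-algebra and not to the Borel one. *)
Definition arcT := caratheodory_type hausdorff1_outer.

Definition arclength : {measure set arcT -> \bar R} :=
  [the measure _ _ of
   (hausdorff1_outer : set (caratheodory_type hausdorff1_outer) -> \bar R)].

(* Borel sigma-algebra; [measurableTypeR R] is R as the domain of
   [lebesgue_measure]. *)
Definition planeT := (measurableTypeR R * measurableTypeR R)%type.

Definition area : {measure set planeT -> \bar R} :=
  [the measure _ _ of (@lebesgue_measure R \x @lebesgue_measure R)%E].

Definition boundary Omega : set (R * R) := closure Omega `\` interior Omega.

(* Near each boundary point, in a rotated frame centred at that point, Omega is
   the part of a rectangle lying strictly above the graph of a Lipschitz
   function; the boundary is then the graph itself. *)
Definition lipschitz_boundary Omega : Prop :=
  forall p, boundary Omega p ->
  exists (c s r h : R) (f : R -> R),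
    [/\ c ^+ 2 + s ^+ 2 = 1, 0 < r, 0 < h,
        [lipschitz f x | x in setT] &
        forall a b : R, `|a| < r -> `|b| < h ->
          Omega (p.1 + a * c - b * s, p.2 + a * s + b * c) <-> f a < b].

Definition e1 : R * R := (1, 0).
Definition e2 : R * R := (0, 1).

Fixpoint Ck (k : nat) (f : R * R -> R) : Prop :=
  if k is k'.+1 then
    [/\ forall x, derivable f x e1, forall x, derivable f x e2,
        Ck k' ('D_e1 f) & Ck k' ('D_e2 f)]
  else continuous f.

Definition smooth (f : R * R -> R) : Prop := forall k, Ck k f.

Definition test_function Omega (phi : R * R -> R) : Prop :=
  let K := closure [set x | phi x != 0] in
  [/\ smooth phi, compact K & K `<=` Omega].

Definition L2 d (T : measurableType d) (mu : {measure set T -> \bar R})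
    (D : set T) (f : T -> R) : Prop :=
  measurable_fun D f /\ (\int[mu]_(x in D) ((f x) ^+ 2)%:E < +oo)%E.

Definition weak_derivative Omega (v : R * R) (u g : R * R -> R) : Prop :=
  L2 area Omega g /\
  forall phi, test_function Omega phi ->
    \int[area]_(x in Omega) (u x * 'D_v phi x) =
    - \int[area]_(x in Omega) (g x * phi x).

Definition H1 Omega (u : R * R -> R) : Prop :=
  [/\ L2 area Omega u,
      exists g, weak_derivative Omega e1 u g &
      exists g, weak_derivative Omega e2 u g].

(* A representative of the a.e. class of weak derivatives. *)
Definition wD Omega (v : R * R) (u : R * R -> R) : R * R -> R :=
  xget (fun=> 0) [set g | weak_derivative Omega v u g].

Definition is_trace Omega (u : R * R -> R) (g : arcT -> R) : Prop :=
  L2 arclength (boundary Omega) g /\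
  exists phi : nat -> R * R -> R,
    [/\ forall n, smooth (phi n),
        (fun n => \int[area]_(x in Omega)
           ((phi n x - u x) ^+ 2 + ('D_e1 (phi n) x - wD Omega e1 u x) ^+ 2
            + ('D_e2 (phi n) x - wD Omega e2 u x) ^+ 2)%:E)%E @ \oo --> 0%E &
        (fun n => \int[arclength]_(x in boundary Omega)
           ((phi n x - g x) ^+ 2)%:E)%E @ \oo --> 0%E].

(* A representative of the trace, which is unique a.e. for Lipschitz Omega. *)
Definition trace Omega (u : R * R -> R) : arcT -> R :=
  xget (fun=> 0) [set g | is_trace Omega u g].

Definition Linfty Omega (rho : arcT -> R) : Prop :=
  measurable_fun (boundary Omega : set arcT) rho /\
  exists M : R, {ae arclength, forall x, boundary Omega x -> `|rho x| <= M}.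

Definition ae_zero Omega (rho : arcT -> R) : Prop :=
  {ae arclength, forall x, boundary Omega x -> rho x = 0}.

Definition weakstar_cvg Omega (rho_ : nat -> arcT -> R) (rho : arcT -> R) :=
  forall f : arcT -> R,
    arclength.-integrable (boundary Omega) (EFin \o f) ->
    (fun n => \int[arclength]_(x in boundary Omega) (rho_ n x * f x)) @ \oo -->
    \int[arclength]_(x in boundary Omega) (rho x * f x).

(* Weak form of: u is harmonic in Omega and its normal derivative on the
   boundary is lam * rho * u.  The zero function is included. *)
Definition steklov_eigenspace Omega (rho : arcT -> R) (lam : R)
    (u : R * R -> R) : Prop :=
  H1 Omega u /\
  forall v, H1 Omega v ->
    \int[area]_(x in Omega) (wD Omega e1 u x * wD Omega e1 v x
                             + wD Omega e2 u x * wD Omega e2 v x) =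
    lam * \int[arclength]_(x in boundary Omega)
            (rho x * trace Omega u x * trace Omega v x).

Definition lin_indep_ae Omega (n : nat) (u : 'I_n -> R * R -> R) : Prop :=
  forall c : 'I_n -> R,
    {ae area, forall x, Omega x -> \sum_(i < n) c i * u i x = 0} ->
    forall i, c i = 0.

(* The eigenvalue of index k, counted from 0 with multiplicity: the least t
   such that the eigenspaces for eigenvalues <= t contain together at least
   k + 1 linearly independent functions. *)
Definition steklov Omega (rho : arcT -> R) (k : nat) : \bar R :=
  ereal_inf [set t%:E | t in [set t : R |
    exists u : 'I_k.+1 -> R * R -> R,
      lin_indep_ae Omega u /\
      forall i, exists2 lam, lam <= t & steklov_eigenspace Omega rho lam (u i)]].

Definition steklov_neumann Omega (S : set arcT) (k : nat) : \bar R :=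
  steklov Omega (\1_S) k.

Definition admissible Omega (alpha : R) : set (arcT -> R) :=
  [set rho : arcT -> R | [/\ Linfty Omega rho,
     {ae arclength, forall x, boundary Omega x -> 0 <= rho x <= 1} &
     (\int[arclength]_(x in boundary Omega) (rho x)%:E =
      alpha%:E * arclength (boundary Omega))%E]].

Definition admissible_sets Omega (alpha : R) : set (set arcT) :=
  [set S : set arcT | [/\ measurable (S : set arcT), S `<=` boundary Omega &
     (arclength S = alpha%:E * arclength (boundary Omega))%E]].

End Plane.

Arguments arcT R : clear implicits.

(* Main.v *)
(* The eigenvalues are read off two quadratic forms on H1: the Dirichlet form a(u, u), and the boundary
   form b(u, u), the integral of rho u^2 over the boundary.  By min-max the k-th eigenvalue is at most t
   exactly when a <= t b on some (k+1)-dimensional subspace.  If b_n -> b pointwise and all these forms are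
   dominated by a form e that is compact for the H1 norm, then a subspace that is good for b is almost good
   for b_n, and conversely weak limits of subspaces that are good for b_n are good for b; hence the
   eigenvalues converge.  Here e(u, u) is the integral of u^2 over the domain plus that of its squared trace
   over the boundary.  Its compactness comes from Rellich's theorem (little mass in thin strips along the
   Lipschitz boundary, Poincare's inequality on small squares inside) and from the trace inequality; a and b
   have no common kernel since the domain is connected.
   For the second part, cut the boundary into small pieces, each inside a chart.  Arc length has no atoms, so
   each piece contains a set whose length is the integral of rho over the piece.  The unions of these sets
   have weights converging to rho, so every eigenvalue of an admissible weight is a limit of eigenvalues of
   admissible sets. *)
From HB Require Import structures.
Require Import Defs.
From mathcomp Require Import all_boot all_order all_algebra.
From mathcomp Require Import all_classical all_reals all_analysis.
From mathcomp Require Import ring lra measurable_realfun.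

Set Implicit Arguments.
Unset Strict Implicit.
Unset Printing Implicit Defensive.

Import Order.TTheory GRing.Theory Num.Theory.
Import numFieldNormedType.Exports.

Local Open Scope classical_set_scope.
Local Open Scope ring_scope.

(** * Compact pencils of quadratic forms *)

Section PsdForms.
Context {R : realType} {V : lmodType R}.
Implicit Types (b h a m e : V -> V -> R) (u v w : V).

(** The definition of [steklov] counts eigenfunctions, whereas convergence is a statement about
    min-max levels. The bridge is the existence of eigenvectors, by constrained minimization of the
    Rayleigh quotient, and the orthogonality of those with distinct eigenvalues. Elements of [h1]
    are functions rather than classes modulo null sets, so the forms are only semidefinite;
    independence is stated relative to a form by [definite_on], and limits matter only up to the
    kernel of [h]. Weak limits are taken along an ultrafilter finer than the tails, so that all
    pairings [h (u n) v] converge at once. Traces are limits of functions smooth on the whole plane,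
    hence such functions must be dense in [H1] up to the boundary. Near a boundary point the
    mollifying kernel is therefore moved off centre, so that only values inside the domain are
    averaged. Straightening a Lipschitz graph is a shear, which preserves area; on the boundary,
    Hausdorff measure is compared with Lebesgue measure through the bound for the length of a
    Lipschitz image. *)

Record psd_form b : Prop := PsdForm {
  formC : forall u v, b u v = b v u;
  form_lin : forall (c : R) u v w, b (c *: u + v) w = c * b u w + b v w;
  form_ge0 : forall u, 0 <= b u u }.

Definition comb n (u : 'I_n -> V) (c : 'I_n -> R) : V := \sum_i c i *: u i.

Section one_form.
Variables (b : V -> V -> R) (bP : psd_form b).

Lemma formDl u v w : b (u + v) w = b u w + b v w.
Proof. by rewrite -{1}[u]scale1r (form_lin bP) mul1r. Qed.

Lemma form0l w : b 0 w = 0.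
Proof. by have /eqP := formDl 0 0 w; rewrite addr0 -subr_eq0 opprD addNKr oppr_eq0 => /eqP. Qed.

Lemma formZl c u w : b (c *: u) w = c * b u w.
Proof. by rewrite -[c *: u]addr0 (form_lin bP) form0l addr0. Qed.

Lemma formNl u w : b (- u) w = - b u w.
Proof. by rewrite -scaleN1r formZl mulN1r. Qed.

Lemma formDr u v w : b w (u + v) = b w u + b w v.
Proof. by rewrite !(formC bP w) formDl. Qed.

Lemma formZr c u w : b w (c *: u) = c * b w u.
Proof. by rewrite !(formC bP w) formZl. Qed.

Lemma formNr u w : b w (- u) = - b w u.
Proof. by rewrite !(formC bP w) formNl. Qed.

Lemma form_suml n (u : 'I_n -> V) c w : b (comb u c) w = \sum_i c i * b (u i) w.
Proof.
rewrite /comb; elim/big_ind2 : _ => [|x1 x2 y1 y2 <- <-|i _].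
- exact: form0l.
- exact: formDl.
- exact: formZl.
Qed.

Lemma form_sumr n (u : 'I_n -> V) c w : b w (comb u c) = \sum_i c i * b w (u i).
Proof.
by rewrite (formC bP) form_suml; apply: eq_bigr => i _; rewrite (formC bP).
Qed.

Lemma form_comb n (u : 'I_n -> V) c :
  b (comb u c) (comb u c) = \sum_i \sum_j c i * c j * b (u i) (u j).
Proof.
rewrite form_suml; apply: eq_bigr => i _; rewrite form_sumr mulr_sumr.
by apply: eq_bigr => j _; rewrite mulrA.
Qed.

Lemma form_quad u v (t : R) :
  b (u + t *: v) (u + t *: v) = b u u + 2 * t * b u v + t ^+ 2 * b v v.
Proof. by rewrite !(formDl, formDr, formZl, formZr) (formC bP v u); ring. Qed.

Lemma form_diag_sub u v :
  b u u = b v v + 2 * b (u - v) v + b (u - v) (u - v).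
Proof. by rewrite !(formDl, formDr, formNl, formNr) (formC bP v u); ring. Qed.

Lemma form_sqD u v : b (u + v) (u + v) <= 2 * b u u + 2 * b v v.
Proof.
have := form_ge0 bP (u - v).
rewrite !(formDl, formDr, formNl, formNr) (formC bP v u); lra.
Qed.

Lemma form_polar u v : b u v = (b (u + v) (u + v) - b (u - v) (u - v)) / 4.
Proof. by rewrite !(formDl, formDr, formNl, formNr) (formC bP v u); field. Qed.

End one_form.

(** The polynomial is evaluated at its minimum [- b / a]; if [a = 0] it is affine, and unless
    [b = 0] it takes the value -1. All Cauchy-Schwarz inequalities and first-variation arguments
    below are instances. *)
Lemma discriminant_le (c b a : R) : 0 <= a ->
  (forall t, 0 <= c + 2 * t * b + t ^+ 2 * a) -> b ^+ 2 <= a * c.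
Proof.
rewrite le_eqVlt => /predU1P[<- H|a0 H].
- have [->|b0] := eqVneq b 0; first by rewrite expr0n mul0r.
  have := H (- (c + 1) / (2 * b)).
  have -> : c + 2 * (- (c + 1) / (2 * b)) * b + (- (c + 1) / (2 * b)) ^+ 2 * 0 = -1.
    by field.
  by lra.
- have := H (- b / a).
  have -> : c + 2 * (- b / a) * b + (- b / a) ^+ 2 * a = (a * c - b ^+ 2) / a.
    by field; rewrite gt_eqF.
  by rewrite pmulr_lge0 ?invr_gt0// subr_ge0.
Qed.

Lemma form_CS b (bP : psd_form b) u v : b u v ^+ 2 <= b u u * b v v.
Proof.
rewrite mulrC; apply: discriminant_le; first exact: form_ge0.
by move=> t; rewrite -form_quad//; exact: form_ge0.
Qed.

(** Cauchy-Schwarz puts an isotropic vector of a semidefinite form into its kernel. *)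
Lemma form_eq0 b (bP : psd_form b) u v : b u u = 0 -> b u v = 0.
Proof.
move=> u0; have := form_CS bP u v; rewrite u0 mul0r => H.
by apply/eqP; rewrite -sqrf_eq0 eq_le H sqr_ge0.
Qed.

(** Completeness for a seminorm: the limit is determined only up to the kernel of [h]. *)
Definition complete_form h := forall u : nat -> V,
  (forall eps : R, 0 < eps -> exists N, forall i j, (N <= i)%N -> (N <= j)%N ->
     h (u i - u j) (u i - u j) <= eps) ->
  exists l, h (u n - l) (u n - l) @[n --> \oo] --> (0 : R).

Lemma cvg0_sq_bound (T : Type) (F : set_system T) (FF : Filter F) (x y : T -> R) (C : R) :
  (\forall t \near F, x t ^+ 2 <= C * y t) -> y t @[t --> F] --> (0 : R) ->
  x t @[t --> F] --> (0 : R).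
Proof.
move=> xy y0; apply/cvgrPdist_lt => eps eps0.
have Cy : C * y t @[t --> F] --> C * 0 by apply: cvgM => //; exact: cvg_cst.
rewrite mulr0 in Cy.
have e2 : 0 < eps ^+ 2 by rewrite exprn_gt0.
move/cvgrPdist_lt : Cy => /(_ _ e2) Cy.
near=> t; rewrite sub0r normrN.
have xt : x t ^+ 2 <= C * y t by near: t.
have : `|0 - C * y t| < eps ^+ 2 by near: t.
rewrite sub0r normrN => /(le_lt_trans (ler_norm _)) /(le_lt_trans xt).
by move=> xe; rewrite ltr_norml; apply/andP; split; nra.
Unshelve. all: by end_near. Qed.

Arguments cvg0_sq_bound [T F FF x y] C _ _.

Lemma cvg_sq_bound (T : Type) (F : set_system T) (FF : Filter F) (x y : T -> R) (l C : R) :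
  (\forall t \near F, (x t - l) ^+ 2 <= C * y t) -> y t @[t --> F] --> (0 : R) ->
  x t @[t --> F] --> l.
Proof.
move=> xy y0; have H : x t - l @[t --> F] --> (0 : R) by exact: cvg0_sq_bound xy y0.
rewrite -[l]add0r; under eq_fun do rewrite -[x _](subrK l).
by apply: cvgD => //; exact: cvg_cst.
Qed.

Arguments cvg_sq_bound [T F FF x y l] C _ _.

Lemma harmonic_cvg0 : (n.+1%:R : R)^-1 @[n --> \oo] --> (0 : R).
Proof. exact: cvg_harmonic. Qed.

Lemma cvg_form_l b (bP : psd_form b) (T : Type) (F : set_system T) (FF : Filter F)
    (u_ : T -> V) u v :
  b (u_ t - u) (u_ t - u) @[t --> F] --> (0 : R) -> b (u_ t) v @[t --> F] --> b u v.
Proof.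
move=> H.
have H0 : b (u_ t - u) v @[t --> F] --> (0 : R).
  apply: (cvg0_sq_bound (b v v)) H => //.
  by apply: nearW => t; rewrite mulrC; exact: form_CS.
rewrite -[b u v]addr0.
under eq_fun do rewrite -[u_ _](subrK u) addrC formDl//.
by apply: cvgD => //; exact: cvg_cst.
Qed.

(* Dirichlet principle: a minimizing sequence of [h v v - 2 l v] is Cauchy. *)
Lemma riesz h (hP : psd_form h) (l : V -> R) (M : R) : complete_form h ->
  (forall (c : R) u v, l (c *: u + v) = c * l u + l v) ->
  (forall u, l u ^+ 2 <= M * h u u) ->
  exists w, forall v, h w v = l v.
Proof.
move=> hcpl lP lM.
have l0 : l 0 = 0.
  have /eqP := lP 1 0 0; rewrite scaler0 addr0 mul1r -subr_eq0 opprD addNKr.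
  by rewrite oppr_eq0 => /eqP.
have lZ c u : l (c *: u) = c * l u by rewrite -[c *: u]addr0 lP l0 addr0.
have lD u v : l (u + v) = l u + l v by rewrite -{1}[u]scale1r lP mul1r.
pose J v := h v v - 2 * l v.
(* With [x = h v v] and [A] the absolute value of [M], boundedness of [l] gives
   [J v >= x - 2 sqrt (A x) >= - A]. *)
have Jlb v : - `|M| <= J v.
  rewrite /J; have hv := form_ge0 hP v.
  have : (l v) ^+ 2 <= `|M| * h v v.
    by apply: (le_trans (lM v)); rewrite ler_wpM2r// ler_norm.
  have : 0 <= `|M| by [].
  move: (`|M|) (h v v) (l v) hv => A x y x0 A0 yA.
  rewrite leNgt; apply/negP => H.
  have : 0 < 2 * y - (x + A) by lra.
  have : 0 < 2 * y + (x + A) by lra.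
  by have := sqr_ge0 (x - A); nra.
pose JE := [set J v | v in setT].
have JE0 : has_inf JE.
  split; first by exists (J 0), 0.
  by exists (- `|M|) => _ [v _ <-].
pose m := inf JE.
have mJ v : m <= J v by apply: ge_inf; [exact: JE0.2|exists v].
have /choice[u uP] : forall n, exists v, J v < m + n.+1%:R^-1.
  move=> n; have n0 : 0 < n.+1%:R^-1 :> R by rewrite invr_gt0 ltr0Sn.
  by have [_ [v _ <-] vm] := inf_adherent n0 JE0; exists v.
(* Euler's equation with an error: [u n] misses the infimum by less than [n.+1%:R^-1], so
   [J (u n + t *: v) >= m] is a polynomial inequality in [t] whose discriminant gives the bound. *)
have hl n v : (h (u n) v - l v) ^+ 2 <= h v v * n.+1%:R^-1.
  apply: discriminant_le; first exact: form_ge0.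
  move=> t; have := mJ (u n + t *: v); have := uP n.
  rewrite /J (form_quad hP) lD lZ.
  move: (h _ _) (h _ _) (h _ _) (l _) (l _) (_^-1) => x1 x2 x3 x4 x5 x6; nra.
have [w wP] : exists l, h (u n - l) (u n - l) @[n --> \oo] --> (0 : R).
  apply: hcpl => eps eps0.
  have : (4 * n.+1%:R^-1 : R) @[n --> \oo] --> (4 * 0 : R).
    by apply: cvgM; [exact: cvg_cst|exact: harmonic_cvg0].
  rewrite mulr0 => /cvgrPdist_lt/(_ _ eps0)[N _ NP]; exists N => i j Ni Nj.
  have lti k : (N <= k)%N -> 4 * k.+1%:R^-1 < eps.
    by move=> /NP /=; rewrite sub0r normrN => /(le_lt_trans (ler_norm _)).
  have := lti _ Ni; have := lti _ Nj; have := uP i; have := uP j.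
  (* Parallelogram identity: comparing [J] at the midpoint with its infimum bounds the distance of
     two almost minimizers. *)
  have := mJ (2^-1 *: (u i + u j)).
  rewrite /J lZ lD !(formZl hP, formZr hP, formDl hP, formDr hP, formNl hP, formNr hP).
  rewrite (formC hP (u j) (u i)).
  by move: (i.+1%:R^-1) (j.+1%:R^-1) => x y; lra.
exists w => v.
have hv : h (u n) v @[n --> \oo] --> h w v by exact: cvg_form_l.
have hv' : h (u n) v @[n --> \oo] --> l v.
  apply: (cvg_sq_bound (h v v)) harmonic_cvg0.
  by apply: nearW => n; exact: hl.
exact: (cvg_unique _ hv hv').
Qed.

(** The image filter clusters somewhere in a segment by compactness, and an ultrafilter converges to
    its cluster points. *)
Lemma ultra_bounded_cvg (F : set_system nat) (FU : UltraFilter F) (x : nat -> R) (K : R) :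
  (\forall n \near F, `|x n| <= K) -> exists l : R, x n @[n --> F] --> l.
Proof.
move=> xK.
have [|l [_ lcl]] := @segment_compact R (- K) K (x n @[n --> F]) _.
  by near=> n; rewrite /= in_itv /= -ler_norml; near: n.
exists l => B Bl.
have [//|FB] := in_ultra_setVsetC (x @^-1` B) FU.
have [y [By]] := lcl (~` B) B FB Bl.
by [].
Unshelve. all: by end_near. Qed.

(** The limits of [h (u n) v] along the ultrafilter form a linear functional of [v], bounded by
    Cauchy-Schwarz; Riesz represents it by [w]. *)
Lemma weak_limit h (hP : psd_form h) (hcpl : complete_form h) (F : set_system nat)
    (FU : UltraFilter F) (u : nat -> V) (M : R) :
  (\forall n \near F, h (u n) (u n) <= M) ->
  exists w, forall v, h (u n) v @[n --> F] --> h w v.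
Proof.
move=> uM.
have bnd v : \forall n \near F, (h (u n) v) ^+ 2 <= M * h v v.
  near=> n; apply: (le_trans (form_CS hP _ _)).
  by rewrite ler_wpM2r ?form_ge0//; near: n.
have /choice[l lP] : forall v, exists l : R, h (u n) v @[n --> F] --> l.
  move=> v; apply: (@ultra_bounded_cvg _ FU _ (1 + `|M * h v v|)).
  near=> n; have : (h (u n) v) ^+ 2 <= M * h v v by near: n.
  have := ler_norm (M * h v v); have := normr_ge0 (M * h v v).
  move: (h (u n) v) (M * _) => x z y0 zy xz.
  by rewrite ler_norml; apply/andP; split; nra.
have [c u1 u2|v|w wP] := @riesz h hP l M hcpl.
- have H : h (u n) (c *: u1 + u2) @[n --> F] --> c * l u1 + l u2.
    under eq_fun do rewrite (formDr hP) (formZr hP).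
    by apply: cvgD; [apply: cvgM; [exact: cvg_cst|exact: lP]|exact: lP].
  exact: (cvg_unique _ (lP _) H).
- have H : (h (u n) v) ^+ 2 @[n --> F] --> (l v) ^+ 2.
    by rewrite expr2; under eq_fun do rewrite expr2; apply: cvgM; exact: lP.
  exact: (cvgr_to_le H (bnd v)).
by exists w => v; rewrite wP.
Unshelve. all: by end_near. Qed.

End PsdForms.

(** * Finite families: independence and orthonormalization *)

Section FiniteDim.
Context {R : realType} {V : lmodType R}.

Lemma cvg_sum_real (T I : Type) (F : set_system T) {FF : Filter F} (r : seq I)
    (f : T -> I -> R) (l : I -> R) :
  (forall i, f t i @[t --> F] --> l i) ->
  \sum_(i <- r) f t i @[t --> F] --> \sum_(i <- r) l i.
Proof.
move=> fl; elim: r => [|i r IH].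
  by rewrite big_nil; under eq_fun do rewrite big_nil; exact: cvg_cst.
by rewrite big_cons; under eq_fun do rewrite big_cons; exact: cvgD.
Qed.

(** An [n] by [m] matrix with [m < n] has dependent rows. This supplies a combination of [u]
    orthogonal to [m] given vectors, both for Gram-Schmidt and for the next eigenvector. *)
Lemma common_kernel n m (u : 'I_n -> V) (l : 'I_m -> V -> R) : (m < n)%N ->
  exists c : 'I_n -> R, (exists i, c i != 0) /\
    forall j, \sum_i c i * l j (u i) = 0.
Proof.
move=> mn; pose M : 'M[R]_(n, m) := \matrix_(i, j) l j (u i).
have : kermx M != 0.
  rewrite kermx_eq0 /row_free; apply/negP => /eqP Mn.
  by have := rank_leq_col M; rewrite Mn leqNgt mn.
move=> /rowV0Pn[x /sub_kermxP xM x0].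
exists (fun i => x ord0 i); split.
  apply/existsP; apply: contraNT x0; rewrite negb_exists => /forallP x0.
  by apply/eqP/rowP => i; rewrite mxE; apply/eqP; rewrite -[_ == _]negbK; exact: x0.
move=> j; have /rowP/(_ j) := xM; rewrite !mxE => xMj; rewrite -[RHS]xMj.
by apply: eq_bigr => i _; rewrite mxE.
Qed.

Variables (b : V -> V -> R) (bP : psd_form b).

(** Linear independence modulo the kernel of [b]. *)
Definition definite_on n (u : 'I_n -> V) :=
  forall c, b (comb u c) (comb u c) = 0 -> forall i, c i = 0.

Lemma form_normalize w : b w w != 0 -> b ((Num.sqrt (b w w))^-1 *: w) ((Num.sqrt (b w w))^-1 *: w) = 1.
Proof.
move=> w0; rewrite (formZl bP) (formZr bP) mulrA -expr2 exprVn sqr_sqrtr ?form_ge0//.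
by rewrite mulVf.
Qed.

Lemma combZ n (u : 'I_n -> V) c (k : R) : k *: comb u c = comb u (fun i => k * c i).
Proof. by rewrite /comb scaler_sumr; apply: eq_bigr => i _; rewrite scalerA. Qed.

Lemma comb_comb n p (u : 'I_n -> V) (v : 'I_p -> V) (d : 'I_p -> 'I_n -> R) c :
  (forall i, v i = comb u (d i)) -> comb v c = comb u (fun j => \sum_i c i * d i j).
Proof.
move=> vE; rewrite /comb; under eq_bigr do rewrite vE /comb scaler_sumr.
rewrite exchange_big; apply: eq_bigr => j _; rewrite scaler_suml.
by apply: eq_bigr => i _; rewrite scalerA.
Qed.

Definition orthonormal n (v : 'I_n -> V) := forall i j, b (v i) (v j) = (i == j)%:R.

Lemma orthonormal_comb n (v : 'I_n -> V) c : orthonormal v ->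
  b (comb v c) (comb v c) = \sum_i c i ^+ 2.
Proof.
move=> vO; rewrite (form_comb bP); apply: eq_bigr => i _.
rewrite (bigD1 i)//= big1 ?addr0 => [|j ji]; first by rewrite vO eqxx mulr1 expr2.
by rewrite vO eq_sym (negbTE ji) mulr0.
Qed.

Lemma sum_sqr_eq0 n (c : 'I_n -> R) : \sum_i c i ^+ 2 = 0 -> forall i, c i = 0.
Proof.
move=> /eqP; rewrite psumr_eq0 => [|i _]; last exact: sqr_ge0.
by move=> /allP H i; apply/eqP; rewrite -sqrf_eq0; apply: H; rewrite mem_index_enum.
Qed.

Lemma orthonormal_definite n (v : 'I_n -> V) : orthonormal v -> definite_on v.
Proof. by move=> vO c; rewrite orthonormal_comb//; exact: sum_sqr_eq0. Qed.

(* [ord_tuple] of a sequence indexed by nat avoids casts when a family grows. *)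
Lemma orthonormalize n (u : 'I_n -> V) : definite_on u ->
  exists2 v : 'I_n -> V, orthonormal v & exists d, forall i, v i = comb u (d i).
Proof.
move=> uD.
suff H m : (m <= n)%N -> exists v : nat -> V,
    (forall i j, (i < m)%N -> (j < m)%N -> b (v i) (v j) = (i == j)%:R) /\
    (forall i, (i < m)%N -> exists d, v i = comb u d).
  have [v [vO vE]] := H n (leqnn n).
  exists (fun i => v (val i)); first by move=> i j; rewrite vO ?ltn_ord// val_eqE.
  have /choice[d dP] : forall i : 'I_n, exists d, v i = comb u d by move=> i; exact: vE.
  by exists d.
elim: m => [|m IH] mn; first by exists (fun=> 0).
have [v [vO vE]] := IH (ltnW mn).
(* The next vector is found by counting dimensions: a combination of all of [u] orthogonal to the
   [m] vectors already built. *)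
have [c [[i0 ci0] cP]] := @common_kernel n m u (fun j w => b w (v j)) mn.
pose w := comb u c.
have w0 : b w w != 0.
  by apply/negP => /eqP/uD/(_ i0) => ci; rewrite ci eqxx in ci0.
pose k := (Num.sqrt (b w w))^-1.
have wv j : (j < m)%N -> b (k *: w) (v j) = 0.
  by move=> jm; rewrite (formZl bP) (form_suml bP) (cP (Ordinal jm)) mulr0.
exists (fun i => if i == m then k *: w else v i); split=> [i j|i].
  rewrite !ltnS => im jm.
  have [ei|im'] := eqVneq i m; have [ej|jm'] := eqVneq j m.
  - by rewrite ei ej eqxx form_normalize.
  - by rewrite wv ?ltn_neqAle ?jm' // ei eq_sym (negbTE jm').
  - by rewrite (formC bP) wv ?ltn_neqAle ?im' // ej (negbTE im').
  - by rewrite vO // ltn_neqAle ?im' ?jm'.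
rewrite ltnS => im; case: (eqVneq i m) => [_|im'].
  by exists (fun i => k * c i); rewrite combZ.
by apply: vE; rewrite ltn_neqAle im'.
Qed.

End FiniteDim.

(** * Levels of a pencil and their convergence *)

Section Levels.
Context {R : realType} {V : lmodType R}.

(** Here [h = a + m] is the Hilbert norm, split into energy and mass, and [e] dominates [m] and all
    [b_ n]. Compactness of [e] is phrased along ultrafilters: bounded families that tend weakly to 0
    tend to 0 for [e]. The field [sys_ker] is what keeps families of bounded energy bounded for
    [h]. *)
Record form_system (h a m e : V -> V -> R) (K : R) (b_ : nat -> V -> V -> R)
    (b : V -> V -> R) : Prop := FormSystem {
  sys_h : psd_form h; sys_a : psd_form a; sys_m : psd_form m; sys_e : psd_form e;
  sys_bn : forall n, psd_form (b_ n); sys_b : psd_form b;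
  sys_complete : complete_form h;
  sys_ham : forall u v, h u v = a u v + m u v;
  sys_me : forall u, m u u <= e u u;
  sys_compact : forall (F : set_system nat) (FU : UltraFilter F) (w : nat -> V) (M : R),
    (\forall n \near F, h (w n) (w n) <= M) ->
    (forall v, h (w n) v @[n --> F] --> (0 : R)) ->
    e (w n) (w n) @[n --> F] --> (0 : R);
  sys_bne : forall n u, b_ n u u <= K * e u u;
  sys_bcvg : forall u v, b_ n u v @[n --> \oo] --> b u v;
  sys_ker : forall u, a u u = 0 -> b u u = 0 -> m u u = 0 }.

Context {h a m e : V -> V -> R} {K : R} {b_ : nat -> V -> V -> R} {b : V -> V -> R}.
Variable (S : form_system h a m e K b_ b).

Let hP := sys_h S.
Let aP := sys_a S.
Let mP := sys_m S.
Let eP := sys_e S.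
Let bnP := sys_bn S.
Let bP := sys_b S.

(** The form changes with [n] together with its argument: expanding around the fixed [u] leaves
    [b_ n u u], which converges by hypothesis, and terms in [u_ n - u], which the uniform bound by
    [K * e] and Cauchy-Schwarz send to 0. *)
Lemma moving_form_diag_cvg (F : set_system nat) {FF : Filter F} u_ u : \oo `<=` F ->
  e (u_ n - u) (u_ n - u) @[n --> F] --> (0 : R) ->
  b_ n (u_ n) (u_ n) @[n --> F] --> b u u.
Proof.
move=> oF eu.
have -> : b u u = b u u + 2 * 0 + 0 by ring.
under eq_fun do rewrite (form_diag_sub (bnP _) _ u).
have dd : b_ n (u_ n - u) (u_ n - u) @[n --> F] --> (0 : R).
  have Ke : K * e (u_ n - u) (u_ n - u) @[n --> F] --> (0 : R).
    by rewrite -[0 in X in _ --> X](mulr0 K); apply: cvgM => //; exact: cvg_cst.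
  apply: (squeeze_cvgr _ (cvg_cst 0) Ke).
  by apply: nearW => n; rewrite form_ge0//= (sys_bne S).
apply: cvgD => //; apply: cvgD.
  by move=> A /(sys_bcvg S) /oF.
apply: cvgM; first exact: cvg_cst.
apply: (@cvg0_sq_bound _ _ _ FF (fun n => b_ n (u_ n - u) u) _ (K * e u u) _ dd).
apply: nearW => n; apply: (le_trans (form_CS (bnP n) _ _)); rewrite mulrC.
by apply: ler_wpM2r; [exact: form_ge0|exact: (sys_bne S)].
Qed.

Lemma moving_form_cvg (F : set_system nat) {FF : Filter F} u_ v_ u v : \oo `<=` F ->
  e (u_ n - u) (u_ n - u) @[n --> F] --> (0 : R) ->
  e (v_ n - v) (v_ n - v) @[n --> F] --> (0 : R) ->
  b_ n (u_ n) (v_ n) @[n --> F] --> b u v.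
Proof.
move=> oF eu ev; rewrite (form_polar bP).
under eq_fun do rewrite (form_polar (bnP _)).
have bound : 2 * e (u_ n - u) (u_ n - u) + 2 * e (v_ n - v) (v_ n - v) @[n --> F] --> (0 : R).
  have -> : 0 = 2 * 0 + 2 * 0 :> R by ring.
  by apply: cvgD; apply: cvgM => //; exact: cvg_cst.
have eN w : e (- w) (- w) = e w w by rewrite (formNl eP) (formNr eP) opprK.
apply: cvgM; last exact: cvg_cst; apply: cvgB; apply: moving_form_diag_cvg => //.
- apply: (squeeze_cvgr _ (cvg_cst 0) bound).
  by apply: nearW => n; rewrite form_ge0//= opprD addrACA form_sqD.
- apply: (squeeze_cvgr _ (cvg_cst 0) bound).
  apply: nearW => n; rewrite form_ge0//= (_ : _ - _ - _ = (u_ n - u) - (v_ n - v)).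
    by apply: (le_trans (form_sqD eP _ _)); rewrite eN.
  by rewrite !opprD !opprK addrACA.
Qed.

(** Compactness turns the weak limit for [h] into a strong limit for [e], hence for [m]; subtracting
    [m] from [h] leaves weak convergence for [a]. *)
Lemma weak_limit_compact (F : set_system nat) {FU : UltraFilter F} (u : nat -> V) (M : R) :
  (\forall n \near F, h (u n) (u n) <= M) ->
  exists w, (forall v, a (u n) v @[n --> F] --> a w v) /\
    e (u n - w) (u n - w) @[n --> F] --> (0 : R).
Proof.
move=> uM; have [w wP] := weak_limit hP (sys_complete S) FU uM.
have ew : e (u n - w) (u n - w) @[n --> F] --> (0 : R).
  apply: (sys_compact S FU (M := 2 * M + 2 * h w w)).
    near=> n; apply: (le_trans (form_sqD hP _ _)).
    rewrite (formNl hP) (formNr hP) opprK lerD2r ler_pM2l//.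
    by near: n.
  move=> v; rewrite -(subrr (h w v)).
  under eq_fun do rewrite (formDl hP) (formNl hP).
  by apply: cvgB => //; exact: cvg_cst.
exists w; split => // v.
have mw : m (u n) v @[n --> F] --> m w v.
  apply: (cvg_form_l mP); apply: (squeeze_cvgr _ (cvg_cst 0) ew).
  by apply: nearW => n; rewrite form_ge0//= (sys_me S).
have aE w' : a w' v = h w' v - m w' v by rewrite (sys_ham S) addrK.
by rewrite aE; under eq_fun do rewrite aE; apply: cvgB.
Unshelve. all: by end_near. Qed.

(** Pass to the limit in [a (u n) w ^+ 2 <= a (u n) (u n) * a w w] and divide by [a w w]. *)
Lemma weak_lower_semicontinuous (F : set_system nat) {FF : ProperFilter F} u w (M : R) :
  (forall v, a (u n) v @[n --> F] --> a w v) ->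
  (forall eps, 0 < eps -> \forall n \near F, a (u n) (u n) <= M + eps) ->
  a w w <= M.
Proof.
move=> uw uM; apply/ler_addgt0Pr => eps eps0.
have := form_ge0 aP w; rewrite le_eqVlt => /predU1P[<-|aw0].
  have /filter_ex[n] := uM _ eps0; exact/le_trans/form_ge0.
rewrite -(ler_pM2r aw0) -expr2.
have H : (a (u n) w) ^+ 2 @[n --> F] --> (a w w) ^+ 2.
  by rewrite expr2; under eq_fun do rewrite expr2; apply: cvgM.
apply: (cvgr_to_le H).
near=> n; apply: (le_trans (form_CS aP _ _)); rewrite ler_pM2r//.
by near: n; exact: uM.
Unshelve. all: by end_near. Qed.

(* If the energies were bounded but [h] were not, the normalized family would
   have a nonzero limit on which both [a] and [b] vanish. *)
Lemma energy_bounded (F : set_system nat) {FU : UltraFilter F} (u : nat -> V) (M : R) :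
  \oo `<=` F ->
  (\forall n \near F, a (u n) (u n) + b_ n (u n) (u n) <= M) ->
  exists M', \forall n \near F, h (u n) (u n) <= M'.
Proof.
move=> oF uM; apply: contrapT => /forallNP unb.
have hinf M' : \forall n \near F, M' < h (u n) (u n).
  have [/unb//|H] := in_ultra_setVsetC [set n | h (u n) (u n) <= M'] FU.
  by apply: filterS H => n /= /negP; rewrite -ltNge.
pose k n := (Num.sqrt (h (u n) (u n)))^-1.
pose w n := k n *: u n.
have h1 : \forall n \near F, h (w n) (w n) = 1.
  by apply: filterS (hinf 0) => n hn; rewrite /w form_normalize// gt_eqF.
have k2 n : k n ^+ 2 = (h (u n) (u n))^-1 by rewrite exprVn sqr_sqrtr// form_ge0.
have k0 (c : V -> V -> R) n : psd_form c -> c (w n) (w n) = (h (u n) (u n))^-1 * c (u n) (u n).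
  by move=> cP; rewrite /w (formZl cP) (formZr cP) mulrA -expr2 k2.
have small eps : 0 < eps -> \forall n \near F, a (w n) (w n) + b_ n (w n) (w n) <= eps.
  move=> eps0; near=> n.
  have hn : Num.max 1 (M / eps) < h (u n) (u n) by near: n; exact: hinf.
  move: hn; rewrite gt_max => /andP[hn1 hn2].
  rewrite (k0 _ _ aP) (k0 _ _ (bnP n)) -mulrDr mulrC ler_pdivrMr ?(lt_trans _ hn1)//.
  apply: (@le_trans _ _ M); first by near: n.
  by rewrite -ler_pdivrMl// mulrC ltW.
have [z [az ez]] := @weak_limit_compact F FU w 1 (filterS (fun n H => eq_ind_r (fun x => x <= 1) (lexx 1) H) h1).
have az0 : a z z = 0.
  apply/eqP; rewrite eq_le form_ge0// andbT.
  apply: (@weak_lower_semicontinuous F _ w z 0 az) => eps eps0; rewrite add0r.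
  apply: filterS (small _ eps0) => n; apply: le_trans; rewrite lerDl; exact: form_ge0.
have bz0 : b z z = 0.
  apply/eqP; rewrite eq_le form_ge0// andbT.
  have H : b_ n (w n) (w n) @[n --> F] --> b z z by exact: moving_form_diag_cvg.
  apply/ler_addgt0Pr => eps eps0; rewrite add0r; apply: (cvgr_to_le H).
  apply: filterS (small _ eps0) => n; apply: le_trans; rewrite lerDr; exact: form_ge0.
have mz0 := sys_ker S az0 bz0.
have mw : m (w n) (w n) @[n --> F] --> (0 : R).
  under eq_fun do rewrite (form_diag_sub mP _ z) mz0 (formC mP _ z) (form_eq0 mP _ mz0) mulr0 !add0r.
  apply: (squeeze_cvgr _ (cvg_cst 0) ez).
  by apply: nearW => n; rewrite form_ge0//= (sys_me S).
(* Contradiction: [h = a + m] equals 1 on the normalized family, but [a] and [m] both become at most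
   one quarter. *)
have /filter_ex[n [hn [an mn]]] : \forall n \near F, h (w n) (w n) = 1 /\
    (a (w n) (w n) + b_ n (w n) (w n) <= 1/4 /\ m (w n) (w n) < 1/4).
  apply: filterI => //; apply: filterI; first by apply: small; lra.
  have /cvgrPdist_lt := mw; have q0 : 0 < 1/4 :> R by lra.
  by move=> /(_ _ q0); apply: filterS => n; rewrite sub0r normrN; exact/le_lt_trans/ler_norm.
by have := form_ge0 (bnP n) (w n); move: hn; rewrite (sys_ham S); lra.
Unshelve. all: by end_near. Qed.

Lemma energy_limit (F : set_system nat) {FU : UltraFilter F} (u : nat -> V) (M : R) :
  \oo `<=` F ->
  (\forall n \near F, a (u n) (u n) + b_ n (u n) (u n) <= M) ->
  exists w, (forall v, a (u n) v @[n --> F] --> a w v) /\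
    e (u n - w) (u n - w) @[n --> F] --> (0 : R).
Proof.
by move=> oF /(energy_bounded oF)[M' /weak_limit_compact].
Qed.

(** The constant sequence [w] is weakly null, so compactness makes the constant [e w w] tend to
    0. *)
Lemma sys_null w : h w w = 0 -> e w w = 0.
Proof.
move=> hw; have [F [FU oF]] := @ultraFilterLemma nat \oo _.
have H : e w w @[_ --> F] --> (0 : R).
  apply: (sys_compact S FU (w := fun=> w) (M := 0)).
    by apply: nearW => n; rewrite hw.
  by move=> v; under eq_fun do rewrite (form_eq0 hP _ hw); exact: cvg_cst.
exact: (cvg_unique _ (cvg_cst (e w w)) H).
Qed.

Lemma sys_null_b w : h w w = 0 -> b w w = 0.
Proof.
move=> /sys_null ew; have H : b_ n w w @[n --> \oo] --> b w w by exact: (sys_bcvg S).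
have bw n : b_ n w w = 0.
  by apply/eqP; rewrite eq_le form_ge0// andbT (le_trans (sys_bne S n w))// ew mulr0.
move: H; under eq_fun do rewrite bw.
by move=> H; exact: (cvg_unique _ H (cvg_cst (0 : R))).
Qed.

(* By the min-max principle, [level c k t] means that the eigenvalue of index [k] is at most [t]. *)
Definition level (c : V -> V -> R) (k : nat) (t : R) := exists u : 'I_k.+1 -> V,
  definite_on h u /\ forall x, a (comb u x) (comb u x) <= t * c (comb u x) (comb u x).

(** On a combination where [c] vanishes the level inequality kills [a], then the kernel condition
    kills [m], hence [h]. So the test space is definite for [c] and can be orthonormalized. *)
Lemma level_orthonormal (c : V -> V -> R) k t : psd_form c ->
  (forall u, a u u = 0 -> c u u = 0 -> m u u = 0) -> level c k t ->
  exists2 v : 'I_k.+1 -> V, orthonormal c v &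
    forall x, a (comb v x) (comb v x) <= t * \sum_i x i ^+ 2.
Proof.
move=> cP cker [u [uh ua]].
have uc : definite_on c u.
  move=> x cx; apply: uh; have ax : a (comb u x) (comb u x) = 0.
    by apply/eqP; rewrite eq_le form_ge0// andbT (le_trans (ua x))// cx mulr0.
  by rewrite (sys_ham S) ax cker// addr0.
have [v vO [d vE]] := orthonormalize cP uc.
exists v => // x; rewrite -(orthonormal_comb cP _ vO) (comb_comb _ vE); exact: ua.
Qed.

Lemma orthonormal_level k t (v : 'I_k.+1 -> V) : orthonormal b v ->
  (forall x, a (comb v x) (comb v x) <= t * \sum_i x i ^+ 2) -> level b k t.
Proof.
move=> vO va; exists v; split => [x /sys_null_b|x]; first exact: orthonormal_definite.
by rewrite (orthonormal_comb bP x vO).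
Qed.

(** The test space for [b] is kept: its Gram matrix for [b_ n] tends to the identity, and the gap
    [t - t'] absorbs the error. *)
Lemma level_upper k t t' : t' < t -> level b k t' ->
  \forall n \near \oo, level (b_ n) k t.
Proof.
move=> tt /(level_orthonormal bP (sys_ker S))[v vO va].
(* Entries of the Gram matrix within [eta] of the identity change the quadratic form by at most
   [eta * k.+1%:R] times the sum of squares; after multiplication by [t] this is still below
   [t - t']. The added 1 covers [t = 0]. *)
pose eta := (t - t') / ((`|t| + 1) * k.+1%:R).
have eta0 : 0 < eta by rewrite divr_gt0 ?subr_gt0// mulr_gt0// ltr_wpDl.
have : \forall n \near \oo, forall i j, `|(i == j)%:R - b_ n (v i) (v j)| < eta.
  apply: filter_forall => i; apply: filter_forall => j.
  rewrite -vO; have H : b_ n (v i) (v j) @[n --> \oo] --> b (v i) (v j) by exact: (sys_bcvg S).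
  by have /cvgrPdist_lt/(_ _ eta0) := H.
apply: filterS => n bnv; exists v; split => [x /sys_null_b|x].
  exact: orthonormal_definite.
apply: (le_trans (va x)).
set s := \sum_i x i ^+ 2.
have s0 : 0 <= s by apply: sumr_ge0 => i _; exact: sqr_ge0.
have bd : `|s - b_ n (comb v x) (comb v x)| <= eta * k.+1%:R * s.
  rewrite [X in `|X - _|](esym (orthonormal_comb bP x vO)) (form_comb bP) (form_comb (bnP n)) -sumrB.
  apply: (le_trans (ler_norm_sum _ _ _)).
  apply: (@le_trans _ _ (\sum_i \sum_j eta * ((x i ^+ 2 + x j ^+ 2) / 2))).
    apply: ler_sum => i _; rewrite -sumrB; apply: (le_trans (ler_norm_sum _ _ _)).
    apply: ler_sum => j _; rewrite -mulrBr vO normrM mulrC.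
    apply: ler_pM => //; first exact/ltW/bnv.
    rewrite normrM -(real_normK (num_real (x i))) -(real_normK (num_real (x j))).
    by have := sqr_ge0 (`|x i| - `|x j|); nra.
  rewrite le_eqVlt; apply/orP; left; apply/eqP.
  under eq_bigr do rewrite -mulr_sumr -mulr_suml big_split/= sumr_const card_ord.
  rewrite -mulr_sumr -mulr_suml big_split/= sumr_const card_ord -/s sumrMnl -/s.
  have E (q x1 x2 : R) : x1 * ((x2 * q + x2 * q) / 2) = x1 * q * x2 by field.
  by rewrite -(mulr_natr s) E.
have {}bd : `|t| * `|s - b_ n (comb v x) (comb v x)| <= (t - t') * s.
  apply: (le_trans (ler_wpM2l (normr_ge0 t) bd)); rewrite !mulrA ler_wpM2r//.
  rewrite /eta (_ : _ * _ * _ = (t - t') * (`|t| / (`|t| + 1))); last first.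
    have := ltr0Sn R k; have := normr_ge0 t; move: (k.+1%:R : R) (`|t|) => q y y0 q0; field.
    by rewrite !gt_eqF//; lra.
  rewrite ler_piMr ?subr_ge0 ?ltW// ltr_pdivrMr ?ltr_wpDl// mul1r; lra.
have := ler_norm (t * (s - b_ n (comb v x) (comb v x))); rewrite normrM.
by move: bd; lra.
Qed.

(* The families orthonormal for [b_ n] converge weakly along an ultrafilter; compactness keeps the limit orthonormal for [b]. *)
Lemma level_lower k t :
  (forall n u, a u u = 0 -> b_ n u u = 0 -> m u u = 0) ->
  (forall N, exists2 n, (N <= n)%N & level (b_ n) k t) -> level b k t.
Proof.
move=> kern H; pose A := [set n | level (b_ n) k t].
(* The good indices are cofinal, so tails restricted to them form a proper filter, which is refined
   to an ultrafilter. *)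
have GP : ProperFilter (within A \oo).
  apply: Build_ProperFilter_ex => B [N _ NB]; have [n Nn An] := H N.
  by exists n; exact: NB.
have [F [FU GF]] := ultraFilterLemma GP.
have oF : \oo `<=` F by move=> B oB; apply: GF; apply: filterS oB => n Bn _.
have FA : F A by apply: GF; apply: nearW.
have /choice[v vP] : forall n, exists v : 'I_k.+1 -> V, A n -> orthonormal (b_ n) v /\
    forall x, a (comb v x) (comb v x) <= t * \sum_i x i ^+ 2.
  move=> n; have [/(level_orthonormal (bnP n) (kern n))[v vO va]|An] := pselect (A n).
    by exists v.
  by exists (fun=> 0) => /An.
have vn n i : A n -> a (v n i) (v n i) <= t.
  move=> /vP[_ /(_ (fun j => (j == i)%:R))].
  rewrite /comb (bigD1 i)//= eqxx scale1r big1 ?addr0; last first.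
    by move=> j /negbTE ->; rewrite scale0r.
  rewrite (bigD1 i)//= eqxx expr1n big1 ?addr0 ?mulr1//.
  by move=> j /negbTE ->; rewrite expr0n.
have /choice[w wP] : forall i, exists w, (forall x, a (v n i) x @[n --> F] --> a w x) /\
    e (v n i - w) (v n i - w) @[n --> F] --> (0 : R).
  move=> i; apply: (@energy_limit F FU (fun n => v n i) (t + 1) oF).
  apply: filterS FA => n An; apply: lerD; first exact: vn.
  by have [-> _] := vP _ An; rewrite eqxx.
apply: (orthonormal_level (v := w)) => [i j|x].
  have H1 : b_ n (v n i) (v n j) @[n --> F] --> b (w i) (w j).
    exact: moving_form_cvg oF (wP i).2 (wP j).2.
  have H2 : b_ n (v n i) (v n j) @[n --> F] --> ((i == j)%:R : R).
    apply: cvg_near_cst.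
    by apply: filterS FA => n An; have [-> _] := vP _ An.
  exact: (cvg_unique _ H1 H2).
apply: (@weak_lower_semicontinuous F _ (fun n => comb (v n) x)) => [y|eps eps0].
  rewrite (form_suml aP); under eq_fun do rewrite (form_suml aP).
  apply: cvg_sum_real => i; apply: cvgM; [exact: cvg_cst|exact: (wP i).1].
apply: filterS FA => n /vP[_ /(_ x)] /le_trans; apply; by rewrite lerDl ltW.
Qed.

End Levels.

(** * Eigenvectors and levels of a fixed pencil *)

Section Eigen.
Context {R : realType} {V : lmodType R}.
Context {h a m e : V -> V -> R} {K : R} {b : V -> V -> R}.
Variable (S : form_system h a m e K (fun=> b) b).

Let hP := sys_h S.
Let aP := sys_a S.
Let bP := sys_b S.

Definition eigenvector (c d : V -> V -> R) (lam : R) (u : V) := forall v, c u v = lam * d u v.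

(* Minimize the Rayleigh quotient on the orthogonal of the eigenvectors already found. *)
Lemma next_eigenvector p (v : nat -> V) (lam : nat -> R) w :
  (forall i, (i < p)%N -> eigenvector a b (lam i) (v i)) ->
  (forall i j, (i < p)%N -> (j < p)%N -> b (v i) (v j) = (i == j)%:R) ->
  b w w = 1 -> (forall i, (i < p)%N -> b w (v i) = 0) ->
  exists u mu, [/\ b u u = 1, forall i, (i < p)%N -> b u (v i) = 0, mu <= a w w &
                   eigenvector a b mu u].
Proof.
move=> vE vO w1 wv.
pose P := [set u | b u u = 1 /\ forall i, (i < p)%N -> b u (v i) = 0].
pose Q := [set a u u | u in P].
have Q0 : has_inf Q.
  split; first by exists (a w w), w.
  by exists 0 => _ [u _ <-]; exact: form_ge0.
pose mu := inf Q.
have muP u : P u -> mu <= a u u by move=> Pu; apply: ge_inf; [exact: Q0.2|exists u].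
have /choice[u uP] : forall n, exists u, P u /\ a u u < mu + n.+1%:R^-1.
  move=> n; have n0 : 0 < n.+1%:R^-1 :> R by rewrite invr_gt0 ltr0Sn.
  by have [_ [u Pu <-] um] := inf_adherent n0 Q0; exists u.
have [F [FU oF]] := @ultraFilterLemma nat \oo _.
have uF eps : 0 < eps -> \forall n \near F, a (u n) (u n) <= mu + eps.
  move=> eps0; apply: oF; have /cvgrPdist_lt/(_ _ eps0) := @harmonic_cvg0 R.
  apply: filterS => n; rewrite sub0r normrN => /(le_lt_trans (ler_norm _)) ne.
  by apply: (le_trans (ltW (uP n).2)); rewrite lerD2l ltW.
have [z [za ze]] : exists z, (forall x, a (u n) x @[n --> F] --> a z x) /\
    e (u n - z) (u n - z) @[n --> F] --> (0 : R).
  apply: (@energy_limit _ _ _ _ _ _ _ _ _ S F FU u (mu + 1 + 1) oF).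
  by apply: filterS (uF 1 ltr01) => n un; rewrite (uP n).1.1 lerD2r.
have z1 : b z z = 1.
  have : b (u n) (u n) @[n --> F] --> b z z by exact: (moving_form_diag_cvg S).
  under eq_fun do rewrite (uP _).1.1.
  by move=> H; exact: (cvg_unique _ H (cvg_cst (1 : R))).
have zv i : (i < p)%N -> b z (v i) = 0.
  move=> ip; have e0 : e (v i - v i) (v i - v i) @[_ --> F] --> (0 : R).
    by under eq_fun do rewrite subrr (form0l (sys_e S)); exact: cvg_cst.
  have : b (u n) (v i) @[n --> F] --> b z (v i).
    exact: (moving_form_cvg S (v_ := fun=> v i)).
  under eq_fun do rewrite (uP _).1.2//.
  by move=> H; exact: (cvg_unique _ H (cvg_cst (0 : R))).
have amu : a z z = mu.
  apply/eqP; rewrite eq_le muP// andbT.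
  exact: (weak_lower_semicontinuous S za).
exists z, mu; split => //; first by apply: muP.
(* Minimality in homogeneous form; it also covers vectors on which [b] vanishes. *)
have Pmin x : (forall i, (i < p)%N -> b x (v i) = 0) -> mu * b x x <= a x x.
  move=> xv; have [x0|x0] := eqVneq (b x x) 0; first by rewrite x0 mulr0 form_ge0.
  have := muP ((Num.sqrt (b x x))^-1 *: x).
  rewrite /P/= form_normalize// (formZl aP) (formZr aP) mulrA -expr2 exprVn.
  rewrite sqr_sqrtr ?form_ge0// mulrC ler_pdivlMr ?lt_neqAle ?(eq_sym 0) ?x0 ?form_ge0//.
  by apply; split=> // i ip; rewrite (formZl bP) xv// mulr0.
(* First variation: the form [a - mu b] is nonnegative on [z + t *: x] and has constant term 0 in
   [t], so the discriminant bound annihilates the linear coefficient. *)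
have orth x : (forall i, (i < p)%N -> b x (v i) = 0) -> a z x = mu * b z x.
  move=> xv; apply/eqP; rewrite -subr_eq0 -sqrf_eq0 eq_le sqr_ge0 andbT.
  rewrite -(mulr0 (a x x - mu * b x x)); apply: discriminant_le.
    by rewrite subr_ge0 Pmin.
  move=> t; have := Pmin (z + t *: x); rewrite (form_quad aP) (form_quad bP) amu z1.
  have zxv i : (i < p)%N -> b (z + t *: x) (v i) = 0.
    by move=> ip; rewrite (formDl bP) (formZl bP) zv// xv// mulr0 addr0.
  move=> /(_ zxv); lra.
(* An arbitrary test vector is its projection on the earlier eigenvectors plus an admissible
   variation [y]; on the projection both sides vanish because [z] is orthogonal to eigenvectors. *)
move=> x; pose y := x - \sum_(i < p) b x (v i) *: v i.
have yv i : (i < p)%N -> b y (v i) = 0.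
  move=> ip; rewrite (formDl bP) (formNl bP) -/(comb (fun j : 'I_p => v j) _) (form_suml bP).
  rewrite (bigD1 (Ordinal ip))//= vO// eqxx mulr1 big1 ?addr0 ?subrr// => j ji.
  by rewrite vO// (_ : (j == i :> nat) = false) ?mulr0//; apply/negbTE; rewrite -val_eqE in ji.
have -> : x = y + comb (fun j : 'I_p => v j) (fun i => b x (v i)) by rewrite subrK.
rewrite (formDr aP) (formDr bP) orth// mulrDr (form_sumr aP) (form_sumr bP).
congr (_ + _); rewrite mulr_sumr; apply: eq_bigr => i _.
by rewrite (formC aP) (vE i)// (formC bP (v i) z) zv// !mulr0.
Qed.

(** As long as fewer than [k.+1] eigenvectors are known, some unit vector of the test space is
    orthogonal to them and has quotient at most [t]; the constrained minimum is then at most [t] as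
    well. *)
Lemma level_eigenvectors k t : level (h := h) (a := a) b k t ->
  exists (v : 'I_k.+1 -> V) (lam : 'I_k.+1 -> R), orthonormal b v /\
    forall i, lam i <= t /\ eigenvector a b (lam i) (v i).
Proof.
move=> /(level_orthonormal S bP (sys_ker S))[u uO ua].
suff H p : (p <= k.+1)%N -> exists (v : nat -> V) (lam : nat -> R),
    (forall i j, (i < p)%N -> (j < p)%N -> b (v i) (v j) = (i == j)%:R) /\
    (forall i, (i < p)%N -> lam i <= t /\ eigenvector a b (lam i) (v i)).
  have [v [lam [vO vE]]] := H _ (leqnn _).
  exists (fun i => v i), (fun i => lam i); split=> i; last exact: vE.
  by move=> j; rewrite vO ?ltn_ord// val_eqE.
elim: p => [|p IH] pk; first by exists (fun=> 0), (fun=> 0).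
have [v [lam [vO vE]]] := IH (ltnW pk).
have [c [[i0 ci0] cP]] := @common_kernel R V k.+1 p u (fun j w => b w (v j)) pk.
pose w := comb u c.
have w0 : b w w != 0.
  by apply/negP => /eqP/(orthonormal_definite bP uO)/(_ i0) => ci; rewrite ci eqxx in ci0.
pose r := (Num.sqrt (b w w))^-1.
have wv j : (j < p)%N -> b (r *: w) (v j) = 0.
  by move=> jm; rewrite (formZl bP) (form_suml bP) (cP (Ordinal jm)) mulr0.
have [z [mu [z1 zv muw zE]]] := next_eigenvector (fun i ip => (vE i ip).2) vO (form_normalize bP w0) wv.
exists (fun i => if i == p then z else v i), (fun i => if i == p then mu else lam i).
split=> [i j|i].
  rewrite !ltnS => im jm.
  have [ei|im'] := eqVneq i p; have [ej|jm'] := eqVneq j p.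
  - by rewrite ei ej eqxx.
  - by rewrite zv ?ltn_neqAle ?jm' // ei eq_sym (negbTE jm').
  - by rewrite (formC bP) zv ?ltn_neqAle ?im' // ej (negbTE im').
  - by rewrite vO // ltn_neqAle ?im' ?jm'.
rewrite ltnS => im; have [_|im'] := eqVneq i p; last by apply: vE; rewrite ltn_neqAle im'.
split=> //; apply: (le_trans muw); rewrite -[t]mulr1 -(form_normalize bP w0) -/r.
rewrite /w combZ (orthonormal_comb bP _ uO); exact: ua.
Qed.

(* Eigenvectors for distinct eigenvalues are orthogonal, so that the square roots of
   [t - lam i] can be moved into the coefficients. *)
Lemma eigenvectors_level k t (u : 'I_k.+1 -> V) (lam : 'I_k.+1 -> R) :
  definite_on h u -> (forall i, lam i <= t /\ eigenvector a b (lam i) (u i)) ->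
  level (h := h) (a := a) b k t.
Proof.
move=> uD uE; exists u; split => // x.
rewrite (form_comb aP) -subr_ge0 (form_comb bP) mulr_sumr -sumrB.
rewrite (_ : \sum_i _ = b (comb u (fun i => Num.sqrt (t - lam i) * x i))
                          (comb u (fun i => Num.sqrt (t - lam i) * x i))); first exact: form_ge0.
rewrite (form_comb bP); apply: eq_bigr => i _; rewrite mulr_sumr -sumrB.
apply: eq_bigr => j _; rewrite (uE i).2.
have [b0|b0] := eqVneq (b (u i) (u j)) 0; first by rewrite b0 !mulr0 subrr.
have lij : lam i = lam j.
  apply: (mulIf b0); rewrite -(uE i).2 (formC aP) (uE j).2 (formC bP); reflexivity.
transitivity (Num.sqrt (t - lam i) ^+ 2 * (x i * x j) * b (u i) (u j)); last by rewrite -lij; ring.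
rewrite sqr_sqrtr ?subr_ge0 ?(uE i).1//; ring.
Qed.

End Eigen.
(** * Square integrable functions *)

Section SquareIntegrable.
Context d (T : measurableType d) (R : realType).
Variable mu : {measure set T -> \bar R}.
Implicit Types (D : set T) (f g : T -> R).

(** The squared norm in the extended reals, meaningful also when infinite; [ip] below is the
    real-valued pairing and agrees with it on [L2]. *)
Definition sqint D f : \bar R := (\int[mu]_(x in D) (f x ^+ 2)%:E)%E.

Lemma sqint_ge0 D f : (0 <= sqint D f)%E.
Proof. by apply: integral_ge0 => x _; rewrite lee_fin sqr_ge0. Qed.

Lemma measurable_sq D f : measurable_fun D f ->
  measurable_fun D (fun x => (f x ^+ 2)%:E).
Proof. by move=> mf; apply/measurable_EFinP; exact: measurable_funX. Qed.

Variables (D : set T) (mD : measurable D).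

Lemma le_sqint f g : measurable_fun D f -> measurable_fun D g ->
  (forall x, D x -> `|f x| <= `|g x|) -> (sqint D f <= sqint D g)%E.
Proof.
move=> mf mg fg; apply: ge0_le_integral => //.
- by move=> x _; rewrite lee_fin sqr_ge0.
- exact: measurable_sq.
- exact: measurable_sq.
move=> x Dx; rewrite lee_fin -(real_normK (num_real (f x))) -(real_normK (num_real (g x))).
by rewrite ler_pXn2r ?nnegrE ?fg.
Qed.

Lemma eq_sqint f g : (forall x, D x -> f x ^+ 2 = g x ^+ 2) -> sqint D f = sqint D g.
Proof. by move=> fg; apply: eq_integral => x /set_mem Dx; rewrite fg. Qed.

Lemma sqintZ (c : R) f : measurable_fun D f ->
  sqint D (fun x => c * f x) = ((c ^+ 2)%:E * sqint D f)%E.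
Proof.
move=> mf; rewrite /sqint -ge0_integralZl_EFin ?sqr_ge0//.
- by apply: eq_integral => x _; rewrite exprMn EFinM.
- by move=> x _; rewrite lee_fin sqr_ge0.
- exact: measurable_sq.
Qed.

Lemma sqintN f : sqint D (fun x => - f x) = sqint D f.
Proof. by apply: eq_sqint => x _; rewrite sqrrN. Qed.

Lemma sqintD_le f g : measurable_fun D f -> measurable_fun D g ->
  (sqint D (fun x => (f x + g x)%R) <= 2%:E * sqint D f + 2%:E * sqint D g)%E.
Proof.
move=> mf mg; have f0 x : (0 <= (f x ^+ 2)%:E)%E by rewrite lee_fin sqr_ge0.
have g0 x : (0 <= (g x ^+ 2)%:E)%E by rewrite lee_fin sqr_ge0.
have two0 : (0 : R) <= 2 by [].
rewrite /sqint -!ge0_integralZl_EFin//; try exact: measurable_sq.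
rewrite -ge0_integralD//; first last.
- by apply: measurable_funeM; exact: measurable_sq.
- by move=> x _; rewrite mule_ge0.
- by apply: measurable_funeM; exact: measurable_sq.
- by move=> x _; rewrite mule_ge0.
apply: ge0_le_integral => //.
- by move=> x _; rewrite lee_fin sqr_ge0.
- by apply: measurable_sq; exact: measurable_funD.
- by apply: emeasurable_funD; apply: measurable_funeM; exact: measurable_sq.
by move=> x _; rewrite -!EFinM -EFinD lee_fin; have := sqr_ge0 (f x - g x); nra.
Qed.

Lemma sqintB_le f g : measurable_fun D f -> measurable_fun D g ->
  (sqint D (fun x => (f x - g x)%R) <= 2%:E * sqint D f + 2%:E * sqint D g)%E.
Proof.
move=> mf mg; rewrite -(sqintN g); apply: (sqintD_le mf).
exact: measurableT_comp.
Qed.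

Lemma L2D f g : L2 mu D f -> L2 mu D g -> L2 mu D (fun x => f x + g x).
Proof.
move=> [mf f2] [mg g2]; split; first exact: measurable_funD.
apply: (le_lt_trans (sqintD_le mf mg)).
by rewrite lte_add_pinfty// lte_mul_pinfty// lee_fin.
Qed.

Lemma L2Z c f : L2 mu D f -> L2 mu D (fun x => c * f x).
Proof.
move=> [mf f2]; split; first by apply: measurable_funM => //; exact: measurable_cst.
by rewrite -/(sqint D _) sqintZ// lte_mul_pinfty// lee_fin sqr_ge0.
Qed.

Lemma L2N f : L2 mu D f -> L2 mu D (fun x => - f x).
Proof.
by move=> /(L2Z (-1)) [m i]; under eq_fun do rewrite -mulN1r.
Qed.

Lemma L2B f g : L2 mu D f -> L2 mu D g -> L2 mu D (fun x => f x - g x).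
Proof. by move=> f2 /L2N; exact: L2D. Qed.

Lemma L2_0 : L2 mu D (fun=> 0).
Proof.
split; first exact: measurable_cst.
by rewrite integral0_eq// => x _; rewrite expr0n.
Qed.

Lemma L2_le f g : measurable_fun D f -> L2 mu D g -> (forall x, D x -> `|f x| <= `|g x|) ->
  L2 mu D f.
Proof. by move=> mf [mg g2] fg; split=> //; apply: le_lt_trans g2; exact: le_sqint. Qed.

Lemma L2_mul_integrable f g : L2 mu D f -> L2 mu D g ->
  mu.-integrable D (EFin \o (fun x => f x * g x)).
Proof.
move=> [mf f2] [mg g2]; apply/integrableP; split.
  by apply/measurable_EFinP; exact: measurable_funM.
have I : (sqint D f + sqint D g < +oo)%E by rewrite lte_add_pinfty.
apply: le_lt_trans I; rewrite -ge0_integralD//; first last.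
- exact: measurable_sq.
- by move=> x _; rewrite lee_fin sqr_ge0.
- exact: measurable_sq.
- by move=> x _; rewrite lee_fin sqr_ge0.
apply: ge0_le_integral => //.
- by apply: measurableT_comp => //; apply/measurable_EFinP; exact: measurable_funM.
- by apply: emeasurable_funD; exact: measurable_sq.
move=> x _; rewrite /= lee_fin normrM -(real_normK (num_real (f x))) -(real_normK (num_real (g x))).
by have := sqr_ge0 (`|f x| - `|g x|); have := normr_ge0 (f x); have := normr_ge0 (g x); nra.
Qed.

Definition ip f g : R := \int[mu]_(x in D) (f x * g x).

Lemma ipC f g : ip f g = ip g f.
Proof. by apply: eq_Rintegral => x _; rewrite mulrC. Qed.

Lemma ip_lin c f g k : L2 mu D f -> L2 mu D g -> L2 mu D k ->
  ip (fun x => c * f x + g x) k = c * ip f k + ip g k.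
Proof.
move=> f2 g2 k2; rewrite /ip -RintegralZl//; last exact: L2_mul_integrable.
rewrite -RintegralD//; try exact: L2_mul_integrable.
  by apply: eq_Rintegral => x _; rewrite mulrDl mulrA.
have /L2_mul_integrable := L2Z c f2; move=> /(_ _ k2).
by under eq_fun do rewrite -mulrA.
Qed.

Lemma sqint_ip f : L2 mu D f -> sqint D f = (ip f f)%:E.
Proof.
move=> f2; have := L2_mul_integrable f2 f2 => /integrable_fin_num H.
by rewrite /ip /Rintegral fineK ?H//; apply: eq_integral => x _; rewrite expr2.
Qed.

Lemma ip_ge0 f : 0 <= ip f f.
Proof. by apply: Rintegral_ge0 => x _; rewrite -expr2 sqr_ge0. Qed.

Lemma sqint_eq0 f : measurable_fun D f -> sqint D f = 0%E ->
  {ae mu, forall x, D x -> f x = 0}.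
Proof.
move=> mf f0; have : (\int[mu]_(x in D) `|(f x ^+ 2)%:E| = 0)%E.
  by rewrite -[RHS]f0; apply: eq_integral => x _; rewrite gee0_abs// lee_fin sqr_ge0.
move/ae_eq_integral_abs => /(_ mD (measurable_sq mf)).
apply: filterS => x H Dx; have := H Dx => -[/eqP].
by rewrite sqrf_eq0 => /eqP.
Qed.

Lemma ae_eq_sqint f g : measurable_fun D f -> measurable_fun D g ->
  {ae mu, forall x, D x -> f x = g x} -> sqint D f = sqint D g.
Proof.
move=> mf mg fg; apply: ge0_ae_eq_integral => //.
- exact: measurable_sq.
- exact: measurable_sq.
- by move=> x _; rewrite lee_fin sqr_ge0.
- by move=> x _; rewrite lee_fin sqr_ge0.
by apply: filterS fg => x H Dx; rewrite H.
Qed.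

Lemma ae_eq_ip f f' g g' : L2 mu D f -> L2 mu D f' -> L2 mu D g -> L2 mu D g' ->
  {ae mu, forall x, D x -> f x = f' x} -> {ae mu, forall x, D x -> g x = g' x} ->
  ip f g = ip f' g'.
Proof.
move=> f2 f2' g2 g2' ff gg; rewrite /ip /Rintegral; congr fine.
have := L2_mul_integrable f2 g2; have := L2_mul_integrable f2' g2'.
move=> /integrableP[m1 _] /integrableP[m2 _].
apply: ae_eq_integral => //; apply: filterS2 ff gg => x fx gx Dx.
by rewrite /= fx// gx.
Qed.

(** Fatou's lemma applied to the squares. *)
Lemma sqint_lim (h : nat -> T -> R) f : (forall n, measurable_fun D (h n)) ->
  (forall x, D x -> h n x @[n --> \oo] --> f x) ->
  (sqint D f <= limn_einf (fun n => sqint D (h n)))%E.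
Proof.
move=> mh hf.
have -> : sqint D f = (\int[mu]_(x in D) limn_einf (fun n => (h n x ^+ 2)%:E))%E.
  apply: eq_integral => x /set_mem Dx.
  have : (h n x ^+ 2)%:E @[n --> \oo] --> (f x ^+ 2)%:E.
    apply: cvg_EFin; first exact: nearW.
    by under eq_fun do rewrite /= expr2; rewrite expr2; apply: cvgM; exact: hf.
  by move=> /cvg_limn_einf_sup[-> _].
apply: fatou => // [n|n x _]; first exact: measurable_sq.
by rewrite lee_fin sqr_ge0.
Qed.

End SquareIntegrable.

(** * Completeness of L2 *)

Section L2Complete.
Context d (T : measurableType d) (R : realType).
Variable mu : {measure set T -> \bar R}.
Variables (D : set T) (mD : measurable D).

Lemma limn_einf_le (u : nat -> \bar R) (c : \bar R) :
  (\forall n \near \oo, (u n <= c)%E) -> (limn_einf u <= c)%E.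
Proof.
move=> [N _ NP]; rewrite limn_einf_lim; apply: lime_le; first exact: is_cvg_einfs.
apply: nearW => n; apply: (@le_trans _ _ (u (maxn n N))).
  by apply: ereal_inf_lbound; exists (maxn n N) => //=; exact: leq_maxl.
by apply: NP; exact: leq_maxr.
Qed.

(** The increments are of order [2^-1 ^+ k], so the telescoping series converges absolutely. *)
Lemma cvg_half_steps (x : nat -> R) (C : R) :
  (forall k, (4 ^+ k * (x k.+1 - x k) ^+ 2 <= C)) -> cvgn x.
Proof.
move=> xC; have C0 : 0 <= C.
  by apply: le_trans (xC 0%N); apply: mulr_ge0; [exact: exprn_ge0|exact: sqr_ge0].
have step k : `|x k.+1 - x k| <= (C + 1) * 2^-1 ^+ k.
  have := xC k; have -> : (4 : R) = 2 ^+ 2 by rewrite -natrX.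
  rewrite -exprM mulnC exprM -exprMn => H.
  rewrite -(@ler_pM2l _ (2 ^+ k)) ?exprn_gt0// [leRHS]mulrC -mulrA -exprMn mulVf// expr1n mulr1.
  rewrite -[X in X * _](@ger0_norm _ (2 ^+ k)) ?exprn_ge0// -normrM.
  by rewrite ler_norml; move: H; move: (_ * _) => y yC; apply/andP; split; nra.
have : cvgn [normed series (telescope x)].
  apply: (@series_le_cvg _ _ (geometric (C + 1) 2^-1)) => [n|n|n|].
  - exact: normr_ge0.
  - by rewrite /= mulr_ge0 ?exprn_ge0// ltW// ltr_wpDl.
  - by rewrite /telescope/=; exact: step.
  - apply: is_cvg_geometric_series; rewrite ger0_norm//; lra.
move=> /normed_cvg; rewrite [in X in _ -> X](_ : x = fun n => x 0%N + series (telescope x) n).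
  by move=> cs; apply: is_cvgD => //; exact: is_cvg_cst.
by apply/funext => n; rewrite -eq_sum_telescope.
Qed.

(** The series of [4 ^+ k * f k x ^+ 2] has its integral bounded by a geometric series of ratio one
    quarter; it is finite almost everywhere and its sum bounds each term. *)
Lemma ae_bounded_series (f : nat -> T -> R) : (forall k, measurable_fun D (f k)) ->
  (forall k, (sqint mu D (f k) <= ((16^-1) ^+ k)%:E)%E) ->
  {ae mu, forall x, D x -> exists C : R, forall k, 4 ^+ k * f k x ^+ 2 <= C}.
Proof.
move=> mf fk; pose g k x : \bar R := ((4 ^+ k)%:E * (f k x ^+ 2)%:E)%E.
have g0 k x : (0 <= g k x)%E by rewrite /g -EFinM lee_fin; apply: mulr_ge0; [exact: exprn_ge0|exact: sqr_ge0].
have mg k : measurable_fun D (g k) by apply: measurable_funeM; exact: measurable_sq.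
pose G x := (\sum_(0 <= k <oo) g k x)%E.
have G0 x : (0 <= G x)%E by apply: nneseries_ge0.
have mG : measurable_fun D G by apply: ge0_emeasurable_sum.
have IG : mu.-integrable D G.
  apply/integrableP; split => //.
  rewrite (_ : (\int[mu]_(x in D) _)%E = (\int[mu]_(x in D) G x)%E); last first.
    by apply: eq_integral => x _; rewrite gee0_abs.
  rewrite integral_nneseries//.
  apply: (@le_lt_trans _ _ (\sum_(0 <= k <oo) (geometric 1 4^-1 k)%:E)%E).
    apply: lee_nneseries => [k _ _|k _]; first exact: integral_ge0.
    have -> : (\int[mu]_(x in D) g k x = (4 ^+ k)%:E * sqint mu D (f k))%E.
      apply: ge0_integralZl_EFin => //; first by move=> x _; rewrite lee_fin sqr_ge0.
      exact: measurable_sq.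
    rewrite /geometric/= mul1r.
    apply: (@le_trans _ _ ((4 ^+ k)%:E * ((16^-1) ^+ k)%:E)%E).
      by apply: lee_wpmul2l; [rewrite lee_fin exprn_ge0|exact: fk].
    by rewrite -EFinM -exprMn lee_fin (_ : 4 * 16^-1 = 4^-1 :> R)//; field.
  have q1 : `|4^-1 : R| < 1 by rewrite ger0_norm//; lra.
  have H : eseries (fun k => (geometric (1 : R) 4^-1 k)%:E) n @[n --> \oo] --> (1 / (1 - 4^-1) : R)%:E.
    under eq_fun do rewrite /eseries/= sumEFin.
    by apply: cvg_EFin; [exact: nearW|exact: cvg_geometric_series].
  by rewrite (cvg_lim _ H)// ltry.
have := integrable_ae mD IG; apply: filterS => x H Dx; have Gx := H Dx.
exists (fine (G x)) => k; rewrite -lee_fin fineK// EFinM.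
apply: le_trans (nneseries_lim_ge (m := 0%N) k.+1 _) => //.
rewrite big_mkord big_ord_recr/= leeDr//.
by apply: sume_ge0 => i _; exact: g0.
Qed.

(** Riesz-Fischer: a subsequence with increments of squared norm at most [16^-1 ^+ k] converges
    almost everywhere, and Fatou's lemma bounds the distance of the whole sequence to its limit. *)
Lemma L2_complete (f : nat -> T -> R) : (forall n, L2 mu D (f n)) ->
  (forall eps : R, 0 < eps -> exists N, forall i j, (N <= i)%N -> (N <= j)%N ->
    (sqint mu D (fun x => (f i x - f j x)%R) <= eps%:E)%E) ->
  exists2 g, L2 mu D g & sqint mu D (fun x => f n x - g x) @[n --> \oo] --> 0%E.
Proof.
move=> f2 fC; have mf n : measurable_fun D (f n) by have [] := f2 n.
have /choice[M MP] : forall k, exists N, forall i j, (N <= i)%N -> (N <= j)%N ->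
    (sqint mu D (fun x => (f i x - f j x)%R) <= ((16^-1) ^+ k)%:E)%E.
  by move=> k; apply: fC; rewrite exprn_gt0// invr_gt0.
(* Partial sums make the indices nondecreasing while staying above [M k]. *)
pose n_ k := \sum_(j < k.+1) M j.
have n_M k : (M k <= n_ k)%N by rewrite /n_ big_ord_recr/= leq_addl.
have n_S k : (n_ k <= n_ k.+1)%N by rewrite {2}/n_ big_ord_recr/= leq_addr.
have n_le j k : (j <= k)%N -> (n_ j <= n_ k)%N.
  by move=> /(homo_leq leqnn leq_trans n_S).
have n_big N : exists k0, forall k, (k0 <= k)%N -> forall i, (M N <= i)%N ->
    (sqint mu D (fun x => (f i x - f (n_ k) x)%R) <= ((16^-1) ^+ N)%:E)%E.
  by exists N => k Nk i Ni; apply: MP => //; apply: leq_trans (n_M N) _; exact: n_le.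
have := @ae_bounded_series (fun k x => f (n_ k.+1) x - f (n_ k) x) _ _.
case=> [k|k|A [mA A0 AP]]; first exact: measurable_funB.
  by apply: MP => //; exact: leq_trans (n_M k) (n_S k).
(* Set to 0 on the exceptional null set, the subsequence converges at every point of [D], so its
   limit is measurable. *)
pose h k x := \1_(~` A) x * f (n_ k) x.
have hE k x : x \notin A -> h k x = f (n_ k) x.
  by move=> xA; rewrite /h indicE in_setC xA mul1r.
have h_cvg x : D x -> cvgn (h^~ x).
  move=> Dx; have [xA|xA] := boolP (x \in A).
    by rewrite /h; under eq_fun do rewrite indicE in_setC xA mul0r; exact: is_cvg_cst.
  rewrite (_ : h^~ x = fun k => f (n_ k) x); last by apply/funext => k; exact: hE.
  have : exists C : R, forall k, 4 ^+ k * (f (n_ k.+1) x - f (n_ k) x) ^+ 2 <= C.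
    apply: contrapT => H; move/negP : xA; apply; apply/mem_set/AP => /=.
    by move=> /(_ Dx).
  by move=> [C CP]; exact: (@cvg_half_steps (fun k => f (n_ k) x) C).
have mh k : measurable_fun D (h k).
  by apply: measurable_funM => //; apply: measurable_indic; exact: measurableC.
pose g x := limn (h^~ x).
have mg : measurable_fun D g by apply: (measurable_fun_cvg mh) => x Dx; exact: h_cvg.
have aeh k : {ae mu, forall x, D x -> h k x = f (n_ k) x}.
  exists A; split => // x /= H; apply: contrapT => xA; apply: H => _.
  by apply: hE; apply/negP => /set_mem.
have key N i : (M N <= i)%N -> (sqint mu D (fun x => (f i x - g x)%R) <= ((16^-1) ^+ N)%:E)%E.
  move=> Mi; apply: (@le_trans _ _ (limn_einf (fun k => sqint mu D (fun x => f i x - h k x)))).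
    apply: sqint_lim => //.
    - by move=> k; exact: measurable_funB.
    - by move=> x Dx; apply: cvgB; [exact: cvg_cst|exact: h_cvg].
  apply: limn_einf_le; have [k0 k0P] := n_big N.
  exists k0 => // k /= k0k; rewrite (_ : sqint _ _ _ = sqint mu D (fun x => f i x - f (n_ k) x)).
    exact: k0P.
  apply: ae_eq_sqint => //; try exact: measurable_funB.
  by apply: filterS (aeh k) => x H Dx; rewrite H.
exists g.
  rewrite (_ : g = fun x => f (M 0%N) x - (f (M 0%N) x - g x)); last by apply/funext => x; rewrite subKr.
  apply: L2B => //; split; first exact: measurable_funB.
  by apply: le_lt_trans (key _ _ (leqnn _)) _; rewrite ltry.
apply/fine_cvgP; split.
  exists (M 0%N) => // i /= Mi; rewrite ge0_fin_numE ?sqint_ge0//.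
  by apply: le_lt_trans (key _ _ Mi) _; rewrite ltry.
apply/cvgrPdist_le => eps eps0.
have q1 : `|16^-1 : R| < 1 by rewrite ger0_norm//; lra.
have /cvgrPdist_le/(_ _ eps0)[N _ NP] := cvg_geometric 1 q1.
exists (M N) => // i /= Mi; rewrite sub0r normrN ger0_norm ?fine_ge0 ?sqint_ge0//.
have := NP N (leqnn N); rewrite /geometric/= mul1r sub0r normrN ger0_norm ?exprn_ge0// => /(le_trans _); apply.
rewrite -lee_fin fineK ?key// ge0_fin_numE ?sqint_ge0//.
by apply: le_lt_trans (key _ _ Mi) _; rewrite ltry.
Qed.

End L2Complete.
(** * Measure and topology of the plane *)

Section AreaPreserving.
Context {R : realType}.
Local Notation planeT := (@planeT R).
Local Notation leb := (@lebesgue_measure R).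

Definition area_preserving (Phi : planeT -> planeT) :=
  measurable_fun setT Phi /\ forall A, measurable A -> area (Phi @^-1` A) = area A.

Lemma area_preserving_comp Phi Psi : area_preserving Phi -> area_preserving Psi ->
  area_preserving (Phi \o Psi).
Proof.
move=> [mPhi aPhi] [mPsi aPsi]; split; first exact: measurableT_comp.
move=> A mA; rewrite comp_preimage aPsi ?aPhi//.
by rewrite -[X in measurable X]setTI; exact: mPhi.
Qed.

Lemma area_preserving_integral Phi (D : set planeT) (F : planeT -> \bar R) :
  area_preserving Phi -> measurable D -> measurable_fun D F ->
  (forall x, D x -> (0 <= F x)%E) ->
  (\int[area]_(x in Phi @^-1` D) F (Phi x) = \int[area]_(x in D) F x)%E.
Proof.
move=> [mPhi aPhi] mD mF F0.
have H := ge0_integral_pushforward mPhi area mD mF; rewrite -H; last first.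
  by move=> y /set_mem; exact: F0.
by apply: eq_measure_integral => A mA _; exact: aPhi.
Qed.

Lemma lebesgue_translation (c : R) (A : set (measurableTypeR R)) : measurable A ->
  leb ((fun y => y + c) @^-1` A) = leb A.
Proof.
move=> mA.
have mc : measurable_fun setT ((fun y => y + c) : measurableTypeR R -> measurableTypeR R).
  by apply: continuous_measurable_fun => y; apply: cvgD; [exact: cvg_id|exact: cvg_cst].
apply/esym; rewrite -[RHS]/(pushforward leb ((fun y => y + c) : measurableTypeR R -> measurableTypeR R) A).
apply: lebesgue_measure_unique => // _ [[a b] /= ab <-].
rewrite /pushforward (_ : _ @^-1` _ = `]a - c, b - c]%classic); last first.
  by apply/seteqP; split=> y; rewrite /= !in_itv/= ltrBlDr lerBrDr.
rewrite !lebesgue_measure_itv/= !lte_fin ltrD2r; case: ifPn => // _.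
by rewrite -!EFinD; congr EFin; ring.
Qed.

Definition shear (g : R -> R) (p : planeT) : planeT := (p.1, p.2 + g p.1).
Definition swapxy (p : planeT) : planeT := (p.2, p.1).
Definition negx (p : planeT) : planeT := (- p.1, p.2).

Lemma measurable_fst_plane : measurable_fun setT (fst : planeT -> R).
Proof. exact: measurable_fst. Qed.

Lemma measurable_snd_plane : measurable_fun setT (snd : planeT -> R).
Proof. exact: measurable_snd. Qed.

Lemma measurable_pair_plane d (T : measurableType d) (f g : T -> R) :
  measurable_fun setT f -> measurable_fun setT g ->
  measurable_fun setT ((fun x => (f x, g x)) : T -> planeT).
Proof.
by move=> mf mg; apply: (@measurable_fun_pair _ _ _ T (measurableTypeR R) (measurableTypeR R)).
Qed.

(** Cavalieri: on each vertical line the shear is a translation. *)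
Lemma area_preserving_shear (g : R -> R) : measurable_fun setT g ->
  area_preserving (shear g).
Proof.
move=> mg; split.
  apply: measurable_pair_plane; first exact: measurable_fst_plane.
  apply: measurable_funD; first exact: measurable_snd_plane.
  by apply: measurableT_comp => //; exact: measurable_fst_plane.
move=> A mA; rewrite /area/= /product_measure1; apply: eq_integral => x _ /=.
rewrite -(lebesgue_translation (g x) (A := xsection A x)); last exact: measurable_xsection.
by congr leb; apply/seteqP; split => y; rewrite /xsection /= !inE.
Qed.

Lemma area_preserving_swap : area_preserving swapxy.
Proof.
have m : measurable_fun setT swapxy.
  by apply: measurable_pair_plane; [exact: measurable_snd_plane|exact: measurable_fst_plane].
split; first exact: m.
move=> A mA; apply/esym; rewrite -[RHS]/(pushforward area swapxy A).
apply: product_measure_unique; last exact: mA.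
move=> B C mB mC; rewrite -[LHS]/(area (swapxy @^-1` (B `*` C))) (_ : _ @^-1` _ = C `*` B); last by apply/seteqP; split => x [].
by rewrite /area/= product_measure1E// muleC.
Qed.

Lemma area_preserving_negx : area_preserving negx.
Proof.
have m : measurable_fun setT negx.
  apply: measurable_pair_plane; last exact: measurable_snd_plane.
  by apply: measurableT_comp => //; exact: measurable_fst_plane.
split; first exact: m.
move=> A mA; apply/esym; rewrite -[RHS]/(pushforward area negx A).
apply: product_measure_unique; last exact: mA.
move=> B C mB mC; rewrite -[LHS]/(area (negx @^-1` (B `*` C))) (_ : _ @^-1` _ = (-%R @^-1` B) `*` C); last by apply/seteqP; split => x [].
rewrite /area/= product_measure1E//; last first.
  rewrite -[X in measurable X]setTI.
  by have := @oppr_measurable R setT; exact.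
by rewrite -(lebesgue_measureN mB).
Qed.

Definition rot (c s : R) (p : planeT) : planeT :=
  (p.1 * c - p.2 * s, p.1 * s + p.2 * c).

(** A rotation is a product of three shears along the axes, with slopes [- t], [s], [- t] where
    [t = s / (1 + c)] is the tangent of half the angle. The half-turn [c = -1], where [t] is
    undefined, is a product of two reflections. *)
Lemma area_preserving_rot (c s : R) : c ^+ 2 + s ^+ 2 = 1 -> area_preserving (rot c s).
Proof.
have mlin (k : R) : measurable_fun setT ((fun x => k * x) : R -> R) by exact: measurable_funM.
have shl k : area_preserving (shear (fun x => k * x)) by exact: area_preserving_shear.
have sw := area_preserving_swap.
move=> cs; have [c1|c1] := eqVneq c (-1).
  have s0 : s = 0 by apply/eqP; rewrite -sqrf_eq0; apply/eqP; move: cs; rewrite c1; lra.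
  rewrite (_ : rot c s = negx \o (swapxy \o (negx \o swapxy))).
    have ng := area_preserving_negx.
    exact: area_preserving_comp ng (area_preserving_comp sw (area_preserving_comp ng sw)).
  by apply/funext => p; rewrite /rot /negx /swapxy /= c1 s0; congr pair; ring.
have c10 : 1 + c != 0 by apply: contra c1 => /eqP c10; apply/eqP; lra.
pose t := s / (1 + c).
have ts : t * s = 1 - c.
  have -> : t * s = s ^+ 2 / (1 + c) by rewrite /t; field.
  have -> : s ^+ 2 = (1 - c) * (1 + c) by rewrite -[LHS](addKr (c ^+ 2)) cs; ring.
  by field.
have tc : t * (1 + c) = s by rewrite /t; field.
rewrite (_ : rot c s = swapxy \o shear (fun x => - t * x) \o swapxy \o
   (shear (fun x => s * x) \o (swapxy \o shear (fun x => - t * x) \o swapxy))).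
  have H := area_preserving_comp (area_preserving_comp sw (shl (- t))) sw.
  exact: area_preserving_comp H (area_preserving_comp (shl s) H).
apply/funext => p; rewrite /rot /swapxy /shear/=.
have e2 : p.1 * s + p.2 * c = p.2 + s * (p.1 - t * p.2).
  have -> : p.2 + s * (p.1 - t * p.2) = p.1 * s + p.2 * (1 - t * s) by ring.
  by rewrite ts; ring.
congr pair; rewrite mulNr ?e2 //.
rewrite mulNr -e2 -[in LHS]tc; have -> : c = 1 - t * s by rewrite ts; ring.
ring.
Qed.

Lemma area_preserving_translation (q : planeT) :
  area_preserving (fun p => (p.1 + q.1, p.2 + q.2)).
Proof.
have H k : area_preserving (shear (fun=> k)) by apply: area_preserving_shear; exact: measurable_cst.
have sw := area_preserving_swap.
exact: (area_preserving_comp (H q.2) (area_preserving_comp (area_preserving_comp sw (H q.1)) sw)).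
Qed.

Lemma area_preserving_reflection (q : planeT) :
  area_preserving (fun p => (q.1 - p.1, q.2 - p.2)).
Proof.
have sw := area_preserving_swap; have ng := area_preserving_negx.
rewrite (_ : (fun _ => _) = (fun p => (p.1 + q.1, p.2 + q.2)) \o
    (negx \o (swapxy \o (negx \o swapxy)))).
  apply: (area_preserving_comp (area_preserving_translation q)).
  exact: (area_preserving_comp ng (area_preserving_comp sw (area_preserving_comp ng sw))).
by apply/funext => p /=; rewrite /negx /swapxy /= [RHS]/= addrC [in RHS](addrC _ q.2).
Qed.

End AreaPreserving.

Section PlaneTopology.
Context {R : realType}.
Local Notation planeT := (@planeT R).

(** A countable base of the plane. It shows that open sets are Borel for the product sigma-algebra,
    and it later turns local statements that hold almost everywhere into a global one. *)
Definition qbox (q : (rat * rat) * (rat * rat)) : set (R * R) :=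
  `]ratr q.1.1, ratr q.1.2[%classic `*` `]ratr q.2.1, ratr q.2.2[%classic.

Lemma open_qbox q : open (qbox q).
Proof.
apply: openI; apply: open_comp; try exact: itv_open.
  by move=> x _; exact: cvg_fst.
by move=> x _; exact: cvg_snd.
Qed.

Lemma measurable_qbox q : measurable (qbox q : set planeT).
Proof. by apply: measurableX. Qed.

Lemma nbhs_qbox (U : set (R * R)) p : nbhs p U -> exists2 q, qbox q p & qbox q `<=` U.
Proof.
move=> /nbhs_ballP[e /= e0 eU].
have rat_lt (x y : R) : x < y -> exists q : rat, x < ratr q < y.
  by move=> xy; have [q] := rat_in_itvoo xy; rewrite in_itv/=; exists q.
have [a1 /andP[a11 a12]] := rat_lt (p.1 - e) p.1 ltac:(lra).
have [b1 /andP[b11 b12]] := rat_lt p.1 (p.1 + e) ltac:(lra).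
have [a2 /andP[a21 a22]] := rat_lt (p.2 - e) p.2 ltac:(lra).
have [b2 /andP[b21 b22]] := rat_lt p.2 (p.2 + e) ltac:(lra).
exists ((a1, b1), (a2, b2)); first by split; rewrite /= in_itv/= ?a12 ?b11 ?a22 ?b21.
move=> x [/=]; rewrite !in_itv/= => /andP[x1 x2] /andP[x3 x4]; apply: eU; split => /=.
  by rewrite -ball_normE/= ltr_distlC; apply/andP; split; lra.
by rewrite -ball_normE/= ltr_distlC; apply/andP; split; lra.
Qed.

Lemma open_bigcup_qbox (U : set (R * R)) : open U ->
  U = \bigcup_(q in [set q | qbox q `<=` U]) qbox q.
Proof.
move=> oU; apply/seteqP; split => [p Up|p [q qU qp]]; last exact: qU.
by have [q qp qU] := nbhs_qbox (open_nbhs_nbhs (conj oU Up)); exists q.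
Qed.

Lemma open_measurable_plane (U : set (R * R)) : open U -> measurable (U : set planeT).
Proof.
move=> /open_bigcup_qbox ->; rewrite bigcup_mkcond.
apply: countable_bigcupT_measurable; first exact: countableP.
by move=> q; case: ifPn => // _; exact: measurable_qbox.
Qed.

Lemma closed_measurable_plane (U : set (R * R)) : closed U -> measurable (U : set planeT).
Proof. by move=> /closed_openC/open_measurable_plane/measurableC; rewrite setCK. Qed.

Lemma continuous_measurable_plane (f : R * R -> R) : continuous f ->
  measurable_fun (setT : set planeT) f.
Proof.
move=> cf.
apply: (@measurability _ _ planeT (measurableTypeR R) setT f _ (RGenOpens.measurableE R)).
move=> _ [_ [a [b ->]] <-]; rewrite setTI; apply: open_measurable_plane.
by apply: open_comp => [x _|]; [exact: cf|exact: itv_open].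
Qed.

End PlaneTopology.
(** * Smooth functions and mollification *)

Section SmoothFunctions.
Context {R : realType}.
Implicit Types (f g : R * R -> R) (x y p q : R * R).

Lemma partial1_quotient f x (h : R) :
  h^-1 *: ((f \o shift x) (h *: e1) - f x) =
  h^-1 *: (((fun t => f (t, x.2)) \o shift x.1) (h *: (1 : R)) - f (x.1, x.2)).
Proof.
congr (_ *: (_ - _)); last by case: x.
by rewrite /= /e1; congr f; case: x => a b; congr pair; rewrite /= ?scaler0 ?add0r.
Qed.

Lemma partial2_quotient f x (h : R) :
  h^-1 *: ((f \o shift x) (h *: e2) - f x) =
  h^-1 *: (((fun t => f (x.1, t)) \o shift x.2) (h *: (1 : R)) - f (x.1, x.2)).
Proof.
congr (_ *: (_ - _)); last by case: x.
by rewrite /= /e2; congr f; case: x => a b; congr pair; rewrite /= ?scaler0 ?add0r.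
Qed.

Opaque e1 e2.

Lemma derivable_e1 f x : derivable f x e1 <-> derivable (fun t => f (t, x.2)) x.1 1.
Proof.
rewrite /derivable; set F := fun h => _; set G := fun h => _.
by rewrite (_ : F = G)//; apply/funext => h; exact: partial1_quotient.
Qed.

Lemma derivable_e2 f x : derivable f x e2 <-> derivable (fun t => f (x.1, t)) x.2 1.
Proof.
rewrite /derivable; set F := fun h => _; set G := fun h => _.
by rewrite (_ : F = G)//; apply/funext => h; exact: partial2_quotient.
Qed.

Lemma derive_e1 f x : 'D_e1 f x = derive1 (fun t => f (t, x.2)) x.1.
Proof.
by rewrite derive1E /derive (funext (partial1_quotient f x)).
Qed.

Lemma derive_e2 f x : 'D_e2 f x = derive1 (fun t => f (x.1, t)) x.2.
Proof.
by rewrite derive1E /derive (funext (partial2_quotient f x)).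
Qed.

Lemma smoothP f : smooth f <->
  [/\ continuous f, forall x, derivable f x e1, forall x, derivable f x e2,
      smooth ('D_e1 f) & smooth ('D_e2 f)].
Proof.
split=> [sf|[cf d1 d2 s1 s2] [|k]].
- split; first exact: (sf 0%N).
  + by case: (sf 1%N) => d1 _ _ _; exact: d1.
  + by case: (sf 1%N) => _ d2 _ _; exact: d2.
  + by move=> k; case: (sf k.+1) => _ _ s1 _; exact: s1.
  + by move=> k; case: (sf k.+1) => _ _ _ s2; exact: s2.
- exact: cf.
- by split; [exact: d1|exact: d2|exact: s1|exact: s2].
Qed.

(** Smoothness is the largest class of continuous functions closed under both partial derivatives,
    so it can be proved by exhibiting any such class. *)
Lemma smooth_coinduction (P : (R * R -> R) -> Prop) :
  (forall f, P f -> [/\ continuous f, forall x, derivable f x e1,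
     forall x, derivable f x e2, P ('D_e1 f) & P ('D_e2 f)]) ->
  forall f, P f -> smooth f.
Proof.
move=> Pc f Pf k; elim: k f Pf => [|k IH] f /Pc[cf d1 d2 P1 P2] //=.
by split=> //; exact: IH.
Qed.

Lemma smooth_continuous f : smooth f -> continuous f.
Proof. by move=> /smoothP[]. Qed.

Lemma smooth_D1 f : smooth f -> smooth ('D_e1 f).
Proof. by move=> /smoothP[]. Qed.

Lemma smooth_D2 f : smooth f -> smooth ('D_e2 f).
Proof. by move=> /smoothP[]. Qed.

Lemma smooth_derivable1 f x : smooth f -> derivable f x e1.
Proof. by move=> /smoothP[]. Qed.

Lemma smooth_derivable2 f x : smooth f -> derivable f x e2.
Proof. by move=> /smoothP[]. Qed.

(* The exponent [n] makes the family stable under differentiation. *)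
Definition flat (n : nat) (t : R) : R := if 0 < t then t ^- n * expR (- t^-1) else 0.

Lemma flat_ge0 n t : 0 <= flat n t.
Proof. by rewrite /flat; case: ifPn => // t0; rewrite mulr_ge0 ?expR_ge0// invr_ge0 exprn_ge0// ltW. Qed.

Lemma flat_gt0 n t : 0 < t -> 0 < flat n t.
Proof. by move=> t0; rewrite /flat t0 mulr_gt0 ?expR_gt0// invr_gt0 exprn_gt0. Qed.

Lemma flat_eq0 n t : t <= 0 -> flat n t = 0.
Proof. by rewrite /flat leNgt => /negbTE ->. Qed.

Lemma flatS n t : flat n.+1 t = t^-1 * flat n t.
Proof.
by rewrite /flat; case: ifPn => [t0|_]; rewrite ?mulr0// exprS invfM mulrA.
Qed.

Lemma flat_le n t : flat n t <= n.+1`!%:R * `|t|.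
Proof.
have [t0|t0] := leP t 0; first by rewrite flat_eq0// mulr_ge0.
rewrite /flat t0 gtr0_norm// expRN -exprVn.
set s := t^-1; have s0 : 0 < s by rewrite invr_gt0.
have -> : t = s^-1 by rewrite invrK.
have H : s ^+ n.+1 / n.+1`!%:R <= expR s.
  by apply: le_trans (expR_ge1Dxn n (ltW s0)); rewrite lerDr.
rewrite ler_pdivrMr ?expR_gt0// mulrAC ler_pdivlMr//.
move: H; rewrite ler_pdivrMr ?ltr0n ?fact_gt0// exprSr => /le_trans; apply.
by rewrite mulrC.
Qed.

(** For [t > 0] this is the chain rule through [t^-1]. At 0 the difference quotient is [flat n.+1]
    itself, which tends to 0 by [flat_le]. *)
Lemma is_derive_flat n t :
  is_derive t (1 : R) (flat n) (- n%:R * flat n.+1 t + flat n.+2 t).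
Proof.
have [t0|t0|t0] := ltgtP t 0.
- rewrite !flat_eq0 ?(ltW t0)// mulr0 addr0.
  apply: (near_eq_is_derive (f := fun=> 0)) => //.
    have : \forall z \near t, z < 0 by exact: lt_nbhsl.
    by apply: filterS => z z0; rewrite flat_eq0// ltW.
- pose G (z : R) : R := z ^+ n * expR (- z).
  have dG : is_derive (t^-1 : R) (1 : R) G (n%:R * t^-1 ^+ n.-1 * expR (- t^-1) - t^-1 ^+ n * expR (- t^-1)).
    have dX : is_derive (t^-1 : R) (1 : R) (fun z : R => z ^+ n) (n%:R * t^-1 ^+ n.-1).
      have := @is_deriveX R R id n t^-1 1 1 (is_derive_id _ _).
      rewrite /GRing.scale/= mulr1 (_ : id ^+ n = fun z => z ^+ n)//.
      by apply/funext => z; rewrite fctE.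
    have dN : is_derive (t^-1 : R) (1 : R) (fun z : R => - z) (-1) by apply: is_derive_eq.
    have dE := is_derive1_comp (is_derive_expR (- t^-1)) dN.
    have dM := is_deriveM dX dE; apply: (@is_derive_eq _ _ _ _ _ _ _ _ dM).
    by rewrite /GRing.scale/=; ring.
  have dV : is_derive t (1 : R) (fun z : R => z^-1) (- t ^- 2).
    have dV := @is_deriveV R id t 1 1 (lt0r_neq0 t0) (is_derive_id _ _).
    by apply: (@is_derive_eq _ _ _ _ _ _ _ _ dV); rewrite /GRing.scale/= mulr1.
  have E : (- n%:R * flat n.+1 t + flat n.+2 t) =
      (n%:R * t^-1 ^+ n.-1 * expR (- t^-1) - t^-1 ^+ n * expR (- t^-1)) * (- t ^- 2).
    rewrite /flat t0 -!exprVn; case: (n) => [|k]; rewrite ?exprS/=; ring.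
  rewrite E; apply: (@near_eq_is_derive _ _ _ (G \o (fun z : R => z^-1))).
    have : \forall z \near t, 0 < z by exact: lt_nbhsr.
    by apply: filterS => z z0; rewrite /flat z0 /G/= exprVn.
- rewrite t0 !flat_eq0// mulr0 addr0.
  have H : h^-1 *: ((flat n \o shift (0 : R)) (h *: (1 : R)) - flat n 0) @[h --> (0 : R)^'] --> (0 : R).
    have B h : `|h^-1 *: ((flat n \o shift (0 : R)) (h *: (1 : R)) - flat n 0)| <= n.+2`!%:R * `|h|.
      rewrite [flat n 0]flat_eq0// subr0 /= addr0 /GRing.scale/= mulr1.
      have [h0|h0] := leP h 0; first by rewrite flat_eq0// mulr0 normr0 mulr_ge0.
      by rewrite -flatS ger0_norm ?flat_ge0// flat_le.
    apply/cvgr0Pnorm_le => eps eps0; near=> h; apply: (le_trans (B h)).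
    rewrite -ler_pdivlMl ?ltr0n ?fact_gt0//.
    near: h; apply: dnbhs0_le; by rewrite mulr_gt0// invr_gt0 ltr0n fact_gt0.
  by split; [exact: (cvgP _ H)|exact: (cvg_lim _ H)].
Unshelve. all: by end_near. Qed.

Lemma flat_continuous n : continuous (flat n).
Proof.
move=> t; apply: differentiable_continuous; apply/derivable1_diffP.
by have [] := is_derive_flat n t.
Qed.

(** A class closed under partial derivatives, since the derivative of [flat n] is a combination of
    [flat n.+1] and [flat n.+2]; it contains the bump functions. *)
Inductive flat_algebra : (R * R -> R) -> Prop :=
| flat_cst c : flat_algebra (fun=> c)
| flat_affine n a b c : flat_algebra (fun x => flat n (a * x.1 + b * x.2 + c))
| flat_add f g : flat_algebra f -> flat_algebra g -> flat_algebra (fun x => f x + g x)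
| flat_mul f g : flat_algebra f -> flat_algebra g -> flat_algebra (fun x => f x * g x).

Definition has_partials f (f1 f2 : R * R -> R) := forall x,
  is_derive x e1 f (f1 x) /\ is_derive x e2 f (f2 x).

Lemma has_partials_D f : (forall x, derivable f x e1) -> (forall x, derivable f x e2) ->
  has_partials f ('D_e1 f) ('D_e2 f).
Proof. by move=> d1 d2 x; split; apply: derivableP. Qed.

Lemma has_partialsE f f1 f2 : has_partials f f1 f2 ->
  [/\ forall x, derivable f x e1, forall x, derivable f x e2, 'D_e1 f = f1 & 'D_e2 f = f2].
Proof.
move=> H; split=> [x|x||].
- by have [[]] := H x.
- by have [_ []] := H x.
- by apply/funext => x; have [[]] := H x.
- by apply/funext => x; have [_ []] := H x.
Qed.

Lemma has_partialsM f g f1 f2 g1 g2 : has_partials f f1 f2 -> has_partials g g1 g2 ->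
  has_partials (fun x => f x * g x) (fun x => f1 x * g x + f x * g1 x)
                                    (fun x => f2 x * g x + f x * g2 x).
Proof.
move=> Hf Hg x; have [d1 d2] := Hf x; have [d3 d4] := Hg x.
by split; (apply: is_derive_eq; rewrite /GRing.scale/= addrC; congr (_ + _); rewrite mulrC).
Qed.

Lemma has_partialsD f g f1 f2 g1 g2 : has_partials f f1 f2 -> has_partials g g1 g2 ->
  has_partials (fun x => f x + g x) (fun x => f1 x + g1 x) (fun x => f2 x + g2 x).
Proof.
by move=> Hf Hg x; have [d1 d2] := Hf x; have [d3 d4] := Hg x; split; apply: is_derive_eq.
Qed.

Lemma has_partials_cst c : has_partials (fun=> c) (fun=> 0) (fun=> 0).
Proof. by move=> x; split; exact: is_derive_cst. Qed.

Lemma is_derive_partial1 f x d : is_derive x.1 (1 : R) (fun t => f (t, x.2)) d ->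
  is_derive x e1 f d.
Proof.
by move=> [d1 d2]; split; [apply/derivable_e1|rewrite derive_e1 derive1E].
Qed.

Lemma is_derive_partial2 f x d : is_derive x.2 (1 : R) (fun t => f (x.1, t)) d ->
  is_derive x e2 f d.
Proof.
by move=> [d1 d2]; split; [apply/derivable_e2|rewrite derive_e2 derive1E].
Qed.

Lemma has_partials_flat n a b c : has_partials (fun x => flat n (a * x.1 + b * x.2 + c))
  (fun x => a * (- n%:R * flat n.+1 (a * x.1 + b * x.2 + c) + flat n.+2 (a * x.1 + b * x.2 + c)))
  (fun x => b * (- n%:R * flat n.+1 (a * x.1 + b * x.2 + c) + flat n.+2 (a * x.1 + b * x.2 + c))).
Proof.
move=> x; split.
  apply: is_derive_partial1; rewrite mulrC.
  apply: (@is_derive1_comp _ (flat n) (fun t : R => a * t + b * x.2 + c)).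
    exact: is_derive_flat.
  by apply: is_derive_eq; rewrite /GRing.scale/=; ring.
apply: is_derive_partial2; rewrite mulrC.
apply: (@is_derive1_comp _ (flat n) (fun t : R => a * x.1 + b * t + c)).
  exact: is_derive_flat.
by apply: is_derive_eq; rewrite /GRing.scale/=; ring.
Qed.

Lemma continuous_fst_plane : continuous (fst : R * R -> R).
Proof. by move=> x; exact: cvg_fst. Qed.

Lemma continuous_snd_plane : continuous (snd : R * R -> R).
Proof. by move=> x; exact: cvg_snd. Qed.

Lemma continuous_pair (T : topologicalType) (f g : T -> R) :
  continuous f -> continuous g -> continuous (fun z => (f z, g z)).
Proof. by move=> cf cg x; exact: (cvg_pair (cf x) (cg x)). Qed.

Lemma flat_algebra_smooth f : flat_algebra f -> smooth f.
Proof.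
apply: smooth_coinduction => {}f F.
suff [f1 [f2 [Hf F1 F2 cf]]] : exists f1 f2, [/\ has_partials f f1 f2, flat_algebra f1,
    flat_algebra f2 & continuous f].
  by have [d1 d2 -> ->] := has_partialsE Hf; split; [exact: cf|exact: d1|exact: d2|exact: F1|exact: F2].
elim: F => {f} [c|n a b c|f g Ff [f1 [f2 [Hf F1 F2 cf]]] Fg [g1 [g2 [Hg G1 G2 cg]]]
  |f g Ff [f1 [f2 [Hf F1 F2 cf]]] Fg [g1 [g2 [Hg G1 G2 cg]]]].
- exists (fun=> 0), (fun=> 0); split; [exact: has_partials_cst|exact: flat_cst|exact: flat_cst|].
  exact: cst_continuous.
- eexists; eexists; split; first exact: has_partials_flat.
  + apply: flat_mul; first exact: flat_cst.
    by apply: flat_add; [apply: flat_mul; [exact: flat_cst|exact: flat_affine]|exact: flat_affine].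
  + apply: flat_mul; first exact: flat_cst.
    by apply: flat_add; [apply: flat_mul; [exact: flat_cst|exact: flat_affine]|exact: flat_affine].
  + move=> x; apply: (@continuous_comp _ _ _ (fun x : R * R => a * x.1 + b * x.2 + c) (flat n)); last exact: flat_continuous.
    apply: cvgD; last exact: cvg_cst.
    by apply: cvgD; apply: cvgM; try exact: cvg_cst; [exact: continuous_fst_plane|exact: continuous_snd_plane].
- eexists; eexists; split; first exact: has_partialsD Hf Hg.
  + exact: flat_add.
  + exact: flat_add.
  + by move=> x; apply: cvgD; [exact: cf|exact: cg].
- eexists; eexists; split; first exact: has_partialsM Hf Hg.
  + by apply: flat_add; exact: flat_mul.
  + by apply: flat_add; exact: flat_mul.
  + by move=> x; apply: cvgM; [exact: cf|exact: cg].
Qed.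

(** Leibniz' rule leaves the class of products of two smooth functions; closing under sums and
    products first makes the coinduction go through. *)
Inductive smooth_algebra : (R * R -> R) -> Prop :=
| smooth_base f : smooth f -> smooth_algebra f
| smooth_add f g : smooth_algebra f -> smooth_algebra g -> smooth_algebra (fun x => f x + g x)
| smooth_mul f g : smooth_algebra f -> smooth_algebra g -> smooth_algebra (fun x => f x * g x).

Lemma smooth_algebra_smooth f : smooth_algebra f -> smooth f.
Proof.
apply: smooth_coinduction => {}f F.
suff [f1 [f2 [Hf F1 F2 cf]]] : exists f1 f2, [/\ has_partials f f1 f2, smooth_algebra f1,
    smooth_algebra f2 & continuous f].
  by have [d1 d2 -> ->] := has_partialsE Hf; split; [exact: cf|exact: d1|exact: d2|exact: F1|exact: F2].
elim: F => {f} [f /smoothP[cf d1 d2 s1 s2]|f g Ff [f1 [f2 [Hf F1 F2 cf]]] Fg [g1 [g2 [Hg G1 G2 cg]]]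
  |f g Ff [f1 [f2 [Hf F1 F2 cf]]] Fg [g1 [g2 [Hg G1 G2 cg]]]].
- exists ('D_e1 f), ('D_e2 f); split; [exact: has_partials_D|exact: smooth_base s1|exact: smooth_base s2|exact: cf].
- eexists; eexists; split; first exact: has_partialsD Hf Hg.
  + exact: smooth_add.
  + exact: smooth_add.
  + by move=> x; apply: cvgD; [exact: cf|exact: cg].
- eexists; eexists; split; first exact: has_partialsM Hf Hg.
  + by apply: smooth_add; exact: smooth_mul.
  + by apply: smooth_add; exact: smooth_mul.
  + by move=> x; apply: cvgM; [exact: cf|exact: cg].
Qed.

Lemma smoothD f g : smooth f -> smooth g -> smooth (fun x => f x + g x).
Proof. by move=> sf sg; apply: smooth_algebra_smooth; apply: smooth_add; exact: smooth_base. Qed.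

Lemma smoothM f g : smooth f -> smooth g -> smooth (fun x => f x * g x).
Proof. by move=> sf sg; apply: smooth_algebra_smooth; apply: smooth_mul; exact: smooth_base. Qed.

Lemma smooth_cst (c : R) : smooth ((fun=> c) : R * R -> R).
Proof. by apply: flat_algebra_smooth; exact: flat_cst. Qed.

Lemma smoothZ c f : smooth f -> smooth (fun x => c * f x).
Proof. by apply: smoothM; exact: smooth_cst. Qed.

Lemma smooth_partials f : smooth f -> has_partials f ('D_e1 f) ('D_e2 f).
Proof. by move=> /smoothP[_ d1 d2 _ _]; exact: has_partials_D. Qed.

Lemma is_derive_fst f (x y : R) : smooth f ->
  is_derive x (1 : R) (fun t => f (t, y)) ('D_e1 f (x, y)).
Proof.
move=> sf; rewrite derive_e1 derive1E; apply: derivableP.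
by have /derivable_e1 := @smooth_derivable1 f (x, y) sf.
Qed.

Lemma is_derive_snd f (x y : R) : smooth f ->
  is_derive y (1 : R) (fun t => f (x, t)) ('D_e2 f (x, y)).
Proof.
move=> sf; rewrite derive_e2 derive1E; apply: derivableP.
by have /derivable_e2 := @smooth_derivable2 f (x, y) sf.
Qed.

Lemma is_derive_csub (c t : R) : is_derive t (1 : R) (fun z : R => c - z) (-1).
Proof.
have H := is_deriveB (is_derive_cst c t (1 : R)) (is_derive_id t (1 : R)).
by apply: (@is_derive_eq _ _ _ _ _ _ _ _ H); rewrite sub0r.
Qed.

Lemma smooth_reflect f q : smooth f -> smooth (fun z => f (q.1 - z.1, q.2 - z.2)).
Proof.
(* Each derivative of the reflected function changes its sign, hence the free factor [c] in the
   class. *)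
move=> sf; pose P g := exists c f, smooth f /\ g = fun z => c * f (q.1 - z.1, q.2 - z.2).
apply: (@smooth_coinduction P); last by exists 1, f; split => //; apply/funext => z; rewrite mul1r.
move=> {f sf} _ [c [f [sf ->]]].
have H : has_partials (fun z => c * f (q.1 - z.1, q.2 - z.2))
    (fun z => - c * 'D_e1 f (q.1 - z.1, q.2 - z.2)) (fun z => - c * 'D_e2 f (q.1 - z.1, q.2 - z.2)).
  move=> x; split.
    apply: is_derive_partial1.
    have e : is_derive x.1 (1 : R) (fun t => q.1 - t) (-1) by exact: is_derive_csub.
    have d' := @is_derive1_comp _ _ (fun t => q.1 - t) x.1 _ _ (is_derive_fst (q.1 - x.1) (q.2 - x.2) sf) e.
    have d'' := is_deriveM (is_derive_cst c x.1 (1 : R)) d'.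
    by apply: (@is_derive_eq _ _ _ _ _ _ _ _ d''); rewrite /GRing.scale/=; ring.
  apply: is_derive_partial2.
  have e : is_derive x.2 (1 : R) (fun t => q.2 - t) (-1) by exact: is_derive_csub.
  have d' := @is_derive1_comp _ _ (fun t => q.2 - t) x.2 _ _ (is_derive_snd (q.1 - x.1) (q.2 - x.2) sf) e.
  have d'' := is_deriveM (is_derive_cst c x.2 (1 : R)) d'.
  by apply: (@is_derive_eq _ _ _ _ _ _ _ _ d''); rewrite /GRing.scale/=; ring.
have [d1 d2 -> ->] := has_partialsE H; split => //.
- move=> x; apply: cvgM; first exact: cvg_cst.
  apply: (@continuous_comp _ _ _ (fun z : R * R => (q.1 - z.1, q.2 - z.2)) f).
    apply: continuous_pair => {}x; (apply: cvgB; [exact: cvg_cst|]).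
      exact: continuous_fst_plane.
    exact: continuous_snd_plane.
  exact: smooth_continuous.
- by exists (- c), ('D_e1 f); split => //; exact: smooth_D1.
- by exists (- c), ('D_e2 f); split => //; exact: smooth_D2.
Qed.

Definition bump p (r : R) x : R :=
  flat 0 (r - (x.1 - p.1)) * flat 0 (r + (x.1 - p.1)) *
  (flat 0 (r - (x.2 - p.2)) * flat 0 (r + (x.2 - p.2))).

Lemma smooth_bump p r : smooth (bump p r).
Proof.
apply: flat_algebra_smooth.
rewrite (_ : bump p r = fun x =>
  flat 0 (-1 * x.1 + 0 * x.2 + (r + p.1)) * flat 0 (1 * x.1 + 0 * x.2 + (r - p.1)) *
  (flat 0 (0 * x.1 + -1 * x.2 + (r + p.2)) * flat 0 (0 * x.1 + 1 * x.2 + (r - p.2)))).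
  by apply: flat_mul; apply: flat_mul; exact: flat_affine.
by apply/funext => x; rewrite /bump; congr (flat _ _ * flat _ _ * (flat _ _ * flat _ _)); ring.
Qed.

Lemma bump_ge0 p r x : 0 <= bump p r x.
Proof. by rewrite /bump !mulr_ge0// flat_ge0. Qed.

Lemma bump_gt0 p r x : `|x.1 - p.1| < r -> `|x.2 - p.2| < r -> 0 < bump p r x.
Proof.
rewrite !ltr_norml => /andP[a1 a2] /andP[a3 a4].
by rewrite /bump !mulr_gt0// flat_gt0//; lra.
Qed.

Lemma bump_eq0 p r x : r <= `|x.1 - p.1| \/ r <= `|x.2 - p.2| -> bump p r x = 0.
Proof.
have K (t : R) : r <= `|t| -> flat 0 (r - t) * flat 0 (r + t) = 0.
  have [t0|t0] := leP 0 t => rt.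
    by rewrite [flat 0 (r - t)]flat_eq0 ?mul0r// subr_le0 -(ger0_norm t0).
  by rewrite [flat 0 (r + t)]flat_eq0 ?mulr0//; rewrite ltr0_norm// in rt; lra.
by rewrite /bump => -[/K ->|/K ->]; rewrite ?mul0r ?mulr0.
Qed.

End SmoothFunctions.

(** * Continuity of measure-preserving families in L2 *)

Lemma cvge0P (R : realType) (T : Type) (F : set_system T) {FF : Filter F} (u : T -> \bar R) :
  (forall t, (0 <= u t)%E) ->
  (u t @[t --> F] --> 0%E <-> forall eps : R, 0 < eps -> \forall t \near F, (u t <= eps%:E)%E).
Proof.
move=> u0; split=> [/fine_cvgP[uf /cvgrPdist_le H] eps eps0|H].
  apply: filterS2 uf (H _ eps0) => t ut; rewrite sub0r normrN => H'.
  by rewrite -(fineK ut) lee_fin (le_trans (ler_norm _)).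
have uf : \forall t \near F, u t \is a fin_num.
  apply: filterS (H 1 ltr01) => t ut; rewrite ge0_fin_numE//.
  by apply: le_lt_trans ut _; rewrite ltry.
apply/fine_cvgP; split=> //; apply/cvgrPdist_le => eps eps0.
apply: filterS2 uf (H _ eps0) => t ut ue.
by rewrite sub0r normrN ger0_norm ?fine_ge0// -lee_fin fineK.
Qed.

Import HBNNSimple.

Section TranslationContinuity.
Context d (T : measurableType d) (R : realType) (mu : {measure set T -> \bar R}).
Context (I : Type) (F : set_system I) {FF : Filter F} (tau : I -> T -> T).
Hypothesis mtau : forall y, measurable_fun setT (tau y).
Hypothesis tau_mu : forall y A, measurable A -> mu (tau y @^-1` A) = mu A.
Implicit Types (f g : T -> R).

Lemma sqint_tau y f : measurable_fun setT f ->
  sqint mu setT (f \o tau y) = sqint mu setT f.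
Proof.
move=> mf; have H := ge0_integral_pushforward (mtau y) mu measurableT (measurable_sq mf).
rewrite /sqint -[LHS]/(\int[mu]_(x in tau y @^-1` setT) ((fun x => (f x ^+ 2)%:E) \o tau y) x)%E.
rewrite -H; last by move=> x _; rewrite lee_fin sqr_ge0.
by apply: eq_measure_integral => A mA _; exact: tau_mu.
Qed.

(** Continuity in the square norm of the action of [tau]. The family is abstract so that one
    argument serves the translations of the line and of the plane. *)
Definition tau_cont f := L2 mu setT f /\ forall eps : R, 0 < eps ->
  \forall y \near F, (sqint mu setT (fun x => (f (tau y x) - f x)%R) <= eps%:E)%E.

Lemma measurable_tau f y : measurable_fun setT f -> measurable_fun setT (f \o tau y).
Proof. by move=> mf; exact: measurableT_comp. Qed.

Lemma tau_contD f g : tau_cont f -> tau_cont g -> tau_cont (fun x => f x + g x).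
Proof.
move=> [f2 fF] [g2 gF]; split; first exact: L2D.
move=> eps eps0; have e4 : 0 < eps / 4 by rewrite divr_gt0.
apply: filterS2 (fF _ e4) (gF _ e4) => y fy gy.
have [mf _] := f2; have [mg _] := g2.
have mfy := measurable_tau y mf; have mgy := measurable_tau y mg.
have -> : (fun x => f (tau y x) + g (tau y x) - (f x + g x)) =
  (fun x => (f (tau y x) - f x) + (g (tau y x) - g x)).
  by apply/funext => x; rewrite opprD addrACA.
apply: (le_trans (sqintD_le _ _ _ _)); try exact: measurable_funB; first exact: measurableT.
apply: (@le_trans _ _ (2%:E * (eps / 4)%:E + 2%:E * (eps / 4)%:E)%E).
  by apply: leeD; apply: lee_wpmul2l.
by rewrite -!EFinM -EFinD lee_fin; lra.
Qed.

Lemma tau_contZ c f : tau_cont f -> tau_cont (fun x => c * f x).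
Proof.
move=> [f2 fF]; split; first exact: L2Z.
move=> eps eps0; have e4 : 0 < eps / (c ^+ 2 + 1) by rewrite divr_gt0// ltr_wpDl// sqr_ge0.
apply: filterS (fF _ e4) => y fy.
have [mf _] := f2; have mfy := measurable_tau y mf.
have -> : (fun x => c * f (tau y x) - c * f x) = (fun x => c * (f (tau y x) - f x)).
  by apply/funext => x; rewrite mulrBr.
rewrite sqintZ//; last exact: measurable_funB.
apply: (@le_trans _ _ ((c ^+ 2)%:E * (eps / (c ^+ 2 + 1))%:E)%E).
  by apply: lee_wpmul2l => //; rewrite lee_fin sqr_ge0.
rewrite -EFinM lee_fin mulrCA ler_piMr ?(ltW eps0)// ler_pdivrMr ?ltr_wpDl ?sqr_ge0// mul1r.
by rewrite lerDl.
Qed.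

Lemma tau_contB f g : tau_cont f -> tau_cont g -> tau_cont (fun x => f x - g x).
Proof.
move=> fF gF; have := tau_contD fF (tau_contZ (-1) gF).
by under [X in tau_cont X]eq_fun do rewrite mulN1r.
Qed.

Lemma tau_cont_sum (J : eqType) (s : seq J) (f : J -> T -> R) :
  (forall j, j \in s -> tau_cont (f j)) -> tau_cont (fun x => \sum_(j <- s) f j x).
Proof.
elim: s => [_|j s IH H].
  under [X in tau_cont X]eq_fun do rewrite big_nil.
  split; first exact: L2_0.
  move=> eps eps0; apply: nearW => y; rewrite /sqint integral0_eq ?lee_fin ?ltW//.
  by move=> x _; rewrite subrr expr0n.
under [X in tau_cont X]eq_fun do rewrite big_cons.
apply: tau_contD; first by apply: H; rewrite mem_head.
by apply: IH => k ks; apply: H; rewrite in_cons ks orbT.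
Qed.

(** Composition with [tau y] is an isometry, so the error of approximating [f] by [f_ n] is the same
    before and after the move. *)
Lemma tau_cont_lim (f_ : nat -> T -> R) f : L2 mu setT f -> (forall n, tau_cont (f_ n)) ->
  sqint mu setT (fun x => f_ n x - f x) @[n --> \oo] --> 0%E -> tau_cont f.
Proof.
move=> f2 fF fl; split => // eps eps0.
have [mf _] := f2; have mfn n : measurable_fun setT (f_ n) by have [[]] := fF n.
have e16 : 0 < eps / 16 by rewrite divr_gt0.
have [n fn] : exists n, (sqint mu setT (fun x => (f_ n x - f x)%R) <= (eps / 16)%:E)%E.
  have H := (cvge0P (fun n => sqint_ge0 mu setT (fun x => f_ n x - f x))).1 fl _ e16.
  exact: filter_ex (H _).
have e4 : 0 < eps / 4 by rewrite divr_gt0.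
apply: filterS ((fF n).2 _ e4) => y fy.
have mfy := measurable_tau y mf; have mfny := measurable_tau y (mfn n).
pose A x := f_ n x - f x.
have mA : measurable_fun setT A by exact: measurable_funB.
have E : (fun x => f (tau y x) - f x) = (fun x => (f_ n (tau y x) - f_ n x) + (A x - A (tau y x))).
  by apply/funext => x; rewrite /A; ring.
rewrite E; apply: (le_trans (sqintD_le _ _ _ _)); first exact: measurableT.
- exact: measurable_funB.
- by apply: measurable_funB => //; exact: measurable_tau.
have HA : (sqint mu setT (fun x => (A x - A (tau y x))%R) <= (eps / 4)%:E)%E.
  apply: (le_trans (sqintB_le _ _ _ _)) => //; first exact: measurable_tau.
  have -> : sqint mu setT (fun x => A (tau y x)) = sqint mu setT A by exact: sqint_tau.
  apply: (@le_trans _ _ (2%:E * (eps / 16)%:E + 2%:E * (eps / 16)%:E)%E).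
    by apply: leeD; apply: lee_wpmul2l.
  by rewrite -!EFinM -EFinD lee_fin; lra.
apply: (@le_trans _ _ (2%:E * (eps / 4)%:E + 2%:E * (eps / 4)%:E)%E).
  by apply: leeD; apply: lee_wpmul2l.
by rewrite -!EFinM -EFinD lee_fin; lra.
Qed.

Lemma sqint_indic (A : set T) : measurable A -> sqint mu setT \1_A = mu A.
Proof.
move=> mA; rewrite /sqint (eq_integral (fun x => (\1_A x)%:E)) ?integral_indic ?setIT//.
by move=> x _; rewrite indicE; case: (x \in A); rewrite ?expr1n ?expr0n.
Qed.

Lemma L2_indic (A : set T) : measurable A -> (mu A < +oo)%E -> L2 mu setT (\1_A).
Proof. by move=> mA Aoo; split; [exact: measurable_indic|rewrite -/(sqint _ _ _) sqint_indic]. Qed.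

(** Dynkin's argument: differences follow by linearity, increasing unions from [tau_cont_lim] and
    continuity of the measure. Cutting with [Q], of finite measure, keeps all indicators square
    integrable. *)
Lemma tau_cont_lambda (Q : set T) : measurable Q -> (mu Q < +oo)%E -> tau_cont \1_Q ->
  lambda_system setT [set A | measurable A /\ tau_cont (\1_(A `&` Q))].
Proof.
move=> mQ Qoo tQ.
have fin A : measurable A -> (mu (A `&` Q) < +oo)%E.
  move=> mA; apply: le_lt_trans Qoo; apply: le_measure; rewrite ?inE//.
  exact: measurableI.
split.
- by move=> A _.
- by split; rewrite ?setTI.
- move=> A B BA [mA tA] [mB tB]; split; first exact: measurableD.
  have -> : \1_((A `\` B) `&` Q) = (fun x => \1_(A `&` Q) x - \1_(B `&` Q) x) :> (T -> R).
    apply/funext => x; rewrite !indicE !in_setI in_setC.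
    case: (boolP (x \in B)) => [xB|_] /=; last by rewrite subr0 andbT.
    by rewrite (mem_set (BA _ (set_mem xB)))/= subrr.
  exact: tau_contB.
- move=> A ndA H; have mA n : measurable (A n) by have [] := H n.
  have mU : measurable (\bigcup_n A n) by exact: bigcup_measurable.
  split => //; apply: (@tau_cont_lim (fun n => \1_(A n `&` Q))).
  + by apply: L2_indic; [exact: measurableI|exact: fin].
  + by move=> n; have [] := H n.
  have -> : (fun n => sqint mu setT (fun x => \1_(A n `&` Q) x - \1_(\bigcup_n A n `&` Q) x)) =
      (fun n => mu ((\bigcup_n A n `&` Q) `\` (A n `&` Q))).
    apply/funext => n; rewrite -sqint_indic; last by apply: measurableD; exact: measurableI.
    apply: eq_sqint => x _; rewrite setDE !indicE [x \in _ `&` ~` _]in_setI in_setC.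
    case: (boolP (x \in A n `&` Q)) => [/set_mem[xA xQ]|_] /=.
      by rewrite mem_set/= ?subrr ?expr0n//; split => //; exists n.
    by rewrite andbT sub0r sqrrN.
  have E : mu (\bigcup_n A n `&` Q) \is a fin_num by rewrite ge0_fin_numE// fin.
  have -> : (fun n => mu ((\bigcup_n A n `&` Q) `\` (A n `&` Q))) =
      (fun n => mu (\bigcup_n A n `&` Q) - mu (A n `&` Q))%E.
    apply/funext => n; rewrite measureD//; [|exact: measurableI|exact: measurableI|exact: fin].
    congr (_ - mu _)%E; apply/seteqP; split=> [x []//|x [xA xQ]]; split => //.
    by split => //; exists n.
  rewrite -(subee E); apply: cvgeB => //; first exact: fin_num_adde_defr.
    exact: cvg_cst.
  rewrite setI_bigcupl; apply: nondecreasing_cvg_mu.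
  - by move=> n; exact: measurableI.
  - by apply: bigcup_measurable => n _; exact: measurableI.
  - by move=> m n mn; apply/subsetPset => x [xA xQ]; split => //; have /subsetPset := ndA _ _ mn; exact.
Qed.

Lemma tau_cont_indic (G : set (set T)) (Q : set T) : setI_closed G ->
  measurable Q -> (mu Q < +oo)%E -> tau_cont \1_Q ->
  (forall A, G A -> measurable A /\ tau_cont (\1_(A `&` Q))) ->
  forall A, <<s G >> A -> tau_cont (\1_(A `&` Q)).
Proof.
move=> GI mQ Qoo tQ GH A GA.
have [] // := lambda_system_subset GI (tau_cont_lambda mQ Qoo tQ) GH _ GA.
Qed.

(* Simple functions cut off by an exhaustion are dense in L2. *)
Lemma tau_cont_L2_ge0 (Q : nat -> set T) f : (forall n, measurable (Q n)) ->
  (forall x, \forall n \near \oo, Q n x) ->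
  (forall n A, measurable A -> tau_cont (\1_(A `&` Q n))) ->
  L2 mu setT f -> (forall x, 0 <= f x) -> tau_cont f.
Proof.
move=> mQ Qx tQ f2 f0; have [mf foo] := f2.
have mEf : measurable_fun setT (EFin \o f) by exact/measurable_EFinP.
have f0' : forall y, setT y -> (0 <= (EFin \o f) y)%E by move=> y _; rewrite lee_fin.
have [g [ndg gf]] := approximation measurableT mEf f0'.
have gx x : g n x @[n --> \oo] --> f x by have /fine_cvgP[] := gf x Logic.I.
suff: sqint mu setT (fun x => g n x * \1_(Q n) x - f x) @[n --> \oo] --> 0%E.
  apply: (@tau_cont_lim (fun n x => g n x * \1_(Q n) x) f f2).
  move=> n; rewrite (_ : (fun x => _) = fun x =>
      \sum_(r <- finmap.enum_fset (fset_set (range (g n)))) r * \1_((g n @^-1` [set r]) `&` Q n) x).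
    apply: tau_cont_sum => r _; apply: tau_contZ; apply: tQ.
    exact: measurable_sfunP.
  apply/funext => x; rewrite {1}(fimfunE (g n) x) fsbig_finite//= mulr_suml.
  by apply: eq_bigr => r _; rewrite -mulrA indicI.
pose h n x : \bar R := ((g n x * \1_(Q n) x - f x) ^+ 2)%:E.
have mh n : measurable_fun setT (h n).
  apply/measurable_EFinP/measurable_funX/measurable_funB => //.
  by apply: measurable_funM => //; exact: measurable_indic.
have gle n x : 0 <= g n x * \1_(Q n) x <= f x.
  apply/andP; split; first by rewrite mulr_ge0// fun_ge0.
  have gfx : g n x <= f x.
    have ndx : nondecreasing_seq (fun m => g m x) by move=> i j ij; have /lefP := ndg _ _ ij; exact.
    have := nondecreasing_cvgn_le ndx (cvgP _ (gx x)) n.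
    by rewrite (cvg_lim _ (gx x)).
  by apply: le_trans gfx; rewrite ler_piMr ?fun_ge0// indicE lern1 leq_b1.
have hcvg x : setT x -> h n x @[n --> \oo] --> 0%E.
  move=> _; apply: cvg_EFin; first exact: nearW.
  have -> : (0 : R) = (f x - f x) ^+ 2 by rewrite subrr expr0n.
  have H : g n x - f x @[n --> \oo] --> f x - f x by apply: cvgB => //; exact: cvg_cst.
  have H2 : (g n x - f x) ^+ 2 @[n --> \oo] --> (f x - f x) ^+ 2.
    by under eq_fun do rewrite expr2; rewrite expr2; apply: cvgM.
  apply: cvg_trans H2; apply: near_eq_cvg.
  by apply: filterS (Qx x) => n Qn; rewrite /= indicE mem_set// mulr1.
have := @dominated_convergence _ _ _ mu setT measurableT h (cst 0%E) (fun x => (f x ^+ 2)%:E) mh.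
have I2 : mu.-integrable setT (fun x => (f x ^+ 2)%:E).
  apply/integrableP; split; first exact: measurable_sq.
  rewrite (_ : (\int[mu]_(x in _) _)%E = sqint mu setT f)//.
  by apply: eq_integral => x _; rewrite gee0_abs// lee_fin sqr_ge0.
case=> //.
- by apply: aeW => x; exact: hcvg.
- apply: aeW => x n _.
  rewrite gee0_abs ?lee_fin ?sqr_ge0//; have /andP[a b] := gle n x.
  by move: a b (f0 x); move: (_ * _) (f x) => a b; nra.
move=> _ _; rewrite integral_cst// mul0e; exact.
Qed.

Lemma tau_cont_L2 (Q : nat -> set T) f : (forall n, measurable (Q n)) ->
  (forall x, \forall n \near \oo, Q n x) ->
  (forall n A, measurable A -> tau_cont (\1_(A `&` Q n))) ->
  L2 mu setT f -> tau_cont f.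
Proof.
move=> mQ Qx tQ f2; have [mf foo] := f2.
have -> : f = (fun x => f^\+ x - f^\- x).
  by apply/funext => x; rewrite -[LHS]/(f x) -{1}(funrposBneg f).
apply: tau_contB; apply: (tau_cont_L2_ge0 mQ Qx tQ) => //.
- apply: (L2_le _ _ f2) => //; first exact: measurable_funrpos.
  by move=> x _; rewrite ger0_norm ?funrpos_ge0// /funrpos ge_max ler_norm normr_ge0.
- apply: (L2_le _ _ f2) => //; first exact: measurable_funrneg.
  by move=> x _; rewrite ger0_norm ?funrneg_ge0// /funrneg ge_max -normrN ler_norm normr_ge0.
Qed.

End TranslationContinuity.

(** * Translations of the line and of the plane *)

Section PlaneTranslation.
Context {R : realType}.
Local Notation planeT := (@planeT R).
Local Notation leb := (@lebesgue_measure R).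

Definition tr1 (y : R) (x : measurableTypeR R) : measurableTypeR R := x - y.

Lemma measurable_tr1 y : measurable_fun setT (tr1 y).
Proof.
by apply: continuous_measurable_fun => x; apply: cvgB; [exact: cvg_id|exact: cvg_cst].
Qed.

Lemma tr1_leb y A : measurable A -> leb (tr1 y @^-1` A) = leb A.
Proof. by move=> mA; rewrite -(lebesgue_translation (- y) mA). Qed.

(** The indicator and its translate differ only within distance [y] of the two end points, on a set
    of length at most four times the absolute value of [y]. *)
Lemma tau_cont_itv (a b : R) : a < b ->
  tau_cont leb (nbhs (0 : R)) tr1 \1_(`]a, b]%classic).
Proof.
move=> ab; set I := `]a, b]%classic.
have mI : measurable (I : set (measurableTypeR R)) by exact: measurable_itv.
split.
  have Ioo : (leb I < +oo)%E by rewrite /I lebesgue_measure_itv/= lte_fin ab -EFinB; exact: ltry.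
  exact: L2_indic.
move=> eps eps0; pose J c (y : R) : set (measurableTypeR R) := `[c - `|y|, c + `|y|]%classic.
have mJ c y : measurable (J c y) by exact: measurable_itv.
have bd y : (sqint leb setT (fun x => (\1_I (tr1 y x) - \1_I x)%R) <= (4 * `|y|)%:E)%E.
  apply: (@le_trans _ _ (\int[leb]_x ((\1_(J a y) x)%:E + (\1_(J b y) x)%:E))%E).
    apply: ge0_le_integral => //.
    - by move=> x _; rewrite lee_fin sqr_ge0.
    - apply: measurable_sq; apply: measurable_funB; last exact: measurable_indic.
      apply: (@measurableT_comp _ _ _ _ _ _ (\1_I : measurableTypeR R -> R)).
        exact: measurable_indic.
      exact: measurable_tr1.
    - by apply: emeasurable_funD; apply/measurable_EFinP; exact: measurable_indic.
    move=> x _; rewrite -EFinD lee_fin !indicE.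
    have HJ c : ((x <= c) && (c < x - y)) || ((c < x) && (x - y <= c)) -> x \in J c y.
      move=> H; rewrite inE /J /= in_itv/=.
      have := ler_norm y; have := ler_norm (- y); rewrite normrN => h1 h2.
      by case/orP: H => /andP[h3 h4]; apply/andP; split; lra.
    have memI z : (z \in I) = (a < z) && (z <= b) by rewrite /I; apply/idP/idP; rewrite inE /= in_itv.
    rewrite /tr1 !memI.
    have sq01 (c d : bool) : ((c%:R - d%:R : R) ^+ 2 <= (c != d)%:R).
      by case: c; case: d; rewrite /= ?subrr ?subr0 ?sub0r ?sqrrN ?expr0n ?expr1n.
    apply: (le_trans (sq01 _ _)).
    case: (x \in J a y) (HJ a) => /= [_|Ha]; first by rewrite -natrD ler_nat; case: (_ != _).
    case: (x \in J b y) (HJ b) => /= [_|Hb]; first by rewrite -natrD ler_nat; case: (_ != _).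
    rewrite addr0 lern0; apply/eqP/eqP; rewrite eqb0 negbK; apply/eqP.
    move: Ha Hb; case: (ltP a x); case: (ltP a (x - y)); case: (leP x b); case: (leP (x - y) b) => //=;
      move=> *; try done; try (exfalso; lra); by [case: (_ isT) | intuition].
  rewrite ge0_integralD//; try (by apply/measurable_EFinP; exact: measurable_indic); try by move=> x _; rewrite lee_fin.
  rewrite !integral_indic// !setIT.
  have lebJ c : leb (J c y) = (2 * `|y|)%:E.
    rewrite /J lebesgue_measure_itv/= lte_fin; case: ifPn => [_|].
      by rewrite -EFinB; congr EFin; ring.
    rewrite -leNgt => H; have : `|y| = 0 by have := normr_ge0 y; lra.
    by move=> ->; rewrite mulr0.
  apply: (@le_trans _ _ (leb (J a y) + leb (J b y))%E) => //.
  by rewrite !lebJ -EFinD lee_fin; lra.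
have e4 : 0 < 4^-1 * eps by rewrite mulr_gt0.
have H := @nbhs0_le R R^o _ e4; apply: filterS H => y ye.
by apply: (le_trans (bd y)); rewrite lee_fin -ler_pdivlMl.
Qed.

Definition box1 (n : nat) : set (measurableTypeR R) := `]- n.+1%:R, n.+1%:R]%classic.

Lemma measurable_box1 n : measurable (box1 n).
Proof. exact: measurable_itv. Qed.

Lemma box1_fin n : (leb (box1 n) < +oo)%E.
Proof.
rewrite /box1 lebesgue_measure_itv/=; case: ifPn => _; [rewrite -EFinB|]; exact: ltry.
Qed.

Lemma box1_exhausts x : \forall n \near \oo, box1 n x.
Proof.
have := archi_boundP (normr_ge0 x); set k := Num.bound _ => xk.
exists k => // n /= kn; rewrite /box1/= in_itv/=.
have : `|x| < n.+1%:R by apply: (lt_le_trans xk); rewrite ler_nat; exact: leqW.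
by rewrite ltr_norml => /andP[-> /ltW ->].
Qed.

Lemma tau_cont_box1 n A : measurable A ->
  tau_cont leb (nbhs (0 : R)) tr1 \1_(A `&` box1 n).
Proof.
have n0 : - n.+1%:R < n.+1%:R :> R by rewrite gtrN.
apply: (@tau_cont_indic _ _ _ leb _ (nbhs (0 : R)) _ tr1 measurable_tr1 tr1_leb (@ocitv R)).
- exact: ocitvI.
- exact: measurable_box1.
- exact: box1_fin.
- exact: tau_cont_itv.
move=> B oB; split; first exact: sub_sigma_algebra.
have /ocitvP[->|[[x1 x2] /= x12 ->]] : ocitv (B `&` box1 n).
  by apply: ocitvI => //; exists (- n.+1%:R, n.+1%:R).
  by rewrite indic0; split; [exact: L2_0|move=> eps eps0; apply: nearW => y; rewrite /sqint integral0_eq ?lee_fin ?ltW// => z _; rewrite subrr expr0n].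
exact: tau_cont_itv.
Qed.

Definition tr2 (y : R * R) (x : planeT) : planeT := (x.1 - y.1, x.2 - y.2).

Lemma area_preserving_tr2 y : area_preserving (tr2 y).
Proof. exact: (area_preserving_translation (- y.1, - y.2)). Qed.

Lemma area_tonelli (F : planeT -> \bar R) : measurable_fun setT F -> (forall x, (0 <= F x)%E) ->
  (\int[area]_p F p = \int[leb]_x \int[leb]_y F (x, y))%E.
Proof. by move=> mF F0; rewrite /area fubini_tonelli1. Qed.

Lemma measurable_fun_fst (f : R -> R) : measurable_fun setT f ->
  measurable_fun setT (fun p : planeT => f p.1).
Proof. by move=> mf; exact: (measurableT_comp mf measurable_fst_plane). Qed.

Lemma measurable_fun_snd (f : R -> R) : measurable_fun setT f ->
  measurable_fun setT (fun p : planeT => f p.2).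
Proof. by move=> mf; exact: (measurableT_comp mf measurable_snd_plane). Qed.

Lemma sqint_tensor (f g : R -> R) : measurable_fun setT f -> measurable_fun setT g ->
  sqint area setT (fun p : planeT => f p.1 * g p.2) =
  (sqint leb setT f * sqint leb setT g)%E.
Proof.
move=> mf mg; rewrite /sqint area_tonelli; first last.
- by move=> x; rewrite lee_fin sqr_ge0.
- by apply: measurable_sq; apply: measurable_funM; [exact: measurable_fun_fst|exact: measurable_fun_snd].
rewrite -ge0_integralZr//; first last.
- by apply: integral_ge0 => x _; rewrite lee_fin sqr_ge0.
- by move=> x _; rewrite lee_fin sqr_ge0.
- exact: measurable_sq.
apply: eq_integral => x _ /=; rewrite -ge0_integralZl_EFin ?sqr_ge0//; last first.
- exact: measurable_sq.
- by move=> y _; rewrite lee_fin sqr_ge0.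
by apply: eq_integral => y _; rewrite exprMn EFinM.
Qed.

(** The coordinates are moved one after the other; each of the two differences is a tensor product,
    whose square norm is a product of one-dimensional norms. *)
Lemma tau_cont_tensor (A B : set (measurableTypeR R)) : measurable A -> measurable B ->
  (leb A < +oo)%E -> (leb B < +oo)%E ->
  tau_cont leb (nbhs (0 : R)) tr1 \1_A -> tau_cont leb (nbhs (0 : R)) tr1 \1_B ->
  tau_cont area (nbhs ((0, 0) : R * R)) tr2 \1_(A `*` B).
Proof.
move=> mA mB Aoo Boo [A2 tA] [B2 tB].
have mAB : measurable (A `*` B : set planeT) by exact: measurableX.
have indX : \1_(A `*` B) = (fun p : planeT => \1_A p.1 * \1_B p.2) :> (planeT -> R).
  by apply/funext => p; rewrite !indicE in_setX mulr_natr mulrb; case: (p.1 \in A); case: (p.2 \in B).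
split; first by apply: L2_indic => //; rewrite /area/= product_measure1E// lte_mul_pinfty// ge0_fin_numE.
move=> eps eps0.
have fA : leb A \is a fin_num by rewrite ge0_fin_numE.
have fB : leb B \is a fin_num by rewrite ge0_fin_numE.
set a := fine (leb A); set b := fine (leb B).
have a0 : 0 <= a by exact: fine_ge0.
have b0 : 0 <= b by exact: fine_ge0.
(* Chosen so that [e1 * b] and [a * e2] are at most a quarter of [eps], also when a factor has
   measure 0. *)
pose e1 := eps / (4 * (b + 1)); pose e2 := eps / (4 * (a + 1)).
have e10 : 0 < e1 by rewrite divr_gt0// mulr_gt0// ltr_wpDl.
have e20 : 0 < e2 by rewrite divr_gt0// mulr_gt0// ltr_wpDl.
have H1 : \forall y \near nbhs ((0, 0) : R * R),
   (sqint leb setT (fun x => (\1_A (tr1 y.1 x) - \1_A x)%R) <= e1%:E)%E.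
  exact: (@continuous_fst_plane R (0, 0) _ (tA _ e10)).
have H2 : \forall y \near nbhs ((0, 0) : R * R),
   (sqint leb setT (fun x => (\1_B (tr1 y.2 x) - \1_B x)%R) <= e2%:E)%E.
  exact: (@continuous_snd_plane R (0, 0) _ (tB _ e20)).
apply: filterS2 H1 H2 => y h1 h2.
have mtA : measurable_fun setT (fun x => \1_A (tr1 y.1 x) : R).
  by apply: (@measurableT_comp _ _ _ _ _ _ (\1_A : measurableTypeR R -> R)); [exact: measurable_indic|exact: measurable_tr1].
have mtB : measurable_fun setT (fun x => \1_B (tr1 y.2 x) : R).
  by apply: (@measurableT_comp _ _ _ _ _ _ (\1_B : measurableTypeR R -> R)); [exact: measurable_indic|exact: measurable_tr1].
have miA : measurable_fun setT (\1_A : measurableTypeR R -> R) by exact: measurable_indic.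
have miB : measurable_fun setT (\1_B : measurableTypeR R -> R) by exact: measurable_indic.
have mf (f g : measurableTypeR R -> R) : measurable_fun setT f -> measurable_fun setT g ->
    measurable_fun setT (fun p : planeT => f p.1 * g p.2).
  by move=> mf mg; apply: measurable_funM; [exact: measurable_fun_fst|exact: measurable_fun_snd].
have -> : (fun x => \1_(A `*` B) (tr2 y x) - \1_(A `*` B) x) = (fun x : planeT =>
    (\1_A (tr1 y.1 x.1) - \1_A x.1) * \1_B (tr1 y.2 x.2) +
    \1_A x.1 * (\1_B (tr1 y.2 x.2) - \1_B x.2)) :> (planeT -> R).
  by apply/funext => x; rewrite indX /tr2 /tr1 /=; ring.
apply: (le_trans (sqintD_le _ _ _ _)); first exact: measurableT.
- by apply: (mf (fun t => \1_A (tr1 y.1 t) - \1_A t) (fun t => \1_B (tr1 y.2 t))) => //; exact: measurable_funB.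
- by apply: (mf \1_A (fun t => \1_B (tr1 y.2 t) - \1_B t)) => //; exact: measurable_funB.
rewrite (sqint_tensor (f := fun t => \1_A (tr1 y.1 t) - \1_A t) (g := fun t => \1_B (tr1 y.2 t)))//; last exact: measurable_funB.
rewrite (sqint_tensor (f := \1_A) (g := fun t => \1_B (tr1 y.2 t) - \1_B t))//; last exact: measurable_funB.
have -> : sqint leb setT (fun t => \1_B (tr1 y.2 t)) = b%:E.
  rewrite /b fineK// -sqint_indic//.
  exact: (@sqint_tau _ _ _ leb _ tr1 measurable_tr1 tr1_leb y.2 \1_B miB).
have -> : sqint leb setT \1_A = a%:E by rewrite /a fineK// sqint_indic.
apply: (@le_trans _ _ (2%:E * (e1%:E * b%:E) + 2%:E * (a%:E * e2%:E))%E).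
  apply: leeD; apply: lee_wpmul2l => //.
    by apply: lee_wpmul2r.
  by apply: lee_wpmul2l.
rewrite -!EFinM -EFinD lee_fin.
have frac (c : R) : 0 <= c -> eps / (4 * (c + 1)) * c <= eps / 4.
  move=> c0; rewrite (_ : _ * c = eps / 4 * (c / (c + 1))); last by field; rewrite gt_eqF//; lra.
  rewrite ler_piMr// ?divr_ge0 ?(ltW eps0)//.
  by rewrite ler_pdivrMr ?ltr_wpDl// mul1r lerDl.
have h3 : e1 * b <= eps / 4 by exact: frac.
have h4 : a * e2 <= eps / 4 by rewrite mulrC; exact: frac.
by lra.
Qed.

(** Rectangles are closed under intersection and generate the product sigma-algebra; the boxes [Q n]
    exhaust the plane. *)
Lemma plane_tau_cont (f : planeT -> R) : L2 area setT f ->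
  tau_cont area (nbhs ((0, 0) : R * R)) tr2 f.
Proof.
pose Q n : set planeT := box1 n `*` box1 n.
have mQ n : measurable (Q n) by apply: measurableX; exact: measurable_box1.
have Qoo n : (area (Q n) < +oo)%E.
  by rewrite /area/= product_measure1E ?lte_mul_pinfty ?ge0_fin_numE ?box1_fin//; exact: measurable_box1.
have mtr y := (area_preserving_tr2 y).1.
have atr y := (area_preserving_tr2 y).2.
apply: (tau_cont_L2 mtr atr mQ).
- move=> x; apply: filterS (filterI (box1_exhausts x.1) (box1_exhausts x.2)) => n [x1 x2].
  by split.
have rect n (A B : set (measurableTypeR R)) : measurable A -> measurable B ->
    tau_cont area (nbhs ((0, 0) : R * R)) tr2 \1_((A `*` B) `&` Q n).
  move=> mA mB; rewrite /Q -setXI.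
  have fin (C : set (measurableTypeR R)) : measurable C -> (leb (C `&` box1 n) < +oo)%E.
    move=> mC; apply: le_lt_trans (box1_fin n); apply: le_measure; rewrite ?inE; last by move=> x [].
      by apply: measurableI => //; exact: measurable_box1.
    exact: measurable_box1.
  by apply: tau_cont_tensor; try exact: fin; try exact: tau_cont_box1; apply: measurableI => //; exact: measurable_box1.
move=> n A mA.
apply: (@tau_cont_indic _ _ _ area _ (nbhs ((0, 0) : R * R)) _ tr2 mtr atr
    [set B `*` C | B in measurable & C in measurable]).
- move=> _ _ [B1 mB1 [C1 mC1 <-]] [B2 mB2 [C2 mC2 <-]].
  by exists (B1 `&` B2); [exact: measurableI|exists (C1 `&` C2); [exact: measurableI|rewrite setXI]].
- exact: mQ.
- exact: Qoo.
- by have := rect n setT setT measurableT measurableT; rewrite setXTT setTI.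
- move=> _ [B mB [C mC <-]]; split; first exact: measurableX.
  exact: rect.
by rewrite -measurable_prod_measurableType.
Qed.

End PlaneTranslation.

(** * Convolution with smooth kernels *)

Section Kernels.
Context {R : realType}.
Local Notation planeT := (@planeT R).
Implicit Types (p q x y z : R * R) (f K u : R * R -> R) (r : R).

Definition csq p r : set (R * R) := [set x | `|x.1 - p.1| <= r /\ `|x.2 - p.2| <= r].

Lemma csqE p r : csq p r = `[p.1 - r, p.1 + r]%classic `*` `[p.2 - r, p.2 + r]%classic.
Proof.
apply/seteqP; split => x; rewrite /csq/= !in_itv/= !ler_distl.
  by move=> [-> ->].
by move=> [-> ->].
Qed.

Lemma compact_csq p r : compact (csq p r).
Proof. by rewrite csqE; apply: compact_setX; exact: segment_compact. Qed.

Arguments compact_csq : clear implicits.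

Lemma plane_hausdorff : hausdorff_space (R * R)%type.
Proof. exact: norm_hausdorff. Qed.

Lemma closed_csq p r : closed (csq p r).
Proof. exact: (compact_closed plane_hausdorff (compact_csq p r)). Qed.

Arguments closed_csq : clear implicits.

(** The centre [p] of the support is free: near the boundary it is moved away from the origin so
    that the convolution only sees points of the domain. *)
Definition kernel p r K := smooth K /\ forall x, ~ csq p r x -> K x = 0.

Lemma kernel_D1 p r K : kernel p r K -> kernel p r ('D_e1 K).
Proof.
move=> [sK K0]; split; first exact: smooth_D1.
move=> x xB.
have d0 : is_derive x e1 K 0.
  apply: (@near_eq_is_derive _ _ _ (fun=> 0)).
  have : nbhs x (~` csq p r).
    by apply: open_nbhs_nbhs; split => //; exact/closed_openC/closed_csq.
  by apply: filterS => z zB; rewrite K0.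
by have [_] := d0.
Qed.

Lemma kernel_D2 p r K : kernel p r K -> kernel p r ('D_e2 K).
Proof.
move=> [sK K0]; split; first exact: smooth_D2.
move=> x xB.
have d0 : is_derive x e2 K 0.
  apply: (@near_eq_is_derive _ _ _ (fun=> 0)).
  have : nbhs x (~` csq p r).
    by apply: open_nbhs_nbhs; split => //; exact/closed_openC/closed_csq.
  by apply: filterS => z zB; rewrite K0.
by have [_] := d0.
Qed.

Lemma compact_bounded_fun (A : set (R * R)) f : compact A -> continuous f ->
  exists2 M, 0 <= M & forall x, A x -> `|f x| <= M.
Proof.
move=> cA cf; have cfA : compact (f @` A).
  by apply: continuous_compact => //; exact: continuous_subspaceT.
have [M [_ MP]] := compact_bounded cfA.
exists (`|M| + 1) => [|x Ax]; first by rewrite addr_ge0.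
apply: MP; last by exists x.
by apply: le_lt_trans (ler_norm M) _; rewrite ltrDl.
Qed.

Lemma kernel_bounded p r K : kernel p r K -> exists2 M, 0 <= M & forall x, `|K x| <= M.
Proof.
move=> [sK K0]; have [M M0 MP] := compact_bounded_fun (compact_csq p r) (smooth_continuous sK).
exists M => // x; have [/MP//|/K0 ->] := pselect (csq p r x).
by rewrite normr0.
Qed.

Lemma has_partials_fst f f1 f2 (a b : R) : has_partials f f1 f2 ->
  is_derive a (1 : R) (fun t => f (t, b)) (f1 (a, b)).
Proof.
move=> /(_ (a, b))[[d1 d2] _]; split; first exact: (iffLR (derivable_e1 f (a, b)) d1).
exact: etrans (esym (etrans (derive_e1 f (a, b)) (derive1E _ _))) d2.
Qed.

Lemma has_partials_snd f f1 f2 (a b : R) : has_partials f f1 f2 ->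
  is_derive b (1 : R) (fun t => f (a, t)) (f2 (a, b)).
Proof.
move=> /(_ (a, b))[_ [d1 d2]]; split; first exact: (iffLR (derivable_e2 f (a, b)) d1).
exact: etrans (esym (etrans (derive_e2 f (a, b)) (derive1E _ _))) d2.
Qed.

Lemma lipschitz_partials f f1 f2 M1 M2 : has_partials f f1 f2 ->
  (forall x, `|f1 x| <= M1) -> (forall x, `|f2 x| <= M2) ->
  forall x y, `|f x - f y| <= M1 * `|x.1 - y.1| + M2 * `|x.2 - y.2|.
Proof.
have mvt (g dg : R -> R) M : (forall t, is_derive t (1 : R) g (dg t)) -> (forall t, `|dg t| <= M) ->
    forall s t, `|g s - g t| <= M * `|s - t|.
  move=> gd dgM s t; wlog st : s t / t <= s.
    by move=> H; have [/H//|/ltW/H] := leP t s; rewrite distrC [`|t - s|]distrC.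
  have cg : {within `[t, s], continuous g}.
    apply: continuous_subspaceT => z; apply: differentiable_continuous.
    by apply/derivable1_diffP; have [] := gd z.
  have [c _ ->] := @MVT_segment _ g dg t s st (fun t0 _ => gd t0) cg.
  by rewrite normrM ler_wpM2r.
move=> fP f1M f2M x y.
have -> : f x - f y = (f (x.1, x.2) - f (y.1, x.2)) + (f (y.1, x.2) - f (y.1, y.2)).
  by rewrite addrA subrK; case: (x); case: (y).
apply: (le_trans (ler_normD _ _)); apply: lerD.
  apply: (mvt (fun t => f (t, x.2)) (fun t => f1 (t, x.2))) => // t.
  exact: has_partials_fst fP.
apply: (mvt (fun t => f (y.1, t)) (fun t => f2 (y.1, t))) => // t.
exact: has_partials_snd fP.
Qed.

Lemma continuous_partials f f1 f2 M1 M2 : has_partials f f1 f2 ->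
  (forall x, `|f1 x| <= M1) -> (forall x, `|f2 x| <= M2) -> continuous f.
Proof.
move=> fP f1M f2M x; have H := lipschitz_partials fP f1M f2M.
have lim0 : M1 * `|x.1 - y.1| + M2 * `|x.2 - y.2| @[y --> x] --> M1 * `|x.1 - x.1| + M2 * `|x.2 - x.2|.
  apply: cvgD; (apply: cvgM; first exact: cvg_cst); apply: cvg_norm; (apply: cvgB; first exact: cvg_cst).
    exact: continuous_fst_plane.
  exact: continuous_snd_plane.
rewrite !subrr !normr0 !mulr0 addr0 in lim0.
apply/cvgrPdist_le => eps eps0; have /cvgrPdist_le/(_ _ eps0) := lim0.
apply: filterS => y; rewrite sub0r normrN => H1.
by apply: (le_trans (H x y)); exact: le_trans (ler_norm _) H1.
Qed.

Definition conv K u x : R := \int[area]_z (K (x.1 - z.1, x.2 - z.2) * u z).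

Lemma continuous_reflect f x : continuous f -> continuous (fun z => f (x.1 - z.1, x.2 - z.2)).
Proof.
move=> cf z; apply: (@continuous_comp _ _ _ (fun z : R * R => (x.1 - z.1, x.2 - z.2)) f); last exact: cf.
apply: continuous_pair => {}z; (apply: cvgB; first exact: cvg_cst).
  exact: continuous_fst_plane.
exact: continuous_snd_plane.
Qed.

Lemma integrable_bounded_mul d (T : measurableType d) (mu : {measure set T -> \bar R})
    (D : set T) (k v : T -> R) M : measurable D -> measurable_fun D k ->
  (forall x : T, D x -> `|k x| <= M) -> mu.-integrable D (EFin \o v) ->
  mu.-integrable D (EFin \o (fun x : T => k x * v x)).
Proof.
move=> mD mk kM iv; have /integrableP[/measurable_EFinP mv _] := iv.
apply: (@le_integrable _ _ _ _ _ _ _ (fun x : T => M%:E * (EFin \o v) x)%E) => //.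
- by apply/measurable_EFinP; exact: measurable_funM.
- move=> x Dx; rewrite /= lee_fin !normrM ler_wpM2r//.
  by apply: le_trans (kM x Dx) _; exact: ler_norm.
- exact: integrableZl.
Qed.

Section fixed_u.
Variable u : R * R -> R.
Hypothesis iu : area.-integrable setT (EFin \o u).

Lemma integrable_conv p r K x : kernel p r K ->
  area.-integrable setT (EFin \o (fun z => K (x.1 - z.1, x.2 - z.2) * u z)).
Proof.
move=> kK; have [M M0 KM] := kernel_bounded kK.
apply: (@integrable_bounded_mul _ _ _ _ _ _ M) => //.
by apply: continuous_measurable_plane; apply: continuous_reflect; exact: smooth_continuous kK.1.
Qed.

Let normu : R := \int[area]_z `|u z|.

Lemma conv_bounded p r K : kernel p r K -> exists M, forall x, `|conv K u x| <= M.
Proof.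
move=> kK; have [M M0 KM] := kernel_bounded kK.
exists (M * normu) => x.
have ik := integrable_conv x kK.
apply: (le_trans (le_normr_Rintegral _ ik)); first exact: measurableT.
have inu : area.-integrable setT (EFin \o (fun z => `|u z|)) by exact: integrable_norm.
rewrite /normu -RintegralZl//; apply: le_Rintegral => //.
- exact: integrable_norm.
- by have := integrableZl measurableT M inu.
by move=> z _; rewrite normrM ler_wpM2r.
Qed.

(** Differentiation under the integral sign, dominated by the absolute value of [u] times a bound
    for the derivative of the kernel. *)
Lemma has_partials_conv p r K : kernel p r K ->
  has_partials (conv K u) (conv ('D_e1 K) u) (conv ('D_e2 K) u).
Proof.
move=> kK x; have [sK K0] := kK.
have [M1 M10 KM1] := kernel_bounded (kernel_D1 kK).
have [M2 M20 KM2] := kernel_bounded (kernel_D2 kK).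
have inu : area.-integrable setT (EFin \o (fun z => `|u z|)) by exact: integrable_norm.
have shift1 (c t : R) : is_derive t (1 : R) (fun s : R => s - c) 1.
  have H := is_deriveB (is_derive_id t (1 : R)) (is_derive_cst c t (1 : R)).
  by apply: (@is_derive_eq _ _ _ _ _ _ _ _ H); rewrite subr0.
split.
  apply: is_derive_partial1.
  pose f (t : R) (z : planeT) := K (t - z.1, x.2 - z.2) * u z.
  have fd (t : R) z : is_derive t (1 : R) (f^~ z) ('D_e1 K (t - z.1, x.2 - z.2) * u z).
    have h := @is_derive1_comp _ _ _ t _ _ (is_derive_fst (t - z.1) (x.2 - z.2) sK) (shift1 z.1 t).
    have h2 := is_deriveM h (is_derive_cst (u z) t (1 : R)).
    by apply: (@is_derive_eq _ _ _ _ _ _ _ _ h2); rewrite /GRing.scale/=; ring.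
  have fE (t : R) z : partial1of2 f t z = 'D_e1 K (t - z.1, x.2 - z.2) * u z.
    by rewrite /partial1of2 derive1E; have [_ ->] := fd t z.
  have x1I : `]x.1 - 1, x.1 + 1[%classic x.1 by rewrite /= in_itv/=; apply/andP; split; lra.
  have if_ (t : R) : `]x.1 - 1, x.1 + 1[%classic t -> area.-integrable setT (EFin \o f t).
    by move=> _; exact: (integrable_conv (t, x.2) kK).
  have df (t : R) z : `]x.1 - 1, x.1 + 1[%classic t -> setT z -> derivable (f^~ z) t 1.
    by move=> _ _; have [] := fd t z.
  pose G z := M1 * `|u z|.
  have G0 z : 0 <= G z by rewrite mulr_ge0.
  have iG : area.-integrable setT (EFin \o G) by have := integrableZl measurableT M1 inu.
  have fG (t : R) z : `]x.1 - 1, x.1 + 1[%classic t -> setT z -> `|partial1of2 f t z| <= G z.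
    by move=> _ _; rewrite fE normrM ler_wpM2r.
  split; first exact: (derivable_under_integral measurableT x1I if_ df G0 iG fG).
  rewrite -derive1E (differentiation_under_integral measurableT x1I if_ df G0 iG fG).
  by apply: eq_Rintegral => z _; rewrite fE.
apply: is_derive_partial2.
pose f (t : R) (z : planeT) := K (x.1 - z.1, t - z.2) * u z.
have fd (t : R) z : is_derive t (1 : R) (f^~ z) ('D_e2 K (x.1 - z.1, t - z.2) * u z).
  have h := @is_derive1_comp _ _ _ t _ _ (is_derive_snd (x.1 - z.1) (t - z.2) sK) (shift1 z.2 t).
  have h2 := is_deriveM h (is_derive_cst (u z) t (1 : R)).
  by apply: (@is_derive_eq _ _ _ _ _ _ _ _ h2); rewrite /GRing.scale/=; ring.
have fE (t : R) z : partial1of2 f t z = 'D_e2 K (x.1 - z.1, t - z.2) * u z.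
  by rewrite /partial1of2 derive1E; have [_ ->] := fd t z.
have x1I : `]x.2 - 1, x.2 + 1[%classic x.2 by rewrite /= in_itv/=; apply/andP; split; lra.
have if_ (t : R) : `]x.2 - 1, x.2 + 1[%classic t -> area.-integrable setT (EFin \o f t).
  by move=> _; exact: (integrable_conv (x.1, t) kK).
have df (t : R) z : `]x.2 - 1, x.2 + 1[%classic t -> setT z -> derivable (f^~ z) t 1.
  by move=> _ _; have [] := fd t z.
pose G z := M2 * `|u z|.
have G0 z : 0 <= G z by rewrite mulr_ge0.
have iG : area.-integrable setT (EFin \o G) by have := integrableZl measurableT M2 inu.
have fG (t : R) z : `]x.2 - 1, x.2 + 1[%classic t -> setT z -> `|partial1of2 f t z| <= G z.
  by move=> _ _; rewrite fE normrM ler_wpM2r.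
split; first exact: (derivable_under_integral measurableT x1I if_ df G0 iG fG).
rewrite -derive1E (differentiation_under_integral measurableT x1I if_ df G0 iG fG).
by apply: eq_Rintegral => z _; rewrite fE.
Qed.

Lemma smooth_conv p r K : kernel p r K -> smooth (conv K u).
Proof.
move=> kK; apply: (@smooth_coinduction _ (fun f => exists2 K, kernel p r K & f = conv K u)); last by exists K.
move=> _ [K' kK' ->].
have [M1 H1] := conv_bounded (kernel_D1 kK'); have [M2 H2] := conv_bounded (kernel_D2 kK').
have H := has_partials_conv kK'.
have [d1 d2 E1 E2] := has_partialsE H; split.
- exact: continuous_partials H H1 H2.
- exact: d1.
- exact: d2.
- by exists ('D_e1 K'); [exact: kernel_D1|exact: E1].
- by exists ('D_e2 K'); [exact: kernel_D2|exact: E2].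
Qed.

Lemma D1_conv p r K x : kernel p r K -> 'D_e1 (conv K u) x = conv ('D_e1 K) u x.
Proof.
move=> kK; have [_ _ E _] := has_partialsE (has_partials_conv kK).
exact: (congr1 (fun f => f x) E).
Qed.

Lemma D2_conv p r K x : kernel p r K -> 'D_e2 (conv K u) x = conv ('D_e2 K) u x.
Proof.
move=> kK; have [_ _ _ E] := has_partialsE (has_partials_conv kK).
exact: (congr1 (fun f => f x) E).
Qed.

End fixed_u.

End Kernels.

(** * Mollification in L2 *)

Section Mollify.
Context {R : realType}.
Local Notation planeT := (@planeT R).
Implicit Types (p q : R * R) (f K u : R * R -> R) (r : R).

(** A copy of [m] that carries a proof of sigma-finiteness, so that Tonelli's theorem can be applied
    to a measure such as [area], whose type does not record it. *)
Definition sigma_finite_of d (T : measurableType d) (m : {measure set T -> \bar R})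
  (H : sigma_finite setT m) : set T -> \bar R := m.

HB.instance Definition _ d (T : measurableType d) (m : {measure set T -> \bar R})
  (H : sigma_finite setT m) := Measure.copy (sigma_finite_of H) m.

HB.instance Definition _ d (T : measurableType d) (m : {measure set T -> \bar R})
  (H : sigma_finite setT m) := Measure_isSigmaFinite.Build _ _ _ (sigma_finite_of H) H.

Lemma tonelli_swap d1 d2 (T1 : measurableType d1) (T2 : measurableType d2)
    (m1 : {measure set T1 -> \bar R}) (m2 : {measure set T2 -> \bar R})
    (F : T1 -> T2 -> \bar R) : sigma_finite setT m1 -> sigma_finite setT m2 ->
  measurable_fun setT (fun xy : T1 * T2 => F xy.1 xy.2) ->
  (forall x y, (0 <= F x y)%E) ->
  [/\ measurable_fun setT (fun x => \int[m2]_y F x y)%E,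
    measurable_fun setT (fun y => \int[m1]_x F x y)%E &
    (\int[m1]_x \int[m2]_y F x y = \int[m2]_y \int[m1]_x F x y)%E].
Proof.
move=> s1 s2 mF F0; split.
- exact: (@measurable_fun_fubini_tonelli_F _ _ T1 T2 R (sigma_finite_of s2) (fun xy => F xy.1 xy.2)).
- exact: (@measurable_fun_fubini_tonelli_G _ _ T1 T2 R (sigma_finite_of s1) (fun xy => F xy.1 xy.2)).
- exact: (@fubini_tonelli _ _ T1 T2 R (sigma_finite_of s1) (sigma_finite_of s2) (fun xy => F xy.1 xy.2)).
Qed.

Lemma area_setX (A B : set (measurableTypeR R)) : measurable A -> measurable B ->
  area (A `*` B) = (lebesgue_measure A * lebesgue_measure B)%E.
Proof. by move=> mA mB; exact: product_measure1E. Qed.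

Lemma sigma_finite_area : sigma_finite setT (@area R).
Proof.
exists (fun n => box1 n `*` box1 n : set planeT).
  apply/esym; rewrite -subTset => x _.
  have [n _ xn] := filterI (box1_exhausts x.1) (box1_exhausts x.2).
  by exists n => //; exact: xn (leqnn n).
move=> n; split; first by apply: measurableX; exact: measurable_box1.
by rewrite area_setX ?lte_mul_pinfty ?ge0_fin_numE ?box1_fin//; exact: measurable_box1.
Qed.

(** The variance of [v] under the probability density [k] is nonnegative. *)
Lemma jensen_sq d (T : measurableType d) (mu : {measure set T -> \bar R}) (k v : T -> R) :
  mu.-integrable setT (EFin \o k) -> (forall x, 0 <= k x) -> \int[mu]_x k x = 1 ->
  mu.-integrable setT (EFin \o (fun x => k x * v x)) -> measurable_fun setT v ->
  (((\int[mu]_x (k x * v x)) ^+ 2)%:E <= \int[mu]_x (k x * v x ^+ 2)%:E)%E.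
Proof.
move=> ik k0 k1 ikv mv; set m := \int[mu]_x _.
have mk : measurable_fun setT k by have /integrableP[/measurable_EFinP] := ik.
have mkv : measurable_fun setT (fun x => k x * v x ^+ 2).
  by apply: measurable_funM => //; exact: measurable_funX.
have kv0 x : 0 <= k x * v x ^+ 2 by rewrite mulr_ge0 ?sqr_ge0.
have [oo|] := eqVneq (\int[mu]_x (k x * v x ^+ 2)%:E)%E +oo%E; first by rewrite oo leey.
rewrite -ltey => fin.
have ikv2 : mu.-integrable setT (EFin \o (fun x => k x * v x ^+ 2)).
  apply/integrableP; split; first exact/measurable_EFinP.
  by under eq_integral do rewrite /= ger0_norm//.
have -> : (\int[mu]_x (k x * v x ^+ 2)%:E)%E = (\int[mu]_x (k x * v x ^+ 2))%:E.
  by rewrite /Rintegral fineK// ge0_fin_numE// integral_ge0// => x _; rewrite lee_fin.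
rewrite lee_fin.
have H : 0 <= \int[mu]_x (k x * (v x - m) ^+ 2).
  by apply: Rintegral_ge0 => x _; rewrite mulr_ge0 ?sqr_ge0.
have E : \int[mu]_x (k x * (v x - m) ^+ 2) =
    \int[mu]_x (k x * v x ^+ 2) + ((- 2 * m) * m + m ^+ 2 * 1).
  have i1 : mu.-integrable setT (EFin \o (fun x => (- 2 * m) * (k x * v x))).
    by have := integrableZl measurableT (- 2 * m) ikv.
  have i2 : mu.-integrable setT (EFin \o (fun x => m ^+ 2 * k x)).
    by have := integrableZl measurableT (m ^+ 2) ik.
  have i3 : mu.-integrable setT (EFin \o (fun x => (- 2 * m) * (k x * v x) + m ^+ 2 * k x)).
    by have := integrableD measurableT i1 i2; apply: eq_integrable.
  have -> : (- 2 * m) * m = \int[mu]_x ((- 2 * m) * (k x * v x)) by rewrite RintegralZl.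
  have -> : m ^+ 2 * 1 = \int[mu]_x (m ^+ 2 * k x) by rewrite RintegralZl// k1.
  by rewrite -RintegralD// -RintegralD//; apply: eq_Rintegral => x _; ring.
by move: H; rewrite E; nra.
Qed.

Lemma kernel_integrable p r K : kernel p r K -> area.-integrable setT (EFin \o K).
Proof.
move=> kK; have [M M0 KM] := kernel_bounded kK.
have mB : measurable (csq p r : set planeT) by exact: (closed_measurable_plane (@closed_csq R p r)).
have Boo : (area (csq p r) < +oo)%E.
  have fin c : (lebesgue_measure (`[(c - r)%R, (c + r)%R]%classic : set (measurableTypeR R)) < +oo)%E.
    by rewrite lebesgue_measure_itv/=; case: ifPn => _; rewrite -?EFinB ltry.
  rewrite csqE area_setX; try exact: measurable_itv.
  by apply: lte_mul_pinfty => //; rewrite ge0_fin_numE.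
have := @integrable_bounded_mul R _ _ area setT K (\1_(csq p r) : planeT -> R) M measurableT.
have mK : measurable_fun (setT : set planeT) K.
  by apply: continuous_measurable_plane; exact: smooth_continuous kK.1.
have i1 : area.-integrable (setT : set planeT) (EFin \o (\1_(csq p r) : planeT -> R)).
  apply/integrableP; split; first by apply/measurable_EFinP; exact: measurable_indic.
  under eq_integral do rewrite /= ger0_norm//.
  by rewrite integral_indic// setIT.
move=> /(_ mK (fun x _ => KM x) i1); apply: eq_integrable => // x _ /=.
rewrite indicE; have [/mem_set ->|xB] := pselect (csq p r x); first by rewrite mulr1.
by rewrite memNset// mulr0 kK.2.
Qed.

Lemma Rintegral_reflect (x : R * R) (k : planeT -> R) : area.-integrable setT (EFin \o k) ->
  measurable_fun setT k -> (forall z, 0 <= k z) ->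
  \int[area]_z k (x.1 - z.1, x.2 - z.2) = \int[area]_z k z.
Proof.
move=> ik mk k0; rewrite /Rintegral; congr fine.
apply: (area_preserving_integral (area_preserving_reflection x) measurableT).
  exact/measurable_EFinP.
by move=> z _; rewrite lee_fin.
Qed.

(** By Jensen the squared error at [x] is at most the [K]-average over [y] of the squared increments
    of [u] under the translation by [y]. Tonelli exchanges the integrals, and only translations in
    the support of [K] count. *)
Lemma mollify p r K u (eps : R) : kernel p r K -> (forall x, 0 <= K x) ->
  \int[area]_x K x = 1 -> L2 area setT u -> area.-integrable setT (EFin \o u) ->
  (forall y, csq p r y -> (sqint area setT (fun x => (u (tr2 y x) - u x)%R) <= eps%:E)%E) ->
  (sqint area setT (fun x => (conv K u x - u x)%R) <= eps%:E)%E.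
Proof.
move=> kK K0 K1 [mu _] iu ueps.
have cK := smooth_continuous kK.1.
have mK : measurable_fun (setT : set planeT) K by exact: continuous_measurable_plane.
have iK := kernel_integrable kK.
pose F (x y : planeT) : \bar R := (K y * (u (tr2 y x) - u x) ^+ 2)%:E.
have F0 x y : (0 <= F x y)%E by rewrite lee_fin mulr_ge0 ?sqr_ge0.
have mtr : measurable_fun (setT : set (planeT * planeT)) (fun xy : planeT * planeT => tr2 xy.2 xy.1).
  have m1 : measurable_fun (setT : set (planeT * planeT)) (fun xy : planeT * planeT => xy.1.1 - xy.2.1 : R).
    apply: measurable_funB.
      exact: (measurableT_comp measurable_fst_plane (measurable_fst (T1 := planeT) (T2 := planeT))).
    exact: (measurableT_comp measurable_fst_plane (measurable_snd (T1 := planeT) (T2 := planeT))).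
  have m2 : measurable_fun (setT : set (planeT * planeT)) (fun xy : planeT * planeT => xy.1.2 - xy.2.2 : R).
    apply: measurable_funB.
      exact: (measurableT_comp measurable_snd_plane (measurable_fst (T1 := planeT) (T2 := planeT))).
    exact: (measurableT_comp measurable_snd_plane (measurable_snd (T1 := planeT) (T2 := planeT))).
  exact: measurable_pair_plane.
have mF : measurable_fun (setT : set (planeT * planeT)) (fun xy : planeT * planeT => F xy.1 xy.2).
  apply/measurable_EFinP/measurable_funM.
    exact: (measurableT_comp mK (measurable_snd (T1 := planeT) (T2 := planeT))).
  apply: measurable_funX; apply: measurable_funB; first exact: (measurableT_comp mu mtr).
  exact: (measurableT_comp mu (measurable_fst (T1 := planeT) (T2 := planeT))).
have step1 x : (((conv K u x - u x) ^+ 2)%:E <= \int[area]_y F x y)%E.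
  pose k (z : planeT) := K (x.1 - z.1, x.2 - z.2).
  have mk : measurable_fun setT k by apply: continuous_measurable_plane; exact: continuous_reflect.
  have ik : area.-integrable setT (EFin \o k).
    apply/integrableP; split; first exact/measurable_EFinP.
    have /integrableP[_] := iK; congr (_ < _)%E; apply/esym.
    have := area_preserving_integral (area_preserving_reflection x) measurableT.
    move=> /(_ (fun z => `|(K z)%:E|%E)); apply.
      by apply: measurableT_comp => //; exact/measurable_EFinP.
    by move=> z _; exact: abse_ge0.
  have k1 : \int[area]_z k z = 1 by rewrite Rintegral_reflect.
  have iku : area.-integrable setT (EFin \o (fun z => k z * (u z - u x))).
    have i1 : area.-integrable setT (EFin \o (fun z => k z * u z)) by exact: (integrable_conv iu x kK).
    have := integrableD measurableT i1 (integrableZl measurableT (- u x) ik).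
    by apply: eq_integrable => // z _ /=; rewrite -EFinM -EFinD; congr EFin; ring.
  have E : conv K u x - u x = \int[area]_z (k z * (u z - u x)).
    rewrite -[X in _ - X]mulr1 -k1 -RintegralZl// -RintegralB//; first last.
    - by have := integrableZl measurableT (u x) ik.
    - exact: (integrable_conv iu x kK).
    by apply: eq_Rintegral => z _; rewrite /k; ring.
  rewrite E; apply: (le_trans (jensen_sq ik (fun z => K0 _) k1 iku _)).
    by apply: measurable_funB => //; exact: measurable_cst.
  rewrite le_eqVlt; apply/orP; left; apply/eqP.
  have G0 z : setT z -> (0 <= (K z * (u (x.1 - z.1, x.2 - z.2) - u x) ^+ 2)%:E)%E.
    by move=> _; rewrite lee_fin mulr_ge0 ?sqr_ge0.
  have := area_preserving_integral (area_preserving_reflection x) measurableT _ G0.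
  rewrite /= => H; rewrite -[RHS]H.
    apply: eq_integral => z _; rewrite /k; congr (EFin (_ * (u _ - _) ^+ 2)).
    by rewrite !subKr; case: (z).
  apply/measurable_EFinP/measurable_funM => //; apply: measurable_funX; apply: measurable_funB => //.
  exact: (measurableT_comp mu (area_preserving_reflection x).1).
have [mint mint2 swap] := tonelli_swap sigma_finite_area sigma_finite_area mF F0.
apply: (@le_trans _ _ (\int[area]_x \int[area]_y F x y)%E).
  apply: ge0_le_integral => //.
  - by move=> x _; rewrite lee_fin sqr_ge0.
  - apply: measurable_sq; apply: measurable_funB => //.
    by apply: continuous_measurable_plane; apply: smooth_continuous; exact: smooth_conv iu _ _ _ kK.
rewrite swap.
have mut y : measurable_fun (setT : set planeT) (fun x => u (tr2 y x) - u x).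
  by apply: measurable_funB => //; exact: (measurableT_comp mu (area_preserving_tr2 y).1).
apply: (@le_trans _ _ (\int[area]_y ((K y)%:E * eps%:E))%E).
  have inner y : (\int[area]_x F x y = (K y)%:E * sqint area setT (fun x => u (tr2 y x) - u x)%R)%E.
    rewrite /sqint -ge0_integralZl_EFin//.
    - by move=> x _; rewrite lee_fin sqr_ge0.
    - exact: measurable_sq.
  have eps0 : (0 <= eps).
    rewrite leNgt; apply/negP => epsn.
    have : forall y, K y = 0.
      move=> y; have [yB|/kK.2//] := pselect (csq p r y).
      have := le_trans (sqint_ge0 _ _ _) (ueps y yB); rewrite lee_fin leNgt epsn; done.
    move=> K00; have := K1; rewrite /Rintegral integral0_eq => [|x _]; last by rewrite K00.
    by move=> /eqP; rewrite eq_sym oner_eq0.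
  apply: ge0_le_integral => //.
  - by move=> y _; apply: integral_ge0 => x _.
  - by under eq_fun do rewrite -EFinM; apply/measurable_EFinP; exact: measurable_funM.
  move=> y _; rewrite inner; have [yB|yB] := pselect (csq p r y).
    by apply: lee_wpmul2l; [rewrite lee_fin|exact: ueps].
  by rewrite kK.2// !mul0e.
have eK : (\int[area]_x (K x)%:E = 1)%E.
  by have := K1; rewrite /Rintegral => H; rewrite -[LHS]fineK ?H//; exact: integrable_fin_num.
under eq_integral do rewrite muleC.
have eps0 : 0 <= eps.
  have [y yB] : exists y, csq p r y.
    apply: contrapT => /forallNP nB; have := K1; rewrite /Rintegral integral0_eq => [|x _].
      by move=> /eqP; rewrite eq_sym oner_eq0.
    by rewrite kK.2.
  by have := le_trans (sqint_ge0 _ _ _) (ueps y yB); rewrite lee_fin.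
rewrite ge0_integralZl_EFin//; first by rewrite eK mule1.
- by move=> x _; rewrite lee_fin.
- exact/measurable_EFinP.
Qed.

(** The bump function is divided by its integral, which is nonzero because the function is positive
    on an open square of positive area. *)
Lemma exists_kernel p r : 0 < r -> exists K, [/\ kernel p r K, forall x, 0 <= K x &
  \int[area]_x K x = 1].
Proof.
move=> r0; have kB : kernel p r (bump p r).
  split; first exact: smooth_bump.
  move=> x xB; apply: bump_eq0; apply: contrapT => /not_orP[/negP + /negP].
  by rewrite -!ltNge => h1 h2; apply: xB; split; exact: ltW.
have iB := kernel_integrable kB; set c := \int[area]_x bump p r x.
have c0 : 0 <= c by apply: Rintegral_ge0 => x _; exact: bump_ge0.
have c_neq0 : c != 0.
  apply/negP => /eqP c00.
  have : (\int[area]_x `|(bump p r x)%:E| = 0)%E.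
    under eq_integral do rewrite gee0_abs ?lee_fin ?bump_ge0//.
    by rewrite -[RHS]/(0%:E) -c00 /c /Rintegral fineK//; exact: integrable_fin_num.
  have mB : measurable_fun setT (EFin \o bump p r) by have /integrableP[] := iB.
  move=> /(iffLR (ae_eq_integral_abs area measurableT mB)) [A [mA A0 AB]].
  pose Q : set planeT := `]p.1 - r, p.1 + r[%classic `*` `]p.2 - r, p.2 + r[%classic.
  have mQ : measurable Q by apply: measurableX; exact: measurable_itv.
  have : (area Q <= area A)%E.
    apply: le_measure; rewrite ?inE//; apply: subset_trans AB => x [/=].
    rewrite !in_itv/= -!ltr_distl => h1 h2 /(_ Logic.I) [] H.
    by have := bump_gt0 h1 h2; rewrite H ltxx.
  have lE (q : R) : lebesgue_measure (`](q - r)%R, (q + r)%R[%classic : set (measurableTypeR R)) =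
      (q + r - (q - r))%:E.
    by rewrite lebesgue_measure_itv/= lte_fin; have -> : q - r < q + r by lra.
  rewrite A0 /Q area_setX; try exact: measurable_itv.
  rewrite !lE -EFinM lee_fin.
  by have : 0 < (p.1 + r - (p.1 - r)) * (p.2 + r - (p.2 - r)); [nra|lra].
exists (fun x => c^-1 * bump p r x); split.
- by split; [exact: smoothZ kB.1|move=> x /kB.2 ->; rewrite mulr0].
- by move=> x; rewrite mulr_ge0 ?invr_ge0// bump_ge0.
- by rewrite RintegralZl// -/c mulVf.
Qed.

End Mollify.
(** * Weak derivatives and the space H1 *)

Section WeakDerivatives.
Context {R : realType}.
Local Notation planeT := (@planeT R).
Implicit Types (p q : R * R) (f K u g : R * R -> R) (r : R).

Lemma area_preserving_integralT (Phi : planeT -> planeT) (F : planeT -> \bar R) :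
  area_preserving Phi -> measurable_fun setT F ->
  (\int[area]_x F (Phi x) = \int[area]_x F x)%E.
Proof.
move=> aP mF; rewrite [LHS]integralE [RHS]integralE.
have e1 := area_preserving_integral aP measurableT (measurable_funepos mF) (fun x _ => funepos_ge0 F x).
have e2 := area_preserving_integral aP measurableT (measurable_funeneg mF) (fun x _ => funeneg_ge0 F x).
rewrite preimage_setT in e1 e2.
rewrite -e1 -e2; congr (_ - _)%E; apply: eq_integral => x _.
  by rewrite !funeposE.
by rewrite !funenegE.
Qed.

Lemma Rintegral_reflectT (x : R * R) (k : planeT -> R) : measurable_fun setT k ->
  \int[area]_z k (x.1 - z.1, x.2 - z.2) = \int[area]_z k z.
Proof.
move=> mk; rewrite /Rintegral; congr fine.
apply: (area_preserving_integralT (area_preserving_reflection x) (F := EFin \o k)).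
exact/measurable_EFinP.
Qed.

Lemma L2_cst d (T : measurableType d) (mu : {measure set T -> \bar R}) (D : set T) (c : R) :
  measurable D -> (mu D < +oo)%E -> L2 mu D (fun=> c).
Proof.
move=> mD Doo; split; first exact: measurable_cst.
rewrite integral_cst//; apply: lte_mul_pinfty => //; first by rewrite lee_fin sqr_ge0.
Qed.

Lemma L2_integrable d (T : measurableType d) (mu : {measure set T -> \bar R}) (D : set T) (f : T -> R) :
  measurable D -> (mu D < +oo)%E -> L2 mu D f -> mu.-integrable D (EFin \o f).
Proof.
move=> mD Doo fL; have := L2_mul_integrable mD fL (L2_cst 1 mD Doo).
by apply: eq_integrable => // x _ /=; rewrite mulr1.
Qed.

Lemma L2_bounded d (T : measurableType d) (mu : {measure set T -> \bar R}) (D : set T) (f : T -> R) M :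
  measurable D -> (mu D < +oo)%E -> measurable_fun D f -> (forall x, D x -> `|f x| <= M) -> L2 mu D f.
Proof.
move=> mD Doo mf fM; apply: (L2_le mD mf (L2_cst M mD Doo)) => x Dx.
by apply: le_trans (fM x Dx) _; exact: ler_norm.
Qed.

Lemma ip_CS d (T : measurableType d) (mu : {measure set T -> \bar R}) (D : set T) (f g : T -> R) :
  measurable D -> L2 mu D f -> L2 mu D g -> ip mu D f g ^+ 2 <= ip mu D f f * ip mu D g g.
Proof.
move=> mD fL gL; apply: discriminant_le; first exact: ip_ge0.
move=> t; pose k x := t * f x + g x.
have kL : L2 mu D k by apply: L2D => //; exact: L2Z.
have e v : L2 mu D v -> ip mu D k v = t * ip mu D f v + ip mu D g v by move=> vL; exact: ip_lin.
suff -> : ip mu D g g + 2 * t * ip mu D f g + t ^+ 2 * ip mu D f f = ip mu D k k by exact: ip_ge0.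
by rewrite e// (ipC _ _ f k) (ipC _ _ g k) !e// (ipC _ _ g f); ring.
Qed.

Lemma cvg_ip d (T : measurableType d) (mu : {measure set T -> \bar R}) (D : set T)
    (f_ : nat -> T -> R) (f g : T -> R) : measurable D -> (forall n, L2 mu D (f_ n)) -> L2 mu D f ->
  L2 mu D g -> sqint mu D (fun x => f_ n x - f x) @[n --> \oo] --> 0%E ->
  ip mu D (f_ n) g @[n --> \oo] --> ip mu D f g.
Proof.
move=> mD fnL fL gL H.
have dL n : L2 mu D (fun x => f_ n x - f x) by exact: L2B.
have {}H : ip mu D (fun x => f_ n x - f x) (fun x => f_ n x - f x) @[n --> \oo] --> (0 : R).
  by move/fine_cvg : H; under eq_fun do rewrite sqint_ip//.
apply: (@cvg_sq_bound _ _ _ _ _ _ _ (ip mu D g g) _ H); apply: nearW => n.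
rewrite mulrC; apply: le_trans (ip_CS mD (dL n) gL); rewrite le_eqVlt; apply/orP; left; apply/eqP.
congr (_ ^+ 2); have -> : (fun x => f_ n x - f x) = (fun x => -1 * f x + f_ n x).
  by apply/funext => x; rewrite mulN1r addrC.
by rewrite ip_lin//; ring.
Qed.

Section domain.
Variable Omega : set (R * R).
Hypothesis oOmega : open Omega.

Let mO : measurable (Omega : set planeT) := open_measurable_plane oOmega.

Lemma L2_restrict g : L2 area Omega g -> L2 area setT (g \_ Omega).
Proof.
move=> [mg g2]; split; first by apply/(measurable_restrictT _ mO).
rewrite (_ : (\int[area]_x _)%E = (\int[area]_(x in Omega) ((g x) ^+ 2)%:E)%E)//.
rewrite [RHS]integral_mkcond; apply: eq_integral => x _.
by rewrite !patchE; case: ifPn; rewrite // expr0n.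
Qed.

(** The support of the reflected kernel lies in the square around [x - p]. This geometric condition
    is all that mollification asks of the domain. *)
Lemma test_kernel p r K x : kernel p r K -> csq (x.1 - p.1, x.2 - p.2) r `<=` Omega ->
  test_function Omega (fun z => K (x.1 - z.1, x.2 - z.2)).
Proof.
move=> [sK K0] xO; set phi := fun z => _; pose B := csq (x.1 - p.1, x.2 - p.2) r.
have sB : closure [set z | phi z != 0] `<=` B.
  rewrite [X in _ `<=` X](closure_id _).1; last exact: closed_csq.
  apply: closureS => z /= z0; apply: contrapT => zB; move/eqP : z0; apply; apply: K0 => H; apply: zB.
  have [h1 h2] := H; split => /=.
    by rewrite (_ : z.1 - _ = - (x.1 - z.1 - p.1)); [rewrite normrN|ring].
  by rewrite (_ : z.2 - _ = - (x.2 - z.2 - p.2)); [rewrite normrN|ring].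
split; first exact: smooth_reflect.
- exact: (subclosed_compact (@closed_closure _ _) (@compact_csq R (x.1 - p.1, x.2 - p.2) r) sB).
- exact: subset_trans sB xO.
Qed.

Lemma test_function_kernel phi : test_function Omega phi -> exists M, kernel (0, 0) M phi.
Proof.
move=> [sphi cphi _]; have [M [_ HM]] := compact_bounded cphi.
exists (M + 1); split => // x xB; apply: contrapT => /eqP phix; apply: xB.
have : `|x| <= M + 1 by apply: (HM (M + 1)); [rewrite ltrDl|exact: subset_closure].
by rewrite prod_normE ge_max => /andP[? ?]; rewrite /csq/= !subr0.
Qed.

Lemma nbhs_csq (U : set (R * R)) x : nbhs x U -> exists2 e : R, 0 < e & csq x e `<=` U.
Proof.
move=> /nbhs_ballP [e /= e0 eU]; exists (e / 2); first by rewrite divr_gt0.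
move=> y [h1 h2]; apply: eU; rewrite -ball_normE /= prod_normE gt_max /=.
have e2 : e / 2 < e by rewrite ltr_pdivrMr// ltr_pMr// ltr1n.
by rewrite (distrC x.1) (distrC x.2) (le_lt_trans h1)// (le_lt_trans h2).
Qed.

Lemma derive_reflect1 K x z : smooth K ->
  'D_e1 (fun z => K (x.1 - z.1, x.2 - z.2)) z = - 'D_e1 K (x.1 - z.1, x.2 - z.2).
Proof.
move=> sK.
suff H : is_derive z e1 (fun z => K (x.1 - z.1, x.2 - z.2)) (- 'D_e1 K (x.1 - z.1, x.2 - z.2)) by have [] := H.
apply: is_derive_partial1.
have h := @is_derive1_comp _ _ _ z.1 _ _ (is_derive_fst (x.1 - z.1) (x.2 - z.2) sK) (is_derive_csub x.1 z.1).
by apply: (@is_derive_eq _ _ _ _ _ _ _ _ h); rewrite /GRing.scale/=; ring.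
Qed.

Lemma derive_reflect2 K x z : smooth K ->
  'D_e2 (fun z => K (x.1 - z.1, x.2 - z.2)) z = - 'D_e2 K (x.1 - z.1, x.2 - z.2).
Proof.
move=> sK.
suff H : is_derive z e2 (fun z => K (x.1 - z.1, x.2 - z.2)) (- 'D_e2 K (x.1 - z.1, x.2 - z.2)) by have [] := H.
apply: is_derive_partial2.
have h := @is_derive1_comp _ _ _ z.2 _ _ (is_derive_snd (x.1 - z.1) (x.2 - z.2) sK) (is_derive_csub x.2 z.2).
by apply: (@is_derive_eq _ _ _ _ _ _ _ _ h); rewrite /GRing.scale/=; ring.
Qed.

Lemma conv_restrict K u x :
  conv K (u \_ Omega) x = \int[area]_(z in Omega) (u z * K (x.1 - z.1, x.2 - z.2)).
Proof.
rewrite /conv [RHS]Rintegral_mkcond; apply: eq_Rintegral => z _.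
by rewrite !patchE; case: ifPn => _; rewrite ?mulr0// mulrC.
Qed.

Hypothesis fOmega : (area Omega < +oo)%E.

Lemma L2_restrict_integrable u : L2 area Omega u -> area.-integrable setT (EFin \o (u \_ Omega)).
Proof.
move=> uL; have := L2_integrable mO fOmega uL.
rewrite (integrable_mkcond _ mO); apply: eq_integrable => // x _.
by rewrite /= !patchE; case: ifPn.
Qed.

Lemma integrable_mul_kernel p r K u x : kernel p r K -> L2 area Omega u ->
  area.-integrable Omega (EFin \o (fun z => u z * K (x.1 - z.1, x.2 - z.2))).
Proof.
move=> kK uL; have [M M0 KM] := kernel_bounded kK.
have mK : measurable_fun Omega (fun z : planeT => K (x.1 - z.1, x.2 - z.2)).
  apply: (measurable_funS measurableT) => //.
  by apply: continuous_measurable_plane; apply: continuous_reflect; exact: smooth_continuous kK.1.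
have := integrable_bounded_mul mO mK (fun z _ => KM _) (L2_integrable mO fOmega uL).
by apply: eq_integrable => // z _ /=; rewrite mulrC.
Qed.

(** The weak derivative is tested with the reflected kernel; the sign from the reflection cancels
    the one from the integration by parts. *)
Lemma conv_weak1 p r K u g x : L2 area Omega u -> weak_derivative Omega e1 u g -> kernel p r K ->
  csq (x.1 - p.1, x.2 - p.2) r `<=` Omega ->
  conv ('D_e1 K) (u \_ Omega) x = conv K (g \_ Omega) x.
Proof.
move=> uL [_ /(_ _ (test_kernel _ _))] H kK xO; have {H} := H _ _ _ _ kK xO.
rewrite !conv_restrict => /(congr1 -%R); rewrite opprK => <-.
under [in RHS]eq_Rintegral do rewrite (derive_reflect1 _ _ kK.1) mulrN -mulN1r.
by rewrite RintegralZl//; [rewrite mulN1r opprK|exact: integrable_mul_kernel (kernel_D1 kK) uL].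
Qed.

Lemma conv_weak2 p r K u g x : L2 area Omega u -> weak_derivative Omega e2 u g -> kernel p r K ->
  csq (x.1 - p.1, x.2 - p.2) r `<=` Omega ->
  conv ('D_e2 K) (u \_ Omega) x = conv K (g \_ Omega) x.
Proof.
move=> uL [_ /(_ _ (test_kernel _ _))] H kK xO; have {H} := H _ _ _ _ kK xO.
rewrite !conv_restrict => /(congr1 -%R); rewrite opprK => <-.
under [in RHS]eq_Rintegral do rewrite (derive_reflect2 _ _ kK.1) mulrN -mulN1r.
by rewrite RintegralZl//; [rewrite mulN1r opprK|exact: integrable_mul_kernel (kernel_D2 kK) uL].
Qed.

Lemma mollify_eps u (eps : R) : L2 area setT u -> area.-integrable setT (EFin \o u) -> 0 < eps ->
  exists2 d : R, 0 < d & forall p r K, csq p r `<=` csq (0, 0) d ->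
    kernel p r K -> (forall x, 0 <= K x) -> \int[area]_x K x = 1 ->
    (sqint area setT (fun x => (conv K u x - u x)%R) <= eps%:E)%E.
Proof.
move=> uL iu eps0; have [_ /(_ _ eps0) H] := plane_tau_cont uL.
have [d d0 dH] := nbhs_csq H; exists d => // p r K sub kK K0 K1.
by apply: (mollify kK K0 K1 uL iu) => y /sub /dH.
Qed.

(** Mollifications of [g] with shrinking kernels are pairings with test functions, so at each point
    of the domain they are eventually 0; yet they approach [g] in the square norm. Fatou's lemma
    then bounds the norm of [g] by every [eps]. *)
Lemma test_functions_separate g : L2 area Omega g ->
  (forall phi, test_function Omega phi -> \int[area]_(x in Omega) (g x * phi x) = 0) ->
  {ae area, forall x, Omega x -> g x = 0}.
Proof.
move=> gL g0; have GL := L2_restrict gL; have iG := L2_restrict_integrable gL.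
have [K HK] := choice (fun n : nat => exists_kernel (0, 0) (r := (n.+1%:R : R)^-1) (ltac:(by rewrite invr_gt0))).
have K0 x : Omega x -> \forall n \near \oo, conv (K n) (g \_ Omega) x = 0.
  move=> Ox; have [d d0 dO] := nbhs_csq (open_nbhs_nbhs (conj oOmega Ox)).
  have := @harmonic_cvg0 R => /cvgr_lt /(_ _ d0); apply: filterS => n nd.
  have [kK _ _] := HK n; rewrite conv_restrict; apply: g0; apply: test_kernel kK _ => y [].
  rewrite /= !subr0 => h1 h2; apply: dO; split; [apply: le_trans h1 _|apply: le_trans h2 _]; exact: ltW.
have mconv n : measurable_fun (setT : set planeT) (conv (K n) (g \_ Omega)).
  by have [kK _ _] := HK n; apply: continuous_measurable_plane; apply: smooth_continuous; exact: smooth_conv iG _ _ _ kK.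
have mG : measurable_fun (setT : set planeT) (g \_ Omega) by have [] := GL.
have E : sqint area Omega g = 0%E.
  have -> : sqint area Omega g = sqint area Omega (fun x => 0 - (g \_ Omega) x).
    by apply: eq_sqint => x Ox; rewrite sub0r sqrrN patchE mem_set.
  have mh n : measurable_fun (Omega : set planeT) (fun x => conv (K n) (g \_ Omega) x - (g \_ Omega) x).
    by apply: (measurable_funS measurableT) => //; exact: measurable_funB.
  have ch x : Omega x -> conv (K n) (g \_ Omega) x - (g \_ Omega) x @[n --> \oo] --> 0 - (g \_ Omega) x.
    move=> Ox; apply: cvgB; last exact: cvg_cst.
    by apply: (cvg_trans _ (@cvg_cst _ (0 : R) _ \oo _)); apply: near_eq_cvg; apply: filterS (K0 x Ox) => n ->.
  have L := sqint_lim area mO mh ch.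
  apply/eqP; rewrite eq_le sqint_ge0 andbT; apply: le_trans L _.
  apply/lee_addgt0Pr => eps eps0; rewrite add0e.
  have [d d0 dH] := mollify_eps GL iG eps0.
  apply: limn_einf_le; have := @harmonic_cvg0 R => /cvgr_lt /(_ _ d0); apply: filterS => n nd.
  have [kK k0 k1] := HK n.
  apply: le_trans (dH (0, 0) n.+1%:R^-1 (K n) _ kK k0 k1).
    apply: ge0_subset_integral => //.
    - by apply: measurable_sq; exact: measurable_funB.
    - by move=> x _; rewrite lee_fin sqr_ge0.
  by move=> y [h1 h2]; split; [apply: le_trans h1 _|apply: le_trans h2 _]; exact: ltW.
by apply: sqint_eq0 => //; have [] := gL.
Qed.

Lemma weak_derivative_unique v u g g' : weak_derivative Omega v u g -> weak_derivative Omega v u g' ->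
  {ae area, forall x, Omega x -> g x = g' x}.
Proof.
move=> [gL gw] [gL' gw'].
have dL : L2 area Omega (fun x => g x - g' x) by exact: L2B.
have : {ae area, forall x, Omega x -> g x - g' x = 0}.
  apply: test_functions_separate => // phi tphi.
  have [M kphi] := test_function_kernel tphi.
  have [C C0 phiC] := kernel_bounded kphi.
  have phiL : L2 area Omega phi.
    apply: (L2_bounded mO fOmega) (fun x _ => phiC x).
    by apply: (measurable_funS measurableT) => //; apply: continuous_measurable_plane; exact: smooth_continuous kphi.1.
  have -> : \int[area]_(x in Omega) ((g x - g' x) * phi x) = ip area Omega (fun x => -1 * g' x + g x) phi.
    by apply: eq_Rintegral => x _; congr (_ * _); ring.
  by rewrite ip_lin// /ip -[X in _ + X]opprK -gw// -[X in _ * X]opprK -gw'//; ring.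
apply: (@filterS _ (almost_everywhere area)) => x H Ox; apply/eqP; rewrite -subr_eq0 H//.
Qed.

End domain.
End WeakDerivatives.

(** * The space H1 of a bounded open set *)

Record bounded_domain {R : realType} := BoundedDomain {
  dom :> set (R * R);
  dom_open : open dom;
  dom_radius : R;
  dom_bounded : dom `<=` csq (0, 0) dom_radius }.

Section H1space.
Context {R : realType}.
Local Notation planeT := (@planeT R).
Variable O : @bounded_domain R.
Local Notation Omega := (dom O).
Implicit Types (p q v : R * R) (f K u g phi chi : R * R -> R) (r : R).

Definition axis v := v = e1 \/ v = e2.

Lemma measurable_dom : measurable (O : set planeT).
Proof. exact: open_measurable_plane (@dom_open R O). Qed.

Let mO := measurable_dom.
Let oO := @dom_open R O.

Lemma area_csq_fin p r : (area (csq p r) < +oo)%E.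
Proof.
have fin (c : R) : (lebesgue_measure (`[(c - r)%R, (c + r)%R]%classic : set (measurableTypeR R)) < +oo)%E.
  by rewrite lebesgue_measure_itv/=; case: ifPn => _; rewrite -?EFinB ltry.
rewrite csqE area_setX; try exact: measurable_itv.
by apply: lte_mul_pinfty => //; rewrite ge0_fin_numE.
Qed.

Lemma measurable_csq p r : measurable (csq p r : set planeT).
Proof. exact: (closed_measurable_plane (@closed_csq R p r)). Qed.

Lemma area_dom_fin : (area O < +oo)%E.
Proof.
apply: le_lt_trans (area_csq_fin (0, 0) (dom_radius O)).
by apply: le_measure; rewrite ?inE; [exact: mO|exact: measurable_csq|exact: dom_bounded].
Qed.

Let fO := area_dom_fin.

Lemma continuous_measurable_dom f : continuous f -> measurable_fun (O : set planeT) f.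
Proof.
by move=> cf; apply: (measurable_funS measurableT) => //; exact: continuous_measurable_plane.
Qed.

Lemma continuous_dom_bounded f : continuous f -> exists2 M, 0 <= M & forall x, Omega x -> `|f x| <= M.
Proof.
move=> cf; have [M M0 HM] := compact_bounded_fun (@compact_csq R (0, 0) (dom_radius O)) cf.
by exists M => // x /(@dom_bounded _ O)/HM.
Qed.

Lemma L2_continuous f : continuous f -> L2 area O f.
Proof.
move=> cf; have [M _ HM] := continuous_dom_bounded cf.
exact: (L2_bounded mO fO (continuous_measurable_dom cf) HM).
Qed.

Lemma L2_smooth f : smooth f -> L2 area O f.
Proof. by move=> /smooth_continuous; exact: L2_continuous. Qed.

Lemma smooth_D v f : axis v -> smooth f -> smooth ('D_v f).
Proof. by move=> [->|->]; [exact: smooth_D1|exact: smooth_D2]. Qed.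

Lemma kernel_D v p r K : axis v -> kernel p r K -> kernel p r ('D_v K).
Proof. by move=> [->|->]; [exact: kernel_D1|exact: kernel_D2]. Qed.

Lemma L2_smooth_mul f u : smooth f -> L2 area O u -> L2 area O (fun x => f x * u x).
Proof.
move=> /smooth_continuous cf uL; have [M M0 HM] := continuous_dom_bounded cf.
have mf := continuous_measurable_dom cf; have [mu _] := uL.
apply: (L2_le mO _ (L2Z mO M uL)) => [|x Ox]; first exact: measurable_funM.
by rewrite !normrM ler_wpM2r// (le_trans (HM x Ox)) ?ler_norm.
Qed.

Lemma weak_derivative_lin v c u u' g g' : axis v -> L2 area O u -> L2 area O u' ->
  weak_derivative O v u g -> weak_derivative O v u' g' ->
  weak_derivative O v (fun x => c * u x + u' x) (fun x => c * g x + g' x).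
Proof.
move=> av uL uL' [gL gw] [gL' gw']; split; first by apply: L2D => //; exact: L2Z.
move=> phi tphi; have [sphi _ _] := tphi.
have pL := L2_smooth sphi; have dL := L2_smooth (smooth_D av sphi).
have := ip_lin mO c uL uL' dL; have := ip_lin mO c gL gL' pL; rewrite /ip => -> ->.
by rewrite gw// gw'//; ring.
Qed.

Lemma wD1P u : H1 O u -> weak_derivative O e1 u (wD O e1 u).
Proof. by move=> [_ H _]; exact: xgetPex. Qed.

Lemma wD2P u : H1 O u -> weak_derivative O e2 u (wD O e2 u).
Proof. by move=> [_ _ H]; exact: xgetPex. Qed.

Lemma wDP v u : axis v -> H1 O u -> weak_derivative O v u (wD O v u).
Proof. by move=> [->|->]; [exact: wD1P|exact: wD2P]. Qed.

Lemma H1P u : H1 O u <-> L2 area O u /\ forall v, axis v -> exists g, weak_derivative O v u g.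
Proof.
split=> [[uL d1 d2]|[uL d]].
  by split; [exact: uL|move=> v [->|->]; [exact: d1|exact: d2]].
by split; [exact: uL|apply: d; left|apply: d; right].
Qed.

Lemma H1_L2 u : H1 O u -> L2 area O u. Proof. by case. Qed.

Lemma wD_L2 v u : axis v -> H1 O u -> L2 area O (wD O v u).
Proof. by move=> av hu; have [] := wDP av hu. Qed.

Lemma wD_unique v u g : axis v -> H1 O u -> weak_derivative O v u g ->
  {ae area, forall x, Omega x -> wD O v u x = g x}.
Proof. by move=> av hu; exact: weak_derivative_unique oO fO _ _ _ _ (wDP av hu). Qed.

Lemma H1_lin c u u' : H1 O u -> H1 O u' -> H1 O (fun x => c * u x + u' x).
Proof.
move=> hu hu'; have [uL uL'] := (H1_L2 hu, H1_L2 hu'); apply/H1P; split.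
  by apply: L2D => //; exact: L2Z.
move=> v av; eexists; apply: weak_derivative_lin => //; exact: wDP.
Qed.

Lemma wD_lin v c u u' : axis v -> H1 O u -> H1 O u' ->
  {ae area, forall x, Omega x -> wD O v (fun x => c * u x + u' x) x = c * wD O v u x + wD O v u' x}.
Proof.
move=> av hu hu'; apply: (wD_unique av (H1_lin c hu hu')).
by apply: weak_derivative_lin; rewrite //; [exact: H1_L2|exact: H1_L2|exact: wDP|exact: wDP].
Qed.

(** The convolution of [K] with the indicator of a large square is constant near the origin; the
    integral is its derivative there. *)
Lemma kernel_integral_D v p r K : axis v -> kernel p r K -> \int[area]_x 'D_v K x = 0.
Proof.
move=> av kK.
(* Large enough to contain the support of the reflected kernel for every base point whose
   coordinates are at most 1 in absolute value. *)
pose B : set (R * R) := csq (- p.1, - p.2) (r + 1).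
have iB : area.-integrable setT (EFin \o (\1_B : planeT -> R)).
  apply/integrableP; split; first by apply/measurable_EFinP; apply: measurable_indic; exact: measurable_csq.
  under eq_integral do rewrite /= ger0_norm//.
  by rewrite integral_indic ?setIT//; [exact: area_csq_fin|exact: measurable_csq].
have E K' x : kernel p r K' -> `|x.1| <= 1 -> `|x.2| <= 1 -> conv K' \1_B x = \int[area]_z K' z.
  move=> kK' x1 x2; rewrite -(Rintegral_reflectT x); last first.
    by apply: continuous_measurable_plane; exact: smooth_continuous kK'.1.
  apply: eq_Rintegral => z _; rewrite indicE.
  have [zB|zB] := pselect (B z); first by rewrite mem_set// mulr1.
  rewrite memNset// mulr0 kK'.2// => -[h1 h2]; apply: zB.
  move: h1 h2 x1 x2; rewrite /B /csq/= !ler_norml => /andP[? ?] /andP[? ?] /andP[? ?] /andP[? ?].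
  by split; apply/andP; split; lra.
rewrite -(E _ (0, 0)) ?normr0//; last exact: kernel_D.
have HD : is_derive ((0, 0) : R * R) v (fun=> \int[area]_z K z) 0 by exact: is_derive_cst.
have -> : conv ('D_v K) \1_B (0, 0) = 'D_v (conv K \1_B) (0, 0).
  by case: av => ->; [rewrite (D1_conv iB _ kK)|rewrite (D2_conv iB _ kK)].
have near1 : \forall x \near ((0, 0) : R * R), (fun=> \int[area]_z K z) x = conv K \1_B x.
  apply/nbhs_ballP; exists 1 => //= x; rewrite -ball_normE /= prod_normE gt_max /=.
  by rewrite !sub0r !normrN => /andP[/ltW ? /ltW ?]; rewrite E.
have [_ +] := near_eq_is_derive near1 HD.
by [].
Qed.

Lemma test_functionM chi phi : smooth chi -> test_function O phi -> test_function O (fun x => chi x * phi x).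
Proof.
move=> schi [sphi cphi pO].
have sub : closure [set x | chi x * phi x != 0] `<=` closure [set x | phi x != 0].
  by apply: closureS => x /=; apply: contra_neq => ->; rewrite mulr0.
split; first exact: smoothM.
- exact: (subclosed_compact (@closed_closure _ _) cphi sub).
- exact: subset_trans sub pO.
Qed.

Lemma derive_mul v chi phi x : axis v -> smooth chi -> smooth phi ->
  'D_v (fun x => chi x * phi x) x = 'D_v chi x * phi x + chi x * 'D_v phi x.
Proof.
move=> av schi sphi.
have [_ _ E1 E2] := has_partialsE (has_partialsM (smooth_partials schi) (smooth_partials sphi)).
by case: av => ->; [exact: (congr1 (fun f => f x) E1)|exact: (congr1 (fun f => f x) E2)].
Qed.

(** The product of [chi] with a test function is a kernel, so the integral of its derivative
    vanishes; Leibniz' rule splits it. *)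
Lemma weak_derivative_smooth v chi : axis v -> smooth chi -> weak_derivative O v chi ('D_v chi).
Proof.
move=> av schi; split=> [|phi tphi]; first by apply: L2_smooth; exact: smooth_D.
have [sphi _ pO] := tphi; have [r kphi] := test_function_kernel tphi.
have kcp : kernel (0, 0) r (fun x => chi x * phi x).
  by split=> [|x xB]; [exact: smoothM|rewrite kphi.2// mulr0].
have := kernel_integral_D av kcp.
have dout x : ~ Omega x -> 'D_v (fun x => chi x * phi x) x = 0.
  move=> Ox; have := test_functionM schi tphi => -[sM _ sub].
  have nb : \forall y \near x, (fun=> 0) y = (fun x => chi x * phi x) y.
    have : open_nbhs x (~` closure [set x | chi x * phi x != 0]).
      by split; [exact/closed_openC/closed_closure|move=> /sub].
    move=> /open_nbhs_nbhs; apply: filterS => y ny; apply/esym/eqP; apply: contrapT => /negP yn.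
    by apply: ny; exact: subset_closure.
  by have [_ ->] := near_eq_is_derive nb (is_derive_cst (0 : R) x v).
have -> : \int[area]_x 'D_v (fun x => chi x * phi x) x =
    \int[area]_(x in O) (1 * ('D_v chi x * phi x) + chi x * 'D_v phi x).
  rewrite [RHS]Rintegral_mkcond; apply: eq_Rintegral => x _; rewrite patchE.
  case: ifPn => [_|/negP Ox]; first by rewrite mul1r derive_mul.
  by rewrite dout// => Ox'; apply: Ox; rewrite inE.
have dchiL := L2_smooth (smooth_D av schi); have chiL := L2_smooth schi.
have dphiL := L2_smooth (smooth_D av sphi); have phiL := L2_smooth sphi.
rewrite RintegralD//; first last.
- exact: L2_mul_integrable.
- have := L2_mul_integrable mO dchiL phiL; apply: eq_integrable => // x _.
  by rewrite /= mul1r.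
under [X in X + _]eq_Rintegral do rewrite mul1r.
by move=> /eqP; rewrite addrC addr_eq0 => /eqP.
Qed.

Lemma H1_smooth chi : smooth chi -> H1 O chi.
Proof.
move=> schi; apply/H1P; split; first exact: L2_smooth.
by move=> v av; exists ('D_v chi); exact: weak_derivative_smooth.
Qed.

Lemma wD_smooth v chi : axis v -> smooth chi -> {ae area, forall x, Omega x -> wD O v chi x = 'D_v chi x}.
Proof. by move=> av schi; apply: wD_unique => //; [exact: H1_smooth|exact: weak_derivative_smooth]. Qed.

(** The derivative of [u] is tested with [chi * phi], again a test function. *)
Lemma weak_derivativeM v chi u g : axis v -> smooth chi -> L2 area O u -> weak_derivative O v u g ->
  weak_derivative O v (fun x => chi x * u x) (fun x => chi x * g x + 'D_v chi x * u x).
Proof.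
move=> av schi uL [gL gw].
have dchiuL := L2_smooth_mul (smooth_D av schi) uL; have chigL := L2_smooth_mul schi gL.
split=> [|phi tphi]; first exact: L2D.
have [sphi _ _] := tphi; have phiL := L2_smooth sphi.
have := gw _ (test_functionM schi tphi).
have -> : \int[area]_(x in O) (u x * 'D_v (fun x => chi x * phi x) x) =
    \int[area]_(x in O) (('D_v chi x * u x) * phi x + (chi x * u x) * 'D_v phi x).
  by apply: eq_Rintegral => x _; rewrite derive_mul//; ring.
rewrite RintegralD//; first last.
- apply: L2_mul_integrable => //; [exact: L2_smooth_mul|exact: L2_smooth (smooth_D av sphi)].
- exact: L2_mul_integrable.
have -> : \int[area]_(x in O) ((chi x * g x + 'D_v chi x * u x) * phi x) =
   \int[area]_(x in O) (g x * (chi x * phi x) + ('D_v chi x * u x) * phi x).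
  by apply: eq_Rintegral => x _; ring.
rewrite RintegralD//; first by move=> H; rewrite opprD -H; ring.
- by apply: L2_mul_integrable => //; apply: L2_smooth_mul.
- exact: L2_mul_integrable.
Qed.

End H1space.

(** * H1 as a vector space with its quadratic forms *)

Section H1type.
Context {R : realType}.
Local Notation planeT := (@planeT R).
Variable O : @bounded_domain R.
Local Notation Omega := (dom O).
Implicit Types (v : R * R) (f g : R * R -> R).

Let mO := measurable_dom O.

Definition h1_pred : {pred (R * R -> R)} := fun u => `[< H1 Omega u >].

Lemma h1_submod_closed : submod_closed h1_pred.
Proof.
split; first by apply/asboolP; exact: (H1_smooth O (smooth_cst (0 : R))).
by move=> c u u' /asboolP hu /asboolP hu'; apply/asboolP; exact: H1_lin.
Qed.

HB.instance Definition _ := GRing.isSubmodClosed.Build R (R * R -> R) h1_pred h1_submod_closed.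

Definition h1 := {u : R * R -> R | u \in h1_pred}.

HB.instance Definition _ := [isSub of h1 for @sval _ _].
HB.instance Definition _ := [Choice of h1 by <:].
HB.instance Definition _ := [SubChoice_isSubLmodule of h1 by <:].

Implicit Types u w : h1.

Lemma h1P u : H1 Omega (val u).
Proof. by have /asboolP := valP u. Qed.

Definition to_h1 f (hf : H1 Omega f) : h1 := Sub f (asboolT hf).

Lemma val_to_h1 f (hf : H1 Omega f) : val (to_h1 hf) = f.
Proof. by rewrite SubK. Qed.

Lemma val_h1_lin (c : R) u w : val (c *: u + w) = fun x => c * val u x + val w x.
Proof. by []. Qed.

Lemma val_h1_sub u w : val (u - w) = fun x => val u x - val w x.
Proof. by []. Qed.

Definition l2form u w : R := ip area Omega (val u) (val w).

Definition gradform v u w : R := ip area Omega (wD Omega v (val u)) (wD Omega v (val w)).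

Definition dirform u w : R := gradform e1 u w + gradform e2 u w.

Definition h1form u w : R := dirform u w + l2form u w.

Lemma l2form_psd : psd_form l2form.
Proof.
split=> [u w|c u w z|u]; [exact: ipC| |exact: ip_ge0].
by rewrite /l2form val_h1_lin ip_lin//; apply: H1_L2; exact: h1P.
Qed.

(** The chosen representative [wD] is linear only almost everywhere, which the integral does not
    see. *)
Lemma gradform_psd v : axis v -> psd_form (gradform v).
Proof.
move=> av; split=> [u w|c u w z|u]; [exact: ipC| |exact: ip_ge0].
have uL u' : L2 area Omega (wD Omega v (val u')) by apply: wD_L2 => //; exact: h1P.
rewrite /gradform -ip_lin//.
apply: (ae_eq_ip mO) => //; first by apply: L2D => //; exact: L2Z.
- by rewrite val_h1_lin; apply: wD_lin => //; exact: h1P.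
- exact: aeW.
Qed.

Lemma psd_formD (b c : h1 -> h1 -> R) : psd_form b -> psd_form c -> psd_form (fun u w => b u w + c u w).
Proof.
move=> bP cP; split=> [u w|k u w z|u].
- by rewrite (formC bP) (formC cP).
- by rewrite (form_lin bP) (form_lin cP); ring.
- by rewrite addr_ge0// form_ge0.
Qed.

Lemma dirform_psd : psd_form dirform.
Proof. by apply: psd_formD; apply: gradform_psd; [left|right]. Qed.

Lemma h1form_psd : psd_form h1form.
Proof. exact: psd_formD dirform_psd l2form_psd. Qed.

Lemma dirformE u w : dirform u w = \int[area]_(x in Omega)
  (wD Omega e1 (val u) x * wD Omega e1 (val w) x + wD Omega e2 (val u) x * wD Omega e2 (val w) x).
Proof.
rewrite RintegralD//; apply: L2_mul_integrable => //; apply: wD_L2; by [left|right|exact: h1P].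
Qed.

Lemma sqint_sub_wD v u w : axis v ->
  sqint area Omega (fun x => wD Omega v (val u) x - wD Omega v (val w) x) = (gradform v (u - w) (u - w))%:E.
Proof.
move=> av; have L u' : L2 area Omega (wD Omega v (val u')) by apply: wD_L2 => //; exact: h1P.
rewrite /gradform -sqint_ip//; apply: ae_eq_sqint => //.
- by have [] := L2B mO (L u) (L w).
- by have [] := L (u - w).
have := wD_lin (-1) av (h1P w) (h1P u).
have -> : (fun x => -1 * val w x + val u x) = val (u - w).
  by rewrite val_h1_sub; apply/funext => x; rewrite mulN1r addrC.
by apply: (@filterS _ (almost_everywhere area)) => x H Ox; rewrite H// mulN1r addrC.
Qed.

Lemma gradform_le v u : axis v -> gradform v u u <= h1form u u.
Proof.
have le3 (x y z : R) : 0 <= x -> 0 <= y -> 0 <= z -> x <= x + y + z /\ y <= x + y + z.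
  by move=> *; split; lra.
have [le1 le2] := le3 _ _ _ (form_ge0 (gradform_psd (or_introl erefl)) u)
  (form_ge0 (gradform_psd (or_intror erefl)) u) (form_ge0 l2form_psd u).
by move=> [->|->]; [exact: le1|exact: le2].
Qed.

Lemma l2form_le u : l2form u u <= h1form u u.
Proof. by rewrite /h1form lerDr; exact: (form_ge0 dirform_psd u). Qed.

(** Both sides of the defining identity are pairings with a fixed square integrable function, hence
    continuous. *)
Lemma weak_derivative_closed v (f_ g_ : nat -> R * R -> R) f g : axis v ->
  (forall n, L2 area Omega (f_ n)) -> L2 area Omega f -> L2 area Omega g ->
  (forall n, weak_derivative Omega v (f_ n) (g_ n)) ->
  sqint area Omega (fun x => f_ n x - f x) @[n --> \oo] --> 0%E ->
  sqint area Omega (fun x => g_ n x - g x) @[n --> \oo] --> 0%E ->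
  weak_derivative Omega v f g.
Proof.
move=> av fnL fL gL wn fc gc; split=> // phi tphi; have [sphi _ _] := tphi.
have pL := L2_smooth O sphi; have dL := L2_smooth O (smooth_D av sphi).
have c1 := cvg_ip mO fnL fL dL fc.
have c2 := cvg_ip mO (fun n => (wn n).1) gL pL gc.
apply: (cvg_unique _ c1); first exact: norm_hausdorff.
have -> : (fun n => ip area Omega (f_ n) ('D_v phi)) = (fun n => - ip area Omega (g_ n) phi).
  by apply/funext => n; exact: (wn n).2.
exact: cvgN c2.
Qed.

(** The functions and both their weak derivatives are Cauchy in L2; by closedness the limits of the
    derivatives are the derivatives of the limit. *)
Lemma h1_complete : complete_form h1form.
Proof.
move=> u uC.
have lim (G : h1 -> R * R -> R) : (forall w, L2 area Omega (G w)) ->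
    (forall w z, (sqint area Omega (fun x => G w x - G z x)%R <= (h1form (w - z) (w - z))%:E)%E) ->
    exists2 g, L2 area Omega g & sqint area Omega (fun x => G (u n) x - g x) @[n --> \oo] --> 0%E.
  move=> GL Gle; apply: (L2_complete mO) => // eps eps0.
  have [N HN] := uC _ eps0; exists N => i j iN jN.
  by apply: le_trans (Gle _ _) _; rewrite lee_fin HN.
have [f fL fc] : exists2 f, L2 area Omega f & sqint area Omega (fun x => val (u n) x - f x) @[n --> \oo] --> 0%E.
  apply: (lim (fun w => val w)) => [w|w z]; first by apply: H1_L2; exact: h1P.
  rewrite (sqint_ip mO); last by apply: (L2B mO) => //; apply: H1_L2; exact: h1P.
  by rewrite lee_fin; exact: l2form_le (w - z).
have limD v : axis v -> exists2 g, L2 area Omega g &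
    sqint area Omega (fun x => wD Omega v (val (u n)) x - g x) @[n --> \oo] --> 0%E.
  move=> av; apply: (lim (fun w => wD Omega v (val w))) => [w|w z]; first by apply: wD_L2 => //; exact: h1P.
  by rewrite sqint_sub_wD// lee_fin; exact: gradform_le.
have wdf v (av : axis v) g (gL : L2 area Omega g)
    (gc : sqint area Omega (fun x => wD Omega v (val (u n)) x - g x) @[n --> \oo] --> 0%E) :
    weak_derivative Omega v f g.
  apply: (weak_derivative_closed av _ fL gL _ fc gc) => n; first by apply: H1_L2; exact: h1P.
  by apply: wDP => //; exact: h1P.
have hf : H1 Omega f.
  by apply/H1P; split=> // v av; have [g gL gc] := limD v av; exists g; exact: wdf.
exists (to_h1 hf).
have cD v : axis v -> gradform v (u n - to_h1 hf) (u n - to_h1 hf) @[n --> \oo] --> (0 : R).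
  move=> av; have [g gL gc] := limD v av.
  have ae : {ae area, forall x, Omega x -> wD Omega v (val (to_h1 hf)) x = g x}.
    by apply: wD_unique => //; exact: wdf.
  suff : sqint area Omega (fun x => wD Omega v (val (u n)) x - wD Omega v (val (to_h1 hf)) x) @[n --> \oo] --> 0%E.
    by under eq_fun do rewrite sqint_sub_wD//; move=> /fine_cvg.
  rewrite (_ : (fun n => sqint _ _ _) = (fun n => sqint area Omega (fun x => wD Omega v (val (u n)) x - g x)))//.
  have L w : L2 area Omega (wD Omega v (val w)) by apply: wD_L2 => //; exact: h1P.
  apply/funext => n; apply: ae_eq_sqint => //; [by have [] := L2B mO (L (u n)) (L (to_h1 hf))|by have [] := L2B mO (L (u n)) gL|].
  by apply: (@filterS _ (almost_everywhere area)) ae => x H Ox; rewrite H.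
rewrite /h1form /dirform -[X in _ --> X]addr0; apply: cvgD.
  by rewrite -[X in _ --> X]addr0; apply: cvgD; apply: cD; [left|right].
move: fc => /fine_cvg; apply: cvg_trans; apply: near_eq_cvg; apply: nearW => n.
rewrite /= (sqint_ip mO)//; apply: (L2B mO); apply: H1_L2; [exact: h1P|exact: (h1P (to_h1 hf))].
Qed.

End H1type.
(** * Arc length *)

Section Hausdorff.
Context {R : realType}.
Local Notation planeT := (@planeT R).
Local Notation edist := (@Defs.edist R).
Implicit Types (p q x y : R * R) (A B X : set (R * R)) (g : R * R -> R) (delta : R).
Local Open Scope ereal_scope.

Lemma le_diam A B : A `<=` B -> diam A <= diam B.
Proof.
move=> AB; rewrite /diam ge_max le_max lexx/= le_max; apply/orP; right.
by apply: le_ereal_sup => _ [pq [h1 h2] <-]; exists pq => //; split; exact: AB.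
Qed.

Lemma diam_le A (c : R) : (0 <= c)%R -> (forall x y, A x -> A y -> (edist x y <= c)%R) ->
  diam A <= c%:E.
Proof.
move=> c0 Ac; rewrite /diam ge_max lee_fin c0/=.
by apply: ge_ereal_sup => _ [pq [h1 h2] <-]; rewrite lee_fin Ac.
Qed.

Lemma edist_le_diam A x y : A x -> A y -> (edist x y)%:E <= diam A.
Proof.
by move=> Ax Ay; rewrite /diam le_max; apply/orP; right; apply: ereal_sup_ubound; exists (x, y).
Qed.

Lemma le_small_diam delta A B : A `<=` B -> small_diam delta A <= small_diam delta B.
Proof.
move=> AB; rewrite /small_diam; case: (leP (diam B)) => [h|_]; last by rewrite leey.
by rewrite (le_trans (le_diam AB) h) le_diam.
Qed.

Lemma small_diam_le delta delta' A : (delta' <= delta)%R -> small_diam delta A <= small_diam delta' A.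
Proof.
move=> dd; rewrite /small_diam; case: (leP _ delta'%:E) => [h|_]; last by rewrite leey.
by rewrite (le_trans h) ?lee_fin.
Qed.

Lemma mu_ext_small_diam_le delta delta' A : (delta' <= delta)%R ->
  mu_ext (small_diam delta) A <= mu_ext (small_diam delta') A.
Proof.
move=> dd; apply: le_ereal_inf_tmp => _ [F cF <-].
apply: (@le_trans _ _ (\sum_(0 <= k <oo) small_diam delta (F k))).
  by apply: ereal_inf_lbound; exists F.
by apply: lee_nneseries => [k _ _|k _]; [exact: small_diam_ge0|exact: small_diam_le].
Qed.

Lemma lee_sup_add (S T : set (\bar R)) (z : \bar R) : (forall s, S s -> 0 <= s) ->
  (forall t, T t -> 0 <= t) -> S !=set0 -> T !=set0 ->
  (forall s t, S s -> T t -> s + t <= z) -> ereal_sup S + ereal_sup T <= z.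
Proof.
move=> S0 T0 [s0 Ss0] [t0 Tt0] H.
have [->|] := eqVneq z +oo; first by rewrite leey.
rewrite -ltey => zoo.
have zf : z \is a fin_num.
  by rewrite ge0_fin_numE// (le_trans (adde_ge0 (S0 _ Ss0) (T0 _ Tt0)) (H _ _ Ss0 Tt0)).
have tf t : T t -> t \is a fin_num.
  move=> Tt; rewrite ge0_fin_numE ?T0// (le_lt_trans _ zoo)// (le_trans _ (H _ _ Ss0 Tt))//.
  by rewrite leeDr//; exact: S0.
have supS : ereal_sup S \is a fin_num.
  have le : ereal_sup S <= z.
    by apply: ge_ereal_sup => s Ss; rewrite (le_trans _ (H _ _ Ss Tt0))// leeDl//; exact: T0.
  rewrite ge0_fin_numE ?(le_lt_trans le)//.
  by rewrite (le_trans (S0 _ Ss0))//; exact: ereal_sup_ubound.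
rewrite addeC -leeBrDr//; apply: ge_ereal_sup => t Tt; rewrite leeBrDr// addeC -leeBrDr ?tf//.
by apply: ge_ereal_sup => s Ss; rewrite leeBrDr ?tf// H.
Qed.

(** Sets separated by two levels of such a function are at positive distance; the coordinates are
    the instances used. *)
Definition nonexpansive g := forall x y, (`|g x - g y| <= edist x y)%R.

Lemma nonexpansive_fst : nonexpansive fst.
Proof.
by move=> x y; rewrite /edist -sqrtr_sqr ler_wsqrtr// lerDl sqr_ge0.
Qed.

Lemma nonexpansive_snd : nonexpansive snd.
Proof.
by move=> x y; rewrite /edist -sqrtr_sqr ler_wsqrtr// lerDr sqr_ge0.
Qed.

Lemma measurable_sublevel g (c : R) : continuous g -> measurable ([set x | g x <= c]%R : set planeT).
Proof.
move=> cg; apply: closed_measurable_plane.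
have -> : [set x | g x <= c]%R = g @^-1` [set t | t <= c]%R by [].
by apply: closed_comp => // x _; exact: cg.
Qed.

Lemma measurable_superlevel g (c : R) : continuous g -> measurable ([set x | c <= g x]%R : set planeT).
Proof.
move=> cg; apply: closed_measurable_plane.
have -> : [set x | c <= g x]%R = g @^-1` [set t | c <= t]%R by [].
by apply: closed_comp => // x _; exact: cg.
Qed.

Section separated.
Variables (g : R * R -> R) (cg : continuous g) (ng : nonexpansive g).

(** A covering set of diameter at most [delta] cannot meet both level regions, so every cover splits
    into a cover of [A] and one of [B]; a set that meets both has infinite [small_diam]. *)
Lemma mu_ext_separated A B (c d delta : R) : (delta < d - c)%R -> (0 < delta)%R ->
  A `<=` [set x | g x <= c]%R -> B `<=` [set x | d <= g x]%R ->
  mu_ext (small_diam delta) A + mu_ext (small_diam delta) B <= mu_ext (small_diam delta) (A `|` B).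
Proof.
move=> dcd delta0 Ac Bd; apply: le_ereal_inf_tmp => _ [F [mF FAB] <-].
pose F1 k := F k `&` [set x | g x <= c]%R; pose F2 k := F k `&` [set x | d <= g x]%R.
have c1 : measurable_cover A F1.
  split=> [k|x Ax]; first exact: (measurableI _ _ (mF k) (measurable_sublevel c cg)).
  by have [k _ Fk] := FAB x (or_introl Ax); exists k => //; split => //; exact: Ac.
have c2 : measurable_cover B F2.
  split=> [k|x Bx]; first exact: (measurableI _ _ (mF k) (measurable_superlevel d cg)).
  by have [k _ Fk] := FAB x (or_intror Bx); exists k => //; split => //; exact: Bd.
apply: (@le_trans _ _ (\sum_(0 <= k <oo) small_diam delta (F1 k) + \sum_(0 <= k <oo) small_diam delta (F2 k))).
  by apply: leeD; apply: ereal_inf_lbound; [exists F1|exists F2].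
rewrite -nneseriesD; try by move=> *; exact: small_diam_ge0.
apply: lee_nneseries => [k _ _|k _]; first by rewrite adde_ge0// small_diam_ge0.
have s0 : small_diam delta set0 = 0 by exact: small_diam0.
have [[x F1x]|/set0P/negP] := pselect (F1 k !=set0); last first.
  rewrite negbK => /eqP ->; rewrite s0 add0e; apply: le_small_diam; exact: subIsetl.
have [[y F2y]|/set0P/negP] := pselect (F2 k !=set0); last first.
  rewrite negbK => /eqP ->; rewrite s0 adde0; apply: le_small_diam; exact: subIsetl.
rewrite [leRHS]/small_diam ifF ?leey//; apply/negbTE; rewrite -ltNge.
have := edist_le_diam F1x.1 F2y.1; apply: lt_le_trans; rewrite lte_fin.
apply: lt_le_trans (ng x y); rewrite distrC; apply: lt_le_trans (ler_norm _).
have := F1x.2; have := F2y.2; rewrite /=; lra.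
Qed.

Lemma hausdorff1_separated A B (c d : R) : (c < d)%R ->
  A `<=` [set x | g x <= c]%R -> B `<=` [set x | d <= g x]%R ->
  hausdorff1 A + hausdorff1 B <= hausdorff1 (A `|` B).
Proof.
move=> cd Ac Bd; apply: lee_sup_add.
- by move=> _ [e _ <-]; apply: mu_ext_ge0 => X; exact: small_diam_ge0.
- by move=> _ [e _ <-]; apply: mu_ext_ge0 => X; exact: small_diam_ge0.
- by exists (mu_ext (small_diam 1) A), 1%R => //=.
- by exists (mu_ext (small_diam 1) B), 1%R => //=.
move=> _ _ [e1 e10 <-] [e2 e20 <-].
(* A common scale, below both given ones, at which no covering set bridges the gap. *)
pose e := Num.min (Num.min e1 e2) ((d - c) / 2)%R.
have e0 : (0 < e)%R by rewrite !lt_min e10 e20 divr_gt0 ?subr_gt0.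
have ee1 : (e <= e1)%R by rewrite !ge_min lexx.
have ee2 : (e <= e2)%R by rewrite !ge_min lexx orbT.
have edc : (e < d - c)%R.
  by apply: (@le_lt_trans _ _ ((d - c) / 2)%R); [rewrite !ge_min lexx orbT|lra].
apply: le_trans (leeD (mu_ext_small_diam_le A ee1) (mu_ext_small_diam_le B ee2)) _.
apply: le_trans (mu_ext_separated edc e0 Ac Bd) _.
by apply: ereal_sup_ubound; exists e.
Qed.

Lemma separated_sum (E : nat -> set (R * R)) (lo hi : nat -> R) N :
  (forall k, E k `<=` [set x | lo k <= g x <= hi k]%R) -> (forall k, hi k.+1 < lo k)%R ->
  (forall k, lo k.+1 <= lo k)%R ->
  \sum_(0 <= k < N) hausdorff1 (E k) <= hausdorff1 (\bigcup_(k in `I_N) E k).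
Proof.
move=> Elh hilo lodec; have lole m n : (m <= n)%N -> (lo n <= lo m)%R.
  move=> /subnKC <-; elim: (n - m)%N => [|j IH]; first by rewrite addn0.
  by rewrite addnS; exact: le_trans (lodec _) IH.
elim: N => [|[|N] IH]; first by rewrite big_nil hausdorff1_ge0.
  by rewrite big_nat1; apply: le_hausdorff1 => x Ex; exists 0%N.
rewrite big_nat_recr//= addeC; apply: le_trans (leeD2l _ IH) _.
have h1 : E N.+1 `<=` [set x | g x <= hi N.+1]%R by move=> x /Elh/= /andP[].
have h2 : \bigcup_(k in `I_N.+1) E k `<=` [set x | lo N <= g x]%R.
  by move=> x [k /= kN /Elh/= /andP[+ _]]; apply: le_trans; exact: lole.
apply: le_trans (hausdorff1_separated (hilo N) h1 h2) _.
apply: le_hausdorff1 => x [Ex|[k /= kN Ex]]; [by exists N.+1 => //=|exists k => //=].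
exact: ltn_trans kN _.
Qed.

(* The layers {c + 1/(k+2) < g <= c + 1/(k+1)} with k even (resp. odd) are pairwise separated, so
   their measures are summable and {g > c} is approximated by sets separated from {g <= c}. *)
Lemma sublevel_caratheodory (c : R) : measurable ([set x | g x <= c]%R : set (arcT R)).
Proof.
apply: le_caratheodory_measurable => X /=.
set A := X `&` _; set C := X `&` _.
pose r k : R := (c + k.+1%:R^-1)%R.
have rlt m n : (m < n)%N -> (r n < r m)%R.
  by move=> mn; rewrite /r ltrD2l ltf_pV2 ?posrE// ltr_nat ltnS.
have rle m n : (m <= n)%N -> (r n <= r m)%R.
  by move=> mn; rewrite /r lerD2l lef_pV2 ?posrE// ler_nat ltnS.
pose L k := X `&` [set x | r k.+1 < g x <= r k]%R.
have parity i N : \sum_(0 <= k < N) hausdorff1 (L (k.*2 + i)%N) <= hausdorff1 X.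
  apply: le_trans (@separated_sum (fun k => L (k.*2 + i)%N) (fun k => r (k.*2 + i).+1)
    (fun k => r (k.*2 + i)%N) N _ _ _) _.
  - by move=> k x [_ /= /andP[/ltW -> ->]].
  - by move=> k; apply: rlt; rewrite doubleS.
  - by move=> k; apply: rle; rewrite ltnS leq_add2r leq_double.
  - by apply: le_hausdorff1 => x [k _ []].
have [Xoo|] := eqVneq (hausdorff1 X) +oo; first by rewrite Xoo leey.
rewrite -ltey => Xoo.
have X0 := hausdorff1_ge0 X.
have tail : \sum_(0 <= k <oo) hausdorff1 (L k) < +oo.
  apply: (@le_lt_trans _ _ (hausdorff1 X + hausdorff1 X)); last by rewrite lte_add_pinfty.
  apply: lime_le; first by apply: is_cvg_nneseries => *; exact: hausdorff1_ge0.
  apply: nearW => n; apply: (@le_trans _ _ (\sum_(0 <= k < n.*2) hausdorff1 (L k))).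
    rewrite [leRHS](@big_cat_nat _ _ _ n)//=; last by rewrite -addnn leq_addr.
    by rewrite leeDl// sume_ge0// => *; exact: hausdorff1_ge0.
  apply: le_trans (leeD (parity 0%N n) (parity 1%N n)); rewrite -big_split/=.
  elim: n => [|n IH]; first by rewrite !big_nil.
  by rewrite doubleS !big_nat_recr//= -addeA leeD// addn0 addn1.
have tl := nneseries_tail_cvg tail (fun k _ => hausdorff1_ge0 (L k)).
apply/lee_addgt0Pr => e e0.
have [N HN] : exists N, \sum_(N <= k <oo) hausdorff1 (L k) <= e%:E.
  have H : \forall N \near \oo, \sum_(N <= k <oo) hausdorff1 (L k) <= e%:E.
    apply: (cvge0P (FF := eventually_filter) _).1 tl _ e0 => N.
    by apply: nneseries_ge0 => *; exact: hausdorff1_ge0.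
  exact: filter_ex H.
pose B := X `&` [set x | r N <= g x]%R.
have CB : C `<=` B `|` \bigcup_(k in ~` `I_N) L k.
  move=> x [Xx /= /negP]; rewrite -ltNge => cx.
  have [rx|xr] := leP (r N) (g x); [by left|right].
  have ex : exists k, (r k.+1 < g x)%R.
    have [n nx] := ltr_add_invr cx; exists n; apply: lt_trans nx; exact: rlt.
  (* The least index with [r k.+1] below [g x] identifies the layer of [x]. *)
  case: (ex_minnP ex) => k kx kmin; exists k.
    move=> /= kN; move: kx; rewrite ltNge => /negP; apply.
    by apply: le_trans (ltW xr) _; exact: rle.
  split => //=; rewrite kx/=; case: k kx kmin => [|k] kx kmin.
    by apply: le_trans (ltW xr) _; exact: rle.
  by rewrite leNgt; apply/negP => /kmin; rewrite ltnn.
have HC : hausdorff1 C <= hausdorff1 B + e%:E.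
  apply: le_trans (le_hausdorff1 CB) _.
  apply: le_trans (outer_measureU2 (@hausdorff1_outer R) _ _) _.
  apply: leeD => //; apply: le_trans HN.
  exact: (outer_measure_sigma_subadditive_tail (@hausdorff1_outer R)).
apply: le_trans (leeD2l _ HC) _; rewrite addeA leeD2r//.
apply: le_trans (@hausdorff1_separated A B c (r N) _ _ _) _.
- by rewrite /r ltrDl invr_gt0.
- by move=> x [].
- by move=> x [].
- by apply: le_hausdorff1 => x [] [].
Qed.

End separated.

Lemma measurable_halfline_fst (c : R) : measurable ([set x | x.1 <= c]%R : set (arcT R)).
Proof. exact: (sublevel_caratheodory (@continuous_fst_plane R) nonexpansive_fst). Qed.

Lemma measurable_halfline_snd (c : R) : measurable ([set x | x.2 <= c]%R : set (arcT R)).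
Proof. exact: (sublevel_caratheodory (@continuous_snd_plane R) nonexpansive_snd). Qed.

Lemma arc_measurable_coordinate (f : arcT R -> R) :
  (forall c : R, measurable ([set x | f x <= c]%R : set (arcT R))) -> measurable_fun setT f.
Proof.
move=> H; apply: (measurability _ (RGenOInfty.measurableE R)) => // _ [_ [c ->] <-]; rewrite setTI.
rewrite (_ : _ @^-1` _ = ~` [set x | f x <= c]%R); first by apply: measurableC; exact: H.
by apply/seteqP; split => x /=; rewrite in_itv/= andbT; [move=> ?; apply/negP|move/negP]; rewrite -ltNge.
Qed.

Lemma arc_measurable_fst : measurable_fun (setT : set (arcT R)) (fst : arcT R -> R).
Proof. exact: arc_measurable_coordinate measurable_halfline_fst. Qed.

Lemma arc_measurable_snd : measurable_fun (setT : set (arcT R)) (snd : arcT R -> R).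
Proof. exact: arc_measurable_coordinate measurable_halfline_snd. Qed.

Lemma arc_measurable_id : measurable_fun (setT : set (arcT R)) (id : arcT R -> planeT).
Proof.
have := measurable_pair_plane arc_measurable_fst arc_measurable_snd.
by congr (measurable_fun _ _); apply/funext => -[].
Qed.

Lemma borel_arc_measurable A : measurable (A : set planeT) -> measurable (A : set (arcT R)).
Proof. by move=> mA; have := arc_measurable_id measurableT mA; rewrite setTI. Qed.

Lemma open_arc_measurable A : open A -> measurable (A : set (arcT R)).
Proof. by move=> /open_measurable_plane; exact: borel_arc_measurable. Qed.

Lemma closed_arc_measurable A : closed A -> measurable (A : set (arcT R)).
Proof. by move=> /closed_measurable_plane; exact: borel_arc_measurable. Qed.

Lemma borel_fun_arc_measurable g : measurable_fun (setT : set planeT) g ->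
  measurable_fun (setT : set (arcT R)) g.
Proof. by move=> mg; exact: (measurableT_comp mg arc_measurable_id). Qed.

Lemma continuous_arc_measurable g : continuous g -> measurable_fun (setT : set (arcT R)) g.
Proof. by move=> cg; apply: borel_fun_arc_measurable; exact: continuous_measurable_plane. Qed.

Section curve.
Variables (gamma : R -> R * R) (C : R).
Hypothesis C0 : (0 < C)%R.
Hypothesis gammaC : forall s t, (edist (gamma s) (gamma t) <= C * `|s - t|)%R.

Lemma continuous_curve : continuous gamma.
Proof.
have c (i : R * R -> R) : nonexpansive i -> continuous (i \o gamma).
  move=> ni s; apply/cvgrPdist_le => e e0; near=> t.
  apply: le_trans (ni _ _) _; apply: le_trans (gammaC s t) _.
  rewrite -ler_pdivlMl//; near: t.
  have : (0 < C^-1 * e)%R by rewrite mulr_gt0// invr_gt0.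
  by move=> e'0; apply/nbhs_ballP; exists (C^-1 * e)%R => // y /ltW.
have -> : gamma = (fun t => ((fst \o gamma) t, (snd \o gamma) t)).
  by apply/funext => t /=; case: (gamma t).
by apply: continuous_pair; apply: c; [exact: nonexpansive_fst|exact: nonexpansive_snd].
Unshelve. all: by end_near. Qed.

(** The interval is cut into [n] equal pieces whose images have diameter at most [delta]; whatever
    [n] is, the diameters add up to at most [C * (t - s)]. *)
Lemma hausdorff1_curve_itv s t : (s <= t)%R ->
  hausdorff1 (gamma @` `]s, t]) <= (C * (t - s))%:E.
Proof.
move=> st; apply: ge_ereal_sup => _ [delta /= d0 <-].
have [n [n0 Hn]] : exists n : nat, (0 < n)%N /\ (C * (t - s) / n%:R <= delta)%R.
  exists (Num.truncn (delta^-1 * (C * (t - s)))).+1; split => //.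
  by rewrite ler_pdivrMr// -ler_pdivrMl// ltW//; exact: truncnS_gt.
pose h := ((t - s) / n%:R)%R.
have h0 : (0 <= h)%R by rewrite divr_ge0// subr_ge0.
have nh : (n%:R * h = t - s)%R by rewrite /h mulrCA mulfV ?mulr1// pnatr_eq0 -lt0n.
pose F k := if (k < n)%N then gamma @` `[(s + k%:R * h)%R, (s + k.+1%:R * h)%R] else set0.
have mF k : measurable (F k : set planeT).
  rewrite /F; case: ifP => _; last exact: measurable0.
  apply: closed_measurable_plane; apply: compact_closed; first exact: plane_hausdorff.
  by apply: continuous_compact; [exact/continuous_subspaceT/continuous_curve|exact: segment_compact].
have cF : measurable_cover (gamma @` `]s, t]) F.
  split=> // x [a]; rewrite /= in_itv/= => /andP[sa at_] <-.
  have hp : (0 < h)%R by rewrite divr_gt0 ?ltr0n// subr_gt0 (lt_le_trans sa).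
  have tE : (t = s + n%:R * h)%R by rewrite nh addrC subrK.
  have ex : exists k, (a <= s + k.+1%:R * h)%R.
    by exists n.-1; rewrite prednK// -tE.
  case: (ex_minnP ex) => k ak kmin; exists k => //.
  have kn : (k < n)%N by rewrite -(prednK n0) ltnS kmin// prednK// -tE.
  rewrite /F kn; exists a => //=; rewrite in_itv/= ak andbT.
  case: k ak kmin kn => [|k] ak kmin kn; first by rewrite mul0r addr0 ltW.
  by rewrite leNgt; apply/negP => /ltW /kmin; rewrite ltnn.
apply: (@le_trans _ _ (\sum_(0 <= k <oo) small_diam delta (F k))).
  by apply: ereal_inf_lbound; exists F.
have dF k : small_diam delta (F k) <= if (k < n)%N then (C * h)%:E else 0.
  rewrite /F; case: ifP => _; last by rewrite small_diam0.
  have dle : diam (gamma @` `[(s + k%:R * h)%R, (s + k.+1%:R * h)%R]) <= (C * h)%:E.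
    apply: diam_le; first by rewrite mulr_ge0// ltW.
    move=> _ _ [a + <-] [b + <-]; rewrite /= !in_itv/= => /andP[a1 a2] /andP[b1 b2].
    apply: le_trans (gammaC a b) _; rewrite ler_pM2l// ler_norml.
    by move: a2 b2; rewrite -natr1 => a2 b2; apply/andP; split; lra.
  by rewrite /small_diam (le_trans dle) ?lee_fin// /h mulrA.
have part N : \sum_(0 <= k < N) small_diam delta (F k) <= ((minn N n)%:R * (C * h))%:E.
  elim: N => [|N IH]; first by rewrite big_nil lee_fin min0n mul0r.
  rewrite big_nat_recr//=; apply: le_trans (leeD IH (dF N)) _.
  case: (ltnP N n) => [Nn|nN]; last by rewrite adde0 lee_fin (minn_idPr (leqW nN)).
  by rewrite (minn_idPl Nn) -EFinD lee_fin -natr1 mulrDl mul1r.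
apply: lime_le; first by apply: is_cvg_nneseries => *; exact: small_diam_ge0.
apply: nearW => N; apply: le_trans (part N) _; rewrite lee_fin.
apply: (@le_trans _ _ (n%:R * (C * h))%R).
  by apply: ler_wpM2r; [rewrite mulr_ge0// ltW|rewrite ler_nat geq_minr].
by rewrite mulrCA nh.
Qed.

(** Lebesgue measure is by definition an infimum over countable covers by half-open intervals; the
    image of such a cover is estimated interval by interval, whatever [B] is. *)
Lemma hausdorff1_curve (B : set R) : hausdorff1 (gamma @` B) <= C%:E * lebesgue_measure B.
Proof.
rewrite -lee_pdivrMl//.
apply: le_ereal_inf_tmp => _ [F [mF BF] <-].
rewrite lee_pdivrMl// -nneseriesZl; last first.
  by move=> k _; have [ab _ <-] := mF k; apply: wlength_itv_ge0 => x y.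
apply: (@le_trans _ _ (\sum_(0 <= k <oo) hausdorff1 (gamma @` F k))).
  apply: le_trans (outer_measure_sigma_subadditive (@hausdorff1_outer R) _).
  apply: le_hausdorff1 => _ [a /BF [k _ Fa] <-]; exists k => //; by exists a.
apply: lee_nneseries => [k _ _|k _]; first exact: hausdorff1_ge0.
have [[a b]/= _ <-] := mF k; have [ab|ba] := leP a b.
  by rewrite wlength_itv_bnd// -EFinM; exact: hausdorff1_curve_itv.
rewrite set_itv_ge ?image_set0 ?hausdorff1_set0; last by rewrite bnd_simp -leNgt ltW.
by rewrite wlength0 mule0.
Qed.

End curve.
End Hausdorff.
(** * Charts of a Lipschitz boundary *)

Lemma compact_cover_seq (R : realType) (T : normedModType R) (A : set T) (U : T -> set T) : compact A ->
  (forall x, A x -> nbhs x (U x)) ->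
  exists s : seq T, (forall x, x \in s -> A x) /\ forall y, A y -> exists2 x, x \in s & U x y.
Proof.
rewrite compact_cover => cA AU.
have [D DA AD] := cA T A (fun x => interior (U x)) (fun x _ => @open_interior _ _)
  (fun x Ax => ex_intro2 _ _ x Ax (AU x Ax)).
exists (finmap.enum_fset D); split=> [x xD|y /AD [x /= xD Uxy]]; first by have := DA x xD; rewrite inE.
by exists x => //; exact: interior_subset Uxy.
Qed.

Section Charts.
Context {R : realType}.
Local Notation planeT := (@planeT R).
Local Notation edist := (@Defs.edist R).
Variable O : @bounded_domain R.
Local Notation Omega := (dom O).
Local Notation Gamma := (boundary (dom O)).
Implicit Types (p x y : R * R).

Definition coord1 p (c s : R) x : R := (x.1 - p.1) * c + (x.2 - p.2) * s.
Definition coord2 p (c s : R) x : R := (x.2 - p.2) * c - (x.1 - p.1) * s.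

(** Unlike [lipschitz_boundary], the window is measured by the height over the graph and not by the
    second coordinate, so that in straightened coordinates it is a rectangle. *)
Record chart := Chart {
  ch_p : R * R; ch_c : R; ch_s : R; ch_rho : R; ch_tau : R; ch_L : R; ch_f : R -> R;
  ch_cs : ch_c ^+ 2 + ch_s ^+ 2 = 1;
  ch_rho0 : 0 < ch_rho; ch_tau0 : 0 < ch_tau; ch_L0 : 0 <= ch_L;
  ch_lip : forall s t, `|ch_f s - ch_f t| <= ch_L * `|s - t|;
  ch_dom : forall x, `|coord1 ch_p ch_c ch_s x| < ch_rho ->
    `|coord2 ch_p ch_c ch_s x - ch_f (coord1 ch_p ch_c ch_s x)| < ch_tau ->
    (Omega x <-> 0 < coord2 ch_p ch_c ch_s x - ch_f (coord1 ch_p ch_c ch_s x)) }.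

Lemma continuous_coord1 p c s : continuous (coord1 p c s).
Proof.
move=> x; apply: cvgD; (apply: cvgM; last exact: cvg_cst); (apply: cvgB; last exact: cvg_cst).
  exact: continuous_fst_plane.
exact: continuous_snd_plane.
Qed.

Lemma continuous_coord2 p c s : continuous (coord2 p c s).
Proof.
move=> x; apply: cvgB; (apply: cvgM; last exact: cvg_cst); (apply: cvgB; last exact: cvg_cst).
  exact: continuous_snd_plane.
exact: continuous_fst_plane.
Qed.

Lemma lipschitz_continuous (f : R -> R) (L : R) : 0 <= L -> (forall s t, `|f s - f t| <= L * `|s - t|) -> continuous f.
Proof.
move=> L0 fL s; apply/cvgrPdist_le => e e0.
have L1 : 0 < L + 1 by rewrite ltr_wpDl.
have d0 : 0 < e / (L + 1) by rewrite divr_gt0.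
apply/nbhs_ballP; exists (e / (L + 1)) => //= t /ltW /= st.
apply: le_trans (fL s t) _; apply: (@le_trans _ _ ((L + 1) * `|s - t|)).
  by rewrite ler_wpM2r// lerDl.
by rewrite mulrC -ler_pdivlMr.
Qed.

Lemma open_norm_lt (r : R) : open [set t : R | `|t| < r].
Proof.
have : open ((@Num.norm R R) @^-1` [set t : R | t < r]); last by [].
by apply: open_comp => [t _|]; [exact: norm_continuous|exact: open_lt].
Qed.

Section one_chart.
Variable K : chart.
Local Notation c := (ch_c K).
Local Notation s := (ch_s K).
Local Notation f := (ch_f K).
Local Notation p := (ch_p K).

(** Straightened coordinates: [ch_a] is the abscissa in the rotated frame, [ch_b] the signed height
    over the graph, and [ch_param] the inverse map. *)
Definition ch_a x : R := coord1 p c s x.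
Definition ch_b x : R := coord2 p c s x - f (ch_a x).
Definition ch_param (q : planeT) : planeT :=
  (p.1 + (q.1 * c - (q.2 + f q.1) * s), p.2 + (q.1 * s + (q.2 + f q.1) * c)).
Definition tube (tau : R) : set (R * R) := [set x | `|ch_a x| < ch_rho K /\ `|ch_b x| < tau].

Let cs := ch_cs K.

Lemma ch_a_param q : ch_a (ch_param q) = q.1.
Proof. by rewrite /ch_a /coord1 /ch_param/= -[RHS]mulr1 -cs; ring. Qed.

Lemma ch_b_param q : ch_b (ch_param q) = q.2.
Proof.
rewrite /ch_b ch_a_param /coord2 /ch_param/=.
have -> : (p.2 + (q.1 * s + (q.2 + f q.1) * c) - p.2) * c - (p.1 + (q.1 * c - (q.2 + f q.1) * s) - p.1) * s =
  (q.2 + f q.1) * (c ^+ 2 + s ^+ 2) by ring.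
by rewrite cs mulr1 addrK.
Qed.

Lemma ch_paramK x : ch_param (ch_a x, ch_b x) = x.
Proof.
rewrite /ch_param/= /ch_b subrK /ch_a /coord1 /coord2.
have E (u v : R) : u * (c ^+ 2 + s ^+ 2) = u by rewrite cs mulr1.
case: x => x1 x2 /=; congr (_, _); apply/eqP; rewrite eq_sym addrC -subr_eq; apply/eqP.
  by rewrite -[LHS](E _ 0); ring.
by rewrite -[LHS](E _ 0); ring.
Qed.

Lemma continuous_ch_f : continuous f.
Proof. exact: lipschitz_continuous (ch_L0 K) (@ch_lip K). Qed.

Lemma continuous_ch_a : continuous ch_a.
Proof. exact: continuous_coord1. Qed.

Lemma continuous_ch_b : continuous ch_b.
Proof.
move=> x; apply: cvgB; first exact: continuous_coord2.
by apply: (@continuous_comp _ _ _ ch_a f); [exact: continuous_ch_a|exact: continuous_ch_f].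
Qed.

Lemma open_tube tau : open (tube tau).
Proof.
apply: openI.
  apply: (@open_comp _ _ ch_a [set t | `|t| < ch_rho K]) => [x _|]; first exact: continuous_ch_a.
  exact: open_norm_lt.
apply: (@open_comp _ _ ch_b [set t | `|t| < tau]) => [x _|]; first exact: continuous_ch_b.
exact: open_norm_lt.
Qed.

(** A shear by the graph function followed by a rotation and a translation. *)
Lemma area_preserving_param : area_preserving ch_param.
Proof.
rewrite (_ : ch_param = (fun q : planeT => (q.1 + p.1, q.2 + p.2)) \o (rot c s \o shear f)).
  apply: (area_preserving_comp (area_preserving_translation p)).
  apply: (area_preserving_comp (area_preserving_rot cs)); apply: area_preserving_shear.
  exact: continuous_measurable_fun continuous_ch_f.
by apply/funext => q; rewrite /= /ch_param /rot /shear/= addrC [X in (_, X)]addrC.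
Qed.

Lemma tube_dom x : tube (ch_tau K) x -> Omega x <-> 0 < ch_b x.
Proof. by move=> [h1 h2]; exact: ch_dom. Qed.

Lemma continuous_param_snd a : continuous (fun b => ch_param (a, b)).
Proof.
rewrite /ch_param/=; apply: continuous_pair => b; (apply: cvgD; first exact: cvg_cst).
  apply: cvgB; first exact: cvg_cst.
  by apply: cvgM; [apply: cvgD; [exact: cvg_id|exact: cvg_cst]|exact: cvg_cst].
apply: cvgD; first exact: cvg_cst.
by apply: cvgM; [apply: cvgD; [exact: cvg_id|exact: cvg_cst]|exact: cvg_cst].
Qed.

(** Points under the graph have a neighbourhood outside the domain, points over it are interior; a
    point on the graph is a limit of points lifted by [e / 2]. *)
Lemma tube_boundary x : tube (ch_tau K) x -> Gamma x <-> ch_b x = 0.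
Proof.
move=> xT; have nx : nbhs x (tube (ch_tau K)) by apply: open_nbhs_nbhs; split => //; exact: open_tube.
rewrite /boundary ((interior_id Omega).1 (@dom_open _ O)).
split=> [[cx nOx]|b0].
  have := contra_not (tube_dom xT).2 nOx => /negP.
  rewrite -leNgt le_eqVlt => /predU1P[//|b0]; exfalso.
  have nb : nbhs x [set y | ch_b y < 0].
    apply: open_nbhs_nbhs; split => //; apply: (@open_comp _ _ ch_b [set t | t < 0]) => [y _|].
      exact: continuous_ch_b.
    exact: open_lt.
  have [y [Oy [yT /= yb]]] := cx _ (filterI nx nb).
  by have := (tube_dom yT).1 Oy; rewrite ltNge ltW.
split; last by move=> /(tube_dom xT); rewrite b0 ltxx.
move=> U xU; have x0 : ch_param (ch_a x, 0) = x by rewrite -b0 ch_paramK.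
have := @continuous_param_snd (ch_a x) 0; rewrite /continuous_at x0 => /(_ _ (filterI nx xU)).
move=> /nbhs_ballP [e /= e0 eU].
have [yT yU] : (tube (ch_tau K) `&` U) (ch_param (ch_a x, e / 2)).
  apply: (eU (e / 2)); rewrite /ball/= sub0r normrN gtr0_norm ?divr_gt0//.
  by rewrite ltr_pdivrMr// ltr_pMr// ltr1n.
exists (ch_param (ch_a x, e / 2)); split => //.
by apply/(tube_dom yT); rewrite ch_b_param divr_gt0.
Qed.

Definition curve (a : R) := ch_param (a, 0).

(** The rotation is an isometry, and the square root of [1 + L ^+ 2] is at most [1 + L]. *)
Lemma curve_lipschitz a b : edist (curve a) (curve b) <= (1 + ch_L K) * `|a - b|.
Proof.
have L0 := ch_L0 K.
rewrite -[leRHS]ger0_norm ?mulr_ge0 ?addr_ge0// -sqrtr_sqr; apply: ler_wsqrtr.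
rewrite /curve /ch_param/= !add0r.
have -> : (p.1 + (a * c - f a * s) - (p.1 + (b * c - f b * s))) ^+ 2 +
    (p.2 + (a * s + f a * c) - (p.2 + (b * s + f b * c))) ^+ 2 =
  ((a - b) ^+ 2 + (f a - f b) ^+ 2) * (c ^+ 2 + s ^+ 2) by ring.
rewrite cs mulr1; have H := @ch_lip K a b.
have H2 : (f a - f b) ^+ 2 <= (ch_L K * `|a - b|) ^+ 2 by rewrite -real_normK ?num_real// lerXn2r// nnegrE ?mulr_ge0.
apply: le_trans (lerD (lexx _) H2) _; rewrite exprMn exprMn real_normK ?num_real//.
by have := sqr_ge0 (a - b); nra.
Qed.

Lemma tube_boundary_curve x : tube (ch_tau K) x -> Gamma x -> x = curve (ch_a x).
Proof. by move=> xT /(tube_boundary xT) b0; rewrite /curve -b0 ch_paramK. Qed.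

(* The displacement [- (t + w)] along the axis of the chart stays above the graph. *)
Lemma tube_cone : exists2 kappa : R, 0 < kappa & exists2 t0 : R, 0 < t0 & forall (t : R) x y, 0 < t -> t <= t0 ->
  Omega x -> `|ch_a x| < ch_rho K / 2 -> `|ch_b x| < ch_tau K / 2 ->
  csq (x.1 - t * s, x.2 + t * c) (kappa * t) y -> Omega y.
Proof.
have [[L0 rho0] tau0] := (ch_L0 K, ch_rho0 K, ch_tau0 K).
have [c1 s1] : `|c| <= 1 /\ `|s| <= 1.
  by split; rewrite -(@ler_pXn2r _ 2)// ?nnegrE// expr1n real_normK ?num_real// -cs ?lerDl ?lerDr sqr_ge0.
(* A perturbation of size [k * t] in each coordinate shifts the rotated ones by at most
   [2 * (k * t)]; with the resulting change of the graph, the height is disturbed by at most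
   [t / 2], half of the lift. *)
pose k : R := (4 * (1 + ch_L K))^-1.
have k0 : 0 < k by rewrite invr_gt0 mulr_gt0// ltr_wpDr.
have k4 : 4 * (1 + ch_L K) * k = 1 by rewrite mulfV// gt_eqF// mulr_gt0// ltr_wpDr.
have k1 : k <= 1 / 4 by have := mulr_ge0 L0 (ltW k0); move: k4; lra.
exists k => //; exists (Num.min (ch_rho K / 2) (ch_tau K / 4)).
  by rewrite lt_min !divr_gt0.
move=> t x y t_gt0; rewrite le_min => /andP[t1 t2] Ox xa xb [y1 y2].
have xT : tube (ch_tau K) x by split; lra.
have b0 := (tube_dom xT).1 Ox.
pose w1 := y.1 - (x.1 - t * s); pose w2 := y.2 - (x.2 + t * c).
have aE : ch_a y = ch_a x + (w1 * c + w2 * s).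
  by rewrite /ch_a /coord1 /w1 /w2; ring.
have cE : coord2 p c s y = coord2 p c s x + t + (w2 * c - w1 * s).
  by rewrite -[X in _ + X + _]mulr1 -cs /coord2 /w1 /w2; ring.
have b1 : `|w1 * c + w2 * s| <= 2 * (k * t).
  apply: le_trans (ler_normD _ _) _; rewrite (_ : 2 * (k * t) = k * t + k * t); last by ring.
  by rewrite lerD// normrM -[leRHS]mulr1 ler_pM.
have b2 : `|w2 * c - w1 * s| <= 2 * (k * t).
  apply: le_trans (ler_normB _ _) _; rewrite (_ : 2 * (k * t) = k * t + k * t); last by ring.
  by rewrite lerD// normrM -[leRHS]mulr1 ler_pM.
have H := @ch_lip K (ch_a y) (ch_a x).
have H2 : `|f (ch_a y) - f (ch_a x)| <= ch_L K * (2 * (k * t)).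
  by apply: le_trans H _; rewrite ler_wpM2l// aE addrC addKr.
have kt : 4 * (k * t) + 4 * (ch_L K * (k * t)) = t.
  have -> : 4 * (k * t) + 4 * (ch_L K * (k * t)) = 4 * (1 + ch_L K) * k * t by ring.
  by rewrite k4 mul1r.
have kt0 : 0 < k * t by rewrite mulr_gt0.
have Lkt0 : 0 <= ch_L K * (k * t) by rewrite mulr_ge0// ltW.
have bE : ch_b y - ch_b x - t = (w2 * c - w1 * s) - (f (ch_a y) - f (ch_a x)).
  by rewrite /ch_b cE; ring.
have bt : `|ch_b y - ch_b x - t| <= t / 2.
  rewrite bE; apply: le_trans (ler_normB _ _) _; apply: le_trans (lerD b2 H2) _; lra.
move: xa xb b1 bt; rewrite !ltr_norml !ler_norml => /andP[xa1 xa2] /andP[xb1 xb2] /andP[b11 b12] /andP[bt1 bt2].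
have yT : tube (ch_tau K) y.
  by split; rewrite /= ltr_norml; apply/andP; split; rewrite ?aE; lra.
by apply/(tube_dom yT); lra.
Qed.

End one_chart.

(** The graph passes through the centre because [q] is a boundary point. Shrinking the base keeps
    the graph in the lower half of the window, so that heights up to [h / 2] over it stay inside. *)
Lemma exists_chart : lipschitz_boundary Omega -> forall q, Gamma q ->
  exists K : chart, tube K (ch_tau K / 2) q /\ `|ch_a K q| < ch_rho K / 2.
Proof.
move=> HL q Gq; have [c [s [r [h [f [cs r0 h0 fL fO]]]]]] := HL q Gq.
have [L L0 {}fL] : exists2 L : R, 0 <= L & forall s t : R, `|f s - f t| <= L * `|s - t|.
  have [M [_ HM]] := fL; exists (`|M| + 1); first by rewrite addr_ge0.
  move=> s1 s2; apply: (HM _ _ (s1, s2)) => //.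
  by apply: le_lt_trans (ler_norm M) _; rewrite ltrDl.
have q0 : coord1 q c s q = 0 /\ coord2 q c s q = 0.
  by rewrite /coord1 /coord2 !subrr !mul0r addr0 subr0.
have invc x : (q.1 + coord1 q c s x * c - coord2 q c s x * s, q.2 + coord1 q c s x * s + coord2 q c s x * c) = x.
  rewrite /coord1 /coord2; case: x => x1 x2 /=.
  have -> : q.1 + ((x1 - q.1) * c + (x2 - q.2) * s) * c - ((x2 - q.2) * c - (x1 - q.1) * s) * s =
    q.1 + (x1 - q.1) * (c ^+ 2 + s ^+ 2) by ring.
  have -> : q.2 + ((x1 - q.1) * c + (x2 - q.2) * s) * s + ((x2 - q.2) * c - (x1 - q.1) * s) * c =
    q.2 + (x2 - q.2) * (c ^+ 2 + s ^+ 2) by ring.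
  by rewrite cs !mulr1 ![_ + (_ - _)]addrC !subrK.
have OE x : `|coord1 q c s x| < r -> `|coord2 q c s x| < h -> Omega x <-> f (coord1 q c s x) < coord2 q c s x.
  by move=> h1 h2; have := fO _ _ h1 h2; rewrite invc.
have [cq nOq] : closure Omega q /\ ~ Omega q.
  by have [h1 h2] := Gq; split => // Oq; apply: h2; rewrite /= ((interior_id Omega).1 (@dom_open _ O)).
(* If [f 0] were negative, [q] would lie in the domain; if positive, a whole neighbourhood of [q]
   would miss it. *)
have f0 : f 0 = 0.
  have [f0|f0|//] := ltgtP (f 0) 0.
    by exfalso; apply: nOq; apply/OE; rewrite ?q0.1 ?q0.2 ?normr0.
  exfalso.
  have o1 : nbhs q [set x | `|coord1 q c s x| < r].
    apply: open_nbhs_nbhs; split; last by rewrite /= q0.1 normr0.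
    apply: (@open_comp _ _ (coord1 q c s) [set t | `|t| < r]) => [x _|]; [exact: continuous_coord1|exact: open_norm_lt].
  have o2 : nbhs q [set x | `|coord2 q c s x| < h].
    apply: open_nbhs_nbhs; split; last by rewrite /= q0.2 normr0.
    apply: (@open_comp _ _ (coord2 q c s) [set t | `|t| < h]) => [x _|]; [exact: continuous_coord2|exact: open_norm_lt].
  have o3 : nbhs q [set x | coord2 q c s x - f (coord1 q c s x) < 0].
    apply: open_nbhs_nbhs; split; last by rewrite /= q0.1 q0.2 sub0r oppr_lt0.
    apply: (@open_comp _ _ (fun x => coord2 q c s x - f (coord1 q c s x)) [set t | t < 0]) => [x _|]; last exact: open_lt.
    apply: cvgB; first exact: continuous_coord2.
    by apply: (@continuous_comp _ _ _ (coord1 q c s) f); [exact: continuous_coord1|exact: (lipschitz_continuous L0 fL)].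
  have [x [Ox [[x1 x2] /= x3]]] := cq _ (filterI (filterI o1 o2) o3).
  by have := (OE x x1 x2).1 Ox; rewrite ltNge => /negP; apply; move: x3; rewrite subr_lt0 => /ltW.
(* On this base the Lipschitz bound keeps the absolute value of the graph function at most
   [h / 2]. *)
pose rho := Num.min r (h / (2 * (L + 1))).
have L1 : 0 < L + 1 by rewrite ltr_wpDl.
have rho0 : 0 < rho by rewrite lt_min r0/= divr_gt0// mulr_gt0.
have rhoL : L * rho <= h / 2.
  apply: (@le_trans _ _ ((L + 1) * rho)); first by rewrite ler_wpM2r ?ltW// ltrDl.
  rewrite mulrC -ler_pdivlMr//; apply: (@le_trans _ _ (h / (2 * (L + 1)))); first by rewrite ge_min lexx orbT.
  by rewrite invfM mulrA.
have h20 : 0 < h / 2 by rewrite divr_gt0.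
have dom x : `|coord1 q c s x| < rho -> `|coord2 q c s x - f (coord1 q c s x)| < h / 2 ->
    (Omega x <-> 0 < coord2 q c s x - f (coord1 q c s x)).
  move=> x1 x2; rewrite subr_gt0; apply: OE; first by apply: lt_le_trans x1 _; rewrite ge_min lexx.
  have fx : `|f (coord1 q c s x)| <= h / 2.
    have := fL (coord1 q c s x) 0; rewrite f0 !subr0 => H; apply: le_trans H _; apply: le_trans rhoL.
    by rewrite ler_wpM2l// ltW.
  by move: x2 fx; rewrite !ltr_norml !ler_norml => /andP[? ?] /andP[? ?]; apply/andP; split; lra.
exists (Chart cs rho0 h20 L0 fL dom); rewrite /tube /ch_b /ch_a /=.
by rewrite q0.1 q0.2 f0 subrr normr0; split; [split => //|]; rewrite divr_gt0.
Qed.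

End Charts.

(** * Calculus along lines *)

Section Calculus.
Context {R : realType}.
Local Notation leb := (@lebesgue_measure R).
Implicit Types (q v : R * R) (phi : R * R -> R).

Lemma mean_value (g dg : R -> R) s t : (forall t, is_derive t (1 : R) g (dg t)) ->
  exists2 x, `|x - t| <= `|s - t| & g s - g t = dg x * (s - t).
Proof.
move=> gd; have cg (a b : R) : {within `[a, b], continuous g}.
  apply: continuous_subspaceT => z; apply: differentiable_continuous.
  by apply/derivable1_diffP; have [] := gd z.
have [st|ts] := leP s t.
  have [x] := @MVT_segment _ g dg s t st (fun t0 _ => gd t0) (cg _ _).
  rewrite in_itv/= => /andP[sx xt] E; exists x; last by rewrite -opprB E -mulrN opprB.
  by rewrite !(distrC _ t) !ger0_norm ?subr_ge0// lerD2l lerN2.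
have [x] := @MVT_segment _ g dg t s (ltW ts) (fun t0 _ => gd t0) (cg _ _).
rewrite in_itv/= => /andP[tx xs] E; exists x => //.
by rewrite !ger0_norm ?subr_ge0 ?(ltW ts)// lerD2r.
Qed.

Lemma is_derive_approx (F : R -> R) (t d : R) :
  (forall eps : R, 0 < eps -> exists2 delta : R, 0 < delta &
     forall h, `|h| < delta -> `|F (t + h) - F t - h * d| <= eps * `|h|) ->
  is_derive t (1 : R) F d.
Proof.
move=> H; have cv : h^-1 *: ((F \o shift t) (h *: (1 : R)) - F t) @[h --> 0^'] --> d.
  apply/cvgrPdist_le => eps eps0; have [delta d0 Hd] := H _ eps0.
  apply/nbhs_ballP; exists delta => //= h; rewrite /ball/= sub0r normrN => hd h0.
  rewrite /shift/= /GRing.scale/= mulr1 (addrC h t).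
  have -> : d - h^-1 * (F (t + h) - F t) = - (h^-1 * (F (t + h) - F t - h * d)) by field.
  by rewrite normrN normrM normfV ler_pdivrMl ?normr_gt0// [leRHS]mulrC; exact: Hd.
split; first by apply/cvg_ex; exists d.
by apply: cvg_lim.
Qed.

(** The increment is decomposed into two steps parallel to the axes; the mean value theorem and the
    continuity of the partial derivatives treat each. *)
Lemma is_derive_line phi q v (t : R) : smooth phi ->
  is_derive t (1 : R) (fun t => phi (q.1 + t * v.1, q.2 + t * v.2))
    (v.1 * 'D_e1 phi (q.1 + t * v.1, q.2 + t * v.2) + v.2 * 'D_e2 phi (q.1 + t * v.1, q.2 + t * v.2)).
Proof.
move=> sphi; apply: is_derive_approx => eps eps0.
set x1 := q.1 + _; set x2 := q.2 + _.
pose e' := eps / (`|v.1| + `|v.2| + 1).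
have v0 : 0 < `|v.1| + `|v.2| + 1 by rewrite ltr_wpDl// addr_ge0.
have e'0 : 0 < e' by rewrite divr_gt0.
have c1 := smooth_continuous (smooth_D1 sphi); have c2 := smooth_continuous (smooth_D2 sphi).
have n1 : \forall y \near ((x1, x2) : R * R), `|'D_e1 phi (x1, x2) - 'D_e1 phi y| <= e'.
  by move/cvgrPdist_le: (c1 (x1, x2)) => /(_ _ e'0).
have n2 : \forall y \near ((x1, x2) : R * R), `|'D_e2 phi (x1, x2) - 'D_e2 phi y| <= e'.
  by move/cvgrPdist_le: (c2 (x1, x2)) => /(_ _ e'0).
have [d d0 dH] := nbhs_csq (filterI n1 n2).
exists (d / (`|v.1| + `|v.2| + 1)) => [|h hd]; first by rewrite divr_gt0.
have hd1 : `|h| * (`|v.1| + `|v.2| + 1) < d by rewrite -ltr_pdivlMr.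
have h1 : `|h * v.1| <= d.
  by rewrite normrM (le_trans _ (ltW hd1))// ler_wpM2l// -addrA lerDl addr_ge0.
have h2 : `|h * v.2| <= d.
  by rewrite normrM (le_trans _ (ltW hd1))// ler_wpM2l// addrAC lerDr addr_ge0.
have -> : q.1 + (t + h) * v.1 = x1 + h * v.1 by rewrite /x1; ring.
have -> : q.2 + (t + h) * v.2 = x2 + h * v.2 by rewrite /x2; ring.
have [y1 y1x E1] := mean_value (x1 + h * v.1) x1 (fun s => is_derive_fst s (x2 + h * v.2) sphi).
have [y2 y2x E2] := mean_value (x2 + h * v.2) x2 (fun s => is_derive_snd x1 s sphi).
have -> : phi (x1 + h * v.1, x2 + h * v.2) - phi (x1, x2) =
   (phi (x1 + h * v.1, x2 + h * v.2) - phi (x1, x2 + h * v.2)) + (phi (x1, x2 + h * v.2) - phi (x1, x2)).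
  by rewrite addrA subrK.
have add0 (a b : R) : a + b - a = b by rewrite addrC addKr.
rewrite E1 E2 !add0; rewrite add0 in y1x; rewrite add0 in y2x.
have B1 := (dH (y1, x2 + h * v.2) _).1; have B2 := (dH (x1, y2) _).2.
have {}B1 : `|'D_e1 phi (x1, x2) - 'D_e1 phi (y1, x2 + h * v.2)| <= e'.
  by apply: B1; split; rewrite /= ?add0// (le_trans y1x).
have {}B2 : `|'D_e2 phi (x1, x2) - 'D_e2 phi (x1, y2)| <= e'.
  apply: B2; split; first by rewrite /= subrr normr0 ltW.
  exact: le_trans y2x h2.
have -> : 'D_e1 phi (y1, x2 + h * v.2) * (h * v.1) + 'D_e2 phi (x1, y2) * (h * v.2) -
    h * (v.1 * 'D_e1 phi (x1, x2) + v.2 * 'D_e2 phi (x1, x2)) =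
  - (h * (v.1 * ('D_e1 phi (x1, x2) - 'D_e1 phi (y1, x2 + h * v.2)) +
          v.2 * ('D_e2 phi (x1, x2) - 'D_e2 phi (x1, y2)))) by ring.
rewrite normrN normrM mulrC ler_wpM2r//; apply: le_trans (ler_normD _ _) _; rewrite !normrM.
apply: (@le_trans _ _ (`|v.1| * e' + `|v.2| * e')); first by rewrite lerD// ler_wpM2l.
by rewrite -mulrDl /e' mulrCA ler_piMr ?(ltW eps0)// ler_pdivrMr// mul1r lerDl.
Qed.

(** The fundamental theorem of calculus, then Cauchy-Schwarz against the constant 1. *)
Lemma sq_increment_le (F F' : R -> R) (a b : R) : a < b -> (forall t, is_derive t (1 : R) F (F' t)) ->
  continuous F' ->
  (((F b - F a) ^+ 2)%:E <= (b - a)%:E * \int[leb]_(t in `]a, b[) (F' t ^+ 2)%:E)%E.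
Proof.
move=> ab dF cF'.
have mI : measurable (`[a, b]%classic : set (measurableTypeR R)) by exact: measurable_itv.
have mF' : measurable_fun (setT : set (measurableTypeR R)) F' by exact: continuous_measurable_fun.
have lI : leb `[a, b]%classic = (b - a)%:E by rewrite lebesgue_measure_itv/= lte_fin ab -EFinB.
have Ioo : (leb `[a, b]%classic < +oo)%E by rewrite lI ltry.
have cF : continuous F.
  by move=> z; apply: differentiable_continuous; apply/derivable1_diffP; have [] := dF z.
have ftc : (\int[leb]_(x in `[a, b]) (F' x)%:E = (F b)%:E - (F a)%:E)%E.
  apply: continuous_FTC2 => //.
  - exact: continuous_subspaceT.
  - split=> [x _||]; first by have [] := dF x.
      exact: cvg_at_right_filter (cF a).
    exact: cvg_at_left_filter (cF b).
  - by move=> x _; rewrite derive1E; have [_ ->] := dF x.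
have [M MF] : exists M, forall x, `[a, b]%classic x -> `|F' x| <= M.
  have := @continuous_compact _ _ F' `[a, b]%classic (continuous_subspaceT cF') (@segment_compact _ a b).
  move=> /compact_bounded [M [_ HM]]; exists (M + 1) => x xI.
  by apply: (HM (M + 1)); [rewrite ltrDl|exists x].
have FL : L2 leb `[a, b] F'.
  by apply: (L2_bounded mI Ioo) (MF); apply: (measurable_funS measurableT).
have OL := L2_cst 1 mI Ioo.
have := ip_CS mI FL OL.
have -> : ip leb `[a, b] F' (fun=> 1) = F b - F a.
  by rewrite /ip; under eq_Rintegral do rewrite mulr1; rewrite /Rintegral ftc.
have -> : ip leb `[a, b] (fun=> 1) (fun=> 1) = b - a.
  rewrite /ip /Rintegral; under eq_integral do rewrite mulr1.
  rewrite (integral_cst _ mI) mul1e.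
  by rewrite [X in fine X](_ : _ = (b - a)%:E).
rewrite -lee_fin => /le_trans; apply.
rewrite mulrC EFinM lee_wpmul2l// ?lee_fin ?subr_ge0 ?(ltW ab)//.
rewrite -sqint_ip// /sqint le_eqVlt; apply/orP; left; apply/eqP.
rewrite integral_itv_bndo_bndc; last first.
  by apply: measurable_sq; apply: (measurable_funS measurableT).
rewrite integral_itv_obnd_cbnd//.
by apply: measurable_sq; apply: (measurable_funS measurableT).
Qed.

End Calculus.

(** * Comparison and transfer of integrals *)

Section CompareMeasures.
Context d {T : measurableType d} {R : realType}.
Local Open Scope ereal_scope.
Import HBNNSimple.

Lemma ge0_le_measure_integral (m1 m2 : {measure set T -> \bar R}) (f : T -> \bar R) :
  (forall B, measurable B -> m1 B <= m2 B) -> (forall x, 0 <= f x) ->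
  \int[m1]_x f x <= \int[m2]_x f x.
Proof.
move=> mm f0; rewrite !ge0_integralTE//.
apply: ge_ereal_sup => _ [h hf <-].
apply: (@le_trans _ _ (sintegral m2 h)); last by apply: ereal_sup_ubound; exists h.
rewrite !sintegralE; apply: lee_fsum => //= r _.
have [r0|r0] := leP 0%R r; first by rewrite lee_wpmul2l ?lee_fin// mm.
by rewrite preimage_nnfun0// !measure0 !mule0.
Qed.

Lemma ge0_integral_mrestr_ge (m : {measure set T -> \bar R}) (D : set T) (mD : measurable D)
  (f : T -> \bar R) : (forall x, 0 <= f x) ->
  \int[m]_(x in D) f x <= \int[mrestr m mD]_x f x.
Proof.
move=> f0; rewrite integral_mkcond.
have p0 x : 0 <= (f \_ D) x by rewrite patchE; case: ifPn.
rewrite !ge0_integralTE//; apply: ge_ereal_sup => _ [h hf <-].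
apply: ereal_sup_ubound; exists h => [x|].
  by apply: le_trans (hf x) _; rewrite patchE; case: ifPn.
rewrite !sintegralE; apply: eq_fsbigr => r _.
have [->|r0] := eqVneq r 0%R; first by rewrite !mul0e.
congr (_ * _); rewrite /= /mrestr; congr (m _); apply/seteqP; split => [x []//|x hx]; split => //.
apply: contrapT => Dx; have := hf x; rewrite patchE memNset// lee_fin => hx0.
move: r0; rewrite /= -hx; have := @fun_ge0 _ _ h x; move=> h0.
by rewrite eq_le hx0 h0.
Qed.

End CompareMeasures.

Section Transfer.
Context d d' {T : measurableType d} {T' : measurableType d'} {R : realType}.
Local Open Scope ereal_scope.

(** The pushforward of [m] restricted to [D] is dominated by [C] times [n] restricted to [E]. This
    moves boundary integrals to the parameter interval of a chart. *)
Lemma ge0_integral_transfer (m : {measure set T -> \bar R}) (n : {measure set T' -> \bar R})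
    (D : set T) (E : set T') (phi : T -> T') (C : R) (g : T' -> \bar R) :
  measurable D -> measurable E -> measurable_fun setT phi -> D `<=` phi @^-1` E -> (0 <= C)%R ->
  (forall B, measurable B -> m (D `&` phi @^-1` B) <= C%:E * n (B `&` E)) ->
  measurable_fun setT g -> (forall x, 0 <= g x) ->
  \int[m]_(x in D) g (phi x) <= C%:E * \int[n]_(y in E) g y.
Proof.
move=> mD mE mphi DE C0 mn mg g0.
have gE0 y : 0 <= (g \_ E) y by rewrite patchE; case: ifPn.
have mgE : measurable_fun setT (g \_ E).
  by apply/(measurable_restrictT _ mE); exact: measurable_funS mg.
have -> : \int[m]_(x in D) g (phi x) = \int[m]_(x in D) (g \_ E) (phi x).
  by apply: eq_integral => x /set_mem /DE Ex; rewrite patchE mem_set.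
apply: le_trans (ge0_integral_mrestr_ge m mD (fun x => gE0 (phi x))) _.
have := ge0_integral_pushforward mphi (mrestr m mD) measurableT mgE (fun y _ => gE0 y).
rewrite preimage_setT => <-.
rewrite [X in _ * X]integral_mkcond.
have -> : C%:E * \int[n]_x (g \_ E) x = \int[mscale (NngNum C0) n]_x (g \_ E) x.
  by rewrite ge0_integral_mscale.
apply: ge0_le_measure_integral => // B mB.
rewrite /= /pushforward /mrestr /mscale/= setIC; apply: le_trans (mn _ mB) _.
by rewrite lee_wpmul2l ?lee_fin// le_measure ?inE//; exact: measurableI.
Qed.

End Transfer.

(** * Estimates along the fibres of a tube *)

Section TubeEstimates.
Context {R : realType}.
Local Notation planeT := (@planeT R).
Local Notation leb := (@lebesgue_measure R).
Variable O : @bounded_domain R.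
Local Notation Omega := (dom O).
Local Notation Gamma := (boundary (dom O)).
Implicit Types (phi : R * R -> R).

Definition grad2 phi x : R := 'D_e1 phi x ^+ 2 + 'D_e2 phi x ^+ 2.

Lemma grad2_ge0 phi x : 0 <= grad2 phi x.
Proof. by rewrite addr_ge0// sqr_ge0. Qed.

Lemma measurable_grad2 phi : smooth phi -> measurable_fun (setT : set planeT) (grad2 phi).
Proof.
move=> sphi; apply: measurable_funD; apply: measurable_funX; apply: continuous_measurable_plane;
  apply: smooth_continuous; [exact: smooth_D1|exact: smooth_D2].
Qed.

Section chart.
Variable K : chart O.
Local Notation rho := (ch_rho K).
Let Psi := ch_param K.
Let I : set (measurableTypeR R) := `]- rho, rho[%classic.
Let J (tau : R) : set (measurableTypeR R) := `]0, tau[%classic.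

Let mI : measurable I := measurable_itv `]- rho, rho[.
Let mJ tau : measurable (J tau) := measurable_itv `]0, tau[.

Let lebJ tau : 0 < tau -> leb (J tau) = tau%:E.
Proof. by move=> t0; rewrite /J lebesgue_measure_itv/= lte_fin t0 oppr0 adde0. Qed.

Definition strip (tau : R) : set (R * R) := [set x | `|ch_a K x| < rho /\ 0 < ch_b K x < tau].

Lemma preimage_strip tau : Psi @^-1` strip tau = I `*` J tau.
Proof.
apply/seteqP; split => q; rewrite /Psi /strip /= ch_a_param ch_b_param /I /J /= !in_itv/= -ltr_norml => -[h1 h2]; by split.
Qed.

Lemma measurable_strip tau : measurable (strip tau : set planeT).
Proof.
have -> : strip tau = tube K tau `&` [set x | 0 < ch_b K x].
  apply/seteqP; split=> x [h1 h2]; split => //.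
  - by split => //; move: h2 => /andP[h2 h3]; rewrite gtr0_norm.
  - by move: h2 => /andP[].
  - exact: h1.1.
  - by rewrite h2/=; move: h1 => [_]; rewrite gtr0_norm.
apply: measurableI; first by apply: open_measurable_plane; exact: open_tube.
apply: open_measurable_plane; apply: (@open_comp _ _ (ch_b K) [set t | 0 < t]) => [x _|].
  exact: continuous_ch_b.
exact: open_gt.
Qed.

Lemma strip_dom tau : tau <= ch_tau K -> strip tau `<=` Omega.
Proof.
move=> tK x [h1 /andP[h2 h3]]; apply/(@tube_dom _ _ K) => //; split => //.
by rewrite gtr0_norm//; exact: lt_le_trans h3 tK.
Qed.

Lemma strip_integral tau (H : R * R -> R) : measurable_fun (setT : set planeT) H -> (forall x, 0 <= H x) ->
  (\int[area]_(x in strip tau) (H x)%:E =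
   \int[leb]_(a in I) \int[leb]_(b in J tau) (H (Psi (a, b)))%:E)%E.
Proof.
move=> mH H0; have mEH : measurable_fun (setT : set planeT) (EFin \o H) by exact/measurable_EFinP.
rewrite -(area_preserving_integral (area_preserving_param K) (measurable_strip tau)); first last.
- by move=> x _; rewrite lee_fin.
- exact: measurable_funS mEH.
rewrite -/Psi preimage_strip integral_mkcond area_tonelli; first last.
- by move=> x; rewrite patchE; case: ifPn => // _; rewrite lee_fin.
- apply/(measurable_restrictT _ (measurableX mI (mJ tau))).
  by apply: (measurable_funS measurableT) => //; exact: (measurableT_comp mEH (area_preserving_param K).1).
rewrite [RHS]integral_mkcond; apply: eq_integral => a _; rewrite patchE.
case: ifPn => aI.
  rewrite [RHS]integral_mkcond; apply: eq_integral => b _; rewrite !patchE.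
  by rewrite in_setX/= aI.
by rewrite integral0_eq// => b _; rewrite patchE in_setX/= (negbTE aI).
Qed.

Let N phi tau a : \bar R := (\int[leb]_(t in J tau) (grad2 phi (Psi (a, t)))%:E)%E.

Lemma PsiE a b : Psi (a, b) = ((Psi (a, 0)).1 + b * - ch_s K, (Psi (a, 0)).2 + b * ch_c K).
Proof. by rewrite /Psi /ch_param/= !add0r; congr (_, _); ring. Qed.

Let mPsi2 a : measurable_fun (setT : set (measurableTypeR R)) (fun t : measurableTypeR R => Psi (a, t) : planeT).
Proof.
apply: (measurableT_comp (area_preserving_param K).1).
exact: measurable_pair_plane (measurable_cst _) (@measurable_id _ _ _).
Qed.

Let mline (H : R * R -> R) a D : measurable_fun (setT : set planeT) H ->
  measurable_fun (D : set (measurableTypeR R)) (fun t => H (Psi (a, t))).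
Proof.
by move=> mH; apply: (measurable_funS measurableT) => //; exact: (measurableT_comp mH (mPsi2 a)).
Qed.

(** Two points on the same fibre: the increment is bounded by the energy along the fibre, and the
    directional derivative by the full gradient. *)
Lemma tube_pointwise phi a tau b b' : smooth phi -> 0 <= b -> b < tau -> 0 <= b' -> b' < tau ->
  ((phi (Psi (a, b)) ^+ 2)%:E <= (2 * phi (Psi (a, b')) ^+ 2)%:E + (2 * tau)%:E * N phi tau a)%E.
Proof.
move=> sphi; have N0 : (0 <= N phi tau a)%E by apply: integral_ge0 => x _; rewrite lee_fin grad2_ge0.
pose F t := phi (Psi (a, t)).
pose F' t := - ch_s K * 'D_e1 phi (Psi (a, t)) + ch_c K * 'D_e2 phi (Psi (a, t)).
have dF t : is_derive t (1 : R) F (F' t).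
  have := @is_derive_line _ phi (Psi (a, 0)) (- ch_s K, ch_c K) t sphi => /=.
  have -> : (fun t0 => phi ((Psi (a, 0)).1 + t0 * - ch_s K, (Psi (a, 0)).2 + t0 * ch_c K)) = F.
    by apply/funext => u; rewrite /F PsiE.
  by rewrite /F' PsiE.
have cPsi t : {for t, continuous (fun t => Psi (a, t))} by exact: continuous_param_snd.
have cF' : continuous F'.
  move=> t; apply: cvgD; (apply: cvgM; first exact: cvg_cst).
    by apply: (@continuous_comp _ _ _ (fun t => Psi (a, t)) ('D_e1 phi)) => //; apply: smooth_continuous; exact: smooth_D1.
  by apply: (@continuous_comp _ _ _ (fun t => Psi (a, t)) ('D_e2 phi)) => //; apply: smooth_continuous; exact: smooth_D2.
have F'2 t : F' t ^+ 2 <= grad2 phi (Psi (a, t)).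
  rewrite /F' /grad2; set d1 := 'D_e1 _ _; set d2 := 'D_e2 _ _.
  have := ch_cs K; move: (ch_c K) (ch_s K) => c s cs.
  have -> : d1 ^+ 2 + d2 ^+ 2 = (- s * d1 + c * d2) ^+ 2 + (c * d1 + s * d2) ^+ 2.
    by rewrite -[LHS]mulr1 -cs; ring.
  by rewrite lerDl sqr_ge0.
have mF2 : measurable_fun (setT : set (measurableTypeR R)) (fun t => (F' t ^+ 2)%:E).
  by apply/measurable_EFinP/measurable_funX; exact: continuous_measurable_fun.
have mG D : measurable_fun (D : set (measurableTypeR R)) (fun t => (grad2 phi (Psi (a, t)))%:E).
  by apply/measurable_EFinP; apply: (@mline (grad2 phi)); exact: measurable_grad2.
have key u v : 0 <= u -> u < v -> v < tau -> (((F v - F u) ^+ 2)%:E <= tau%:E * N phi tau a)%E.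
  move=> u0 uv vt; apply: le_trans (sq_increment_le uv dF cF') _.
  apply: lee_pmul.
  - by rewrite lee_fin subr_ge0 ltW.
  - by apply: integral_ge0 => x _; rewrite lee_fin sqr_ge0.
  - by rewrite lee_fin; lra.
  apply: (@le_trans _ _ (\int[leb]_(t in `]u, v[) (grad2 phi (Psi (a, t)))%:E)%E).
    apply: ge0_le_integral => //.
    - by move=> x _; rewrite lee_fin sqr_ge0.
    - exact: measurable_funS mF2.
    - by move=> x _; rewrite lee_fin.
  apply: ge0_subset_integral => //.
  - by move=> x _; rewrite lee_fin grad2_ge0.
  - move=> x; rewrite /J /= !in_itv/= => /andP[h1 h2]; apply/andP; split; lra.
move=> b0 bt b'0 b't.
have H : (((F b - F b') ^+ 2)%:E <= tau%:E * N phi tau a)%E.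
  have [bb|bb|->] := ltgtP b b'.
  - by rewrite -opprB sqrrN; exact: key.
  - exact: key.
  - by rewrite subrr expr0n/= mule_ge0// lee_fin; lra.
apply: (@le_trans _ _ (2 * F b' ^+ 2 + 2 * (F b - F b') ^+ 2)%:E).
  by rewrite lee_fin; have := sqr_ge0 (F b - 2 * F b'); rewrite /F; nra.
rewrite EFinD leeD2l// EFinM [(2 * tau)%:E]EFinM -muleA lee_wpmul2l//.
Qed.

(** [tube_pointwise] integrated over [b']. With [b = 0] it controls boundary values, with [b] in a
    short interval the mass of a thin strip. *)
Lemma tube_average phi a tau b : smooth phi -> 0 < tau -> 0 <= b -> b < tau ->
  (tau%:E * (phi (Psi (a, b)) ^+ 2)%:E <=
   2%:E * \int[leb]_(t in J tau) (phi (Psi (a, t)) ^+ 2)%:E + (2 * tau ^+ 2)%:E * N phi tau a)%E.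
Proof.
move=> sphi tau0 b0 bt.
have N0 : (0 <= N phi tau a)%E by apply: integral_ge0 => x _; rewrite lee_fin grad2_ge0.
have mphi2 : measurable_fun (J tau) (fun t => (phi (Psi (a, t)) ^+ 2)%:E).
  apply: measurable_sq; apply: (@mline phi a).
  exact: (continuous_measurable_plane (smooth_continuous sphi)).
have -> : (tau%:E * (phi (Psi (a, b)) ^+ 2)%:E = \int[leb]_(t in J tau) (phi (Psi (a, b)) ^+ 2)%:E)%E.
  by rewrite integral_cst// -(lebJ tau0) muleC.
have -> : ((2 * tau ^+ 2)%:E * N phi tau a = \int[leb]_(t in J tau) ((2 * tau)%:E * N phi tau a))%E.
  by rewrite integral_cst// -[X in (_ = _ * X)%E]/(leb (J tau)) lebJ// muleAC -EFinM; congr (_%:E * _)%E; ring.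
have -> : (2%:E * \int[leb]_(t in J tau) (phi (Psi (a, t)) ^+ 2)%:E =
    \int[leb]_(t in J tau) (2 * phi (Psi (a, t)) ^+ 2)%:E)%E.
  by rewrite -ge0_integralZl_EFin// => x _; rewrite lee_fin sqr_ge0.
have mE : measurable_fun (J tau) (fun t => (2 * phi (Psi (a, t)) ^+ 2)%:E).
  by apply/measurable_EFinP; apply: measurable_funM => //; exact/measurable_EFinP.
rewrite -ge0_integralD//; first last.
- by move=> x _; rewrite mule_ge0// lee_fin; lra.
- by move=> x _; rewrite lee_fin mulr_ge0 ?sqr_ge0.
apply: ge0_le_integral => //.
- by move=> x _; rewrite lee_fin sqr_ge0.
- by apply: emeasurable_funD => //; exact: measurable_cst.
move=> t; rewrite /J /= in_itv/= => /andP[t0 tt].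
by apply: tube_pointwise => //; exact: ltW.
Qed.

End chart.
End TubeEstimates.

(** * Finite covers and the trace inequality *)

Section FiniteCovers.
Context {R : realType}.

Lemma common_lower_bound n (t : 'I_n -> R) : (forall i, 0 < t i) ->
  exists2 m : R, 0 < m & forall i, m <= t i.
Proof.
elim: n t => [|n IH] t t0; first by exists 1 => // -[].
have [m m0 mt] := IH (fun i => t (lift ord0 i)) (fun i => t0 _).
exists (Num.min m (t ord0)); first by rewrite lt_min m0 t0.
by move=> i; case: (unliftP ord0 i) => [j ->|->]; rewrite ge_min ?mt// lexx orbT.
Qed.

Lemma integral_cover_le d (T : measurableType d) (mu : {measure set T -> \bar R}) (A : set T) n
    (B : 'I_n -> set T) (F : T -> \bar R) : measurable A -> (forall i, measurable (B i)) ->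
  A `<=` \bigcup_i B i -> measurable_fun A F -> (forall x, A x -> 0 <= F x)%E ->
  (\int[mu]_(x in A) F x <= \sum_i \int[mu]_(x in A `&` B i) F x)%E.
Proof.
move=> mA mB AB mF F0.
have mFB i : measurable_fun A (F \_ (B i)).
  by apply/(measurable_restrict _ (mB i) mA); apply: measurable_funS mF => //; exact: subIsetl.
have FB0 i x : A x -> (0 <= (F \_ (B i)) x)%E.
  by move=> Ax; rewrite patchE; case: ifPn => // _; exact: F0.
under eq_bigr do rewrite integral_mkcondr.
rewrite -ge0_integral_sum//.
apply: ge0_le_integral => //.
- by apply: emeasurable_sum => i _; exact: mFB.
move=> x Ax; have [i _ Bx] := AB x Ax.
rewrite (bigD1 i)//= patchE mem_set// leeDl// sume_ge0// => j _; exact: FB0.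
Qed.

End FiniteCovers.

Section TraceBound.
Context {R : realType}.
Local Notation planeT := (@planeT R).
Local Notation leb := (@lebesgue_measure R).
Variable O : @bounded_domain R.
Local Notation Omega := (dom O).
Local Notation Gamma := (boundary (dom O)).
Hypothesis HL : lipschitz_boundary Omega.
Implicit Types (phi : R * R -> R).

Lemma closure_dom : closure Omega `<=` csq (0, 0) (dom_radius O).
Proof.
rewrite [X in _ `<=` X](closure_id _).1; last exact: closed_csq.
by apply: closureS; exact: dom_bounded.
Qed.

Lemma boundaryE : Gamma = closure Omega `\` Omega.
Proof. by rewrite /boundary ((interior_id Omega).1 (@dom_open _ O)). Qed.

Lemma closed_boundary : closed Gamma.
Proof.
rewrite boundaryE setDE; apply: closedI; first exact: closed_closure.
exact: open_closedC (@dom_open _ O).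
Qed.

Lemma compact_boundary : compact Gamma.
Proof.
apply: (subclosed_compact closed_boundary (@compact_csq R (0, 0) (dom_radius O))).
by rewrite boundaryE => x [/closure_dom].
Qed.

Lemma measurable_boundary : measurable (Gamma : set (arcT R)).
Proof. exact: closed_arc_measurable closed_boundary. Qed.

(** Half the chart in both directions, which leaves room for moving points along its axis. *)
Definition half_tube (K : chart O) : set (R * R) :=
  [set y | tube K (ch_tau K / 2) y /\ `|ch_a K y| < ch_rho K / 2].

Lemma open_half_tube K : open (half_tube K).
Proof.
apply: openI; first exact: open_tube.
by apply: (@open_comp _ _ (ch_a K) [set t | `|t| < ch_rho K / 2]) => [x _|]; [exact: continuous_ch_a|exact: open_norm_lt].
Qed.

Lemma half_tubeW K : half_tube K `<=` tube K (ch_tau K).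
Proof.
move=> y [[h1 h2] _]; split => //; apply: lt_trans h2 _.
by rewrite ltr_pdivrMr// ltr_pMr ?ch_tau0// ltr1n.
Qed.

Lemma boundary_cover : exists n (K : 'I_n -> chart O), Gamma `<=` \bigcup_i half_tube (K i).
Proof.
pose K q (Gq : Gamma q) := projT1 (cid (exists_chart HL Gq)).
have KP q (Gq : Gamma q) : half_tube (K q Gq) q by exact: projT2 (cid (exists_chart HL Gq)).
(* A chart depends on a proof that [q] is a boundary point; quantifying over proofs makes the
   neighbourhood a function of every [q]. *)
pose U q : set (R * R) := [set y | forall Gq : Gamma q, half_tube (K q Gq) y].
have GU q : Gamma q -> nbhs q (U q).
  move=> Gq; apply: (@filterS _ _ _ (half_tube (K q Gq))) => [y Hy Gq'|].
    by rewrite (Prop_irrelevance Gq' Gq).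
  by apply: open_nbhs_nbhs; split; [exact: open_half_tube|exact: KP].
have [s [sG sU]] := compact_cover_seq compact_boundary GU.
exists (size s), (fun i => K _ (sG _ (mem_tnth i (in_tuple s)))) => y /sU[x xs Uy].
have is_ : (index x s < size s)%N by rewrite index_mem.
exists (Ordinal is_) => //; have E : tnth (in_tuple s) (Ordinal is_) = x by rewrite (tnth_nth x)/= nth_index.
move: (sG _ _); rewrite E => G; exact: Uy.
Qed.

Definition ch_itv (K : chart O) : set (measurableTypeR R) := `]- ch_rho K, ch_rho K[%classic.

Lemma measurable_ch_itv K : measurable (ch_itv K).
Proof. exact: measurable_itv. Qed.

(** Inside the tube the boundary is contained in the image of the parameters under the Lipschitz
    [curve]. *)
Lemma arclength_tube (K : chart O) (B : set R) :
  (hausdorff1 (Gamma `&` tube K (ch_tau K) `&` ch_a K @^-1` B) <=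
   (1 + ch_L K)%:E * leb (B `&` ch_itv K))%E.
Proof.
have C0 : 0 < 1 + ch_L K by rewrite ltr_wpDr// ch_L0.
apply: le_trans (hausdorff1_curve C0 (curve_lipschitz K) _).
apply: le_hausdorff1 => x [[Gx xT] xB]; exists (ch_a K x); last by rewrite -tube_boundary_curve.
by split => //; rewrite /ch_itv /= in_itv/= -ltr_norml; exact: xT.1.
Qed.

Lemma measurable_tube (K : chart O) tau : measurable (tube K tau : set (arcT R)).
Proof. by apply: open_arc_measurable; exact: open_tube. Qed.

Lemma measurable_boundary_tube (K : chart O) tau : measurable (Gamma `&` tube K tau : set (arcT R)).
Proof. exact: measurableI _ _ measurable_boundary (measurable_tube K tau). Qed.

Lemma measurable_ch_a (K : chart O) : measurable_fun (setT : set (arcT R)) (ch_a K).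
Proof. by apply: continuous_arc_measurable; exact: continuous_ch_a. Qed.

Lemma integral_boundary_tube (K : chart O) (g : R * R -> \bar R) : measurable_fun (setT : set planeT) g ->
  (forall x, 0 <= g x)%E ->
  (\int[arclength]_(x in (Gamma `&` tube K (ch_tau K) : set (arcT R))) g x <=
   (1 + ch_L K)%:E * \int[leb]_(a in ch_itv K) g (curve K a))%E.
Proof.
move=> mg g0; have C0 : 0 <= 1 + ch_L K by rewrite addr_ge0// ch_L0.
have mc : measurable_fun (setT : set (measurableTypeR R)) (fun a => g (curve K a)).
  apply: (measurableT_comp mg); apply: (measurableT_comp (area_preserving_param K).1).
  exact: measurable_pair_plane (@measurable_id _ _ _) (measurable_cst _).
apply: le_trans (ge0_integral_transfer (measurable_boundary_tube K (ch_tau K))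
  (measurable_ch_itv K) (measurable_ch_a K) _ C0 _ mc (fun a => g0 _)).
- rewrite le_eqVlt; apply/orP; left; apply/eqP; apply: eq_integral => x /set_mem [Gx xT].
  by rewrite -tube_boundary_curve.
- by move=> x [_ [xT _]]; rewrite /ch_itv /= in_itv/= -ltr_norml.
- by move=> B _; exact: arclength_tube.
Qed.

Lemma arclength_boundary_fin : (arclength (Gamma : set (arcT R)) < +oo)%E.
Proof.
have [n [K GK]] := boundary_cover.
have sub : Gamma `<=` \bigcup_i tube (K i) (ch_tau (K i)).
  by move=> y /GK[i _ /half_tubeW yi]; exists i.
have := integral_cover_le (F := fun=> 1%E) (@arclength R) measurable_boundary (fun i => measurable_tube (K i) (ch_tau (K i))) sub
  (measurable_cst _) (fun _ _ => lee01).
rewrite integral_cst ?mul1e; last exact: measurable_boundary.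
move=> /le_lt_trans; apply; apply: lte_sum_pinfty => i _.
rewrite integral_cst ?mul1e; last exact: measurable_boundary_tube.
have := arclength_tube (K i) setT; rewrite preimage_setT setIT setTI => /le_lt_trans; apply.
apply: lte_mul_pinfty; rewrite ?lee_fin//; first by rewrite addr_ge0// ch_L0.
by rewrite /ch_itv lebesgue_measure_itv/=; case: ifP => _; rewrite -?EFinD ltry.
Qed.

Section one.
Variable K : chart O.
Local Notation rho := (ch_rho K).
Local Notation I := (ch_itv K).
Let mI : measurable I := measurable_ch_itv K.
Let J (tau : R) : set (measurableTypeR R) := `]0, tau[%classic.
Let mJ tau : measurable (J tau) := measurable_itv `]0, tau[.

Let Phi phi tau a : \bar R := (\int[leb]_(t in J tau) (phi (ch_param K (a, t)) ^+ 2)%:E)%E.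
Let N phi tau a : \bar R := (\int[leb]_(t in J tau) (grad2 phi (ch_param K (a, t)))%:E)%E.

Let measurable_inner (H : R * R -> R) tau : measurable_fun (setT : set planeT) H -> (forall x, 0 <= H x) ->
  measurable_fun I (fun a => \int[leb]_(t in J tau) (H (ch_param K (a, t)))%:E)%E.
Proof.
move=> mH H0; apply: (measurable_funS measurableT) => //.
pose F (q : planeT) : \bar R := ((fun q => (H (ch_param K q))%:E) \_ (setT `*` J tau)) q.
have mF : measurable_fun setT F.
  apply/(measurable_restrictT _ (measurableX measurableT (mJ tau))).
  apply: (measurable_funS measurableT) => //; apply/measurable_EFinP.
  exact: (measurableT_comp mH (area_preserving_param K).1).
have F0 q : (0 <= F q)%E by rewrite /F patchE; case: ifPn => // _; rewrite lee_fin.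
have := @measurable_fun_fubini_tonelli_F _ _ _ _ R leb F mF F0.
apply: eq_measurable_fun => a _; rewrite /fubini_F [RHS]integral_mkcond.
by apply: eq_integral => t _; rewrite /F !patchE in_setX/= in_setT.
Qed.

Let mPhi phi tau : smooth phi -> measurable_fun I (Phi phi tau).
Proof.
move=> sphi; apply: (measurable_inner (H := fun x => phi x ^+ 2)) => [|x]; last exact: sqr_ge0.
by apply: measurable_funX; exact: continuous_measurable_plane (smooth_continuous sphi).
Qed.

Let mN phi tau : smooth phi -> measurable_fun I (N phi tau).
Proof.
by move=> sphi; apply: (measurable_inner (H := grad2 phi)); [exact: measurable_grad2|exact: grad2_ge0].
Qed.

Let intPhi phi tau : smooth phi -> (\int[leb]_(a in I) Phi phi tau a = sqint area (strip K tau) phi)%E.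
Proof.
move=> sphi; rewrite /sqint (strip_integral K tau (H := fun x => phi x ^+ 2))// => [|x]; last exact: sqr_ge0.
by apply: measurable_funX; exact: continuous_measurable_plane (smooth_continuous sphi).
Qed.

Let intN phi tau : smooth phi -> (\int[leb]_(a in I) N phi tau a = \int[area]_(x in strip K tau) (grad2 phi x)%:E)%E.
Proof.
by move=> sphi; rewrite (strip_integral K tau (H := grad2 phi))//; [exact: measurable_grad2|exact: grad2_ge0].
Qed.

Let N0 phi tau a : (0 <= N phi tau a)%E.
Proof. by apply: integral_ge0 => x _; rewrite lee_fin grad2_ge0. Qed.

Let Phi0 phi tau a : (0 <= Phi phi tau a)%E.
Proof. by apply: integral_ge0 => x _; rewrite lee_fin sqr_ge0. Qed.

(** The right-hand side of [tube_average] integrated over the base of the chart. *)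
Definition tube_energy phi tau : \bar R :=
  (2%:E * sqint area (strip K tau) phi + (2 * tau ^+ 2)%:E * \int[area]_(x in strip K tau) (grad2 phi x)%:E)%E.

Let integral_right phi tau : smooth phi ->
  (\int[leb]_(a in I) (2%:E * Phi phi tau a + (2 * tau ^+ 2)%:E * N phi tau a) = tube_energy phi tau)%E.
Proof.
move=> sphi; have c0 : 0 <= 2 * tau ^+ 2 :> R by rewrite mulr_ge0 ?sqr_ge0.
rewrite ge0_integralD//; first last.
- by apply: measurable_funeM; exact: mN.
- by move=> a _; rewrite mule_ge0.
- by apply: measurable_funeM; exact: mPhi.
- by move=> a _; rewrite mule_ge0.
rewrite !ge0_integralZl_EFin//; [by rewrite intPhi// intN//|exact: mN|exact: mPhi].
Qed.

Let measurable_right phi tau : smooth phi ->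
  measurable_fun I (fun a => 2%:E * Phi phi tau a + (2 * tau ^+ 2)%:E * N phi tau a)%E.
Proof.
by move=> sphi; apply: emeasurable_funD; apply: measurable_funeM; [exact: mPhi|exact: mN].
Qed.

Lemma curve_trace_le phi tau : smooth phi -> 0 < tau ->
  (tau%:E * \int[leb]_(a in ch_itv K) (phi (curve K a) ^+ 2)%:E <= tube_energy phi tau)%E.
Proof.
move=> sphi tau0; rewrite -integral_right//.
have mc : measurable_fun I (fun a => (phi (curve K a) ^+ 2)%:E).
  apply: (measurable_funS measurableT) => //; apply: measurable_sq.
  apply: (measurableT_comp (continuous_measurable_plane (smooth_continuous sphi))).
  apply: (measurableT_comp (area_preserving_param K).1).
  exact: measurable_pair_plane (@measurable_id _ _ _) (measurable_cst _).
rewrite -ge0_integralZl_EFin//; first last.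
- exact: ltW.
- by move=> a _; rewrite lee_fin sqr_ge0.
apply: ge0_le_integral => //.
- by move=> a _; rewrite mule_ge0 ?lee_fin ?sqr_ge0// ltW.
- exact: measurable_funeM.
- exact: measurable_right.
by move=> a _; apply: tube_average.
Qed.

(** [tube_average] for the full height [tau], integrated over the short height [tau']: the gain
    [tau' / tau] is what makes thin strips negligible. *)
Lemma strip_le phi tau tau' : smooth phi -> 0 < tau' -> tau' <= tau ->
  (tau%:E * sqint area (strip K tau') phi <= tau'%:E * tube_energy phi tau)%E.
Proof.
move=> sphi tau0 tt; have tau_gt0 : 0 < tau by exact: lt_le_trans tt.
rewrite -integral_right// -intPhi// -!ge0_integralZl_EFin//; first last.
- exact: ltW.
- exact: mPhi.
- exact: ltW.
- exact: measurable_right.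
- by move=> a _; rewrite adde_ge0// mule_ge0// lee_fin mulr_ge0 ?sqr_ge0.
have B0 a : (0 <= 2%:E * Phi phi tau a + (2 * tau ^+ 2)%:E * N phi tau a)%E.
  by rewrite adde_ge0// mule_ge0// lee_fin mulr_ge0 ?sqr_ge0.
apply: ge0_le_integral => //.
- by move=> a _; rewrite mule_ge0// lee_fin ltW.
- by apply: measurable_funeM; exact: mPhi.
- by apply: measurable_funeM; exact: measurable_right.
move=> a _.
have mline : measurable_fun (J tau') (fun t => (phi (ch_param K (a, t)) ^+ 2)%:E).
  apply: (measurable_funS measurableT) => //; apply: measurable_sq.
  apply: (measurableT_comp (continuous_measurable_plane (smooth_continuous sphi))).
  apply: (measurableT_comp (area_preserving_param K).1).
  exact: measurable_pair_plane (measurable_cst _) (@measurable_id _ _ _).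
rewrite /Phi -ge0_integralZl_EFin//; first last.
- exact: ltW.
- by move=> t _; rewrite lee_fin sqr_ge0.
have lJ : leb (J tau') = tau'%:E by rewrite /J lebesgue_measure_itv/= lte_fin tau0 oppr0 adde0.
rewrite -[X in (X * (_ + _))%E]lJ muleC -integral_cst//.
apply: ge0_le_integral => //.
- by move=> t _; rewrite mule_ge0 ?lee_fin ?sqr_ge0// ltW.
- exact: measurable_funeM.
move=> t; rewrite /J /= in_itv/= => /andP[t0 tt'].
by apply: tube_average => //; [exact: ltW|exact: lt_le_trans tt' tt].
Qed.

Lemma tube_energy_le phi tau : smooth phi -> 0 < tau -> tau <= ch_tau K ->
  (tube_energy phi tau <= 2%:E * sqint area Omega phi + (2 * tau ^+ 2)%:E * \int[area]_(x in Omega) (grad2 phi x)%:E)%E.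
Proof.
move=> sphi t0 tK; apply: leeD.
  rewrite lee_wpmul2l// ge0_subset_integral//; try exact: measurable_strip; try exact: measurable_dom.
  - by apply: measurable_sq; apply: continuous_measurable_dom; exact: smooth_continuous.
  - by move=> x _; rewrite lee_fin sqr_ge0.
  - exact: strip_dom.
apply: lee_wpmul2l; first by rewrite lee_fin mulr_ge0 ?sqr_ge0.
rewrite ge0_subset_integral//; try exact: measurable_strip; try exact: measurable_dom.
- by apply: (measurable_funS measurableT) => //; apply/measurable_EFinP; exact: measurable_grad2.
- by move=> x _; rewrite lee_fin grad2_ge0.
- exact: strip_dom.
Qed.

End one.

(** The height [tau] of the averaging stays free: a small [tau] makes the coefficient of the
    gradient small at the expense of the mass, which is how the trace becomes compact. *)
Lemma trace_bound : exists C : R, 0 <= C /\ exists2 t0 : R, 0 < t0 & forall phi tau, smooth phi -> 0 < tau -> tau <= t0 ->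
  (\int[arclength]_(x in Gamma) (phi x ^+ 2)%:E <=
   (C / tau)%:E * sqint area Omega phi + (C * tau)%:E * \int[area]_(x in Omega) (grad2 phi x)%:E)%E.
Proof.
have [n [K GK]] := boundary_cover.
have [t0 t00 tK] := common_lower_bound (fun i => ch_tau0 (K i)).
exists (\sum_i 2 * (1 + ch_L (K i))); split.
  by apply: sumr_ge0 => i _; rewrite mulr_ge0// addr_ge0// ch_L0.
exists t0 => // phi tau sphi tau0 tt.
have sub : Gamma `<=` \bigcup_i tube (K i) (ch_tau (K i)).
  by move=> y /GK[i _ /half_tubeW yi]; exists i.
have mphi : measurable_fun (setT : set planeT) phi by exact: continuous_measurable_plane (smooth_continuous sphi).
have mphi2 : measurable_fun (Gamma : set (arcT R)) (fun x => (phi x ^+ 2)%:E).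
  apply: measurable_sq; exact: (measurable_funS measurableT (@subsetT _ _) (borel_fun_arc_measurable mphi)).
apply: le_trans (integral_cover_le (@arclength R) measurable_boundary
  (fun i => measurable_tube (K i) (ch_tau (K i))) sub mphi2 _) _.
  by move=> x _; rewrite lee_fin sqr_ge0.
have S0 : (0 <= sqint area Omega phi)%E by exact: sqint_ge0.
have G0 : (0 <= \int[area]_(x in Omega) (grad2 phi x)%:E)%E.
  by apply: integral_ge0 => x _; rewrite lee_fin grad2_ge0.
set S := sqint _ _ _ in S0 *; set G := integral _ _ _ in G0 *.
rewrite !mulr_suml -!sumEFin !ge0_sume_distrl; first last.
- by move=> i _; rewrite lee_fin mulr_ge0 ?mulr_ge0 ?addr_ge0 ?invr_ge0 ?(ltW tau0)// ch_L0.
- by move=> i _; rewrite lee_fin mulr_ge0 ?mulr_ge0 ?addr_ge0 ?(ltW tau0)// ch_L0.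
rewrite -big_split/=; apply: lee_sum => i _.
have C0 : 0 <= 1 + ch_L (K i) by rewrite addr_ge0// ch_L0.
apply: le_trans (integral_boundary_tube (K i) (g := fun x => (phi x ^+ 2)%:E) (measurable_sq mphi) _) _.
  by move=> x; rewrite lee_fin sqr_ge0.
have := le_trans (curve_trace_le (K i) sphi tau0) (tube_energy_le sphi tau0 (le_trans tt (tK i))).
rewrite -/S -/G -lee_pdivlMl// => /(lee_wpmul2l (x := (1 + ch_L (K i))%:E)); rewrite lee_fin => /(_ C0).
move=> /le_trans; apply; rewrite ge0_muleDr//; last first.
- by rewrite mule_ge0// lee_fin mulr_ge0 ?sqr_ge0.
- by rewrite mule_ge0.
rewrite ge0_muleDr//; last first.
- apply: mule_ge0; first by rewrite lee_fin invr_ge0 ltW.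
  by apply: mule_ge0 => //; rewrite lee_fin mulr_ge0 ?sqr_ge0.
- apply: mule_ge0; first by rewrite lee_fin invr_ge0 ltW.
  exact: mule_ge0.
rewrite !muleA -!EFinM le_eqVlt; apply/orP; left; apply/eqP; congr (_%:E * _ + _%:E * _)%E.
  by ring.
by field; exact: lt0r_neq0.
Qed.

End TraceBound.
(** * Density of smooth functions *)

Lemma Rintegral_eq0 d (T : measurableType d) (R : realType) (mu : {measure set T -> \bar R})
    (D : set T) (f : T -> R) : (forall x, D x -> f x = 0) -> \int[mu]_(x in D) f x = 0.
Proof. by move=> f0; rewrite /Rintegral integral0_eq// => x Dx; rewrite f0. Qed.

Section Density.
Context {R : realType}.
Local Notation planeT := (@planeT R).
Variable O : @bounded_domain R.
Local Notation Omega := (dom O).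
Local Notation Gamma := (boundary (dom O)).
Implicit Types (p q x : R * R) (w phi chi f u : R * R -> R) (G : R * R -> R * R -> R).

Let mO := measurable_dom O.
Let oO := @dom_open R O.
Let fO := area_dom_fin O.

Lemma csq_refl p (r : R) : 0 <= r -> csq p r p.
Proof. by move=> r0; rewrite /csq /= !subrr normr0. Qed.

Lemma nbhs_of_csq p (r : R) : 0 < r -> nbhs p (csq p r).
Proof.
move=> r0; apply/nbhs_ballP; exists r => // x; rewrite -ball_normE /= prod_normE gt_max /=.
by rewrite (distrC p.1) (distrC p.2) => /andP[/ltW ? /ltW ?].
Qed.

Lemma subset_csq p (r r' : R) : r <= r' -> csq p r `<=` csq p r'.
Proof. by move=> rr x [h1 h2]; split; exact: le_trans rr. Qed.

(** The indicator of the square of half-side [3 / 2 * d], mollified at scale [d / 4]: it equals 1 up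
    to [5 / 4 * d] and vanishes beyond [7 / 4 * d]. The margin past [d] makes the derivatives vanish
    on the inner square. *)
Lemma exists_cutoff p (d : R) : 0 < d -> exists chi, [/\ kernel p (2 * d) chi,
  forall x, csq p d x -> chi x = 1 & forall v x, axis v -> csq p d x -> 'D_v chi x = 0].
Proof.
move=> d0; have d4 : 0 < d / 4 by rewrite divr_gt0.
have [k [kk k0 k1]] := exists_kernel (0, 0) d4.
pose B : set (R * R) := csq p (3 / 2 * d).
have iB : area.-integrable setT (EFin \o (\1_B : planeT -> R)).
  apply/integrableP; split; first by apply/measurable_EFinP; apply: measurable_indic; exact: measurable_csq.
  under eq_integral do rewrite /= ger0_norm//.
  by rewrite integral_indic ?setIT//; [exact: area_csq_fin|exact: measurable_csq].
pose chi := conv k \1_B.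
have one x : csq p (5 / 4 * d) x -> chi x = 1.
  move=> [x1 x2]; rewrite -k1 -(Rintegral_reflectT x); last first.
    by apply: continuous_measurable_plane; exact: smooth_continuous kk.1.
  apply: eq_Rintegral => z _; rewrite indicE.
  have [zB|zB] := pselect (B z); first by rewrite mem_set// mulr1.
  rewrite memNset// mulr0 kk.2// => -[h1 h2]; apply: zB; move: x1 x2 h1 h2.
  rewrite /B /csq/= !subr0 !ler_norml => /andP[? ?] /andP[? ?] /andP[? ?] /andP[? ?].
  by split; apply/andP; split; lra.
exists chi; split.
- split=> [|x xB]; first exact: smooth_conv iB _ _ _ kk.
  rewrite /chi /conv; apply: Rintegral_eq0 => z _.
  have [zB|zB] := pselect (B z); last by rewrite indicE memNset// mulr0.
  rewrite kk.2 ?mul0r// => -[h1 h2]; apply: xB; move: zB h1 h2.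
  rewrite /B /csq/= !subr0 !ler_norml => -[/andP[? ?] /andP[? ?]] /andP[? ?] /andP[? ?].
  by split; apply/andP; split; lra.
- by move=> x xd; apply: one; apply: subset_csq xd; lra.
move=> v x _ [x1 x2].
have nb : \forall y \near x, (fun=> 1) y = chi y.
  apply: filterS (nbhs_of_csq x d4) => y [y1 y2]; rewrite one//; move: x1 x2 y1 y2.
  rewrite /csq/= !ler_norml => /andP[? ?] /andP[? ?] /andP[? ?] /andP[? ?].
  by split; apply/andP; split; lra.
by have [_ ->] := near_eq_is_derive nb (is_derive_cst (1 : R) x v).
Qed.

(** The derivatives are carried as explicit functions: for products with cutoffs the Leibniz
    expression holds pointwise, whereas the chosen [wD] agrees with it only almost everywhere. *)
Definition weak_triple w G := L2 area Omega w /\ forall v, axis v -> weak_derivative Omega v w (G v).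

Definition smooth_approximable w G := forall eps : R, 0 < eps -> exists phi, [/\ smooth phi,
  (sqint area Omega (fun x => (phi x - w x)%R) <= eps%:E)%E &
  forall v, axis v -> (sqint area Omega (fun x => ('D_v phi x - G v x)%R) <= eps%:E)%E].

Lemma smooth_approximable_eq w w' G G' : (forall x, Omega x -> w x = w' x) ->
  (forall v x, axis v -> Omega x -> G v x = G' v x) -> smooth_approximable w G -> smooth_approximable w' G'.
Proof.
move=> ww GG H eps eps0; have [phi [sphi h1 h2]] := H _ eps0; exists phi; split => //.
  by apply: le_trans h1; rewrite le_eqVlt; apply/orP; left; apply/eqP; apply: eq_sqint => x Ox; rewrite ww.
move=> v av; apply: le_trans (h2 v av).
by rewrite le_eqVlt; apply/orP; left; apply/eqP; apply: eq_sqint => x Ox; rewrite GG.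
Qed.

Lemma derive_add v phi chi x : axis v -> smooth phi -> smooth chi ->
  'D_v (fun x => phi x + chi x) x = 'D_v phi x + 'D_v chi x.
Proof.
move=> av s1 s2.
have [_ _ E1 E2] := has_partialsE (has_partialsD (smooth_partials s1) (smooth_partials s2)).
by case: av => ->; [exact: (congr1 (fun f => f x) E1)|exact: (congr1 (fun f => f x) E2)].
Qed.

Lemma sqint_add_eps f f' (eps : R) : measurable_fun (Omega : set planeT) f -> measurable_fun (Omega : set planeT) f' ->
  (sqint area Omega f <= (eps / 4)%:E)%E -> (sqint area Omega f' <= (eps / 4)%:E)%E ->
  (sqint area Omega (fun x => (f x + f' x)%R) <= eps%:E)%E.
Proof.
move=> mf mf' h h'; apply: le_trans (sqintD_le area mO mf mf') _.
apply: (@le_trans _ _ (2%:E * (eps / 4)%:E + 2%:E * (eps / 4)%:E)%E).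
  by apply: leeD; apply: lee_wpmul2l.
by rewrite -!EFinM -EFinD lee_fin; lra.
Qed.

Lemma smooth_approximableD w w' G G' : weak_triple w G -> weak_triple w' G' ->
  smooth_approximable w G -> smooth_approximable w' G' ->
  smooth_approximable (fun x => w x + w' x) (fun v x => G v x + G' v x).
Proof.
move=> [[mw _] tG] [[mw' _] tG'] H H' eps eps0; have e4 : 0 < eps / 4 by rewrite divr_gt0.
have [phi [sphi h1 h2]] := H _ e4; have [phi' [sphi' h1' h2']] := H' _ e4.
have mS f : smooth f -> measurable_fun (Omega : set planeT) f.
  by move=> /smooth_continuous; exact: continuous_measurable_dom.
exists (fun x => phi x + phi' x); split; first exact: smoothD.
  have -> : (fun x => phi x + phi' x - (w x + w' x)) = (fun x => (phi x - w x) + (phi' x - w' x)).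
    by apply/funext => x; ring.
  by apply: sqint_add_eps => //; apply: measurable_funB => //; exact: mS.
move=> v av; have [[[mG _] _] [[mG' _] _]] := (tG v av, tG' v av).
have -> : (fun x => 'D_v (fun x => phi x + phi' x) x - (G v x + G' v x)) =
    (fun x => ('D_v phi x - G v x) + ('D_v phi' x - G' v x)).
  by apply/funext => x; rewrite derive_add//; ring.
apply: sqint_add_eps; [| |exact: h2|exact: h2']; apply: measurable_funB => //; apply: mS; exact: smooth_D.
Qed.

(** A uniform interior cone condition: direction [nu], opening [kappa], height [t0]. *)
Definition cone_set (B : set (R * R)) := exists (nu : R * R) (kappa t0 : R), [/\ 0 < kappa, 0 < t0 &
  forall t x, 0 < t -> t <= t0 -> Omega x -> B x ->
    csq (x.1 + t * nu.1, x.2 + t * nu.2) (kappa * t) `<=` Omega].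

Lemma sqint_restrict_le f u : measurable_fun (setT : set planeT) f -> L2 area Omega u ->
  (sqint area Omega (fun x => (f x - u x)%R) <= sqint area setT (fun x => (f x - (u \_ Omega) x)%R))%E.
Proof.
move=> mf uL; have [mu _] := L2_restrict oO uL.
have -> : sqint area Omega (fun x => f x - u x) = sqint area Omega (fun x => f x - (u \_ Omega) x).
  by apply: eq_sqint => x Ox; rewrite patchE mem_set.
apply: ge0_subset_integral => //; first by apply: measurable_sq; exact: measurable_funB.
by move=> x _; rewrite lee_fin sqr_ge0.
Qed.

(** The kernel is centred at [- t nu], so at a point [x] of [B] the convolution only uses the cone
    at [x], where it commutes with weak derivatives. Outside [B] nothing of the support of [w] is
    reached, and both sides vanish. *)
Lemma cone_approximable B p (d : R) w G : 0 < d -> cone_set B -> csq p (3 * d) `<=` B -> weak_triple w G ->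
  (forall x, Omega x -> ~ csq p (2 * d) x -> w x = 0 /\ forall v, axis v -> G v x = 0) ->
  smooth_approximable w G.
Proof.
move=> d0 [nu [kappa [t0 [kappa0 t00 cone]]]] dB [wL tG] wG0 eps eps0.
have ext u : L2 area Omega u -> exists2 d : R, 0 < d & forall p r K, csq p r `<=` csq (0, 0) d ->
    kernel p r K -> (forall x, 0 <= K x) -> \int[area]_x K x = 1 ->
    (sqint area setT (fun x => (conv K (u \_ Omega) x - (u \_ Omega) x)%R) <= eps%:E)%E.
  by move=> uL; apply: mollify_eps => //; [exact: L2_restrict|exact: L2_restrict_integrable].
have [d1 d10 H1] := ext _ wL.
have [d2 d20 H2] := ext _ (tG _ (or_introl erefl)).1.
have [d3 d30 H3] := ext _ (tG _ (or_intror erefl)).1.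
pose N := `|nu.1| + `|nu.2| + kappa.
have N0 : 0 < N by rewrite ltr_wpDl// addr_ge0.
(* Below the height of the cone; the total displacement [t * N] is at most [d], which keeps the
   support within the triple square, and below the three mollification scales of [w] and its
   derivatives. *)
pose t := Num.min t0 (Num.min (d / N) (Num.min (d1 / N) (Num.min (d2 / N) (d3 / N)))).
have t_gt0 : 0 < t by rewrite !lt_min t00 !divr_gt0.
have tt0 : t <= t0 by rewrite ge_min lexx.
have tN e : t <= e / N -> t * N <= e by rewrite -ler_pdivlMr.
have td : t * N <= d by apply: tN; rewrite !ge_min lexx orbT.
have td1 : t * N <= d1 by apply: tN; rewrite !ge_min lexx !orbT.
have td2 : t * N <= d2 by apply: tN; rewrite !ge_min lexx !orbT.
have td3 : t * N <= d3 by apply: tN; rewrite !ge_min lexx !orbT.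
have kt0 : 0 < kappa * t by rewrite mulr_gt0.
pose pt : R * R := (- (t * nu.1), - (t * nu.2)).
have [K [kK K0 K1]] := exists_kernel pt kt0.
have b1 : `|t * nu.1| + kappa * t <= t * N.
  by rewrite normrM (gtr0_norm t_gt0) /N !mulrDr; have := mulr_ge0 (ltW t_gt0) (normr_ge0 nu.2); lra.
have b2 : `|t * nu.2| + kappa * t <= t * N.
  by rewrite normrM (gtr0_norm t_gt0) /N !mulrDr; have := mulr_ge0 (ltW t_gt0) (normr_ge0 nu.1); lra.
have sub e : t * N <= e -> csq pt (kappa * t) `<=` csq (0, 0) e.
  move=> tNe x [] /=; rewrite /csq/= !opprK !subr0 => h1 h2; split.
    have := ler_normB (x.1 + t * nu.1) (t * nu.1); rewrite addrK; lra.
  have := ler_normB (x.2 + t * nu.2) (t * nu.2); rewrite addrK; lra.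
have iw := L2_restrict_integrable oO fO wL.
have sphi : smooth (conv K (w \_ Omega)) by exact: smooth_conv iw _ _ _ kK.
have mS f : smooth f -> measurable_fun (setT : set planeT) f.
  by move=> /smooth_continuous; exact: continuous_measurable_plane.
have cE (u : R * R -> R) x K' : kernel pt (kappa * t) K' -> Omega x -> ~ B x ->
    (forall z, Omega z -> ~ csq p (2 * d) z -> u z = 0) -> conv K' (u \_ Omega) x = 0.
  move=> kK' Ox Bx u0; apply: Rintegral_eq0 => z _; rewrite patchE.
  case: ifPn => [/set_mem Oz|]; last by rewrite mulr0.
  have [zd|zd] := pselect (csq p (2 * d) z); last by rewrite u0// mulr0.
  rewrite kK'.2 ?mul0r// => -[]; rewrite /= !opprK => h1 h2; apply: Bx; apply: dB.
  case: zd => z1 z2; split.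
    have -> : x.1 - p.1 = (x.1 - z.1 + t * nu.1) - t * nu.1 + (z.1 - p.1) by ring.
    apply: le_trans (ler_normD _ _) _; have := ler_normB (x.1 - z.1 + t * nu.1) (t * nu.1); lra.
  have -> : x.2 - p.2 = (x.2 - z.2 + t * nu.2) - t * nu.2 + (z.2 - p.2) by ring.
  apply: le_trans (ler_normD _ _) _; have := ler_normB (x.2 - z.2 + t * nu.2) (t * nu.2); lra.
exists (conv K (w \_ Omega)); split => //.
  apply: le_trans (sqint_restrict_le (mS _ sphi) wL) _.
  exact: (H1 pt (kappa * t) K (sub _ td1)).
have DE v x : axis v -> Omega x -> 'D_v (conv K (w \_ Omega)) x = conv K (G v \_ Omega) x.
  move=> av Ox; have [Bx|Bx] := pselect (B x).
    have xO : csq (x.1 - pt.1, x.2 - pt.2) (kappa * t) `<=` Omega.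
      by rewrite /= !opprK; exact: cone.
    case: av => ->.
      by rewrite (D1_conv iw _ kK); apply: (conv_weak1 oO fO wL _ kK xO); apply: tG; left.
    by rewrite (D2_conv iw _ kK); apply: (conv_weak2 oO fO wL _ kK xO); apply: tG; right.
  rewrite (cE (G v) x K)//; last by move=> z Oz zd; have [_ ->] := wG0 z Oz zd.
  have -> : 'D_v (conv K (w \_ Omega)) x = conv ('D_v K) (w \_ Omega) x.
    by case: av => ->; [rewrite (D1_conv iw _ kK)|rewrite (D2_conv iw _ kK)].
  by apply: cE => //; [exact: kernel_D|move=> z Oz zd; have [] := wG0 z Oz zd].
move=> v av; have GL := (tG v av).1.
have -> : sqint area Omega (fun x => 'D_v (conv K (w \_ Omega)) x - G v x) =
    sqint area Omega (fun x => conv K (G v \_ Omega) x - G v x).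
  by apply: eq_sqint => x Ox; rewrite DE.
apply: le_trans (sqint_restrict_le _ GL) _.
  by apply: mS; exact: smooth_conv (L2_restrict_integrable oO fO GL) _ _ _ kK.
case: av => ->; [exact: (H2 pt (kappa * t) K (sub _ td2))|exact: (H3 pt (kappa * t) K (sub _ td3))].
Qed.

Lemma cone_interior p (r : R) : 0 < r -> csq p (2 * r) `<=` Omega -> cone_set (csq p r).
Proof.
move=> r0 rO; exists (0, 0), 1, r; split=> // t x t0 tr _ [x1 x2] y [].
rewrite /= !mulr0 !addr0 mul1r => y1 y2; apply: rO; move: x1 x2 y1 y2.
rewrite /csq/= !ler_norml => /andP[? ?] /andP[? ?] /andP[? ?] /andP[? ?].
by split; apply/andP; split; lra.
Qed.

Lemma cone_half_tube (K : chart O) : cone_set (half_tube K).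
Proof.
have [kappa kappa0 [t0 t00 H]] := tube_cone K.
exists (- ch_s K, ch_c K), kappa, t0; split => // t x t_gt0 tt Ox [[_ xb] xa] y /=.
by rewrite mulrN; exact: H.
Qed.

Hypothesis HL : lipschitz_boundary Omega.

(** The simple square is where the cutoff is 1, the double one contains its support, and the triple
    one contains every point from which mollification can reach that support. *)
Definition good_square (pd : (R * R) * R) := 0 < pd.2 /\
  exists2 B, cone_set B & csq pd.1 (3 * pd.2) `<=` B.

Lemma closure_good_cover : exists s : seq ((R * R) * R), (forall pd, pd \in s -> good_square pd) /\
  forall x, Omega x -> exists2 pd, pd \in s & csq pd.1 pd.2 x.
Proof.
have cO : compact (closure Omega).
  exact: (subclosed_compact (@closed_closure _ _) (@compact_csq R (0, 0) (dom_radius O)) (@closure_dom _ O)).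
have ex q : exists d : R, closure Omega q -> good_square (q, d).
  have [Oq|nOq] := pselect (Omega q).
    have [e e0 eO] := nbhs_csq (open_nbhs_nbhs (conj oO Oq)).
    exists (e / 6) => _; split; first by rewrite /= divr_gt0.
    exists (csq q (e / 2)); last by apply: subset_csq => /=; lra.
    by apply: cone_interior; [rewrite divr_gt0|apply: subset_trans eO; apply: subset_csq; lra].
  have [cq|ncq] := pselect (closure Omega q); last by exists 0.
  have Gq : Gamma q by rewrite boundaryE.
  have [K Kq] := exists_chart HL Gq.
  have [e e0 eK] := nbhs_csq (open_nbhs_nbhs (conj (@open_half_tube R O K) Kq)).
  exists (e / 3) => _; split; first by rewrite /= divr_gt0.
  by exists (half_tube K); [exact: cone_half_tube|apply: subset_trans eK; apply: subset_csq => /=; lra].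
have [d dP] := choice ex.
have nd q : closure Omega q -> nbhs q (csq q (d q)) by move=> /dP[/= d0 _]; exact: nbhs_of_csq.
have [s [sO sU]] := compact_cover_seq cO nd.
exists [seq (q, d q) | q <- s]; split=> [_ /mapP[q qs ->]|x Ox]; first exact: dP (sO q qs).
have [q qs qx] := sU x (subset_closure Ox).
by exists (q, d q) => //; apply/mapP; exists q.
Qed.

(** A sequential partition of unity: one square is removed at a time. The part [chi * w] is
    approximable by the cone condition, and the rest vanishes on that square and is left to the
    remaining ones. *)
Lemma smooth_approximable_support (s : seq ((R * R) * R)) w G : (forall pd, pd \in s -> good_square pd) ->
  weak_triple w G ->
  (forall x, Omega x -> (forall pd, pd \in s -> ~ csq pd.1 pd.2 x) -> w x = 0 /\ forall v, axis v -> G v x = 0) ->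
  smooth_approximable w G.
Proof.
elim: s w G => [|[p d] s IH] w G gs tw w0.
  move=> eps eps0; exists (fun=> 0); split; first exact: smooth_cst.
    rewrite /sqint integral0_eq ?lee_fin ?ltW// => x Ox.
    by have [-> _] := w0 x Ox (fun _ => ltac:(by [])); rewrite subrr expr0n.
  move=> v av; rewrite /sqint integral0_eq ?lee_fin ?ltW// => x Ox.
  have [_ ->//] := w0 x Ox (fun _ => ltac:(by [])).
  by rewrite derive_cst subr0 expr0n.
have [/= d0 [B cB dB]] := gs (p, d) (mem_head _ _).
have [chi [kchi chi1 dchi0]] := exists_cutoff p d0; have schi := kchi.1.
pose psi x := 1 + -1 * chi x.
have spsi : smooth psi by apply: smoothD; [exact: smooth_cst|exact: smoothZ].
have dpsi v x : axis v -> 'D_v psi x = - 'D_v chi x.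
  move=> av; rewrite /psi derive_add//; [|exact: smooth_cst|exact: smoothZ].
  rewrite derive_cst add0r derive_mul//; last exact: smooth_cst.
  by rewrite derive_cst mul0r add0r mulN1r.
have tr f : smooth f -> weak_triple (fun x => f x * w x) (fun v x => f x * G v x + 'D_v f x * w x).
  move=> sf; have [wL tG] := tw; split; first exact: L2_smooth_mul.
  by move=> v av; apply: weak_derivativeM => //; exact: tG.
apply: (smooth_approximable_eq (w := fun x => chi x * w x + psi x * w x)
  (G := fun v x => (chi x * G v x + 'D_v chi x * w x) + (psi x * G v x + 'D_v psi x * w x))).
- by move=> x _; rewrite /psi; ring.
- by move=> v x av _; rewrite dpsi// /psi; ring.
apply: smooth_approximableD; [exact: tr|exact: tr| |].
  apply: (cone_approximable d0 cB dB (tr _ schi)) => x Ox xd.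
  rewrite kchi.2// !mul0r; split=> // v av.
  by rewrite (kernel_D av kchi).2// !mul0r addr0.
apply: (IH _ _ _ (tr _ spsi)) => [pd pds|x Ox xs]; first by apply: gs; rewrite in_cons pds orbT.
have [xd|xd] := pselect (csq p d x).
  have p0 : psi x = 0 by rewrite /psi chi1//; ring.
  by rewrite p0 !mul0r; split=> // v av; rewrite dpsi// dchi0// !mul0r oppr0 mul0r addr0.
have [pd|-> H] := w0 x Ox; last by rewrite !mulr0; split=> // v av; rewrite H// !mulr0 addr0.
by rewrite in_cons => /predU1P[-> //|]; exact: xs.
Qed.

Lemma H1_smooth_dense u (eps : R) : H1 Omega u -> 0 < eps -> exists phi, [/\ smooth phi,
  (sqint area Omega (fun x => (phi x - u x)%R) <= eps%:E)%E &
  forall v, axis v -> (sqint area Omega (fun x => ('D_v phi x - wD Omega v u x)%R) <= eps%:E)%E].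
Proof.
move=> hu; have [s [gs sO]] := closure_good_cover.
apply: (smooth_approximable_support gs (G := fun v => wD Omega v u)).
  by split; [exact: H1_L2 hu|move=> v av; exact: wDP].
by move=> x Ox H; have [pd pds /(H pd pds)] := sO x Ox.
Qed.

End Density.
(** * Traces *)

Section L2Extra.
Context d (T : measurableType d) (R : realType) (mu : {measure set T -> \bar R}) (D : set T).
Hypothesis mD : measurable D.
Implicit Types f g h : T -> R.

Lemma ip_split f g : L2 mu D f -> L2 mu D g ->
  ip mu D f f <= 2 * ip mu D (fun x => f x - g x) (fun x => f x - g x) + 2 * ip mu D g g.
Proof.
move=> fL gL; have dL := L2B mD fL gL.
rewrite -lee_fin EFinD !EFinM -!sqint_ip//.
have := sqintD_le mu mD dL.1 gL.1.
by under [X in sqint _ _ X]eq_fun do rewrite subrK.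
Qed.

Lemma cvg_ip0 (f_ : nat -> T -> R) : (forall n, L2 mu D (f_ n)) ->
  sqint mu D (f_ n) @[n --> \oo] --> 0%E <-> ip mu D (f_ n) (f_ n) @[n --> \oo] --> (0 : R).
Proof.
move=> fL; split.
  by move/fine_cvg; under eq_fun do rewrite sqint_ip//.
move=> H; under eq_fun do rewrite sqint_ip//.
by apply: cvg_EFin; [exact: nearW|exact: H].
Qed.

Lemma sqint_sum2 f g : measurable_fun D f -> measurable_fun D g ->
  (\int[mu]_(x in D) (f x ^+ 2 + g x ^+ 2)%:E = sqint mu D f + sqint mu D g)%E.
Proof.
move=> mf mg; rewrite /sqint -ge0_integralD//.
- by move=> x _; rewrite lee_fin sqr_ge0.
- exact: measurable_sq.
- by move=> x _; rewrite lee_fin sqr_ge0.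
- exact: measurable_sq.
Qed.

Lemma sqint_sum3 f g h : measurable_fun D f -> measurable_fun D g -> measurable_fun D h ->
  (\int[mu]_(x in D) (f x ^+ 2 + g x ^+ 2 + h x ^+ 2)%:E = sqint mu D f + sqint mu D g + sqint mu D h)%E.
Proof.
move=> mf mg mh; rewrite -sqint_sum2// /sqint -ge0_integralD//.
- by move=> x _; rewrite lee_fin addr_ge0 ?sqr_ge0.
- under eq_fun do rewrite EFinD; apply: emeasurable_funD; exact: measurable_sq.
- by move=> x _; rewrite lee_fin sqr_ge0.
- exact: measurable_sq.
Qed.

Lemma ip_sum2 f g : L2 mu D f -> L2 mu D g ->
  (\int[mu]_(x in D) (f x ^+ 2 + g x ^+ 2)%:E = (ip mu D f f + ip mu D g g)%:E)%E.
Proof. by move=> fL gL; rewrite EFinD -!sqint_ip//; exact: sqint_sum2 fL.1 gL.1. Qed.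

Lemma sqint_cvg_eq (f_ g_ : nat -> T -> R) : (forall n x, D x -> f_ n x = g_ n x) ->
  sqint mu D (f_ n) @[n --> \oo] --> 0%E -> sqint mu D (g_ n) @[n --> \oo] --> 0%E.
Proof.
move=> fg; rewrite (_ : (fun n => sqint mu D (f_ n)) = (fun n => sqint mu D (g_ n)))//.
by apply/funext => n; apply: eq_sqint => x Dx; rewrite fg.
Qed.

Lemma cvg_sqint_lin (c : R) (f_ g_ : nat -> T -> R) :
  (forall n, measurable_fun D (f_ n)) -> (forall n, measurable_fun D (g_ n)) ->
  sqint mu D (f_ n) @[n --> \oo] --> 0%E -> sqint mu D (g_ n) @[n --> \oo] --> 0%E ->
  sqint mu D (fun x => c * f_ n x + g_ n x) @[n --> \oo] --> 0%E.
Proof.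
move=> mf mg /(cvge0P (fun n => sqint_ge0 mu D (f_ n))) cf /(cvge0P (fun n => sqint_ge0 mu D (g_ n))) cg.
apply/(cvge0P (fun n => sqint_ge0 mu D _)) => eps eps0.
pose e1 := eps / (4 * (c ^+ 2 + 1)).
have c1 : 0 < c ^+ 2 + 1 by rewrite ltr_wpDl ?sqr_ge0.
have e10 : 0 < e1 by rewrite divr_gt0// mulr_gt0.
have e20 : 0 < eps / 4 by rewrite divr_gt0.
apply: filterS2 (cf _ e10) (cg _ e20) => n h1 h2.
have mcf : measurable_fun D (fun x => c * f_ n x) by apply: measurable_funM => //; exact: measurable_cst.
apply: le_trans (sqintD_le mu mD mcf (mg n)) _; rewrite sqintZ//.
apply: (@le_trans _ _ (2%:E * ((c ^+ 2)%:E * e1%:E) + 2%:E * (eps / 4)%:E)%E).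
  by apply: leeD; apply: lee_wpmul2l => //; apply: lee_wpmul2l => //; rewrite lee_fin sqr_ge0.
rewrite -!EFinM -EFinD lee_fin.
have : c ^+ 2 * e1 <= eps / 4.
  rewrite /e1 invfM !mulrA ler_pdivrMr// mulrC mulrA; have := sqr_ge0 c; nra.
lra.
Qed.

End L2Extra.

Section RealSequences.
Context {R : realType}.

Lemma cvge0_sum3 (a b c : nat -> \bar R) : (forall n, (0 <= a n)%E) -> (forall n, (0 <= b n)%E) ->
  (forall n, (0 <= c n)%E) -> (a n + b n + c n)%E @[n --> \oo] --> 0%E ->
  [/\ a n @[n --> \oo] --> 0%E, b n @[n --> \oo] --> 0%E & c n @[n --> \oo] --> 0%E].
Proof.
move=> a0 b0 c0; have S0 n : (0 <= a n + b n + c n)%E by rewrite !adde_ge0.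
move=> /(cvge0P S0) H; split; [apply/(cvge0P a0)|apply/(cvge0P b0)|apply/(cvge0P c0)] => e e0;
  apply: filterS (H _ e0) => n; apply: le_trans.
- by rewrite -addeA leeDl// adde_ge0.
- by rewrite addeAC leeDr// adde_ge0.
- by rewrite leeDr// adde_ge0.
Qed.

(** The numerical core of [trace_estimate]: two uses of [(x + y) ^+ 2 <= 2 * x ^+ 2 + 2 * y ^+ 2]
    produce the factor 4, and [eps] collects the approximation errors [e]. *)
Lemma trace_arithmetic (C tau e eps Tg Tp Tgp U P UP U1 P1 UP1 U2 P2 UP2 : R) : 0 <= C -> 0 < tau ->
  eps = e * (2 + 4 * C / tau + 8 * C * tau) ->
  Tp <= C / tau * P + C * tau * (P1 + P2) -> Tgp <= e -> Tg <= 2 * Tgp + 2 * Tp ->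
  P <= 2 * UP + 2 * U -> P1 <= 2 * UP1 + 2 * U1 -> P2 <= 2 * UP2 + 2 * U2 ->
  UP <= e -> UP1 <= e -> UP2 <= e ->
  Tg <= 4 * C / tau * U + 4 * C * tau * (U1 + U2) + eps.
Proof.
move=> C0 tau0 ->; have : 0 <= C / tau by rewrite divr_ge0// ltW.
have : 0 <= C * tau by rewrite mulr_ge0// ltW.
rewrite -!(mulrA 4) -(mulrA 8); move: (C / tau) (C * tau) => A B B0 A0 Hn nG' sG s0 s1 s2 n0 n1 n2.
have h0 : B * P <= B * (2 * e + 2 * U) by apply: ler_wpM2l => //; lra.
have h1 : A * P <= A * (2 * e + 2 * U) by apply: ler_wpM2l => //; lra.
have h2 : B * (P1 + P2) <= B * (4 * e + 2 * U1 + 2 * U2) by apply: ler_wpM2l => //; lra.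
lra.
Qed.

End RealSequences.


Section Trace.
Context {R : realType}.
Local Notation planeT := (@planeT R).
Variable O : @bounded_domain R.
Local Notation Omega := (dom O).
Local Notation Gamma := (boundary (dom O) : set (arcT R)).
Hypothesis HL : lipschitz_boundary Omega.
Implicit Types (u phi : R * R -> R) (g : arcT R -> R).

Let mO := measurable_dom O.
Let mG : measurable Gamma := measurable_boundary O.
Let fG := arclength_boundary_fin HL.

Lemma measurable_smooth_arc phi : smooth phi -> measurable_fun Gamma phi.
Proof.
move=> sphi; apply: (measurable_funS measurableT (@subsetT _ _)).
by apply: continuous_arc_measurable; exact: smooth_continuous.
Qed.

Lemma continuous_boundary_bounded phi : continuous phi -> exists2 M, 0 <= M & forall x, boundary Omega x -> `|phi x| <= M.
Proof. exact: compact_bounded_fun (@compact_boundary _ O). Qed.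

Lemma L2_smooth_boundary phi : smooth phi -> L2 arclength Gamma phi.
Proof.
move=> sphi; have [M _ HM] := continuous_boundary_bounded (smooth_continuous sphi).
exact: (L2_bounded mG fG (measurable_smooth_arc sphi) HM).
Qed.

Definition smooth_cvg u (phi : nat -> R * R -> R) := [/\ forall n, smooth (phi n),
  sqint area Omega (fun x => phi n x - u x) @[n --> \oo] --> 0%E &
  forall v, axis v -> sqint area Omega (fun x => 'D_v (phi n) x - wD Omega v u x) @[n --> \oo] --> 0%E].

Lemma exists_smooth_cvg u : H1 Omega u -> exists w_ : nat -> R * R -> R, smooth_cvg u w_.
Proof.
move=> hu; have eps0 (n : nat) : 0 < (n.+1%:R : R)^-1 by rewrite invr_gt0.
have [phi Hphi] := choice (fun n => H1_smooth_dense HL hu (eps0 n)).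
have small (e : R) : 0 < e -> \forall n \near \oo, (n.+1%:R : R)^-1 <= e.
  by move=> e0; have := @harmonic_cvg0 R => /cvgr_lt /(_ _ e0); apply: filterS => n /ltW.
exists phi; split=> [n||v av]; first by have [] := Hphi n.
  apply/(cvge0P (fun n => sqint_ge0 _ _ _)) => e e0; apply: filterS (small e e0) => n ne.
  by have [_ h _] := Hphi n; apply: le_trans h _; rewrite lee_fin.
apply/(cvge0P (fun n => sqint_ge0 _ _ _)) => e e0; apply: filterS (small e e0) => n ne.
by have [_ _ h] := Hphi n; apply: le_trans (h v av) _; rewrite lee_fin.
Qed.

Lemma is_traceP u g : H1 Omega u -> is_trace Omega u g <-> L2 arclength Gamma g /\
  exists w_ : nat -> R * R -> R, smooth_cvg u w_ /\ sqint arclength Gamma (fun x => w_ n x - g x) @[n --> \oo] --> 0%E.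
Proof.
move=> hu; have [mu _] := H1_L2 hu.
have mD v : axis v -> measurable_fun (Omega : set planeT) (wD Omega v u) by move=> av; have [] := wD_L2 av hu.
have mS f : smooth f -> measurable_fun (Omega : set planeT) f.
  by move=> /smooth_continuous; exact: continuous_measurable_dom.
have E phi : smooth phi -> (\int[area]_(x in Omega)
      ((phi x - u x) ^+ 2 + ('D_e1 phi x - wD Omega e1 u x) ^+ 2 + ('D_e2 phi x - wD Omega e2 u x) ^+ 2)%:E =
    sqint area Omega (fun x => phi x - u x)%R + sqint area Omega (fun x => 'D_e1 phi x - wD Omega e1 u x)%R +
    sqint area Omega (fun x => 'D_e2 phi x - wD Omega e2 u x)%R)%E.
  move=> sphi.
  exact: (sqint_sum3 area mO (measurable_funB (mS _ sphi) mu)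
    (measurable_funB (mS _ (smooth_D1 sphi)) (mD _ (or_introl erefl)))
    (measurable_funB (mS _ (smooth_D2 sphi)) (mD _ (or_intror erefl)))).
split=> -[gL [phi H]]; split=> //; exists phi.
  have [sphi c1 c2] := H; split; last exact: c2.
  have c1' : (sqint area Omega (fun x => phi n x - u x)%R + sqint area Omega (fun x => 'D_e1 (phi n) x - wD Omega e1 u x)%R +
    sqint area Omega (fun x => 'D_e2 (phi n) x - wD Omega e2 u x)%R)%E @[n --> \oo] --> 0%E.
    by move: c1; rewrite (_ : (fun n => integral _ _ _) = (fun n => (sqint area Omega (fun x => phi n x - u x)%R +
      sqint area Omega (fun x => 'D_e1 (phi n) x - wD Omega e1 u x)%R +
      sqint area Omega (fun x => 'D_e2 (phi n) x - wD Omega e2 u x)%R)%E))//; apply/funext => n; rewrite E.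
  have [h0 h1 h2] := cvge0_sum3 (fun n => sqint_ge0 _ _ _) (fun n => sqint_ge0 _ _ _) (fun n => sqint_ge0 _ _ _) c1'.
  by split; [exact: sphi|exact: h0|move=> v [->|->]; [exact: h1|exact: h2]].
have [[sphi c0 cD] c2] := H; split; [exact: sphi| |exact: c2].
rewrite (_ : (fun n => integral _ _ _) = (fun n => (sqint area Omega (fun x => phi n x - u x)%R +
      sqint area Omega (fun x => 'D_e1 (phi n) x - wD Omega e1 u x)%R +
      sqint area Omega (fun x => 'D_e2 (phi n) x - wD Omega e2 u x)%R)%E)); last by apply/funext => n; rewrite E.
rewrite -[X in _ --> X]adde0 -[X in _ --> (X + _)%E]adde0.
apply: cvgeD => //; last by apply: cD; right.
by apply: cvgeD => //; apply: cD; left.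
Qed.

Lemma trace_bound_ip : exists C : R, 0 <= C /\ exists2 t0 : R, 0 < t0 & forall phi tau, smooth phi -> 0 < tau -> tau <= t0 ->
  ip arclength Gamma phi phi <= C / tau * ip area Omega phi phi +
   C * tau * (ip area Omega ('D_e1 phi) ('D_e1 phi) + ip area Omega ('D_e2 phi) ('D_e2 phi)).
Proof.
have [C [C0 [t0 t00 H]]] := trace_bound HL; exists C; split=> //; exists t0 => // phi tau sphi tau0 tt.
have L1 := L2_smooth O (smooth_D1 sphi); have L2' := L2_smooth O (smooth_D2 sphi).
have key (a b x y z w : R) (g : \bar R) : (w%:E <= a%:E * x%:E + b%:E * g)%E -> g = (y + z)%:E -> w <= a * x + b * (y + z).
  by move=> + gE; rewrite gE -!EFinM -EFinD lee_fin.
apply: key.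
  by rewrite -!sqint_ip//; [exact: H|exact: L2_smooth|exact: L2_smooth_boundary].
exact: (ip_sum2 mO L1 L2').
Qed.

(** The smooth inequality passes to the limit along the sequence that defines the trace. *)
Lemma trace_estimate : exists C : R, 0 <= C /\ exists2 t0 : R, 0 < t0 & forall u g tau, H1 Omega u ->
  is_trace Omega u g -> 0 < tau -> tau <= t0 ->
  ip arclength Gamma g g <= C / tau * ip area Omega u u +
   C * tau * (ip area Omega (wD Omega e1 u) (wD Omega e1 u) + ip area Omega (wD Omega e2 u) (wD Omega e2 u)).
Proof.
have [C [C0 [t0 t00 H]]] := trace_bound_ip; exists (4 * C); split; first by rewrite mulr_ge0.
exists t0 => // u g tau hu tu tau0 tt.
have [gL [phi [[sphi c0 cD] cG]]] := (is_traceP g hu).1 tu.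
have uL := H1_L2 hu; have dL v (av : axis v) := wD_L2 av hu.
have pG n := L2_smooth_boundary (sphi n); have pO n := L2_smooth O (sphi n).
have pD v (av : axis v) n := L2_smooth O (smooth_D av (sphi n)).
have k0 := (cvg_ip0 mO (fun n => L2B mO (pO n) uL)).1 c0.
have kD v (av : axis v) := (cvg_ip0 mO (fun n => L2B mO (pD v av n) (dL v av))).1 (cD v av).
have kG := (cvg_ip0 mG (fun n => L2B mG (pG n) gL)).1 cG.
apply/ler_addgt0Pr => eps eps0.
pose M := 2 + 4 * C / tau + 8 * C * tau.
have M0 : 0 < M.
  by rewrite /M ltr_wpDr ?mulr_ge0 ?(ltW tau0)// ltr_wpDr// divr_ge0 ?mulr_ge0// ltW.
pose e := eps / M; have e0 : 0 < e by rewrite divr_gt0.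
have near (x : nat -> R) : x n @[n --> \oo] --> (0 : R) -> \forall n \near \oo, x n <= e.
  by move=> /cvgr_lt /(_ _ e0); apply: filterS => n /ltW.
have a1 : axis (e1 : R * R) by left. have a2 : axis (e2 : R * R) by right.
have [n [[n0 nG] [n1 n2]]] := filter_ex (filterI (filterI (near _ k0) (near _ kG)) (filterI (near _ (kD _ a1)) (near _ (kD _ a2)))).
have s0 := ip_split mO (pO n) uL.
have s1 := ip_split mO (pD _ a1 n) (dL _ a1); have s2 := ip_split mO (pD _ a2 n) (dL _ a2).
have sG := ip_split mG gL (pG n).
have nG' : ip arclength Gamma (fun x => g x - phi n x) (fun x => g x - phi n x) <= e.
  by apply: le_trans nG; rewrite le_eqVlt; apply/orP; left; apply/eqP; apply: eq_Rintegral => x _; ring.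
have Hn := H _ _ (sphi n) tau0 tt.
have eM : eps = e * (2 + 4 * C / tau + 8 * C * tau) by rewrite /e divfK// gt_eqF.
exact: (trace_arithmetic C0 tau0 eM Hn nG' sG s0 s1 s2 n0 n1 n2).
Qed.

(** The trace inequality applied to differences makes the boundary values of an approximating
    sequence Cauchy, and L2 of the boundary is complete. *)
Lemma exists_trace u : H1 Omega u -> exists g, is_trace Omega u g.
Proof.
move=> hu; have [C [C0 [t0 t00 H]]] := trace_bound_ip.
have [phi [sphi c0 cD]] := exists_smooth_cvg hu.
have uL := H1_L2 hu; have dL v (av : axis v) := wD_L2 av hu.
have pG n := L2_smooth_boundary (sphi n); have pO n := L2_smooth O (sphi n).
have pD v (av : axis v) n := L2_smooth O (smooth_D av (sphi n)).
have k0 := (cvg_ip0 mO (fun n => L2B mO (pO n) uL)).1 c0.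
have kD v (av : axis v) := (cvg_ip0 mO (fun n => L2B mO (pD v av n) (dL v av))).1 (cD v av).
have a1 : axis (e1 : R * R) by left. have a2 : axis (e2 : R * R) by right.
have [g gL gc] : exists2 g, L2 arclength Gamma g & sqint arclength Gamma (fun x => phi n x - g x) @[n --> \oo] --> 0%E.
  apply: (L2_complete mG pG) => eps eps0.
  pose A := C / t0; pose B := C * t0.
  have A0 : 0 <= A by rewrite divr_ge0// ltW.
  have B0 : 0 <= B by rewrite mulr_ge0// ltW.
  pose M := 4 * A + 8 * B + 1.
  have M0 : 0 < M by rewrite /M; lra.
  pose e := eps / M; have e0 : 0 < e by rewrite divr_gt0.
  have fin : A * (4 * e) + B * (4 * e + 4 * e) <= eps.
    have -> : eps = e * M by rewrite /e divfK// gt_eqF.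
    by rewrite /M; lra.
  have near (x : nat -> R) : x n @[n --> \oo] --> (0 : R) -> \forall n \near \oo, x n <= e.
    by move=> /cvgr_lt /(_ _ e0); apply: filterS => n /ltW.
  have [N _ HN] := filterI (near _ k0) (filterI (near _ (kD _ a1)) (near _ (kD _ a2))).
  exists N => i j iN jN.
  have sij : smooth (fun x => phi i x + -1 * phi j x) by apply: smoothD => //; exact: smoothZ.
  have E : (fun x => phi i x - phi j x) = (fun x => phi i x + -1 * phi j x).
    by apply/funext => x; rewrite mulN1r.
  rewrite E (sqint_ip mG (L2_smooth_boundary sij)).
  rewrite lee_fin; apply: le_trans (H _ _ sij t00 (lexx t0)) _; rewrite -/A -/B.
  have cmp (f f' w : R * R -> R) : L2 area Omega f -> L2 area Omega f' -> L2 area Omega w ->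
      ip area Omega (fun x => f x - w x) (fun x => f x - w x) <= e ->
      ip area Omega (fun x => f' x - w x) (fun x => f' x - w x) <= e ->
      ip area Omega (fun x => f x - f' x) (fun x => f x - f' x) <= 4 * e.
    move=> fL fL' wL h h'.
    have := ip_split mO (L2B mO fL fL') (L2B mO wL fL').
    have -> : (fun x => f x - f' x - (w x - f' x)) = (fun x => f x - w x) by apply/funext => x; ring.
    have -> : ip area Omega (fun x => w x - f' x) (fun x => w x - f' x) = ip area Omega (fun x => f' x - w x) (fun x => f' x - w x).
      by apply: eq_Rintegral => x _; ring.
    by move: h h'; lra.
  have [i0 [i1 i2]] := HN i iN; have [j0 [j1 j2]] := HN j jN.
  have h0 : ip area Omega (fun x => phi i x + -1 * phi j x) (fun x => phi i x + -1 * phi j x) <= 4 * e.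
    by rewrite -E; exact: cmp i0 j0.
  have DE v : axis v -> 'D_v (fun x => phi i x + -1 * phi j x) = (fun x => 'D_v (phi i) x - 'D_v (phi j) x).
    move=> av; apply/funext => x; rewrite derive_add//; last exact: smoothZ.
    rewrite derive_mul//; last exact: smooth_cst.
    by rewrite derive_cst mul0r add0r mulN1r.
  have h1 : ip area Omega ('D_e1 (fun x => phi i x + -1 * phi j x)) ('D_e1 (fun x => phi i x + -1 * phi j x)) <= 4 * e.
    by rewrite DE//; exact: cmp (pD _ a1 i) (pD _ a1 j) (dL _ a1) i1 j1.
  have h2 : ip area Omega ('D_e2 (fun x => phi i x + -1 * phi j x)) ('D_e2 (fun x => phi i x + -1 * phi j x)) <= 4 * e.
    by rewrite DE//; exact: cmp (pD _ a2 i) (pD _ a2 j) (dL _ a2) i2 j2.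
  exact: le_trans (lerD (ler_wpM2l A0 h0) (ler_wpM2l B0 (lerD h1 h2))) fin.
by exists g; apply/(is_traceP g hu); split => //; exists phi.
Qed.

Lemma traceP u : H1 Omega u -> is_trace Omega u (trace Omega u).
Proof. by move=> hu; apply: xgetPex; exact: exists_trace. Qed.

Lemma is_trace_lin (c : R) u u' g g' : H1 Omega u -> H1 Omega u' -> is_trace Omega u g -> is_trace Omega u' g' ->
  is_trace Omega (fun x => c * u x + u' x) (fun x => c * g x + g' x).
Proof.
move=> hu hu' /(is_traceP g hu) [gL [phi [[sphi c0 cD] cG]]] /(is_traceP g' hu') [gL' [phi' [[sphi' c0' cD'] cG']]].
apply/(is_traceP _ (H1_lin c hu hu')); split; first exact: (L2D mG (L2Z mG c gL) gL').
have uL := H1_L2 hu; have uL' := H1_L2 hu'.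
have pG n := L2_smooth_boundary (sphi n); have pO n := L2_smooth O (sphi n).
have pG' n := L2_smooth_boundary (sphi' n); have pO' n := L2_smooth O (sphi' n).
exists (fun n x => c * phi n x + phi' n x); split.
  split=> [n||v av]; first by apply: smoothD => //; exact: smoothZ.
    apply: sqint_cvg_eq (cvg_sqint_lin mO c (fun n => (L2B mO (pO n) uL).1) (fun n => (L2B mO (pO' n) uL').1) c0 c0').
    by move=> n x _; ring.
  have pD n := L2_smooth O (smooth_D av (sphi n)); have pD' n := L2_smooth O (smooth_D av (sphi' n)).
  have dL := wD_L2 av hu; have dL' := wD_L2 av hu'.
  have := cvg_sqint_lin mO c (fun n => (L2B mO (pD n) dL).1) (fun n => (L2B mO (pD' n) dL').1) (cD v av) (cD' v av).
  rewrite (_ : (fun n => sqint _ _ _) = (fun n => sqint area Omega (fun x => 'D_v (fun x => c * phi n x + phi' n x) x - wD Omega v (fun x => c * u x + u' x) x)))//.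
  apply/funext => n; apply: ae_eq_sqint => //.
  - by apply: measurable_funD; [apply: measurable_funM; [exact: measurable_cst|exact: (L2B mO (pD n) dL).1]|exact: (L2B mO (pD' n) dL').1].
  - apply: measurable_funB; last exact: (wD_L2 av (H1_lin c hu hu')).1.
    apply: continuous_measurable_dom; apply: smooth_continuous; apply: smooth_D => //.
    by apply: smoothD => //; exact: smoothZ.
  apply: (@filterS _ (almost_everywhere area)) (wD_lin c av hu hu') => x H Ox.
  rewrite H// derive_add//; last exact: smoothZ.
  rewrite derive_mul//; last exact: smooth_cst.
  by rewrite derive_cst mul0r add0r; ring.
apply: sqint_cvg_eq (cvg_sqint_lin mG c (fun n => (L2B mG (pG n) gL).1) (fun n => (L2B mG (pG' n) gL').1) cG cG').
by move=> n x _; ring.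
Qed.

Lemma is_trace_ae0 u g : H1 Omega u -> ip area Omega u u = 0 ->
  (forall v, axis v -> ip area Omega (wD Omega v u) (wD Omega v u) = 0) ->
  is_trace Omega u g -> ip arclength Gamma g g = 0.
Proof.
move=> hu u0 d0 tu; have [C [C0 [t0 t00 H]]] := trace_estimate.
have := H _ _ _ hu tu t00 (lexx _).
have key (a b x y z w : R) : w <= a * x + b * (y + z) -> x = 0 -> y = 0 -> z = 0 -> w <= 0.
  by move=> H0 x0 y0 z0; move: H0; rewrite x0 y0 z0 addr0 !mulr0 addr0.
move=> /key /(_ u0 (d0 _ (or_introl erefl)) (d0 _ (or_intror erefl))) g0.
by apply/eqP; rewrite eq_le g0 ip_ge0.
Qed.

(** The difference is a trace of the zero function, and the trace estimate forces its norm to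
    vanish. *)
Lemma is_trace_unique u g g' : H1 Omega u -> is_trace Omega u g -> is_trace Omega u g' ->
  {ae arclength, forall x, Gamma x -> g x = g' x}.
Proof.
move=> hu tg tg'; have tr := is_trace_lin (-1) hu hu tg' tg.
have zE : (fun x => -1 * u x + u x) = (fun=> 0) by apply/funext => x; ring.
have s0 := smooth_cst (0 : R).
have hz := H1_smooth O s0.
have gL := (is_traceP g hu).1 tg; have gL' := (is_traceP g' hu).1 tg'.
rewrite zE in tr; have dL : L2 arclength Gamma (fun x => -1 * g' x + g x).
  by apply: L2D; [exact: mG|apply: L2Z; [exact: mG|exact: gL'.1]|exact: gL.1].
have g0 : ip arclength Gamma (fun x => -1 * g' x + g x) (fun x => -1 * g' x + g x) = 0.
  apply: (is_trace_ae0 hz _ _ tr); first by apply: Rintegral_eq0 => x _; rewrite mulr0.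
  move=> v av; have wL := wD_L2 av hz.
  have zL : L2 area Omega (fun=> (0 : R)) by exact: L2_0.
  rewrite (ae_eq_ip mO wL zL wL zL); first by apply: Rintegral_eq0 => x _; rewrite mulr0.
    by apply: (@filterS _ (almost_everywhere area)) (wD_smooth O av s0) => x H Ox; rewrite H// derive_cst.
  by apply: (@filterS _ (almost_everywhere area)) (wD_smooth O av s0) => x H Ox; rewrite H// derive_cst.
have : sqint arclength Gamma (fun x => -1 * g' x + g x) = 0%E by rewrite sqint_ip// g0.
move=> /(sqint_eq0 mG dL.1); apply: (@filterS _ (almost_everywhere arclength)) => x H Gx.
by have := H Gx; rewrite mulN1r addrC => /eqP; rewrite subr_eq0 => /eqP.
Qed.

Lemma is_trace_smooth phi : smooth phi -> is_trace Omega phi phi.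
Proof.
move=> sphi; have hphi := H1_smooth O sphi; apply/(is_traceP _ hphi); split; first exact: L2_smooth_boundary.
have z d (T : measurableType d) (mu : {measure set T -> \bar R}) (D : set T) (f : T -> R) :
    (forall x, D x -> f x = 0) -> sqint mu D f @[n --> \oo] --> 0%E.
  move=> f0; rewrite (_ : sqint mu D f = 0%E); first exact: cvg_cst.
  by rewrite /sqint integral0_eq// => x Dx; rewrite f0// expr0n.
exists (fun=> phi); split; last by apply: z => x _; rewrite subrr.
split=> // [|v av]; first by apply: z => x _; rewrite subrr.
rewrite (_ : sqint area Omega (fun x => 'D_v phi x - wD Omega v phi x) = sqint area Omega (fun=> 0)); last first.
  apply: ae_eq_sqint => //; first exact: (L2B mO (L2_smooth O (smooth_D av sphi)) (wD_L2 av hphi)).1.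
  by apply: (@filterS _ (almost_everywhere area)) (wD_smooth O av sphi) => x H Ox; rewrite H// subrr.
exact: z.
Qed.

Lemma trace_smooth phi : smooth phi -> {ae arclength, forall x, Gamma x -> trace Omega phi x = phi x}.
Proof.
move=> sphi; have hphi := H1_smooth O sphi.
exact: (is_trace_unique hphi (traceP hphi) (is_trace_smooth sphi)).
Qed.

Lemma trace_L2 u : H1 Omega u -> L2 arclength Gamma (trace Omega u).
Proof. by move=> hu; have := (is_traceP _ hu).1 (traceP hu) => -[]. Qed.

Lemma trace_lin (c : R) u u' : H1 Omega u -> H1 Omega u' ->
  {ae arclength, forall x, Gamma x -> trace Omega (fun x => c * u x + u' x) x = c * trace Omega u x + trace Omega u' x}.
Proof.
move=> hu hu'; apply: (is_trace_unique (H1_lin c hu hu')); first exact: traceP (H1_lin c hu hu').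
by apply: is_trace_lin => //; exact: traceP.
Qed.

End Trace.
(** * Compactness *)

Section ProductIntegrals.
Context {R : realType}.
Local Notation planeT := (@planeT R).
Local Notation mR := (measurableTypeR R).
Local Notation leb := (@lebesgue_measure R).
Implicit Types (A B : set mR) (H : planeT -> \bar R).
Local Open Scope ereal_scope.

Section restricted.
Variables (A B : set mR) (mA : measurable A) (mB : measurable B).
Variables (H : planeT -> \bar R) (mH : measurable_fun setT H) (H0 : forall x, 0 <= H x).

Let F (x y : mR) : \bar R := (H \_ (A `*` B)) (x, y).

Let F0 x y : 0 <= F x y. Proof. by rewrite /F patchE; case: ifPn. Qed.

Let mF : measurable_fun setT (H \_ (A `*` B)).
Proof.
apply/(measurable_restrictT _ (measurableX mA mB)).
exact: (measurable_funS measurableT (@subsetT _ _) mH).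
Qed.

Let mF' : measurable_fun setT (fun xy : mR * mR => F xy.1 xy.2).
Proof. by move: mF; congr (measurable_fun _ _); apply/funext => -[]. Qed.

Let FE x : x \in A -> \int[leb]_y F x y = \int[leb]_(y in B) H (x, y).
Proof.
move=> xA; rewrite [RHS]integral_mkcond; apply: eq_integral => y _.
by rewrite /F !patchE in_setX/= xA.
Qed.

Let FE' y : y \in B -> \int[leb]_x F x y = \int[leb]_(x in A) H (x, y).
Proof.
move=> yB; rewrite [RHS]integral_mkcond; apply: eq_integral => x _.
by rewrite /F !patchE in_setX/= yB andbT.
Qed.

Lemma integral_setX : \int[area]_(x in A `*` B) H x = \int[leb]_(x in A) \int[leb]_(y in B) H (x, y).
Proof.
rewrite integral_mkcond area_tonelli//; last by move=> x; rewrite patchE; case: ifPn.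
rewrite [RHS]integral_mkcond; apply: eq_integral => x _; rewrite patchE; case: ifPn => xA; first exact: FE.
by rewrite integral0_eq// => y _; rewrite patchE in_setX/= (negbTE xA).
Qed.

Lemma integral_setX_swap : \int[area]_(x in A `*` B) H x = \int[leb]_(y in B) \int[leb]_(x in A) H (x, y).
Proof.
rewrite integral_mkcond area_tonelli//; last by move=> x; rewrite patchE; case: ifPn.
have [_ _ ->] := tonelli_swap (sigma_finiteT leb) (sigma_finiteT leb) mF' F0.
rewrite [RHS]integral_mkcond; apply: eq_integral => y _; rewrite patchE; case: ifPn => yB; first exact: FE'.
by rewrite integral0_eq// => x _; rewrite /F patchE in_setX/= (negbTE yB) andbF.
Qed.

Lemma measurable_inner_l : measurable_fun A (fun x => \int[leb]_(y in B) H (x, y)).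
Proof.
have [m _ _] := tonelli_swap (sigma_finiteT leb) (sigma_finiteT leb) mF' F0.
by apply: (eq_measurable_fun _ (fun x xA => FE xA)); exact: (measurable_funS measurableT (@subsetT _ _) m).
Qed.

Lemma measurable_inner_r : measurable_fun B (fun y => \int[leb]_(x in A) H (x, y)).
Proof.
have [_ m _] := tonelli_swap (sigma_finiteT leb) (sigma_finiteT leb) mF' F0.
by apply: (eq_measurable_fun _ (fun x xA => FE' xA)); exact: (measurable_funS measurableT (@subsetT _ _) m).
Qed.

End restricted.
End ProductIntegrals.

Lemma ge0_integral_affine d (T : measurableType d) (R : realType) (mu : {measure set T -> \bar R})
    (D : set T) (a b : \bar R) (c : R) (g : T -> \bar R) : measurable D -> mu D = b -> (0 <= a)%E -> 0 <= c ->
  measurable_fun D g -> (forall x, D x -> 0 <= g x)%E ->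
  (\int[mu]_(x in D) (a + c%:E * g x) = a * b + c%:E * \int[mu]_(x in D) g x)%E.
Proof.
move=> mD <- a0 c0 mg g0; rewrite ge0_integralD//.
- by rewrite integral_cst// ge0_integralZl_EFin.
- by move=> x Dx; rewrite mule_ge0// g0.
- exact: measurable_funeM.
Qed.

(** * Poincare's inequality on a square *)

Section Poincare.
Context {R : realType}.
Local Notation planeT := (@planeT R).
Local Notation mR := (measurableTypeR R).
Local Notation leb := (@lebesgue_measure R).
Implicit Types (phi : R * R -> R).

(** Half-open, so that the cells of a grid are disjoint and leave no gaps. *)
Definition cell (p : R * R) (d : R) : set (R * R) :=
  `[p.1, p.1 + d[%classic `*` `[p.2, p.2 + d[%classic.

Section cell.
Variables (p : R * R) (d : R).
Hypothesis d0 : 0 < d.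
Let A : set mR := `[p.1, p.1 + d[%classic.
Let B : set mR := `[p.2, p.2 + d[%classic.
Local Notation Q := (cell p d).

Let mA : measurable A := measurable_itv _.
Let mB : measurable B := measurable_itv _.

Let lA : leb A = d%:E.
Proof. by rewrite /A lebesgue_measure_itv/= lte_fin ltrDl d0 -EFinB addrAC subrr add0r. Qed.
Let lB : leb B = d%:E.
Proof. by rewrite /B lebesgue_measure_itv/= lte_fin ltrDl d0 -EFinB addrAC subrr add0r. Qed.

Lemma measurable_cell : measurable (Q : set planeT).
Proof. exact: measurableX. Qed.

Lemma area_cell : area (Q : set planeT) = (d ^+ 2)%:E.
Proof. by rewrite /cell area_setX// -/A -/B expr2 EFinM -{1}lA -lB. Qed.

Lemma cell_csq : Q `<=` csq p d.
Proof.
move=> x []; rewrite /= !in_itv/= => /andP[h1 h2] /andP[h3 h4].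
by rewrite /csq/= !ger0_norm ?subr_ge0//; split; lra.
Qed.

Let Qoo : (area (Q : set planeT) < +oo)%E. Proof. by rewrite area_cell ltry. Qed.

Lemma L2_smooth_cell phi : smooth phi -> L2 area Q phi.
Proof.
move=> /smooth_continuous cphi; have [M _ HM] := compact_bounded_fun (@compact_csq R p d) cphi.
apply: (L2_bounded measurable_cell Qoo (M := M)) => [|x /cell_csq/HM//].
exact: (measurable_funS measurableT (@subsetT _ _) (continuous_measurable_plane cphi)).
Qed.

Section smooth.
Variable phi : R * R -> R.
Hypothesis sphi : smooth phi.

Let H1' (x : planeT) : \bar R := ('D_e1 phi x ^+ 2)%:E.
Let H2' (x : planeT) : \bar R := ('D_e2 phi x ^+ 2)%:E.
Let g1 (y : mR) : \bar R := (\int[leb]_(s in A) H1' (s, y))%E.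
Let g2 (x : mR) : \bar R := (\int[leb]_(t in B) H2' (x, t))%E.

Let mH1 : measurable_fun setT H1'.
Proof. by apply: measurable_sq; apply: continuous_measurable_plane; apply: smooth_continuous; exact: smooth_D1. Qed.
Let mH2 : measurable_fun setT H2'.
Proof. by apply: measurable_sq; apply: continuous_measurable_plane; apply: smooth_continuous; exact: smooth_D2. Qed.
Let H10 x : (0 <= H1' x)%E. Proof. by rewrite lee_fin sqr_ge0. Qed.
Let H20 x : (0 <= H2' x)%E. Proof. by rewrite lee_fin sqr_ge0. Qed.
Let g10 y : (0 <= g1 y)%E. Proof. by apply: integral_ge0 => s _; exact: H10. Qed.
Let g20 y : (0 <= g2 y)%E. Proof. by apply: integral_ge0 => s _; exact: H20. Qed.

Let increment (F F' : R -> R) (c : R) (I : set mR) s t : I = `[c, c + d[%classic ->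
  (forall t, is_derive t (1 : R) F (F' t)) -> continuous F' -> I s -> I t ->
  (((F s - F t) ^+ 2)%:E <= d%:E * \int[leb]_(r in I) (F' r ^+ 2)%:E)%E.
Proof.
move=> IE dF cF'; wlog st : s t / s < t => [hw|].
  move=> Is It; have [st|ts|->] := ltgtP s t; first exact: hw.
    by rewrite -opprB sqrrN; exact: hw.
  rewrite subrr expr0n/=; apply: mule_ge0; first by rewrite lee_fin ltW.
  by apply: integral_ge0 => x _; rewrite lee_fin sqr_ge0.
rewrite IE /= !in_itv/= => /andP[s1 s2] /andP[t1 t2].
rewrite -opprB sqrrN; apply: le_trans (sq_increment_le st dF cF') _.
have mF2 : measurable_fun (setT : set mR) (fun t => (F' t ^+ 2)%:E).
  by apply/measurable_EFinP/measurable_funX; exact: continuous_measurable_fun.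
apply: lee_pmul.
- by rewrite lee_fin subr_ge0 ltW.
- by apply: integral_ge0 => x _; rewrite lee_fin sqr_ge0.
- by rewrite lee_fin; lra.
apply: ge0_subset_integral; [exact: measurable_itv|exact: measurable_itv| | |].
- exact: measurable_funS mF2.
- by move=> x _; rewrite lee_fin sqr_ge0.
- by move=> x; rewrite /= !in_itv/= => /andP[h1 h2]; apply/andP; split; lra.
Qed.

Let cD1 (y : R) : continuous (fun s => 'D_e1 phi (s, y)).
Proof.
move=> s; have c := @continuous_pair R R (fun s : R => s) (fun=> y) (fun z => @cvg_id _ _) (fun z => cvg_cst _).
apply: (@continuous_comp _ _ _ (fun s : R => (s, y)) ('D_e1 phi)).
  exact: c.
exact: smooth_continuous (smooth_D1 sphi) _.
Qed.

Let cD2 (x : R) : continuous (fun t => 'D_e2 phi (x, t)).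
Proof.
move=> s; have c := @continuous_pair R R (fun=> x) (fun t : R => t) (fun z => cvg_cst _) (fun z => @cvg_id _ _).
apply: (@continuous_comp _ _ _ (fun t : R => (x, t)) ('D_e2 phi)).
  exact: c.
exact: smooth_continuous (smooth_D2 sphi) _.
Qed.

(** From [x] to [y] along a horizontal and then a vertical segment; the corner is [(y.1, x.2)], and
    each increment is bounded by the energy of its whole line. *)
Let pointwise x y : Q x -> Q y ->
  (((phi x - phi y) ^+ 2)%:E <= (2 * d)%:E * g1 x.2 + (2 * d)%:E * g2 y.1)%E.
Proof.
move=> [x1 x2] [y1 y2].
have h1 := increment (erefl A) (fun s => is_derive_fst s x.2 sphi) (@cD1 x.2) x1 y1.
have h2 := increment (erefl B) (fun t => is_derive_snd y.1 t sphi) (@cD2 y.1) x2 y2.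
apply: (@le_trans _ _ (2 * (phi (x.1, x.2) - phi (y.1, x.2)) ^+ 2 + 2 * (phi (y.1, x.2) - phi (y.1, y.2)) ^+ 2)%:E).
  rewrite lee_fin -!surjective_pairing.
  move: (phi x) (phi y) (phi (y.1, x.2)) => a b c.
  by have := sqr_ge0 (a - 2 * c + b); nra.
have key (a : R) (g : \bar R) : (a%:E <= d%:E * g)%E -> ((2 * a)%:E <= (2 * d)%:E * g)%E.
  by move=> ag; rewrite EFinM (EFinM 2 d) -muleA; apply: lee_wpmul2l.
by rewrite EFinD; apply: leeD; apply: key; [exact: h1|exact: h2].
Qed.

Let G1 : R := ip area Q ('D_e1 phi) ('D_e1 phi).
Let G2 : R := ip area Q ('D_e2 phi) ('D_e2 phi).

Let intg1 : (\int[leb]_(y in B) g1 y = G1%:E)%E.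
Proof.
rewrite /G1 -sqint_ip; [|exact: measurable_cell|exact: L2_smooth_cell (smooth_D1 sphi)].
by rewrite /sqint (integral_setX_swap mA mB mH1 H10).
Qed.

Let intg2 : (\int[leb]_(x in A) g2 x = G2%:E)%E.
Proof.
rewrite /G2 -sqint_ip; [|exact: measurable_cell|exact: L2_smooth_cell (smooth_D2 sphi)].
by rewrite /sqint (integral_setX mA mB mH2 H20).
Qed.

Let mg1 : measurable_fun B g1. Proof. exact: (measurable_inner_r mA mB mH1 H10). Qed.
Let mg2 : measurable_fun A g2. Proof. exact: (measurable_inner_l mA mB mH2 H20). Qed.

Let mext (I : set mR) (g : mR -> \bar R) : measurable I -> measurable_fun I g -> measurable_fun setT (g \_ I).
Proof. by move=> mI mg; apply/(measurable_restrictT _ mI). Qed.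

Let fst_integral (g : mR -> \bar R) : measurable_fun A g -> (forall x, 0 <= g x)%E ->
  measurable_fun (Q : set planeT) (fun x => g x.1) /\
  (\int[area]_(x in Q) g x.1 = d%:E * \int[leb]_(x in A) g x)%E.
Proof.
move=> mg g0; have mg' : measurable_fun setT (fun x : planeT => (g \_ A) x.1).
  exact: (measurableT_comp (mext mA mg) measurable_fst_plane).
have E x : x \in Q -> (g \_ A) x.1 = g x.1 by move=> /set_mem [x1 _]; rewrite patchE mem_set.
split; first by apply: (eq_measurable_fun _ E); exact: (measurable_funS measurableT (@subsetT _ _) mg').
have -> : (\int[area]_(x in Q) g x.1 = \int[area]_(x in Q) (g \_ A) x.1)%E.
  by apply: eq_integral => x xQ; rewrite E.
rewrite (integral_setX mA mB mg'); last by move=> x; rewrite patchE; case: ifPn.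
rewrite -ge0_integralZl_EFin//; last exact: ltW.
by apply: eq_integral => x xA /=; rewrite integral_cst// patchE xA -lB muleC.
Qed.

Let snd_integral (g : mR -> \bar R) : measurable_fun B g -> (forall x, 0 <= g x)%E ->
  measurable_fun (Q : set planeT) (fun x => g x.2) /\
  (\int[area]_(x in Q) g x.2 = d%:E * \int[leb]_(x in B) g x)%E.
Proof.
move=> mg g0; have mg' : measurable_fun setT (fun x : planeT => (g \_ B) x.2).
  exact: (measurableT_comp (mext mB mg) measurable_snd_plane).
have E x : x \in Q -> (g \_ B) x.2 = g x.2 by move=> /set_mem [_ x2]; rewrite patchE mem_set.
split; first by apply: (eq_measurable_fun _ E); exact: (measurable_funS measurableT (@subsetT _ _) mg').
have -> : (\int[area]_(x in Q) g x.2 = \int[area]_(x in Q) (g \_ B) x.2)%E.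
  by apply: eq_integral => x xQ; rewrite E.
rewrite (integral_setX_swap mA mB mg'); last by move=> x; rewrite patchE; case: ifPn.
rewrite -ge0_integralZl_EFin//; last exact: ltW.
by apply: eq_integral => x xB /=; rewrite integral_cst// patchE xB -lA muleC.
Qed.

Let S : R := \int[area]_(x in Q) phi x.

Let mQ := measurable_cell.
Let phiL := L2_smooth_cell sphi.

Let oneL : L2 area Q (fun=> (1 : R)) := L2_cst 1 mQ Qoo.

Let one_one : ip area Q (fun=> 1) (fun=> 1) = d ^+ 2.
Proof.
rewrite /ip /Rintegral; under eq_integral do rewrite mulr1.
by rewrite integral_cst// mul1e [X in fine X](_ : _ = (d ^+ 2)%:E)//; exact: area_cell.
Qed.

Let phi_one : ip area Q phi (fun=> 1) = S.
Proof. by rewrite /ip /S; apply: eq_Rintegral => x _; rewrite mulr1. Qed.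

(** The left side is the square of the integral over [y] of [phi x - phi y]; Cauchy-Schwarz against
    1 and [pointwise] bound it. *)
Let average x : Q x -> (((d ^+ 2 * phi x - S) ^+ 2)%:E <= (2 * d ^+ 5)%:E * g1 x.2 + (2 * d ^+ 4 * G2)%:E)%E.
Proof.
move=> Qx; have cL : L2 area Q (fun=> phi x) := L2_cst (phi x) mQ Qoo.
have dL : L2 area Q (fun y => phi x - phi y) by exact: L2B.
have e1 : ip area Q (fun y => phi x - phi y) (fun=> 1) = d ^+ 2 * phi x - S.
  have -> : (fun y => phi x - phi y) = (fun y => -1 * phi y + phi x * 1).
    by apply/funext => y; ring.
  rewrite ip_lin//; last exact: L2Z.
  have -> : ip area Q (fun=> phi x * 1) (fun=> 1) = phi x * d ^+ 2.
    have z0 : L2 area Q (fun=> (0 : R)) by exact: L2_0.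
    have := ip_lin mQ (phi x) oneL z0 oneL; rewrite one_one.
    rewrite (_ : (fun=> phi x * 1 + 0) = (fun=> phi x * 1)); last by apply/funext => y; rewrite addr0.
    by move=> ->; rewrite [X in _ + X](_ : _ = 0) ?addr0//; apply: Rintegral_eq0 => y _; rewrite mul0r.
  by rewrite phi_one; ring.
have := ip_CS mQ dL oneL; rewrite e1 one_one -lee_fin => /le_trans; apply.
rewrite EFinM -sqint_ip//.
have [m2 E2] := fst_integral mg2 g20.
have : (sqint area Q (fun y => (phi x - phi y)%R) <= (2 * d ^+ 3)%:E * g1 x.2 + (2 * d ^+ 2 * G2)%:E)%E.
  apply: (@le_trans _ _ (\int[area]_(y in Q) ((2 * d)%:E * g1 x.2 + (2 * d)%:E * g2 y.1))%E).
    apply: ge0_le_integral => //.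
    - by move=> y _; rewrite lee_fin sqr_ge0.
    - exact: measurable_sq dL.1.
    - apply: emeasurable_funD; first exact: measurable_cst.
      exact: measurable_funeM.
    - by move=> y Qy; exact: pointwise.
  have dd : 0 <= 2 * d by rewrite mulr_ge0// ltW.
  have a0 : (0 <= (2 * d)%:E * g1 x.2)%E by apply: mule_ge0; [rewrite lee_fin|exact: g10].
  rewrite (ge0_integral_affine mQ area_cell a0 dd m2 (fun y _ => g20 y.1)) E2 intg2.
  rewrite -!EFinM muleAC -EFinM; apply: leeD; last by rewrite lee_fin; lra.
  by rewrite le_eqVlt; apply/orP; left; apply/eqP; congr (_%:E * _)%E; ring.
move=> /(lee_wpmul2r (x := (d ^+ 2)%:E)); rewrite lee_fin sqr_ge0 => /(_ isT) /le_trans; apply.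
rewrite ge0_muleDl ?lee_fin ?mule_ge0 ?lee_fin ?mulr_ge0 ?exprn_ge0 ?(ltW d0) ?ip_ge0//.
rewrite -EFinM muleAC -EFinM; apply: leeD; last by rewrite lee_fin; lra.
by rewrite le_eqVlt; apply/orP; left; apply/eqP; congr (_%:E * _)%E; ring.
Qed.

(** [average] is integrated over [x]; the integral of the square of [d ^+ 2 * phi x - S] expands to
    [d ^+ 4] times the mass minus [d ^+ 2 * S ^+ 2]. *)
Lemma poincare_smooth : ip area Q phi phi <= (d ^+ 2)^-1 * S ^+ 2 + 2 * d ^+ 2 * (G1 + G2).
Proof.
have d5 : 0 <= 2 * d ^+ 5 by rewrite mulr_ge0// exprn_ge0// ltW.
have d4 : 0 <= 2 * d ^+ 4 * G2 by rewrite !mulr_ge0 ?exprn_ge0 ?ip_ge0// ltW.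
have dS : L2 area Q (fun x => d ^+ 2 * phi x + - S * 1).
  by apply: L2D => //; [exact: L2Z|exact: L2Z].
have lin : ip area Q (fun x => d ^+ 2 * phi x + - S * 1) (fun x => d ^+ 2 * phi x + - S * 1) =
    d ^+ 4 * ip area Q phi phi - d ^+ 2 * S ^+ 2.
  have SL : L2 area Q (fun=> - S * 1 : R) by exact: L2Z.
  have Sv v : L2 area Q v -> ip area Q (fun=> - S * 1) v = - S * ip area Q (fun=> 1) v.
    move=> vL; have z0 : L2 area Q (fun=> (0 : R)) by exact: L2_0.
    have := ip_lin mQ (- S) oneL z0 vL.
    rewrite (_ : (fun=> - S * 1 + 0) = (fun=> - S * 1)); last by apply/funext => y; rewrite addr0.
    by move=> ->; rewrite [X in _ + X](_ : _ = 0) ?addr0//; apply: Rintegral_eq0 => y _; rewrite mul0r.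
  pose k x := d ^+ 2 * phi x + - S * 1; have kL : L2 area Q k by [].
  have e v : L2 area Q v -> ip area Q k v = d ^+ 2 * ip area Q phi v + - S * ip area Q (fun=> 1) v.
    by move=> vL; rewrite /k ip_lin// Sv.
  change (ip area Q k k = d ^+ 4 * ip area Q phi phi - d ^+ 2 * S ^+ 2).
  have c1 := etrans (ipC area Q phi k) (e _ phiL).
  have c2 := etrans (ipC area Q (fun=> 1) k) (e _ oneL).
  have c3 := etrans (ipC area Q (fun=> 1) phi) phi_one.
  by rewrite (e k kL) c1 c2 c3 one_one phi_one; ring.
have : ((d ^+ 4 * ip area Q phi phi - d ^+ 2 * S ^+ 2)%:E <= (2 * d ^+ 6 * (G1 + G2))%:E)%E.
  rewrite -lin -sqint_ip//.
  have [m1 E1] := snd_integral mg1 g10.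
  apply: (@le_trans _ _ (\int[area]_(x in Q) ((2 * d ^+ 5)%:E * g1 x.2 + (2 * d ^+ 4 * G2)%:E))%E).
    apply: ge0_le_integral => //.
    - by move=> y _; rewrite lee_fin sqr_ge0.
    - exact: measurable_sq dS.1.
    - apply: emeasurable_funD; [exact: measurable_funeM|exact: measurable_cst].
    - by move=> x Qx; rewrite mulr1; exact: average.
  under eq_integral do rewrite addeC.
  rewrite (ge0_integral_affine mQ area_cell (_ : 0 <= (2 * d ^+ 4 * G2)%:E)%E d5 m1 (fun y _ => g10 y.2)) ?lee_fin// E1 intg1.
  by rewrite -!EFinM -EFinD lee_fin; lra.
rewrite lee_fin => H.
have d40 : 0 < d ^+ 4 by exact: exprn_gt0.
rewrite -(ler_pM2l d40).
have -> : d ^+ 4 * ((d ^+ 2)^-1 * S ^+ 2 + 2 * d ^+ 2 * (G1 + G2)) = d ^+ 2 * S ^+ 2 + 2 * d ^+ 6 * (G1 + G2).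
  by field; exact: lt0r_neq0.
lra.
Qed.

End smooth.
End cell.
End Poincare.

(** * Limits on subsets, covers and packings *)

Section L2Limits.
Context d (T : measurableType d) (R : realType) (mu : {measure set T -> \bar R}).
Implicit Types (D E : set T) (f g : T -> R).

Lemma L2_subset D E f : measurable D -> measurable E -> D `<=` E -> L2 mu E f -> L2 mu D f.
Proof.
move=> mD mE DE [mf f2]; have mfD := measurable_funS mE DE mf; split=> //.
apply: le_lt_trans f2; apply: ge0_subset_integral => //; first exact: measurable_sq.
by move=> x _; rewrite lee_fin sqr_ge0.
Qed.

Lemma sqint_subset D E f : measurable D -> measurable E -> D `<=` E -> measurable_fun E f ->
  (sqint mu D f <= sqint mu E f)%E.
Proof.
move=> mD mE DE mf; apply: ge0_subset_integral => //; first exact: measurable_sq.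
by move=> x _; rewrite lee_fin sqr_ge0.
Qed.

Lemma ip_subset D E f : measurable D -> measurable E -> D `<=` E -> L2 mu E f ->
  ip mu D f f <= ip mu E f f.
Proof.
move=> mD mE DE fL; rewrite -lee_fin -!sqint_ip//; last exact: L2_subset fL.
by apply: sqint_subset => //; exact: fL.1.
Qed.

Lemma cvg_sqint_subset D E (f_ : nat -> T -> R) : measurable D -> measurable E -> D `<=` E ->
  (forall n, measurable_fun E (f_ n)) -> sqint mu E (f_ n) @[n --> \oo] --> 0%E ->
  sqint mu D (f_ n) @[n --> \oo] --> 0%E.
Proof.
move=> mD mE DE mf /(cvge0P (fun n => sqint_ge0 mu E (f_ n))) H.
apply/(cvge0P (fun n => sqint_ge0 mu D (f_ n))) => e e0.
by apply: filterS (H _ e0) => n; apply: le_trans; exact: sqint_subset.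
Qed.

Lemma cvg_ip_diag D (f_ : nat -> T -> R) f : measurable D -> (forall n, L2 mu D (f_ n)) -> L2 mu D f ->
  sqint mu D (fun x => f_ n x - f x) @[n --> \oo] --> 0%E ->
  ip mu D (f_ n) (f_ n) @[n --> \oo] --> ip mu D f f.
Proof.
move=> mD fnL fL H.
have c1 := cvg_ip mD fnL fL fL H.
have c0 := (cvg_ip0 mD (fun n => L2B mD (fnL n) fL)).1 H.
have E n : ip mu D (f_ n) (f_ n) = ip mu D (fun x => f_ n x - f x) (fun x => f_ n x - f x) +
    2 * ip mu D (f_ n) f - ip mu D f f.
  pose k x := -1 * f x + f_ n x.
  have kE : (fun x => f_ n x - f x) = k by apply/funext => x; rewrite /k mulN1r addrC.
  have e v : L2 mu D v -> ip mu D k v = -1 * ip mu D f v + ip mu D (f_ n) v by move=> vL; exact: ip_lin.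
  have kL : L2 mu D k by apply: L2D => //; exact: L2Z.
  rewrite kE (e k kL) (etrans (ipC mu D f k) (e f fL)) (etrans (ipC mu D (f_ n) k) (e _ (fnL n))).
  by rewrite (ipC mu D f (f_ n)); ring.
under eq_fun do rewrite E.
have -> : nbhs (ip mu D f f) = nbhs (0 + 2 * ip mu D f f - ip mu D f f) by congr nbhs; ring.
apply: (cvgB (f := fun n => ip mu D (fun x => f_ n x - f x) (fun x => f_ n x - f x) + 2 * ip mu D (f_ n) f)
  (g := fun=> ip mu D f f)); last exact: cvg_cst.
apply: (cvgD (f := fun n => ip mu D (fun x => f_ n x - f x) (fun x => f_ n x - f x))
  (g := fun n => 2 * ip mu D (f_ n) f)); first exact: c0.
by apply: (cvgM (f := fun=> 2)); [exact: cvg_cst|exact: c1].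
Qed.

End L2Limits.

Section Packing.
Context {R : realType}.

Lemma integral_cover_le_fin d (T : measurableType d) (mu : {measure set T -> \bar R}) (A : set T) (I : finType)
    (B : I -> set T) (F : T -> \bar R) : measurable A -> (forall i, measurable (B i)) ->
  A `<=` \bigcup_i B i -> measurable_fun A F -> (forall x, A x -> 0 <= F x)%E ->
  (\int[mu]_(x in A) F x <= \sum_i \int[mu]_(x in A `&` B i) F x)%E.
Proof.
move=> mA mB AB mF F0.
have mFB i : measurable_fun A (F \_ (B i)).
  by apply/(measurable_restrict _ (mB i) mA); apply: measurable_funS mF => //; exact: subIsetl.
have FB0 i x : A x -> (0 <= (F \_ (B i)) x)%E.
  by move=> Ax; rewrite patchE; case: ifPn => // _; exact: F0.
under eq_bigr do rewrite integral_mkcondr.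
rewrite -ge0_integral_sum//.
apply: ge0_le_integral => //.
- by apply: emeasurable_sum => i _; exact: mFB.
move=> x Ax; have [i _ Bx] := AB x Ax.
rewrite (bigD1 i)//= patchE mem_set// leeDl// sume_ge0// => j _; exact: FB0.
Qed.

Lemma integral_packing_le d (T : measurableType d) (mu : {measure set T -> \bar R}) (A : set T) (I : finType)
    (B : I -> set T) (F : T -> \bar R) : measurable A -> (forall i, measurable (B i)) ->
  (forall i, B i `<=` A) -> (forall i j x, B i x -> B j x -> i = j) ->
  measurable_fun A F -> (forall x, A x -> 0 <= F x)%E ->
  (\sum_i \int[mu]_(x in B i) F x <= \int[mu]_(x in A) F x)%E.
Proof.
move=> mA mB BA dB mF F0.
have mFB i : measurable_fun A (F \_ (B i)).
  by apply/(measurable_restrict _ (mB i) mA); apply: measurable_funS mF => //; exact: subIsetl.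
have FB0 i x : A x -> (0 <= (F \_ (B i)) x)%E.
  by move=> Ax; rewrite patchE; case: ifPn => // _; exact: F0.
have E i : (\int[mu]_(x in B i) F x = \int[mu]_(x in A) (F \_ (B i)) x)%E.
  by rewrite -integral_mkcondr; congr (integral _ _ _); rewrite setIC; apply/esym/setIidPl.
under eq_bigr do rewrite E.
rewrite -ge0_integral_sum//.
apply: ge0_le_integral => //.
- by move=> x Ax; apply: sume_ge0 => i _; exact: FB0.
- by apply: emeasurable_sum => i _; exact: mFB.
move=> x Ax; have [[i Bx]|nB] := pselect (exists i, B i x).
  rewrite (bigD1 i)//= patchE mem_set// big1 ?adde0// => j ji.
  by rewrite patchE memNset// => Bj; move: ji; rewrite (dB _ _ _ Bj Bx) eqxx.
rewrite big1 ?F0// => i _; rewrite patchE memNset// => Bx; apply: nB; by exists i.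
Qed.

End Packing.

(** * Strips and small squares for functions of H1 *)

Section Rellich.
Context {R : realType}.
Local Notation planeT := (@planeT R).
Variable O : @bounded_domain R.
Local Notation Omega := (dom O).
Local Notation Gamma := (boundary (dom O)).
Hypothesis HL : lipschitz_boundary Omega.
Implicit Types (p : R * R) (d : R) (u : R * R -> R) (w : h1 O).

Let mO := measurable_dom O.

Section limits.
Variables (u : R * R -> R) (hu : H1 Omega u).
Variables (D : set (R * R)) (mD : measurable (D : set planeT)) (DO : D `<=` Omega).
Variable phi : nat -> R * R -> R.
Hypothesis cphi : smooth_cvg O u phi.

Let sphi n : smooth (phi n). Proof. by have [] := cphi. Qed.

Lemma smooth_cvg_ip : ip area D (phi n) (phi n) @[n --> \oo] --> ip area D u u.
Proof.
have [_ c0 _] := cphi; have uL := H1_L2 hu; have pL n := L2_smooth O (sphi n).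
apply: (cvg_ip_diag mD) => [n||]; [exact: L2_subset (pL n)|exact: L2_subset uL|].
by apply: (cvg_sqint_subset mD mO DO) c0 => n; exact: (L2B mO (pL n) uL).1.
Qed.

Lemma smooth_cvg_ipD v : axis v ->
  ip area D ('D_v (phi n)) ('D_v (phi n)) @[n --> \oo] --> ip area D (wD Omega v u) (wD Omega v u).
Proof.
move=> av; have [_ _ cD] := cphi; have uL := wD_L2 av hu; have pL n := L2_smooth O (smooth_D av (sphi n)).
apply: (cvg_ip_diag mD) => [n||]; [exact: L2_subset (pL n)|exact: L2_subset uL|].
by apply: (cvg_sqint_subset mD mO DO) (cD v av) => n; exact: (L2B mO (pL n) uL).1.
Qed.

Lemma smooth_cvg_Rintegral : \int[area]_(x in D) phi n x @[n --> \oo] --> \int[area]_(x in D) u x.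
Proof.
have [_ c0 _] := cphi; have uL := H1_L2 hu; have pL n := L2_smooth O (sphi n).
have Doo : (area (D : set planeT) < +oo)%E.
  by apply: le_lt_trans (area_dom_fin O); apply: le_measure; rewrite ?inE.
have := cvg_ip mD (fun n => L2_subset mD mO DO (pL n)) (L2_subset mD mO DO uL) (L2_cst 1 mD Doo)
  (cvg_sqint_subset mD mO DO (fun n => (L2B mO (pL n) uL).1) c0).
have E f : ip area D f (fun=> 1) = \int[area]_(x in D) f x.
  by apply: eq_Rintegral => x _; rewrite mulr1.
by rewrite E; under eq_fun do rewrite E.
Qed.

End limits.

Lemma cvg_le_real (x y : nat -> R) (a b : R) : (forall n, x n <= y n) ->
  x n @[n --> \oo] --> a -> y n @[n --> \oo] --> b -> a <= b.
Proof. by move=> xy cx cy; apply: (ler_cvg_to cx cy); exact: nearW. Qed.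

Lemma poincare_H1 p d u : 0 < d -> cell p d `<=` Omega -> H1 Omega u ->
  ip area (cell p d) u u <= (d ^+ 2)^-1 * (\int[area]_(x in cell p d) u x) ^+ 2 +
    2 * d ^+ 2 * (ip area (cell p d) (wD Omega e1 u) (wD Omega e1 u) +
                  ip area (cell p d) (wD Omega e2 u) (wD Omega e2 u)).
Proof.
move=> d0 QO hu; have [phi cphi] := exists_smooth_cvg HL hu.
have mQ := measurable_cell p d; have [sphi _ _] := cphi.
apply: (cvg_le_real (fun n => poincare_smooth p d0 (sphi n))).
  exact: (smooth_cvg_ip hu mQ QO cphi).
apply: cvgD.
  apply: cvgM; first exact: cvg_cst.
  have c := smooth_cvg_Rintegral hu mQ QO cphi.
  by under eq_fun do rewrite expr2; rewrite expr2; exact: (cvgM c c).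
apply: cvgM; first exact: cvg_cst.
by apply: cvgD; apply: smooth_cvg_ipD => //; [left|right].
Qed.

Lemma strip_H1 (K : chart O) (tau tau' : R) u : 0 < tau' -> tau' <= tau -> tau <= ch_tau K -> H1 Omega u ->
  tau * ip area (strip K tau') u u <= tau' * (2 * ip area Omega u u +
    2 * tau ^+ 2 * (ip area Omega (wD Omega e1 u) (wD Omega e1 u) + ip area Omega (wD Omega e2 u) (wD Omega e2 u))).
Proof.
move=> t0 tt tK hu; have [phi cphi] := exists_smooth_cvg HL hu; have [sphi _ _] := cphi.
have tau0 : 0 < tau by exact: lt_le_trans tt.
have mS := measurable_strip K tau'; have SO := strip_dom (le_trans tt tK).
have le n : tau * ip area (strip K tau') (phi n) (phi n) <= tau' * (2 * ip area Omega (phi n) (phi n) +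
    2 * tau ^+ 2 * (ip area Omega ('D_e1 (phi n)) ('D_e1 (phi n)) + ip area Omega ('D_e2 (phi n)) ('D_e2 (phi n)))).
  have pL := L2_smooth O (sphi n).
  have G := ip_sum2 mO (L2_smooth O (smooth_D (or_introl erefl) (sphi n))) (L2_smooth O (smooth_D (or_intror erefl) (sphi n))).
  have h := le_trans (strip_le K (sphi n) t0 tt) (lee_wpmul2l (ltW t0 : 0 <= tau'%:E)%E (tube_energy_le (sphi n) tau0 tK)).
  move: h; rewrite (sqint_ip mS (L2_subset mS mO SO pL)) (sqint_ip mO pL).
  have -> : (\int[area]_(x in Omega) (grad2 (phi n) x)%:E)%E = _ := G.
  by rewrite -lee_fin !(EFinM, EFinD).
have mOO : Omega `<=` Omega by [].
apply: (cvg_le_real le).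
  by apply: cvgM; [exact: cvg_cst|exact: (smooth_cvg_ip hu mS SO cphi)].
apply: cvgM; first exact: cvg_cst.
apply: cvgD; (apply: cvgM; first exact: cvg_cst); first exact: (smooth_cvg_ip hu mO mOO cphi).
by apply: cvgD; apply: smooth_cvg_ipD => //; [left|right].
Qed.

Lemma lebesgue_number (K : set (R * R)) : compact K -> K `<=` Omega ->
  exists2 eta : R, 0 < eta & forall x, K x -> csq x eta `<=` Omega.
Proof.
move=> cK KO.
have ex x : exists e : R, K x -> 0 < e /\ csq x e `<=` Omega.
  have [Kx|] := pselect (K x); last by exists 0.
  by have [e e0 eO] := nbhs_csq (open_nbhs_nbhs (conj (@dom_open _ O) (KO x Kx))); exists e.
have [e eP] := choice ex.
have nb x : K x -> nbhs x (csq x (e x / 2)) by move=> /eP[e0 _]; apply: nbhs_of_csq; rewrite divr_gt0.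
have [s [sK sU]] := compact_cover_seq cK nb.
have e0 (i : 'I_(size s)) : 0 < e (tnth (in_tuple s) i) / 2.
  by rewrite divr_gt0//; exact: (eP _ (sK _ (mem_tnth i (in_tuple s)))).1.
have [m m0 mle] := common_lower_bound e0; exists m => // y Ky z [z1 z2].
have [x xs [x1 x2]] := sU y Ky.
have is_ : (index x s < size s)%N by rewrite index_mem.
have := mle (Ordinal is_); rewrite (tnth_nth x)/= nth_index// => mx.
apply: (eP x (sK x xs)).2; move: z1 z2 x1 x2 mx.
rewrite /csq/= !ler_norml => /andP[? ?] /andP[? ?] /andP[? ?] /andP[? ?] ?.
by split; apply/andP; split; lra.
Qed.

(** Take the closure minus the tubes: a point of the closure outside the domain lies on the
    boundary, at height 0 in some chart, hence in a tube however thin. *)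
Lemma interior_compact n (K : 'I_n -> chart O) (tau : R) : 0 < tau -> Gamma `<=` \bigcup_i half_tube (K i) ->
  exists C : set (R * R), [/\ compact C, C `<=` Omega & Omega `<=` C `|` \bigcup_i tube (K i) tau].
Proof.
move=> tau0 GK; pose U := \bigcup_i tube (K i) tau.
have oU : open U by apply: bigcup_open => i _; exact: open_tube.
exists (closure Omega `\` U); split.
- rewrite setDE; apply: (@subclosed_compact _ _ (csq (0, 0) (dom_radius O))).
  + by apply: closedI; [exact: closed_closure|exact: open_closedC].
  + exact: compact_csq.
  + by move=> x [/closure_dom].
- move=> x [cx Ux]; apply: contrapT => Ox.
  have Gx : Gamma x by rewrite boundaryE.
  have [i _ xi] := GK x Gx; apply: Ux; exists i => //.
  have xT := half_tubeW xi; split; first exact: xT.1.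
  by rewrite ((tube_boundary xT).1 Gx) normr0.
- move=> x Ox; have [Ux|Ux] := pselect (U x); first by right.
  by left; split=> //; exact: subset_closure.
Qed.

(** The integral over a cell is bounded for the [h1form] norm; represented by Riesz, it tends to 0
    along weakly null families. *)
Lemma h1_cell_functional p d : 0 < d -> cell p d `<=` Omega -> exists v : h1 O,
  forall w, h1form v w = \int[area]_(x in cell p d) val w x.
Proof.
move=> d0 QO; have mQ := measurable_cell p d.
have Qoo : (area (cell p d : set planeT) < +oo)%E by rewrite area_cell// ltry.
have oneL := L2_cst 1 mQ Qoo.
have wL w : L2 area (cell p d) (val w) by apply: (L2_subset mQ mO QO); apply: H1_L2; exact: h1P.
have E w : \int[area]_(x in cell p d) val w x = ip area (cell p d) (val w) (fun=> 1).
  by apply: eq_Rintegral => x _; rewrite mulr1.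
apply: (@riesz _ _ _ (h1form_psd O) (fun w => \int[area]_(x in cell p d) val w x)
  (ip area (cell p d) (fun=> 1) (fun=> 1)) (@h1_complete _ O)).
- by move=> c w z; rewrite !E val_h1_lin ip_lin.
- move=> w; rewrite E; apply: le_trans (ip_CS mQ (wL w) oneL) _; rewrite mulrC ler_wpM2l ?ip_ge0//.
  apply: le_trans (l2form_le w); apply: ip_subset => //; apply: H1_L2; exact: h1P.
Qed.

Lemma cell_grid (M delta : R) : 0 < M -> 0 < delta -> exists (N : nat) (d : R), [/\ 0 < d, d <= delta &
  let c (ij : 'I_N * 'I_N) := cell (- M + ij.1%:R * d, - M + ij.2%:R * d) d in
  csq (0, 0) (M / 2) `<=` \bigcup_ij c ij /\ forall i j x, c i x -> c j x -> i = j].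
Proof.
(* The grid divides a square of side [2 * M] into cells of side at most [delta]; claiming the cover
   only for half that square keeps clear of its open edges. *)
move=> M0 delta0; pose N := (Num.truncn (delta^-1 * (2 * M))).+1; pose d := 2 * M / N%:R.
have N0 : 0 < N%:R :> R by [].
have d0 : 0 < d by rewrite divr_gt0 ?mulr_gt0.
have Nd : N%:R * d = 2 * M by rewrite /d mulrCA mulfV ?mulr1// gt_eqF.
exists N, d; split=> //.
  rewrite /d ler_pdivrMr// -ler_pdivrMl//; apply/ltW; exact: truncnS_gt.
have idx (t : R) : - (M / 2) <= t -> t <= M / 2 -> exists i : 'I_N, - M + i%:R * d <= t < - M + i%:R * d + d.
  move=> t1 t2; have s0 : 0 <= (t + M) / d by rewrite divr_ge0 ?(ltW d0)//; lra.
  have /andP[k1 k2] := truncn_itv s0.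
  have kN : (Num.truncn ((t + M) / d) < N)%N.
    rewrite -(ltr_nat R); apply: le_lt_trans k1 _; rewrite ltr_pdivrMr// Nd; lra.
  exists (Ordinal kN) => /=; move: k1 k2; move: (Num.truncn ((t + M) / d)) => j; rewrite ler_pdivlMr// ltr_pdivrMr// -natr1 mulrDl mul1r => k1 k2.
  by apply/andP; split; lra.
split=> [x [x1 x2]|[i1 i2] [j1 j2] x].
  move: x1 x2; rewrite /= !subr0 !ler_norml => /andP[x1 x2] /andP[x3 x4].
  have [i hi] := idx x.1 x1 x2; have [j hj] := idx x.2 x3 x4.
  by exists (i, j) => //; split; rewrite /= in_itv/=.
have uniq (t : R) (i j : 'I_N) : - M + i%:R * d <= t < - M + i%:R * d + d ->
    - M + j%:R * d <= t < - M + j%:R * d + d -> i = j.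
  wlog ij : i j / (i <= j)%N.
    by move=> H; have [/H//|/ltnW/H H' h h'] := leqP i j; apply/esym; exact: H'.
  move=> /andP[_ h] /andP[h' _]; apply/val_inj/eqP; rewrite eqn_leq ij/= leqNgt.
  apply/negP => lt; have : i%:R * d + d <= j%:R * d.
    by rewrite -{2}[d]mul1r -mulrDl natr1 ler_wpM2r ?(ltW d0)// ler_nat.
  lra.
move=> []; rewrite /= !in_itv/= => h1 h2 []; rewrite /= !in_itv/= => h3 h4.
by rewrite (uniq _ _ _ h1 h3) (uniq _ _ _ h2 h4).
Qed.

End Rellich.

(** * Rellich's theorem *)

Section Compactness.
Context {R : realType}.
Local Notation planeT := (@planeT R).
Variable O : @bounded_domain R.
Local Notation Omega := (dom O).
Local Notation Gamma := (boundary (dom O)).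
Hypothesis HL : lipschitz_boundary Omega.
Implicit Types (p : R * R) (d : R) (u w : h1 O).

Let mO := measurable_dom O.

Lemma ip_cover_le (I : finType) (B : I -> set (R * R)) (f : R * R -> R) :
  (forall i, measurable (B i : set planeT)) -> (forall i, B i `<=` Omega) -> Omega `<=` \bigcup_i B i ->
  L2 area Omega f -> ip area Omega f f <= \sum_i ip area (B i) f f.
Proof.
move=> mB BO OB fL; rewrite -lee_fin -sqint_ip//.
have -> : ((\sum_i ip area (B i) f f)%:E = \sum_i (\int[area]_(x in Omega `&` B i) (f x ^+ 2)%:E))%E.
  rewrite -sumEFin; apply: eq_bigr => i _; rewrite -sqint_ip//; last exact: L2_subset fL.
  by congr (integral _ _ _); apply/esym/setIidPr.
rewrite /sqint; apply: (@integral_cover_le_fin R _ planeT area Omega I B (fun x => (f x ^+ 2)%:E)) => //; first by apply: measurable_sq => //; exact: fL.1.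
by move=> x _; rewrite lee_fin sqr_ge0.
Qed.

Lemma ip_packing_le (I : finType) (B : I -> set (R * R)) (f : R * R -> R) :
  (forall i, measurable (B i : set planeT)) -> (forall i, B i `<=` Omega) ->
  (forall i j x, B i x -> B j x -> i = j) ->
  L2 area Omega f -> \sum_i ip area (B i) f f <= ip area Omega f f.
Proof.
move=> mB BO dB fL; rewrite -lee_fin -sqint_ip//.
have -> : ((\sum_i ip area (B i) f f)%:E = \sum_i (\int[area]_(x in B i) (f x ^+ 2)%:E))%E.
  by rewrite -sumEFin; apply: eq_bigr => i _; rewrite -sqint_ip//; exact: L2_subset fL.
apply: integral_packing_le => //; first by apply: measurable_sq => //; exact: fL.1.
by move=> x _; rewrite lee_fin sqr_ge0.
Qed.

Lemma ip_set0 (f g : R * R -> R) : ip area (set0 : set planeT) f g = 0.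
Proof. by rewrite /ip /Rintegral integral_set0. Qed.

Lemma strip_estimate n (K : 'I_n -> chart O) eps : 0 < eps -> exists tau : R,
  [/\ 0 < tau, forall i, tau <= ch_tau (K i) &
    forall w, \sum_i ip area (strip (K i) tau) (val w) (val w) <= eps * h1form w w].
Proof.
move=> eps0; have [t0 t00 t0K] := common_lower_bound (fun i => ch_tau0 (K i)).
(* Each strip carries at most [2 * tau * (t0^-1 + t0)] times [h1form w w], and there are [n] of
   them; [n.+1] keeps [C] positive when there is none. *)
pose C := 2 * n.+1%:R * (t0^-1 + t0); have C0 : 0 < C by rewrite !mulr_gt0// addr_gt0// invr_gt0.
pose tau := Num.min t0 (eps / C).
have tau0 : 0 < tau by rewrite lt_min t00 divr_gt0.
have tt : tau <= t0 by rewrite ge_min lexx.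
exists tau; split=> // [i|w]; first exact: le_trans (t0K i).
set a := ip area Omega (val w) (val w); set b := dirform w w.
have a0 : 0 <= a by exact: ip_ge0.
have b0 : 0 <= b by exact: form_ge0 (dirform_psd O) w.
have hE : h1form w w = b + a by [].
have H i : ip area (strip (K i) tau) (val w) (val w) <= 2 * tau * (t0^-1 + t0) * (b + a).
  have := strip_H1 HL tau0 tt (t0K i) (h1P w); rewrite -/a -/b => h.
  rewrite -(ler_pM2l t00); apply: le_trans h _.
  have -> : t0 * (2 * tau * (t0^-1 + t0) * (b + a)) = tau * (2 * (t0 * t0^-1 + t0 ^+ 2) * (b + a)) by ring.
  rewrite ler_pM2l// mulfV ?gt_eqF//.
  have := sqr_ge0 t0; move: (t0 ^+ 2) => s s0; change (2 * a + 2 * s * b <= 2 * (1 + s) * (b + a)).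
  by have := mulr_ge0 s0 a0; lra.
apply: le_trans (ler_sum _ (fun i _ => H i)) _.
rewrite sumr_const card_ord -[leLHS]mulr_natl [leLHS]mulrA hE; apply: ler_wpM2r; first exact: addr_ge0.
apply: (@le_trans _ _ (C * tau)); last first.
  by rewrite mulrC -ler_pdivlMr// ge_min lexx orbT.
rewrite /C -subr_ge0; have -> : 2 * n.+1%:R * (t0^-1 + t0) * tau - n%:R * (2 * tau * (t0^-1 + t0)) =
  2 * tau * (t0^-1 + t0) by rewrite -natr1; ring.
by rewrite !mulr_ge0 ?(ltW tau0)// addr_ge0 ?invr_ge0 ?(ltW t00).
Qed.

Lemma cell_diam p d x : cell p d x -> cell p d `<=` csq x d.
Proof.
move=> [+ +] y [+ +]; rewrite /= !in_itv/= => /andP[a1 a2] /andP[a3 a4] /andP[b1 b2] /andP[b3 b4].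
by rewrite /csq/=; split; rewrite ler_norml; apply/andP; split; lra.
Qed.

Lemma sqr_small (d eps : R) : 0 < d -> d <= 1 -> d <= eps / 4 -> 2 * d ^+ 2 <= eps / 2.
Proof.
move=> d0 d1 d4; have : d ^+ 2 <= d by rewrite expr2 ler_piMr// ltW.
by move: (d ^+ 2) => s; lra.
Qed.

(* Rellich's theorem in quantitative form: near the boundary the mass is small by the strip estimate, inside
   the Poincare inequality on a grid of small squares leaves only finitely many averages. *)
Lemma rellich eps : 0 < eps -> exists (I : finType) (v : I -> h1 O) (A : R),
  forall w, l2form w w <= eps * h1form w w + A * \sum_i h1form (v i) w ^+ 2.
Proof.
move=> eps0; have e20 : 0 < eps / 2 by rewrite divr_gt0.
have [n [K GK]] := boundary_cover HL.
have [tau [tau0 tauK stripH]] := strip_estimate K e20.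
have [C [cC CO OC]] := interior_compact tau0 GK.
have [eta eta0 etaP] := lebesgue_number cC CO.
(* Below [eta], a cell that meets the compact part lies in the domain; the other two bounds give
   [2 * d ^+ 2 <= eps / 2] for the Poincare constant. *)
pose delta := Num.min eta (Num.min 1 (eps / 4)).
have delta0 : 0 < delta by rewrite !lt_min eta0 ltr01 divr_gt0.
pose M := 2 * (`|dom_radius O| + 1); have M0 : 0 < M by rewrite mulr_gt0// ltr_wpDl.
have [N [d [d0 dd /= [cov disj]]]] := cell_grid M0 delta0.
pose c (ij : 'I_N * 'I_N) := cell (- M + ij.1%:R * d, - M + ij.2%:R * d) d.
(* Cells that leave the domain are replaced by the empty set, with functional 0; the strips cover
   what is lost. *)
pose B ij := if pselect (c ij `<=` Omega) then c ij else set0.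
have BO ij : B ij `<=` Omega by rewrite /B; case: pselect => // ?; exact: sub0set.
have mB ij : measurable (B ij : set planeT) by rewrite /B; case: pselect => ?; [exact: measurable_cell|exact: measurable0].
have dB i j x : B i x -> B j x -> i = j.
  by rewrite /B; case: pselect => // ?; case: pselect => // ?; exact: disj.
have arith (x1 x2 x3 y s : R) : x1 = 0 -> x2 = 0 -> x3 = 0 -> x1 <= (d ^+ 2)^-1 * s ^+ 2 + y * (x2 + x3).
  by move=> -> -> ->; rewrite addr0 mulr0 addr0 mulr_ge0 ?invr_ge0 ?sqr_ge0.
have ex ij : exists v : h1 O, forall w, ip area (B ij) (val w) (val w) <=
    (d ^+ 2)^-1 * h1form v w ^+ 2 + 2 * d ^+ 2 *
     (ip area (B ij) (wD Omega e1 (val w)) (wD Omega e1 (val w)) +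
      ip area (B ij) (wD Omega e2 (val w)) (wD Omega e2 (val w))).
  rewrite /B; case: pselect => [cO|?].
    have [v vP] := h1_cell_functional d0 cO; exists v => w; rewrite vP.
    have := poincare_H1 HL d0 cO (h1P w); exact: id.
  by exists 0 => w; apply: arith; exact: ip_set0.
have [v vP] := choice ex.
exists ('I_N * 'I_N)%type, v, (d ^+ 2)^-1 => w.
pose D (i : 'I_n + 'I_N * 'I_N) := match i with inl i => strip (K i) tau | inr ij => B ij end.
have mD i : measurable (D i : set planeT) by case: i => i; [exact: measurable_strip|exact: mB].
have DO i : D i `<=` Omega by case: i => i; [exact: strip_dom|exact: BO].
have OD : Omega `<=` \bigcup_i D i.
  move=> x Ox; have [Cx|[i _ xi]] := OC x Ox.
    have [ij _ cx] : (\bigcup_ij c ij) x.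
      apply: cov; have [x1 x2] := dom_bounded Ox; have r := ler_norm (dom_radius O).
      rewrite /csq/= /M mulrC mulKf//; split; [apply: le_trans x1 _|apply: le_trans x2 _]; lra.
    exists (inr ij) => //=; rewrite /B; case: pselect => // - []; move=> y cy.
    apply: (etaP x Cx); have [y1 y2] := cell_diam cx cy.
    have de : d <= eta by apply: le_trans dd _; rewrite ge_min lexx.
    by split; [exact: le_trans y1 de|exact: le_trans y2 de].
  exists (inl i) => //=; split; first exact: xi.1.
  have [xi1 xi2] := xi.
  rewrite ((tube_dom (K := K i) _).1 Ox) /=; last by split=> //; exact: lt_le_trans (tauK i).
  by apply: le_lt_trans xi2; exact: ler_norm.
have wL := H1_L2 (h1P w).
apply: le_trans (ip_cover_le mD DO OD wL) _.
rewrite big_sumType/= [eps in eps * _](splitr eps) mulrDl -addrA; apply: lerD; first exact: stripH.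
apply: le_trans (ler_sum _ (fun ij _ => vP ij w)) _.
rewrite big_split/= -!mulr_sumr addrC; apply: lerD => //; rewrite big_split/=.
have D1 := ip_packing_le mB BO dB (wD_L2 (or_introl erefl) (h1P w)).
have D2 := ip_packing_le mB BO dB (wD_L2 (or_intror erefl) (h1P w)).
apply: le_trans (ler_wpM2l _ (lerD D1 D2)) _; first by rewrite mulr_ge0// sqr_ge0.
have d2 : 2 * d ^+ 2 <= eps / 2.
  have d1 : d <= 1 by apply: le_trans dd _; rewrite !ge_min lexx !orbT.
  have d4 : d <= eps / 4 by apply: le_trans dd _; rewrite !ge_min lexx !orbT.
  exact: sqr_small d0 d1 d4.
apply: le_trans (ler_wpM2r _ d2) _; first exact: form_ge0 (dirform_psd O) w.
by rewrite ler_wpM2l ?(ltW e20)// /h1form lerDl; exact: ip_ge0.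
Qed.

End Compactness.

(** * The compact form with boundary term *)

Section TraceForm.
Context {R : realType}.
Variable O : @bounded_domain R.
Local Notation Omega := (dom O).
Local Notation Gamma := (boundary (dom O)).
Hypothesis HL : lipschitz_boundary Omega.
Implicit Types (u w : h1 O).

Let mG : measurable (Gamma : set (arcT R)) := measurable_boundary O.

Definition trform u w : R := ip arclength (Gamma : set (arcT R)) (trace Omega (val u)) (trace Omega (val w)).

Definition eform u w : R := l2form u w + trform u w.

Lemma tr_lin (c : R) u w : {ae arclength, forall x, Gamma x ->
  trace Omega (val (c *: u + w)) x = c * trace Omega (val u) x + trace Omega (val w) x}.
Proof. by rewrite val_h1_lin; exact (trace_lin HL c (h1P u) (h1P w)). Qed.

Lemma tr_L2 u : L2 arclength (Gamma : set (arcT R)) (trace Omega (val u)).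
Proof. exact (trace_L2 HL (h1P u)). Qed.

Lemma trform_psd : psd_form trform.
Proof.
split=> [u v|c u v w|u]; [exact: ipC| |exact: ip_ge0].
have L : L2 arclength (Gamma : set (arcT R)) (fun x => c * trace Omega (val u) x + trace Omega (val v) x).
  exact (L2D mG (L2Z mG c (tr_L2 u)) (tr_L2 v)).
have rf : {ae arclength, forall x, Gamma x -> trace Omega (val w) x = trace Omega (val w) x} by exact: nearW.
exact (etrans (ae_eq_ip mG (tr_L2 (c *: u + v)) L (tr_L2 w) (tr_L2 w) (tr_lin c u v) rf)
  (ip_lin mG c (tr_L2 u) (tr_L2 v) (tr_L2 w))).
Qed.

Lemma eform_psd : psd_form eform.
Proof. by apply: psd_formD; [exact: l2form_psd|exact: trform_psd]. Qed.

(** The height [tau] is fixed so that the trace costs at most [eta / 2] of the energy; the resulting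
    large multiple [1 + C / tau] of the mass is then compensated by a small enough constant in
    [rellich]. *)
Lemma eform_estimate eta : 0 < eta -> exists (I : finType) (v : I -> h1 O) (A : R),
  forall w, eform w w <= eta * h1form w w + A * \sum_i h1form (v i) w ^+ 2.
Proof.
move=> eta0; have [C [C0 [t0 t00 trP]]] := trace_estimate HL.
have C1 : 0 < C + 1 by rewrite ltr_wpDl.
pose tau := Num.min t0 (eta / (2 * (C + 1))).
have tau0 : 0 < tau by rewrite lt_min t00 divr_gt0// mulr_gt0.
have tt : tau <= t0 by rewrite ge_min lexx.
have Ct : C * tau <= eta / 2.
  apply: (@le_trans _ _ ((C + 1) * tau)); first by rewrite ler_pM2r// lerDl.
  rewrite mulrC -ler_pdivlMr//.
  by rewrite /tau ge_min; apply/orP; right; rewrite -mulrA -invfM.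
have B0 : 0 < 1 + C / tau by rewrite ltr_wpDr// divr_ge0// ltW.
have [I [v [A rel]]] := rellich HL (divr_gt0 (divr_gt0 eta0 (ltr0Sn R 1)) B0).
exists I, v, ((1 + C / tau) * A) => w.
have := trP _ _ _ (h1P w) (traceP HL (h1P w)) tau0 tt.
have := rel w.
set s := \sum_i _; rewrite /eform /trform /h1form.
move: (form_ge0 (dirform_psd O) w) (form_ge0 (l2form_psd O) w).
rewrite -/(dirform w w) -/(l2form w w).
move: (ip arclength _ _ _) (dirform w w) (l2form w w) s => t d l s d0 l0 h1 h2.
have h3 := ler_wpM2l (ltW B0) h1.
have e3 : (1 + C / tau) * (eta / 2 / (1 + C / tau) * (d + l) + A * s) =
  eta / 2 * (d + l) + (1 + C / tau) * A * s by move: (1 + C / tau) B0 => B B0; field; rewrite gt_eqF.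
rewrite e3 in h3.
have h4 := ler_wpM2r d0 Ct.
have h5 : 0 <= eta / 2 * l by rewrite mulr_ge0// divr_ge0// ltW.
move: h2 h3 h4 h5; rewrite mulrDl mul1r.
move: (C / tau * l) (C * tau * d) ((1 + C / tau) * A * s) => x y z h2 h3 h4 h5.
lra.
Qed.

(** In [eform_estimate] the finitely many functionals tend to 0 along a weakly null family, and the
    remaining term is a small multiple of the bound [M]. *)
Lemma eform_compact (F : set_system nat) (FU : UltraFilter F) (w : nat -> h1 O) (M : R) :
  (\forall n \near F, h1form (w n) (w n) <= M) ->
  (forall v, h1form (w n) v @[n --> F] --> (0 : R)) ->
  eform (w n) (w n) @[n --> F] --> (0 : R).
Proof.
move=> wM wv; apply/cvgr0Pnorm_le => eps eps0.
have M0 : 0 < `|M| + 1 by rewrite ltr_wpDl.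
have [I [v [A est]]] := eform_estimate (divr_gt0 (divr_gt0 eps0 (ltr0Sn R 1)) M0).
have c : A * \sum_i h1form (v i) (w n) ^+ 2 @[n --> F] --> A * \sum_(i : I) 0 * 0.
  apply: (cvgM (f := fun=> A)); first exact: cvg_cst.
  apply: cvg_sum_real => i; under eq_fun do rewrite (formC (h1form_psd O)) expr2.
  by apply: cvgM; exact: wv.
have z : \sum_(i : I) (0 * 0) = 0 :> R by apply: big1 => i _; rewrite mulr0.
rewrite z mulr0 in c.
have e20 : 0 < eps / 2 by rewrite divr_gt0.
move/cvgr0Pnorm_le : c => /(_ _ e20) c.
apply: filterS2 wM c => n h1 h2.
rewrite ger0_norm; last exact: form_ge0 eform_psd _.
apply: le_trans (est _) _; rewrite [leRHS]splitr; apply: lerD; last exact: le_trans (ler_norm _) h2.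
apply: (@le_trans _ _ (eps / 2 / (`|M| + 1) * (`|M| + 1))); last by rewrite divfK// gt_eqF.
apply: ler_wpM2l; first by apply: divr_ge0; exact: ltW.
by apply: le_trans h1 _; apply: le_trans (ler_norm M) _; rewrite lerDl.
Qed.

End TraceForm.
(** * Eigenvalues as levels *)

Section Constants.
Context {R : realType}.
Local Notation planeT := (@planeT R).
Variable O : @bounded_domain R.
Local Notation Omega := (dom O).
Local Notation Gamma := (boundary (dom O)).
Hypothesis HL : lipschitz_boundary Omega.
Implicit Types (p x y : R * R) (d c : R) (u : R * R -> R).

Let mO := measurable_dom O.

Let null v u := ip area Omega (wD Omega v u) (wD Omega v u) = 0.

Lemma ip_cell_sub p d u c : 0 < d -> L2 area (cell p d) u ->
  ip area (cell p d) (fun x => u x - c) (fun x => u x - c) =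
  ip area (cell p d) u u - 2 * c * \int[area]_(x in cell p d) u x + c ^+ 2 * d ^+ 2.
Proof.
move=> d0 uL; have mQ := measurable_cell p d.
have Qoo : (area (cell p d : set planeT) < +oo)%E by rewrite area_cell// ltry.
have oneL := L2_cst 1 mQ Qoo.
have k : (fun x => u x - c) = (fun x => - c * (fun=> 1) x + u x) by apply/funext => x; rewrite mulr1 addrC.
have kL : L2 area (cell p d) (fun x => - c * (fun=> 1) x + u x) by exact (L2D mQ (L2Z mQ (- c) oneL) uL).
have e v : L2 area (cell p d) v -> ip area (cell p d) (fun x => - c * (fun=> 1) x + u x) v =
  - c * ip area (cell p d) (fun=> 1) v + ip area (cell p d) u v by move=> vL; exact (ip_lin mQ (- c) oneL uL vL).
rewrite k (e _ kL) (etrans (ipC area _ (fun=> 1) _) (e _ oneL)) (etrans (ipC area _ u _) (e _ uL)).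
have -> : ip area (cell p d) (fun=> 1) (fun=> 1) = d ^+ 2.
  rewrite /ip /Rintegral mul1r integral_cst// mul1e; rewrite [X in fine X = _](area_cell p d0) //.
have -> : ip area (cell p d) u (fun=> 1) = \int[area]_(x in cell p d) u x.
  by apply: eq_Rintegral => x _; rewrite mulr1.
have -> : ip area (cell p d) (fun=> 1) u = \int[area]_(x in cell p d) u x.
  by apply: eq_Rintegral => x _; rewrite mul1r.
by ring.
Qed.

Lemma ip_restrict0 D f : measurable (D : set planeT) -> D `<=` Omega -> L2 area Omega f ->
  ip area Omega f f = 0 -> ip area D f f = 0.
Proof.
move=> mD DO fL f0; apply/le_anti/andP; split; last exact: ip_ge0.
by rewrite -f0; exact: ip_subset.
Qed.

(** Without gradient, Poincare's inequality says that the variance of [u] on the cell is 0, and [c]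
    is its mean. *)
Lemma cell_constant p d u : 0 < d -> cell p d `<=` Omega -> H1 Omega u -> null e1 u -> null e2 u ->
  exists c, {ae area, forall x, cell p d x -> u x = c}.
Proof.
move=> d0 QO hu n1 n2; have mQ := measurable_cell p d.
have uL := L2_subset mQ mO QO (H1_L2 hu).
have Qoo : (area (cell p d : set planeT) < +oo)%E by rewrite area_cell// ltry.
have arith (x1 x2 x3 y k : R) : x2 = 0 -> x3 = 0 -> x1 <= y + k * (x2 + x3) -> x1 <= y.
  by move=> -> ->; rewrite addr0 mulr0 addr0.
have h := arith _ _ _ _ _ (ip_restrict0 mQ QO (wD_L2 (or_introl erefl) hu) n1)
  (ip_restrict0 mQ QO (wD_L2 (or_intror erefl) hu) n2) (poincare_H1 HL d0 QO hu).
set I := \int[area]_(x in cell p d) u x in h.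
pose c := (d ^+ 2)^-1 * I; exists c.
have kL : L2 area (cell p d) (fun x => u x - c) by exact (L2B mQ uL (L2_cst c mQ Qoo)).
have z : ip area (cell p d) (fun x => u x - c) (fun x => u x - c) = 0.
  apply/le_anti/andP; split; last exact: ip_ge0.
  rewrite (ip_cell_sub c d0 uL) -/I; apply: le_trans (lerD (lerB h (lexx _)) (lexx _)) _.
  have dn : d ^+ 2 != 0 by rewrite expf_neq0// gt_eqF.
  rewrite /c le_eqVlt; apply/orP; left; apply/eqP; move: (d ^+ 2) dn => s sn; field; exact: sn.
have sz : sqint area (cell p d) (fun x => u x - c) = 0%E := etrans (sqint_ip mQ kL) (congr1 EFin z).
move: (sqint_eq0 mQ kL.1 sz).
by apply: (@filterS _ (almost_everywhere area)) => x H /H /eqP; rewrite subr_eq0 => /eqP.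
Qed.

(** Every point has a rational box on which [u] is almost everywhere constant. The set of points
    with a given local constant is open, distinct constants give disjoint sets, and connectedness
    leaves one of them. *)
Lemma constant_ae u : connected Omega -> H1 Omega u -> null e1 u -> null e2 u ->
  exists c, {ae area, forall x, Omega x -> u x = c}.
Proof.
move=> Oc hu n1 n2; have oO := @dom_open _ O.
pose good q c := {ae area, forall y, qbox q y -> u y = c}.
pose P x c := exists2 q, qbox q x & good q c.
have ex x : Omega x -> exists c, P x c.
  move=> Ox; have [e e0 eO] := nbhs_csq (open_nbhs_nbhs (conj oO Ox)).
  pose p := (x.1 - e / 2, x.2 - e / 2).
  have xc : csq x (e / 4) `<=` cell p e.
    move=> y [+ +]; rewrite !ler_norml => /andP[a1 a2] /andP[a3 a4].
    by split; rewrite /= in_itv/=; apply/andP; split; lra.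
  have cO : cell p e `<=` Omega.
    apply: subset_trans eO; apply: cell_diam; apply: xc; apply: csq_refl; rewrite divr_ge0// ltW//.
  have [c cP] := cell_constant e0 cO hu n1 n2; exists c.
  have [q qx qc] := nbhs_qbox (nbhs_of_csq x (divr_gt0 e0 (ltr0Sn R 3))).
  exists q => //; move: cP; apply: (@filterS _ (almost_everywhere area)) => y H qy; apply: H.
  by apply: xc; exact: qc.
(* Two boxes around the same point share a cell of positive area, where both constants are
   attained. *)
have uniq x c c' : P x c -> P x c' -> c = c'.
  move=> [q qx gq] [q' qx' gq']; apply: contrapT => cc.
  have N : nbhs x (qbox q `&` qbox q').
    by apply: filterI; apply: open_nbhs_nbhs; split => //; exact: open_qbox.
  have [d d0 dN] := nbhs_csq N.
  have QN : cell x d `<=` qbox q `&` qbox q' by apply: subset_trans dN; exact: cell_csq.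
  have : area.-negligible (cell x d : set planeT).
    have G : area.-negligible (~` ([set y | qbox q y -> u y = c] `&` [set y | qbox q' y -> u y = c']) : set planeT).
      exact: (@filterI _ (almost_everywhere area)).
    apply: negligibleS G => y Qy [h1 h2]; have [b1 b2] := QN y Qy.
    by apply: cc; rewrite -(h1 b1) -(h2 b2).
  have mQ := measurable_cell x d.
  move=> /(negligibleP area mQ).1; rewrite [X in X = _](area_cell x d0) => -[] /eqP.
  by rewrite expf_eq0/= gt_eqF.
have [[x0 Ox0]|nO] := pselect (exists x, Omega x); last first.
  by exists 0; apply: aeW => x Ox; exfalso; apply: nO; exists x.
have [c Pc] := ex x0 Ox0; exists c.
pose B := Omega `&` [set x | P x c].
have oP c' : open [set x | P x c'].
  rewrite openE => x [q qx gq]; have N : nbhs x (qbox q) by apply: open_nbhs_nbhs; split=> //; exact: open_qbox.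
  apply: (@filterS _ (nbhs x) _ (qbox q)) => [y qy|//].
  by exists q.
have BO : B = Omega.
  apply: Oc; first by exists x0.
    by exists [set x | P x c].
  exists (~` (\bigcup_(c' in [set c' | c' <> c]) [set x | P x c'])).
    by apply: open_closedC; apply: bigcup_open => c' _; exact: oP.
  apply/seteqP; split => x [Ox].
    by move=> Px; split=> // -[c' /= cc Px']; apply: cc; exact: uniq Px' Px.
  move=> H; split=> //=; have [c' Px'] := ex x Ox.
  have [<-//|cc] := pselect (c' = c); exfalso; apply: H; by exists c'.
(* The exceptional set is covered by the null sets of countably many rational boxes; codes that
   stand for no good box contribute the empty set. *)
pose F k : set planeT := if unpickle k is Some q then (if pselect (good q c) then [set y | ~ (qbox q y -> u y = c)] else set0) else set0.
have nF k : area.-negligible (F k).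
  rewrite /F; case: unpickle => [q|]; last exact: negligible_set0.
  by case: pselect => [//|?]; exact: negligible_set0.
apply: negligibleS (negligible_bigcup nF) => x /not_implyP [Ox ux].
have [q qx gq] : P x c by move: Ox; rewrite -BO => -[].
have Fq : F (pickle q) x.
  by rewrite /F pickleK; case: (pselect (good q c)) => [_ /(_ qx)|].
exact (ex_intro2 _ _ (pickle q) I Fq).
Qed.

End Constants.

(** * Convergence of infima of levels *)

Section Levels.
Context {R : realType}.

Lemma cvg_of_real_bounds (f : nat -> \bar R) (L : \bar R) :
  (forall x : R, (L < x%:E)%E -> \forall n \near \oo, (f n <= x%:E)%E) ->
  (forall x : R, (x%:E < L)%E -> \forall n \near \oo, (x%:E <= f n)%E) ->
  f n @[n --> \oo] --> L.
Proof.
case: L => [l| |] U D; last 2 first.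
- by apply/cvgeyPge => A; apply: D; rewrite ltry.
- by apply/cvgeNyPle => A; apply: U; rewrite ltNyr.
have B e : 0 < e -> \forall n \near \oo, ((l - e)%:E <= f n <= (l + e)%:E)%E.
  move=> e0.
  have h1 := U (l + e); have h2 := D (l - e); rewrite !lte_fin ltrDl gtrBl in h1 h2.
  by apply: filterS2 (h1 e0) (h2 e0) => n -> ->.
apply/fine_cvgP; split.
  apply: filterS (B 1 ltr01) => n /andP[h1 h2].
  by rewrite fin_numE; move: h1 h2; case: (f n).
apply/cvgrPdist_le => e e0; apply: filterS (B e e0) => n /=.
case: (f n) => [r| |] //=; last by move=> /andP[_].
rewrite !lee_fin => /andP[h1 h2].
by rewrite ler_norml; apply/andP; split; lra.
Qed.

(** The second hypothesis controls the upper limit. The third, with monotonicity, controls the lower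
    one: infima below [x] at arbitrarily late indices would put [x] into [P]. *)
Lemma cvg_ereal_inf_levels (P_ : nat -> R -> Prop) (P : R -> Prop) :
  (forall n t t', t <= t' -> P_ n t -> P_ n t') ->
  (forall t t', t' < t -> P t' -> \forall n \near \oo, P_ n t) ->
  (forall t, (forall N, exists2 n, (N <= n)%N & P_ n t) -> P t) ->
  (fun n => ereal_inf [set t%:E | t in P_ n]) @ \oo --> ereal_inf [set t%:E | t in P].
Proof.
move=> mono U D; apply: cvg_of_real_bounds => x.
  move=> /ereal_inf_lt[_ [t Pt <-]]; rewrite lte_fin => tx.
  by apply: filterS (U _ _ tx Pt) => n Pn; apply: ereal_inf_lbound; exists x.
move=> xL; apply: contrapT => nn.
suff Px : P x by move: xL; rewrite ltNge => /negP; apply; apply: ereal_inf_lbound; exists x.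
apply: D => N; apply: contrapT => H; apply: nn; exists N => // n /= Nn.
rewrite leNgt; apply/negP => /ereal_inf_lt[_ [t Pt <-]]; rewrite lte_fin => /ltW tx.
by apply: H; exists n => //; exact: mono Pt.
Qed.

End Levels.

Lemma ip_mulAC d (T : measurableType d) (R : realType) (mu : {measure set T -> \bar R}) (D : set T) (r f g : T -> R) :
  ip mu D (fun x => r x * f x) g = ip mu D (fun x => r x * g x) f.
Proof. by apply: eq_Rintegral => x _; rewrite mulrAC. Qed.

Lemma measurable_fun_compl d (T : measurableType d) (R : realType) (D : set T) (M : R) (r : T -> R) :
  measurable_fun D r -> measurable_fun D (fun x => M + -1 * r x).
Proof. by move=> mr; apply: measurable_funD => //; apply: measurable_funM. Qed.

Lemma ip_const0 d (T : measurableType d) (R : realType) (mu : {measure set T -> \bar R}) (D : set T) (f : T -> R) :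
  ip mu D (fun=> 0) f = 0.
Proof. by apply: Rintegral_eq0 => x _; rewrite mul0r. Qed.

(** * Weights and Steklov eigenvalues *)

Section Weights.
Context {R : realType}.
Variable O : @bounded_domain R.
Local Notation Omega := (dom O).
Local Notation Gamma := (boundary (dom O)).
Hypothesis HL : lipschitz_boundary Omega.
Hypothesis Oc : connected Omega.
Implicit Types (u w : h1 O) (rho f g : arcT R -> R) (M : R).
Local Notation tr := (fun w : h1 O => trace Omega (val w)).
Local Notation ipG := (ip arclength (Gamma : set (arcT R))).

Let mO := measurable_dom O.
Let mG : measurable (Gamma : set (arcT R)) := measurable_boundary O.

(** The bounds hold at every boundary point; a weight bounded only almost everywhere is first
    replaced by such a representative. *)
Definition weight M rho := measurable_fun (Gamma : set (arcT R)) rho /\ forall x, Gamma x -> 0 <= rho x <= M.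

Lemma weight_L2 M rho f : weight M rho -> L2 arclength (Gamma : set (arcT R)) f ->
  L2 arclength (Gamma : set (arcT R)) (fun x => rho x * f x).
Proof.
move=> [mr rM] fL; have ML := L2Z mG M fL.
apply: (L2_le _ _ ML); [exact: mG|exact (measurable_funM mr fL.1)|move=> x Gx].
have /andP[r0 r1] := rM x Gx; rewrite !normrM (ger0_norm r0) (ger0_norm (le_trans r0 r1)).
exact: ler_wpM2r.
Qed.

Lemma ip_weight_ge0 M rho f : weight M rho -> 0 <= ipG (fun x => rho x * f x) f.
Proof.
move=> [mr rM]; apply: Rintegral_ge0 => x Gx; have /andP[r0 _] := rM x Gx.
by rewrite -mulrA; apply: mulr_ge0 => //; rewrite -expr2 sqr_ge0.
Qed.

Definition bform rho u w : R := ipG (fun x => rho x * tr u x) (tr w).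

Lemma bform_psd M rho : weight M rho -> psd_form (bform rho).
Proof.
move=> W; split=> [u v|c u v w|u]; last exact: ip_weight_ge0 W.
  exact: ip_mulAC.
have L z := weight_L2 W (tr_L2 HL z).
have Ll : L2 arclength (Gamma : set (arcT R)) (fun x => c * (rho x * tr u x) + rho x * tr v x).
  exact (L2D mG (L2Z mG c (L u)) (L v)).
have rf : {ae arclength, forall x, Gamma x -> tr w x = tr w x} by exact: nearW.
have El : {ae arclength, forall x, Gamma x -> rho x * tr (c *: u + v) x = c * (rho x * tr u x) + rho x * tr v x}.
  apply: (@filterS _ (almost_everywhere arclength) _ _ _ _ (tr_lin HL c u v)) => x H Gx.
  by rewrite H// mulrDr mulrCA.
exact (etrans (ae_eq_ip mG (L (c *: u + v)) Ll (tr_L2 HL w) (tr_L2 HL w) El rf)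
  (ip_lin mG c (L u) (L v) (tr_L2 HL w))).
Qed.

(** The complement [M - rho] is a weight too, so its form is nonnegative. *)
Lemma bform_le M rho u : 0 <= M -> weight M rho -> bform rho u u <= M * eform u u.
Proof.
move=> M0 W; have Wc : weight M (fun x => M + -1 * rho x).
  split; first exact: measurable_fun_compl W.1.
  by move=> x Gx; have := W.2 x Gx; rewrite mulN1r subr_ge0 => /andP[h1 ->]/=; rewrite gerBl.
apply: (@le_trans _ _ (M * trform u u)); last by apply: ler_wpM2l => //; rewrite lerDr; exact: ip_ge0.
have := ip_weight_ge0 (tr u) Wc.
have L := tr_L2 HL u.
have -> : (fun x => (M + -1 * rho x) * tr u x) = (fun x => -1 * (rho x * tr u x) + M * tr u x).
  by apply/funext => x; rewrite mulrDl addrC mulrA.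
have MZ : ipG (fun x => M * tr u x) (tr u) = M * ipG (tr u) (tr u).
  have := ip_lin mG (M - 1) L L L.
  rewrite [X in ip _ _ X](_ : _ = (fun x => M * tr u x)); last by apply/funext => x; rewrite mulrBl mul1r subrK.
  by move=> ->; rewrite mulrBl mul1r subrK.
have -> := ip_lin mG (-1) (weight_L2 W L) (L2Z mG M L) L.
rewrite [X in _ + X]MZ mulN1r addrC subr_ge0; exact.
Qed.

(** The generator of the kernel of the Dirichlet form; [bform rho one one] is the integral of [rho]
    and tells whether the weight is degenerate. *)
Definition one : h1 O := to_h1 (H1_smooth O (smooth_cst 1)).

Lemma one_form0 : dirform one one = 0.
Proof.
have H v : axis v -> gradform v one one = 0.
  move=> av; have wL := wD_L2 av (H1_smooth O (smooth_cst 1)).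
  have zL : L2 area Omega (fun=> 0) := L2_0 area Omega.
  have z : {ae area, forall x, Omega x -> wD Omega v (fun=> 1) x = 0}.
    apply: (@filterS _ (almost_everywhere area) _ _ _ _ (wD_smooth O av (smooth_cst 1))) => x H /H ->.
    exact (derive_cst (1 : R) x v).
  apply: etrans (ae_eq_ip mO wL zL wL zL z z) _.
  exact: ip_const0.
by rewrite /dirform !H ?addr0//; [right|left].
Qed.

(** [eform_estimate] with vanishing right-hand side: all pairings with [w] are 0 by
    Cauchy-Schwarz. *)
Lemma eform_null w : h1form w w = 0 -> eform w w = 0.
Proof.
move=> w0; have [I [v [A est]]] := eform_estimate HL ltr01.
apply/le_anti/andP; split; last exact: form_ge0 (eform_psd HL) w.
apply: le_trans (est w) _; rewrite w0 mulr0 add0r big1 ?mulr0// => i _.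
by rewrite (formC (h1form_psd O)) (form_eq0 (h1form_psd O) _ w0) expr0n.
Qed.

Lemma dirform_null w : dirform w w = 0 -> exists c, h1form (w - c *: one) (w - c *: one) = 0.
Proof.
move=> w0; have dP := dirform_psd O.
have g0 : gradform e1 w w = 0 /\ gradform e2 w w = 0.
  move: w0; rewrite /dirform => /eqP; rewrite paddr_eq0; first by move=> /andP[/eqP -> /eqP ->].
    exact: ip_ge0.
  exact: ip_ge0.
have [c wc] := constant_ae HL Oc (h1P w) g0.1 g0.2; exists c.
rewrite /h1form (_ : dirform _ _ = 0) ?add0r; last first.
  by rewrite !(formDl dP, formNl dP, formZl dP) !(form_eq0 dP _ w0) !(form_eq0 dP _ one_form0) !mulr0 subrr.
have L : L2 area Omega (val (w - c *: one)) := H1_L2 (h1P _).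
have zL : L2 area Omega (fun=> 0) := L2_0 area Omega.
have z : {ae area, forall x, Omega x -> val (w - c *: one) x = 0}.
  apply: (@filterS _ (almost_everywhere area) _ _ _ _ wc) => x H Ox.
  rewrite addrC -scaleNr val_h1_lin H// [val one x]/(1 : R) mulr1; exact: addNr.
apply: etrans (ae_eq_ip mO L zL L zL z z) _.
exact: ip_const0.
Qed.

(** Without energy [w] is a constant [c] up to a null element, on which [bform] vanishes; expanding
    there gives [c ^+ 2 * bform rho one one = 0], hence [c = 0]. *)
Lemma bform_kernel M rho w : 0 <= M -> weight M rho -> bform rho one one != 0 ->
  dirform w w = 0 -> bform rho w w = 0 -> l2form w w = 0.
Proof.
move=> M0 W b1 w0 bw0; have [c h0] := dirform_null w0.
have bP := bform_psd W.
have bz : bform rho (w - c *: one) (w - c *: one) = 0.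
  apply/le_anti/andP; split; last exact: form_ge0 bP _.
  by apply: le_trans (bform_le _ M0 W) _; rewrite eform_null// mulr0.
have c0 : c = 0.
  move: bz; rewrite !(formDl bP, formNl bP, formZl bP, formDr bP, formNr bP, formZr bP).
  rewrite (formC bP one w) !(form_eq0 bP _ bw0) !mulr0 subr0 !sub0r mulrN opprK mulrA => /eqP.
  by rewrite mulf_eq0 (negbTE b1) orbF mulf_eq0 orbb => /eqP.
by move: h0; rewrite c0 scale0r subr0 /h1form w0 add0r.
Qed.

Lemma weighted_system M (rho_ : nat -> arcT R -> R) rho : 0 <= M -> (forall n, weight M (rho_ n)) -> weight M rho ->
  bform rho one one != 0 ->
  (forall u w, bform (rho_ n) u w @[n --> \oo] --> bform rho u w) ->
  form_system (@h1form _ O) (@dirform _ O) (@l2form _ O) (@eform _ O) M (fun n => bform (rho_ n)) (bform rho).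
Proof.
move=> M0 Wn W b1 bc; split.
- exact: h1form_psd.
- exact: dirform_psd.
- exact: l2form_psd.
- exact: eform_psd.
- by move=> n; exact: bform_psd (Wn n).
- exact: bform_psd W.
- exact: h1_complete.
- by [].
- by move=> u; rewrite lerDl; exact: ip_ge0.
- exact: eform_compact.
- by move=> n u; exact: bform_le.
- exact: bc.
- by move=> u; exact: bform_kernel W b1.
Qed.

Lemma ae0_h1form w : {ae area, forall x, Omega x -> val w x = 0} -> h1form w w = 0.
Proof.
move=> w0; have L : L2 area Omega (val w) := H1_L2 (h1P w).
have zL : L2 area Omega (fun=> 0) := L2_0 area Omega.
have z0 : ip area Omega (fun=> 0) (fun=> 0) = 0 :> R.
  exact: ip_const0.
have H v : axis v -> gradform v w w = 0.
  move=> av; have wL := wD_L2 av (h1P w).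
  have wd : weak_derivative Omega v (val w) (fun=> 0).
    split=> // phi [sphi cK KO]; rewrite [X in _ = - X]Rintegral_eq0 ?oppr0; last by move=> x _; rewrite mul0r.
    have -> : \int[area]_(x in Omega) (val w x * 'D_v phi x) = ip area Omega (val w) ('D_v phi) by [].
    have DL : L2 area Omega ('D_v phi) := L2_smooth O (smooth_D av sphi).
    have rf : {ae area, forall x, Omega x -> 'D_v phi x = 'D_v phi x} by exact: nearW.
    apply: etrans (ae_eq_ip mO L zL DL DL w0 rf) _.
    exact: ip_const0.
  have z := wD_unique av (h1P w) wd.
  exact: etrans (ae_eq_ip mO wL zL wL zL z z) z0.
rewrite /h1form /dirform !H ?add0r; [|by right|by left].
exact: etrans (ae_eq_ip mO L zL L zL w0 w0) z0.
Qed.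

Lemma h1form_ae0 w : h1form w w = 0 -> {ae area, forall x, Omega x -> val w x = 0}.
Proof.
move=> w0; have L : L2 area Omega (val w) := H1_L2 (h1P w).
apply: (sqint_eq0 mO L.1); rewrite (sqint_ip mO L); congr EFin.
by apply/le_anti/andP; split; [rewrite -w0 l2form_le|exact: ip_ge0].
Qed.

Lemma val_comb n (u : 'I_n -> h1 O) c x : val (comb u c) x = \sum_i c i * val (u i) x.
Proof.
rewrite /comb; elim/big_rec2 : _ => [//|i y z _ <-].
by rewrite val_h1_lin.
Qed.

Lemma lin_indepP n (u : 'I_n -> h1 O) : lin_indep_ae Omega (fun i => val (u i)) <-> definite_on (@h1form _ O) u.
Proof.
split=> H c.
  move=> /h1form_ae0 z; apply: H; move: z; apply: (@filterS _ (almost_everywhere area)) => x Hx Ox.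
  by rewrite -val_comb Hx.
move=> z; apply: H; apply: ae0_h1form; move: z.
by apply: (@filterS _ (almost_everywhere area)) => x Hx Ox; rewrite val_comb Hx.
Qed.

Lemma eigenspaceP rho lam u : steklov_eigenspace Omega rho lam (val u) <-> eigenvector (@dirform _ O) (bform rho) lam u.
Proof.
split=> [[_ H] v|H]; first by rewrite dirformE; exact: H (h1P v).
by split=> [|v hv]; [exact: h1P|rewrite -(val_to_h1 hv) -dirformE; exact: H].
Qed.

(** The definition by eigenfunctions meets the min-max description: a constant sequence of weights
    forms a [form_system], to which both passages between eigenvectors and levels apply. *)
Lemma steklov_level M rho k : 0 <= M -> weight M rho -> bform rho one one != 0 ->
  steklov Omega rho k = ereal_inf [set t%:E | t in level (h := @h1form _ O) (a := @dirform _ O) (bform rho) k].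
Proof.
move=> M0 W b1.
have S : form_system (@h1form _ O) (@dirform _ O) (@l2form _ O) (@eform _ O) M (fun=> bform rho) (bform rho).
  by apply: weighted_system => // u w; exact: cvg_cst.
congr (ereal_inf [set _%:E | _ in _]); apply/seteqP; split=> t.
  move=> [u [ui ue]].
  have hu i : H1 Omega (u i) by have [lam _ []] := ue i.
  pose v i := to_h1 (hu i); have vE : (fun i => val (v i)) = u by apply/funext => i; rewrite val_to_h1.
  have [lam lamP] := choice (fun i => let: ex_intro2 l h1 h2 := ue i in ex_intro (fun l => l <= t /\
    steklov_eigenspace Omega rho l (u i)) l (conj h1 h2)).
  apply: (eigenvectors_level S (u := v) (lam := lam)); first by apply/lin_indepP; rewrite vE.
  move=> i; have [h1 h2] := lamP i; split=> //; apply/eigenspaceP; by rewrite val_to_h1.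
move=> /(level_eigenvectors S)[v [lam [vO vE]]]; exists (fun i => val (v i)); split.
  by apply/lin_indepP => c /(sys_null_b S); exact: (@orthonormal_definite _ _ _ (bform_psd W) _ _ vO c).
by move=> i; have [h1 h2] := vE i; exists (lam i) => //; apply/eigenspaceP.
Qed.

Lemma steklov_cvg M (rho_ : nat -> arcT R -> R) rho k : 0 <= M -> (forall n, weight M (rho_ n)) -> weight M rho ->
  (forall n, bform (rho_ n) one one != 0) -> bform rho one one != 0 ->
  (forall u w, bform (rho_ n) u w @[n --> \oo] --> bform rho u w) ->
  (fun n => steklov Omega (rho_ n) k) @ \oo --> steklov Omega rho k.
Proof.
move=> M0 Wn W bn1 b1 bc.
have S := weighted_system M0 Wn W b1 bc.
under eq_fun do rewrite (steklov_level k M0 (Wn _) (bn1 _)).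
rewrite (steklov_level k M0 W b1); apply: cvg_ereal_inf_levels.
- move=> n t t' tt [u [uh ua]]; exists u; split=> // x; apply: le_trans (ua x) _.
  by apply: ler_wpM2r => //; exact: form_ge0 (bform_psd (Wn n)) _.
- by move=> t t'; exact: level_upper S _ t t'.
- move=> t; apply: (level_lower S) => n w; exact: bform_kernel (Wn n) (bn1 n).
Qed.

End Weights.
(** * Weak-star continuity *)

Import HBSimple.
Section BoundedWeak.
Context d (T : measurableType d) (R : realType) (mu : {measure set T -> \bar R}) (D : set T).
Hypotheses (mD : measurable D) (Doo : (mu D < +oo)%E).
Implicit Types (f g k r : T -> R) (M : R).

Lemma ip_sum_seq (J : Type) (s : seq J) (c : J -> R) (F : J -> T -> R) k :
  (forall j, L2 mu D (F j)) -> L2 mu D k ->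
  L2 mu D (fun x => \sum_(j <- s) c j * F j x) /\
  ip mu D (fun x => \sum_(j <- s) c j * F j x) k = \sum_(j <- s) c j * ip mu D (F j) k.
Proof.
move=> FL kL; elim: s => [|j s [IH1 IH2]].
  under eq_fun do rewrite big_nil; rewrite big_nil; split; first exact: L2_0.
  by apply: Rintegral_eq0 => x _; rewrite mul0r.
under eq_fun do rewrite big_cons; rewrite big_cons; split.
  by apply: L2D => //; exact: L2Z.
by rewrite ip_lin// IH2.
Qed.

Lemma L2_indic_on A : measurable A -> L2 mu D (\1_A).
Proof.
move=> mA; apply: (L2_bounded (M := 1)) => //.
by move=> x _; rewrite indicE ger0_norm//; case: (x \in A).
Qed.

Lemma le_ip_bounded_diff M r f g : 0 <= M -> measurable_fun D r -> (forall x, D x -> `|r x| <= M) ->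
  mu.-integrable D (EFin \o f) -> mu.-integrable D (EFin \o g) ->
  `|ip mu D r f - ip mu D r g| <= M * \int[mu]_(x in D) `|f x - g x|.
Proof.
move=> M0 mr rM fi gi.
have rf := integrable_bounded_mul mD mr rM fi; have rg := integrable_bounded_mul mD mr rM gi.
have fg : mu.-integrable D (EFin \o (fun x => f x - g x)) by exact: integrableB fi gi.
have fga : mu.-integrable D (EFin \o (fun x => `|f x - g x|)) by exact: integrable_norm fg.
rewrite /ip -RintegralB// -RintegralZl//.
apply: le_trans (le_normr_Rintegral mD _) _; first exact: integrableB rf rg.
apply: le_Rintegral => //.
- exact: integrable_norm (integrableB mD rf rg).
- exact: integrableZl fga.
by move=> x Dx; rewrite -mulrBr normrM ler_wpM2r// rM.
Qed.

(** Convergence on indicators extends to simple functions by linearity, and to integrable ones by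
    density because the [r_ n] are uniformly bounded. *)
Lemma bounded_weak_cvg M (r_ : nat -> T -> R) r : 0 <= M ->
  (forall n, measurable_fun D (r_ n)) -> (forall n x, D x -> `|r_ n x| <= M) ->
  measurable_fun D r -> (forall x, D x -> `|r x| <= M) ->
  (forall A, measurable A -> A `<=` D -> ip mu D (r_ n) (\1_A) @[n --> \oo] --> ip mu D r (\1_A)) ->
  forall f, mu.-integrable D (EFin \o f) -> ip mu D (r_ n) f @[n --> \oo] --> ip mu D r f.
Proof.
move=> M0 mr_ r_M mr rM H f fi.
have rL n : L2 mu D (r_ n) by exact: L2_bounded (r_M n).
have rL' : L2 mu D r by exact: L2_bounded rM.
have HS (g : {sfun T >-> R}) : ip mu D (r_ n) g @[n --> \oo] --> ip mu D r g.
  have mA y : measurable (g @^-1` [set y]) by exact: measurable_sfunP.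
  have E k : L2 mu D k -> ip mu D k g =
      \sum_(y <- finmap.enum_fset (fset_set (range g))) y * ip mu D k (\1_((g @^-1` [set y]) `&` D)).
    move=> kL; rewrite ipC.
    have gE : (g : T -> R) = (fun x => \sum_(y <- finmap.enum_fset (fset_set (range g))) y * \1_(g @^-1` [set y]) x).
      by apply/funext => x; rewrite {1}fimfunE fsbig_finite.
    apply: (etrans (congr1 (fun h => ip mu D h k) gE)).
    have [_ ->] := @ip_sum_seq _ (finmap.enum_fset (fset_set (range g))) id (fun y => \1_(g @^-1` [set y])) k
      (fun y => L2_indic_on (mA y)) kL.
    apply: eq_bigr => y _; congr (_ * _); rewrite ipC; apply: eq_Rintegral => x; rewrite inE => Dx; congr (_ * _).
    by rewrite !indicE; congr (_%:R); rewrite in_setI (mem_set Dx) andbT.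
  under eq_fun do rewrite E//; rewrite E//; apply: cvg_sum_real => y.
  apply: cvgM; first exact: cvg_cst.
  by apply: H; [exact: measurableI|exact: subIsetr].
apply/cvgrPdist_le => eps eps0.
have e3 : 0 < eps / 3 by rewrite divr_gt0.
have e0 : 0 < eps / 3 / (M + 1) by rewrite !divr_gt0// ltr_wpDl.
have [g_ [gi _ gf]] := approximation_sfun_integrable mD fi.
have g0 n : (0 <= \int[mu]_(z in D) `|(EFin \o f) z - (g_ n z)%:E|)%E by apply: integral_ge0.
have [N _ /(_ N (leqnn N)) /= gN] := (cvge0P g0).1 gf _ e0.
have fgi : mu.-integrable D (EFin \o (fun x => `|f x - g_ N x|)) by exact: integrable_norm (integrableB mD fi (gi N)).
have fg : \int[mu]_(x in D) `|f x - g_ N x| <= eps / 3 / (M + 1).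
  rewrite -lee_fin /Rintegral fineK; first exact: gN.
  exact: integrable_fin_num fgi.
have small k : measurable_fun D k -> (forall x, D x -> `|k x| <= M) -> `|ip mu D k f - ip mu D k (g_ N)| <= eps / 3.
  move=> mk kM; apply: le_trans (le_ip_bounded_diff M0 mk kM fi (gi N)) _.
  apply: le_trans (ler_wpM2l M0 fg) _.
  have M1 : 0 < M + 1 by rewrite ltr_wpDl.
  by rewrite mulrA ler_pdivrMr// mulrC mulrDr mulr1 lerDl ltW.
have /cvgrPdist_le/(_ _ e3) c := HS (g_ N).
apply: filterS c => n h; have h1 := small _ mr rM; have h2 := small _ (mr_ n) (r_M n).
have -> : ip mu D r f - ip mu D (r_ n) f = (ip mu D r f - ip mu D r (g_ N)) +
  (ip mu D r (g_ N) - ip mu D (r_ n) (g_ N)) + - (ip mu D (r_ n) f - ip mu D (r_ n) (g_ N)) by ring.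
have -> : eps = eps / 3 + eps / 3 + eps / 3 by field.
apply: le_trans (ler_normD _ _) _; rewrite normrN; apply: lerD => //.
by apply: le_trans (ler_normD _ _) _; apply: lerD.
Qed.

End BoundedWeak.

(** * Representatives of weights *)

Section AlmostEverywhere.
Context d (T : measurableType d) (R : realType) (mu : {measure set T -> \bar R}) (D : set T).
Hypotheses (mD : measurable D).
Implicit Types (f g r : T -> R) (M : R).

Lemma ae_eq_Rintegral f g : measurable_fun D f -> measurable_fun D g ->
  {ae mu, forall x, D x -> f x = g x} -> \int[mu]_(x in D) f x = \int[mu]_(x in D) g x.
Proof.
move=> mf mg fg; congr fine; apply: ae_eq_integral => //; try exact/measurable_EFinP.
by apply: filterS fg => x H Dx; rewrite H.
Qed.

(** The integral over the set where [r] is negative can only vanish. *)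
Lemma ae_ge0_of_integrals r : measurable_fun D r ->
  (forall A, measurable A -> A `<=` D -> (0 <= \int[mu]_(x in A) (r x)%:E)%E) ->
  {ae mu, forall x, D x -> 0 <= r x}.
Proof.
move=> mr H; pose A := D `&` r @^-1` `]-oo, 0[%classic.
have mA : measurable A by exact: mr.
have AD : A `<=` D by exact: subIsetl.
have Alt x : A x -> r x < 0 by move=> [_]; rewrite /= in_itv.
have mrA : measurable_fun A (EFin \o r) by apply/measurable_EFinP; exact: measurable_funS mr.
have /(ae_eq_integral_abs mu mA mrA) : (\int[mu]_(x in A) `|(r x)%:E| = 0)%E.
  apply/le_anti/andP; split; last exact: integral_ge0.
  have -> : (\int[mu]_(x in A) `|(r x)%:E| = - \int[mu]_(x in A) (r x)%:E)%E.
    rewrite (_ : (\int[mu]_(x in A) (r x)%:E)%E = (\int[mu]_(x in A) - `|(r x)%:E|)%E).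
      by rewrite integral_ge0N ?oppeK// => x _; exact: abse_ge0.
    by apply: eq_integral => x /set_mem /Alt r0; rewrite lte0_abs ?lte_fin// oppeK.
  by rewrite oppe_le0; exact: H.
apply: filterS => x H' Dx; rewrite leNgt; apply/negP => r0.
have Ax : A x by split=> //=; rewrite in_itv.
by have [z] := H' Ax; move: r0; rewrite z ltxx.
Qed.

(** Truncation to the interval from 0 to the absolute value of [M], which is nonempty whatever the
    sign of [M]. *)
Lemma bounded_representative r M : measurable_fun D r -> {ae mu, forall x, D x -> `|r x| <= M} ->
  {ae mu, forall x, D x -> 0 <= r x} -> exists2 r' : T -> R, measurable_fun D r' &
    (forall x, 0 <= r' x <= `|M|) /\ {ae mu, forall x, D x -> r x = r' x}.
Proof.
move=> mr rM r0; exists (fun x => Num.min (Num.max (r x) 0) `|M|).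
  by apply: measurable_minr => //; exact: measurable_maxr.
split=> [x|]; first by apply/andP; split; [rewrite le_min le_max lexx orbT normr_ge0|rewrite ge_min lexx orbT].
apply: filterS2 rM r0 => x h1 h2 Dx.
rewrite (max_idPl (h2 Dx)) (min_idPl _)//.
by apply: le_trans (ler_norm _) (le_trans (h1 Dx) (ler_norm _)).
Qed.

Lemma Rintegral_indicM (A : set T) r : measurable A -> A `<=` D ->
  ip mu D r (\1_A) = \int[mu]_(x in A) r x.
Proof.
move=> mA AD; rewrite /ip /Rintegral; congr fine.
rewrite -{2}(setIidr AD) integral_mkcondr; apply: eq_integral => x _.
by rewrite patchE indicE; case: ifPn => xA; rewrite ?mulr1 ?mulr0.
Qed.

End AlmostEverywhere.

(** * Continuity of the eigenvalues *)

Section WeakStarContinuity.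
Context {R : realType}.
Variable O : @bounded_domain R.
Local Notation Omega := (dom O).
Local Notation Gamma := (boundary (dom O)).
Hypothesis HL : lipschitz_boundary Omega.
Hypothesis Oc : connected Omega.
Implicit Types (u w : h1 O) (rho f g : arcT R -> R) (M : R) (S : set (arcT R)).

Let mG : measurable (Gamma : set (arcT R)) := measurable_boundary O.
Let Goo := arclength_boundary_fin HL.

Lemma bform_ae rho rho' u w : measurable_fun (Gamma : set (arcT R)) rho -> measurable_fun (Gamma : set (arcT R)) rho' ->
  {ae arclength, forall x, Gamma x -> rho x = rho' x} -> bform rho u w = bform rho' u w.
Proof.
move=> mr mr' rr; have [mu_ mw] := ((tr_L2 HL u).1, (tr_L2 HL w).1).
apply: (ae_eq_Rintegral mG (measurable_funM (measurable_funM mr mu_) mw) (measurable_funM (measurable_funM mr' mu_) mw)).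
by apply: (@filterS _ (almost_everywhere arclength) _ _ _ _ rr) => x H Gx; congr (_ * _ * _); exact: H.
Qed.

Lemma steklov_bform rho rho' k : (forall u w, bform rho u w = bform rho' u w) ->
  steklov Omega rho k = steklov Omega rho' k.
Proof.
move=> H; have E lam (u : R * R -> R) : steklov_eigenspace Omega rho lam u = steklov_eigenspace Omega rho' lam u.
  apply/propext; split=> -[hu He]; split=> // v hv; have h := H (to_h1 hu) (to_h1 hv).
    exact (etrans (He v hv) (congr1 (fun z => lam * z) h)).
  exact (etrans (He v hv) (congr1 (fun z => lam * z) (esym h))).
congr (ereal_inf [set _%:E | _ in _]); apply/seteqP; split => t [u [ui ue]]; exists u; split=> // i.
  by have [lam h1 h2] := ue i; exists lam => //; rewrite -E.
by have [lam h1 h2] := ue i; exists lam => //; rewrite E.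
Qed.

Lemma weight_integrable M rho : weight O M rho -> arclength.-integrable (Gamma : set (arcT R)) (EFin \o rho).
Proof.
move=> [mr rM]; apply: (L2_integrable mG Goo); apply: (L2_bounded (M := M) mG Goo mr) => x Gx.
by have /andP[r0 r1] := rM x Gx; rewrite ger0_norm.
Qed.

Lemma bform_one M rho : weight O M rho -> bform rho (one O) (one O) = \int[arclength]_(x in Gamma) rho x.
Proof.
move=> W; have m1 := (tr_L2 HL (one O)).1.
apply: (ae_eq_Rintegral mG (measurable_funM (measurable_funM W.1 m1) m1) W.1).
apply: (@filterS _ (almost_everywhere arclength) _ _ _ _ (trace_smooth HL (smooth_cst 1))) => x H Gx.
have tE : trace Omega (val (one O)) x = 1 by exact: H.
by rewrite /mul_fun /= tE !mulr1.
Qed.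

Lemma bform_one_neq0 M rho : weight O M rho -> ~ ae_zero Omega rho -> bform rho (one O) (one O) != 0.
Proof.
move=> W; apply: contra_notN; rewrite (bform_one W) => /eqP z.
have mr : measurable_fun (Gamma : set (arcT R)) (EFin \o rho) by apply/measurable_EFinP; exact: W.1.
suff /(ae_eq_integral_abs arclength mG mr) : (\int[arclength]_(x in (Gamma : set (arcT R))) `|(rho x)%:E| = 0)%E.
  by apply: (@filterS _ (almost_everywhere arclength)) => x H /H[].
have -> : (\int[arclength]_(x in (Gamma : set (arcT R))) `|(rho x)%:E| = \int[arclength]_(x in (Gamma : set (arcT R))) (rho x)%:E)%E.
  by apply: eq_integral => x /set_mem Gx; have /andP[r0 _] := W.2 x Gx; rewrite gee0_abs// lee_fin.
have /integrable_fin_num F := weight_integrable W.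
move: (congr1 EFin z); rewrite /Rintegral fineK; first exact: id.
exact: F.
Qed.

Lemma weight_indic S : measurable (S : set (arcT R)) -> weight O 1 (\1_S).
Proof.
move=> mS; split; first exact: measurable_indic.
by move=> x _; rewrite indicE; case: (x \in S); rewrite ?lexx ?ler01.
Qed.

Lemma weight_le M M' rho : M <= M' -> weight O M rho -> weight O M' rho.
Proof. by move=> MM [mr rM]; split=> // x /rM /andP[-> /le_trans]; exact. Qed.

(** The hypothesis is convergence of the weights against indicators; it extends to all integrable
    functions, among them the products of two traces, which is the pointwise convergence of the
    boundary forms. *)
Lemma weakstar_continuity rho (S : nat -> set (arcT R)) : Linfty Omega rho ->
  (forall n, measurable (S n : set (arcT R))) -> (forall n, S n `<=` Gamma) ->
  (forall A : set (arcT R), measurable (A : set (arcT R)) -> A `<=` Gamma ->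
     (fun n => arclength (A `&` S n)) @ \oo --> (\int[arclength]_(x in A) (rho x)%:E)%E) ->
  ~ ae_zero Omega rho -> (forall n, ~ ae_zero Omega (\1_(S n))) ->
  weakstar_cvg Omega (fun n => \1_(S n)) rho /\
  forall k : nat, (fun n => steklov Omega (\1_(S n)) k) @ \oo --> steklov Omega rho k.
Proof.
move=> [mr [M rM]] mS SG HA nz nzS.
(* Nonnegativity of the limit weight comes from its integrals being limits of lengths. *)
have r0 : {ae arclength, forall x, Gamma x -> 0 <= rho x}.
  apply: (ae_ge0_of_integrals mG mr) => A mA AG.
  apply: (@cvge_ge _ \oo _ _ _ _ _ _ (HA A mA AG)).
  by apply: nearW => n; exact: measure_ge0.
have [rho' mr' [r'M rr']] := bounded_representative mr rM r0.
(* One bound for the limit weight and for all indicators. *)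
pose K := Num.max `|M| 1.
have K0 : 0 <= K by rewrite le_max normr_ge0.
have W : weight O K rho'.
  by split=> // x _; have /andP[-> h] := r'M x; rewrite le_max h.
have Wn n : weight O K (\1_(S n)) by apply: weight_le (weight_indic (mS n)); rewrite le_max lexx orbT.
have HI A : measurable (A : set (arcT R)) -> A `<=` Gamma ->
    ip arclength Gamma (\1_(S n)) (\1_A) @[n --> \oo] --> ip arclength Gamma rho' (\1_A).
  move=> mA AG.
  have E1 n : ip arclength Gamma (\1_(S n)) (\1_A) = fine (arclength (A `&` S n)).
    rewrite (Rintegral_indicM arclength _ mA AG) /Rintegral (integral_indic arclength mA (mS n)); congr (fine (arclength _)).
    exact: setIC.
  under eq_fun do rewrite E1.
  rewrite (Rintegral_indicM arclength _ mA AG).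
  have mrA' := measurable_funS mG AG mr'.
  have /integrable_fin_num F : arclength.-integrable A (EFin \o rho').
    exact: (integrableS mG mA AG (weight_integrable W)).
  have FE : (\int[arclength]_(x in A) (rho x)%:E = (\int[arclength]_(x in A) rho' x)%:E)%E.
    rewrite /Rintegral fineK; last exact: F.
    have m1 : measurable_fun A (EFin \o rho) by apply/measurable_EFinP; exact: measurable_funS mr.
    have m2 : measurable_fun A (EFin \o rho') by apply/measurable_EFinP.
    have ae : ae_eq arclength A (EFin \o rho) (EFin \o rho').
      by apply: (@filterS _ (almost_everywhere arclength) _ _ _ _ rr') => x H /AG /H /= ->.
    exact (ae_eq_integral _ _ mA m1 m2 ae).
  apply: fine_cvg; rewrite -FE; exact: HA.
have wk f : arclength.-integrable Gamma (EFin \o f) ->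
    ip arclength Gamma (\1_(S n)) f @[n --> \oo] --> ip arclength Gamma rho' f.
  apply: (bounded_weak_cvg (M := K) mG Goo K0) => //.
  - by move=> n x Gx; have /andP[h1 h2] := (Wn n).2 x Gx; rewrite ger0_norm.
  - by move=> x Gx; have /andP[h1 h2] := W.2 x Gx; rewrite ger0_norm.
split=> [f fi|k].
  have := wk f fi; have -> // : ip arclength Gamma rho' f = \int[arclength]_(x in Gamma) (rho x * f x).
  have mf : measurable_fun (Gamma : set (arcT R)) f by apply/measurable_EFinP; exact: measurable_int fi.
  apply: (ae_eq_Rintegral mG (measurable_funM mr' mf) (measurable_funM mr mf)).
  by apply: (@filterS _ (almost_everywhere arclength) _ _ _ _ rr') => x H Gx; congr (_ * _); exact/esym/H.
have nz' : ~ ae_zero Omega rho'.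
  move=> z; apply: nz; apply: (@filterS2 _ (almost_everywhere arclength) _ _ _ _ _ rr' z) => x H H' Gx.
  by rewrite H// H'.
have -> : steklov Omega rho k = steklov Omega rho' k by apply: steklov_bform => u w; exact: bform_ae.
have bc u w : bform (\1_(S n)) u w @[n --> \oo] --> bform rho' u w.
  have E r : bform r u w = ip arclength Gamma r (fun x => trace Omega (val u) x * trace Omega (val w) x).
    by apply: eq_Rintegral => x _; rewrite mulrA.
  rewrite E; under eq_fun do rewrite E.
  exact: (wk _ (L2_mul_integrable mG (tr_L2 HL u) (tr_L2 HL w))).
exact (steklov_cvg HL Oc K0 Wn W (fun n => bform_one_neq0 (Wn n) (nzS n)) (bform_one_neq0 W nz') bc).
Qed.

End WeakStarContinuity.
(** * Relaxation by characteristic functions *)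

Section DenseConvergence.
Context {R : realType} {V : lmodType R}.
Implicit Types (b e : V -> V -> R) (u v w : V).

(** Young's inequality: [b] is nonnegative on [t^-1 *: u] plus or minus [v]. *)
Lemma form_cross_le b K e u v t : psd_form b -> 0 < t -> (forall w, b w w <= K * e w w) ->
  `|2 * b u v| <= t * (K * e v v) + t^-1 * (K * e u u).
Proof.
move=> bP t0 bK; have tn : t != 0 by rewrite gt_eqF.
have q (s : R) : s ^+ 2 = 1 -> 2 * s * b u v <= t * b v v + t^-1 * b u u.
  move=> s1; have := form_ge0 bP (t^-1 *: u + (- s) *: v).
  rewrite (form_quad bP) !(formZl bP, formZr bP) sqrrN s1 mul1r -(ler_pM2l t0) mulr0.
  have -> : t * (t^-1 * (t^-1 * b u u) + 2 * - s * (t^-1 * b u v) + b v v) =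
    t * b v v + t^-1 * b u u - 2 * s * b u v by field.
  by rewrite subr_ge0.
have h1 := q 1 (expr1n _ _); have h2 := q (-1) (etrans (sqrrN 1) (expr1n _ _)).
have h3 := ler_wpM2l (ltW t0) (bK v).
have h4 : t^-1 * b u u <= t^-1 * (K * e u u) by apply: ler_wpM2l (bK u); rewrite invr_ge0 ltW.
by rewrite ler_norml; apply/andP; split; lra.
Qed.

(** The uniform bound by [K * e] makes replacing [u] by a nearby element of [D] cost little,
    uniformly in [n]; polarization gives the mixed values. *)
Lemma form_cvg_dense (b_ : nat -> V -> V -> R) b e K (D : V -> Prop) : 0 <= K ->
  psd_form e -> psd_form b -> (forall n, psd_form (b_ n)) ->
  (forall w, b w w <= K * e w w) -> (forall n w, b_ n w w <= K * e w w) ->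
  (forall u eta, 0 < eta -> exists2 w, D w & e (u - w) (u - w) <= eta) ->
  (forall w, D w -> b_ n w w @[n --> \oo] --> b w w) ->
  forall u v, b_ n u v @[n --> \oo] --> b u v.
Proof.
move=> K0 eP bP bnP bK bnK dense Dcvg.
suff diag u : b_ n u u @[n --> \oo] --> b u u.
  move=> u v; rewrite (form_polar bP); under eq_fun do rewrite (form_polar (bnP _)).
  by apply: cvgM; [apply: cvgB; exact: diag|exact: cvg_cst].
apply/cvgrPdist_le => eps eps0.
(* [E] bounds [e w w] for every [w] within 1 of [u]. The weight [t] in Young's inequality makes the
   term in [w] at most [eps / 8]; only then is [eta] chosen, against the large factor [1 + t^-1] of
   the term in [u - w]. *)
pose E := 2 * e u u + 2; have E0 : 0 < E by rewrite ltr_wpDl// mulr_ge0// form_ge0.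
pose K1 := K + 1; have K10 : 0 < K1 by rewrite ltr_wpDl.
pose t := eps / (8 * K1 * E); have t0 : 0 < t by rewrite divr_gt0// !mulr_gt0.
pose eta := Num.min 1 (eps / (8 * K1 * (1 + t^-1))).
have ti : 0 < 1 + t^-1 by rewrite addr_gt0// invr_gt0.
have eta0 : 0 < eta by rewrite lt_min ltr01 divr_gt0// !mulr_gt0.
have [w Dw ew] := dense u eta eta0.
have near_w c : psd_form c -> (forall z, c z z <= K * e z z) -> `|c u u - c w w| <= eps / 4.
  move=> cP cK; set x := u - w.
  have -> : c u u - c w w = 2 * c x w + c x x by rewrite (form_diag_sub cP u w) -/x; ring.
  apply: le_trans (ler_normD _ _) _; rewrite (ger0_norm (form_ge0 cP x)).
  apply: le_trans (lerD (form_cross_le x w cP t0 cK) (cK x)) _.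
  have ewE : e w w <= E.
    have -> : w = u + - x by rewrite /x opprB addrC subrK.
    apply: le_trans (form_sqD eP u (- x)) _; rewrite lerD2l -[leRHS]mulr1 ler_pM2l//.
    rewrite formNl// formNr// opprK; apply: le_trans ew _; by rewrite ge_min lexx.
  have KK : K <= K1 by rewrite lerDl.
  have h1 : t * (K * e w w) <= eps / 8.
    have -> : eps / 8 = t * (K1 * E) by rewrite /t; field; rewrite !gt_eqF.
    rewrite ler_pM2l//; apply: ler_pM => //; exact: form_ge0.
  have h2 : (1 + t^-1) * (K * e x x) <= eps / 8.
    have he : e x x <= eps / (8 * K1 * (1 + t^-1)) by apply: le_trans ew _; rewrite ge_min lexx orbT.
    have -> : eps / 8 = (1 + t^-1) * (K1 * (eps / (8 * K1 * (1 + t^-1)))).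
      move: (1 + t^-1) ti => z z0; field; by rewrite !gt_eqF.
    rewrite ler_pM2l//; apply: ler_pM => //; exact: form_ge0.
  move: h1 h2; rewrite [(1 + t^-1) * _]mulrDl mul1r.
  move: (t * (K * e w w)) (t^-1 * (K * e x x)) (K * e x x) => a1 a2 a3 h1 h2.
  lra.
have e2 : 0 < eps / 2 by rewrite divr_gt0.
have /cvgrPdist_le/(_ _ e2) c := Dcvg w Dw.
apply: filterS c => n h.
have h1 := near_w b bP bK; have h2 := near_w (b_ n) (bnP n) (bnK n).
have -> : b u u - b_ n u u = (b u u - b w w) + (b w w - b_ n w w) + - (b_ n u u - b_ n w w) by ring.
have -> : eps = eps / 4 + eps / 2 + eps / 4 by field.
apply: le_trans (ler_normD _ _) _; rewrite normrN; apply: lerD => //.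
by apply: le_trans (ler_normD _ _) _; apply: lerD.
Qed.

End DenseConvergence.

(** * Boundary sets with prescribed density *)

Section CellSets.
Context {R : realType}.
Variable O : @bounded_domain R.
Local Notation Omega := (dom O).
Local Notation Gamma := (boundary (dom O)).
Hypothesis HL : lipschitz_boundary Omega.
Local Notation leb := (@lebesgue_measure R).
Implicit Types (K : chart O) (P S : set (arcT R)) (rho f g : arcT R -> R).

Let mG : measurable (Gamma : set (arcT R)) := measurable_boundary O.
Let Goo := arclength_boundary_fin HL.

Let fin_arc P : measurable P -> P `<=` Gamma -> arclength P \is a fin_num.
Proof.
move=> mP PG; rewrite ge0_fin_numE ?measure_ge0//; apply: le_lt_trans Goo.
by apply: le_measure => //; rewrite inE.
Qed.

(* The Hausdorff measure has no atoms: inside a chart the mass to the left of [s] is Lipschitz in [s]. *)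
Lemma subset_of_length K P (t : R) : measurable P -> P `<=` Gamma `&` tube K (ch_tau K) ->
  0 <= t <= fine (arclength P) -> exists S, [/\ measurable S, S `<=` P & arclength S = t%:E].
Proof.
move=> mP PK /andP[t0 tP].
have PG : P `<=` Gamma by move=> x /PK[].
pose A (s : R) : set (arcT R) := P `&` (ch_a K @^-1` `]-oo, s]%classic).
have mB (I : set R) : measurable (I : set (measurableTypeR R)) -> measurable (P `&` (ch_a K @^-1` I) : set (arcT R)).
  move=> mI; apply: measurableI => //; rewrite -[X in measurable X]setTI.
  exact: (measurable_ch_a K measurableT mI).
have mA s : measurable (A s) by exact: mB.
have AP s : A s `<=` P by exact: subIsetl.
have finA s : arclength (A s) \is a fin_num by apply: fin_arc => // x /AP /PG.
pose F s := fine (arclength (A s)).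
have Fle s s' : s <= s' -> F s <= F s'.
  move=> ss; rewrite -lee_fin !fineK//; apply: le_measure; rewrite ?inE//.
  move=> x [Px xs]; split=> //; move: xs; rewrite /= !in_itv/= => xs; exact: le_trans ss.
have C0 : 0 <= 1 + ch_L K by rewrite addr_ge0// ch_L0.
have Fup s s' : s <= s' -> F s' <= F s + (1 + ch_L K) * (s' - s).
  move=> ss; rewrite -lee_fin EFinD !fineK//.
  pose I : set R := `]s, s']%classic.
  have mI : measurable (I : set (measurableTypeR R)) by exact: measurable_itv.
  have cover : A s' `<=` A s `|` (P `&` (ch_a K @^-1` I)).
    move=> x [Px]; rewrite /= !in_itv/= => xs.
    have [xs'|xs'] := leP (ch_a K x) s; [left|right]; split=> //.
    by rewrite /I /= in_itv/= xs'.
  apply: le_trans (le_measure _ _ _ cover) _; rewrite ?inE//; first by apply: measurableU => //; exact: mB.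
  apply: le_trans (measureU2 _ _ _) _ => //; first exact: mB.
  rewrite leeD2l//.
  have h := arclength_tube K I.
  have sub : P `&` (ch_a K @^-1` I) `<=` Gamma `&` tube K (ch_tau K) `&` ch_a K @^-1` I.
    by move=> x [/PK]; split.
  have h0 : (arclength (P `&` (ch_a K @^-1` I)) <= (1 + ch_L K)%:E * leb (I `&` ch_itv K))%E.
    by apply: le_trans h; exact: le_hausdorff1 sub.
  apply: le_trans h0 _; rewrite EFinM lee_wpmul2l//.
  apply: (@le_trans _ _ (leb I)).
    apply: le_measure => [||x []//]; rewrite inE//.
    by apply: measurableI => //; exact: measurable_ch_itv.
  rewrite [X in (X <= _)%E](lebesgue_measure_itv `]s, s']) /= lte_fin.
  by case: ifPn => _; rewrite ?EFinB// lee_fin subr_ge0.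
have Flip s s' : `|F s - F s'| <= (1 + ch_L K) * `|s - s'|.
  wlog ss : s s' / s <= s'.
    by move=> H; have [h|/ltW h] := leP s s'; [exact: H|rewrite distrC (distrC s); exact: H].
  rewrite distrC (distrC s) !ger0_norm ?subr_ge0//; last exact: Fle.
  by rewrite lerBlDl; exact: Fup.
have cF := lipschitz_continuous C0 Flip.
have rho0 := ch_rho0 K.
have F0 : F (- ch_rho K) = 0.
  rewrite /F (_ : A _ = set0) ?measure0//; apply/seteqP; split => // x [/PK[_ [+ _]]].
  by rewrite /= in_itv/= ltr_norml => /andP[h _]; rewrite leNgt h.
have F1 : F (ch_rho K) = fine (arclength P).
  rewrite /F (_ : A _ = P)//; apply/seteqP; split => [x /AP//|x Px]; split=> //.
  have [_ [+ _]] := PK x Px; rewrite ltr_norml => /andP[_ h].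
  by rewrite /= in_itv/= ltW.
have rr : - ch_rho K <= ch_rho K by rewrite ge0_cp// ltW.
have v01 : Num.min (F (- ch_rho K)) (F (ch_rho K)) <= t <= Num.max (F (- ch_rho K)) (F (ch_rho K)).
  by rewrite F0 F1 ge_min le_max t0 tP orbT.
have [s _ Fs] := IVT rr (continuous_subspaceT cF) v01.
exists (A s); split=> //; by rewrite -Fs fineK.
Qed.

(** A point is sorted by the first half-tube of the cover that contains it and by its cell in a fine
    grid; both choices are unique, so the pieces are disjoint. *)
Lemma boundary_cells (delta : R) : 0 < delta -> exists (J : finType) (P : J -> set (arcT R)) (K : J -> chart O),
  [/\ forall j, measurable (P j), forall j, P j `<=` Gamma `&` tube (K j) (ch_tau (K j)),
      forall i j x, P i x -> P j x -> i = j, Gamma `<=` \bigcup_j P j &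
      forall j x y, P j x -> P j y -> csq x delta y].
Proof.
move=> delta0; have [n [K GK]] := boundary_cover HL.
pose M := 2 * (`|dom_radius O| + 1); have M0 : 0 < M by rewrite mulr_gt0// ltr_wpDl.
have [N [d [d0 dd /= [cov disj]]]] := cell_grid M0 delta0.
pose c (ij : 'I_N * 'I_N) := cell (- M + ij.1%:R * d, - M + ij.2%:R * d) d.
pose T (i : 'I_n) := half_tube (K i) `\` \bigcup_(j in [set j : 'I_n | (j < i)%N]) half_tube (K j).
exists ('I_n * ('I_N * 'I_N))%type, (fun j => Gamma `&` T j.1 `&` c j.2), (fun j => K j.1); split.
- move=> j; apply: measurableI; last by apply: borel_arc_measurable; exact: measurable_cell.
  apply: measurableI; first exact: mG.
  by apply: measurableD; apply: open_arc_measurable; [|apply: bigcup_open => i _]; exact: open_half_tube.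
- by move=> j x [[Gx [xT _]] _]; split=> //; exact: half_tubeW.
- move=> [i ij] [i' ij'] x [[_ [x1 n1]] x2] [[_ [y1 n2]] y2] /=.
  have /= e := disj _ _ _ x2 y2; rewrite e; congr pair; apply/val_inj/eqP; rewrite eqn_leq.
  apply/andP; split; rewrite leqNgt; apply/negP => lt.
    by apply: n1; exists i'.
  by apply: n2; exists i.
- move=> x Gx; have [i0 _ xi0] := GK x Gx.
  have xi0' : `[< half_tube (K i0) x >] by apply/asboolP.
  have [i /asboolP xi imin] := @arg_minnP _ i0 (fun i => `[< half_tube (K i) x >]) (fun i => nat_of_ord i) xi0'.
  have [ij _ cx] : (\bigcup_ij c ij) x.
    apply: cov; have cx := closure_dom Gx.1; have [x1 x2] := cx.
    have r := ler_norm (dom_radius O).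
    rewrite /csq/= /M mulrC mulKf//; split; [apply: le_trans x1 _|apply: le_trans x2 _]; lra.
  exists (i, ij) => //; split => //; split=> //; split=> // -[j /= ji xj].
  have := imin j; rewrite leqNgt ji => /(_ _)/negP; apply => //; exact/asboolP.
- move=> j x y [_ x1] [_ y1]; have [h1 h2] := cell_diam x1 y1.
  by split; [exact: le_trans h1 dd|exact: le_trans h2 dd].
Qed.

(** In each cell a subset is taken whose length is the integral of [rho], so the union and [rho]
    pair equally with functions constant on cells. Such a function lies within [omega] of [f], and
    this error enters once for each of the two weights. *)
Lemma approximating_set (delta : R) rho : 0 < delta -> weight O 1 rho -> exists S : set (arcT R),
  [/\ measurable S, S `<=` Gamma & forall f (omega : R), L2 arclength (Gamma : set (arcT R)) f ->
    (forall x y, Gamma x -> Gamma y -> csq x delta y -> `|f x - f y| <= omega) ->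
    `|ip arclength Gamma (\1_S) f - ip arclength Gamma rho f| <= 2 * (omega * fine (arclength (Gamma : set (arcT R))))].
Proof.
move=> delta0 W; have [J [P [K [mP PK dP GP Pd]]]] := boundary_cells delta0.
have PG j : P j `<=` Gamma by move=> x /PK[].
have ri := weight_integrable HL W.
have riP j := integrableS mG (mP j) (PG j) ri.
have ex j : exists S, [/\ measurable S, S `<=` P j & arclength S = (\int[arclength]_(x in P j) rho x)%:E].
  apply: (subset_of_length (mP j) (PK j)); apply/andP; split.
    by apply: Rintegral_ge0 => x /PG /W.2 /andP[].
  have <- : \int[arclength]_(x in P j) (fun=> 1) x = fine (arclength (P j)) by rewrite Rintegral_cst// mul1r.
  apply: le_Rintegral => //.
    apply: (L2_integrable (mP j)); first by rewrite -ge0_fin_numE ?measure_ge0//; exact: fin_arc.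
    by apply: L2_cst => //; rewrite -ge0_fin_numE ?measure_ge0//; exact: fin_arc.
  by move=> x /PG /W.2 /andP[].
have [S_ SP] := choice ex.
pose S : set (arcT R) := \bigcup_j S_ j.
have mS : measurable S by apply: fin_bigcup_measurable => // j _; have [] := SP j.
have SG : S `<=` Gamma by move=> x [j _ Sx]; have [_ SPj _] := SP j; exact: PG (SPj x Sx).
have SPj j : P j `&` S = S_ j.
  have [_ sub _] := SP j; apply/seteqP; split => [x [Px [i _ Sx]]|x Sx]; last by split; [exact: sub|exists j].
  by have [_ subi _] := SP i; rewrite (dP j i x Px (subi x Sx)).
exists S; split=> // f omega fL osc.
have exc j : exists c : R, forall x, P j x -> `|f x - c| <= omega.
  have [[y Py]|nP] := pselect (exists y, P j y); last by exists 0 => x Px; exfalso; apply: nP; exists x.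
  exists (f y) => x Px; apply: osc; [exact: PG Px|exact: PG Py|exact: Pd Px Py].
have [c cP] := choice exc.
pose g x := \sum_(j <- index_enum J) c j * \1_(P j) x.
have gI r : L2 arclength (Gamma : set (arcT R)) r -> L2 arclength (Gamma : set (arcT R)) g /\
    ip arclength Gamma g r = \sum_(j <- index_enum J) c j * ip arclength Gamma (\1_(P j)) r.
  exact: (ip_sum_seq mG (index_enum J) c (fun j => L2_indic_on mG Goo (mP j))).
have gL : L2 arclength (Gamma : set (arcT R)) g by exact: (gI _ fL).1.
have fg x : Gamma x -> `|f x - g x| <= omega.
  move=> Gx; have [j _ Px] := GP x Gx; rewrite /g (bigD1_seq j) ?mem_index_enum ?index_enum_uniq//=.
  rewrite indicE mem_set// mulr1 big1 ?addr0; first exact: cP.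
  move=> i ij; rewrite indicE memNset ?mulr0// => Pi; move: ij; by rewrite (dP i j x Pi Px) eqxx.
have fi := L2_integrable mG Goo fL; have gi := L2_integrable mG Goo gL.
have fgi : arclength.-integrable Gamma (EFin \o (fun x => `|f x - g x|)) by exact: integrable_norm (integrableB mG fi gi).
have fg1 : \int[arclength]_(x in Gamma) `|f x - g x| <= omega * fine (arclength (Gamma : set (arcT R))).
  have <- : \int[arclength]_(x in Gamma) (fun=> omega) x = omega * fine (arclength (Gamma : set (arcT R))) by rewrite Rintegral_cst.
  by apply: le_Rintegral => //; apply: L2_integrable => //; exact: L2_cst.
have diff r : weight O 1 r -> `|ip arclength Gamma r f - ip arclength Gamma r g| <= omega * fine (arclength (Gamma : set (arcT R))).
  move=> Wr; apply: le_trans fg1; rewrite -[leRHS]mul1r.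
  apply: (le_ip_bounded_diff mG ler01 Wr.1 _ fi gi) => x Gx.
  by have /andP[h1 h2] := Wr.2 x Gx; rewrite ger0_norm.
have WL r : weight O 1 r -> L2 arclength (Gamma : set (arcT R)) r.
  move=> Wr; apply: (L2_bounded (M := 1) mG Goo Wr.1) => x Gx.
  by have /andP[h1 h2] := Wr.2 x Gx; rewrite ger0_norm.
have WS := weight_indic O mS.
have same : ip arclength Gamma (\1_S) g = ip arclength Gamma rho g.
  rewrite ipC (gI _ (WL _ WS)).2 [RHS]ipC (gI _ (WL _ W)).2; apply: eq_bigr => j _; congr (_ * _).
  rewrite ipC (Rintegral_indicM arclength _ (mP j) (PG j)) [RHS]ipC (Rintegral_indicM arclength _ (mP j) (PG j)).
  rewrite {1}/Rintegral (integral_indic arclength (mP j) mS) setIC SPj; have [_ _ ->] := SP j.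
  by [].
have h1 := diff _ WS; have h2 := diff _ W.
have -> : ip arclength Gamma (\1_S) f - ip arclength Gamma rho f =
  (ip arclength Gamma (\1_S) f - ip arclength Gamma (\1_S) g) - (ip arclength Gamma rho f - ip arclength Gamma rho g).
  by rewrite same; ring.
by apply: le_trans (ler_normB _ _) _; rewrite mulrDl mul1r; apply: lerD.
Qed.

End CellSets.

(** * Relaxation of the extremal problems *)

Section Relaxation.
Context {R : realType}.
Variable O : @bounded_domain R.
Local Notation Omega := (dom O).
Local Notation Gamma := (boundary (dom O)).
Hypothesis HL : lipschitz_boundary Omega.
Hypothesis Oc : connected Omega.
Implicit Types (u w : h1 O) (S : set (arcT R)) (rho f g : arcT R -> R).

Let mO := measurable_dom O.
Let mG : measurable (Gamma : set (arcT R)) := measurable_boundary O.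
Let Goo := arclength_boundary_fin HL.

Lemma eform_le : exists2 C : R, 0 <= C & forall w, eform w w <= C * h1form w w.
Proof.
have [C [C0 [t0 t00 trP]]] := trace_estimate HL.
have Ct : 0 <= C / t0 by rewrite divr_ge0// ltW.
have Ct' : 0 <= C * t0 by rewrite mulr_ge0// ltW.
exists (1 + C / t0 + C * t0); first by rewrite !addr_ge0.
move=> w; have := trP _ _ _ (h1P w) (traceP HL (h1P w)) t00 (lexx _).
rewrite -/(trform w w) -/(l2form w w) -/(dirform w w) /eform /h1form.
have := form_ge0 (dirform_psd O) w; have := form_ge0 (l2form_psd O) w.
move: (C / t0) (C * t0) Ct Ct' (trform w w) (dirform w w) (l2form w w) => x y x0 y0 t d l l0 d0 h.
have h1 := mulr_ge0 x0 d0; have h2 := mulr_ge0 y0 l0.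
have -> : (1 + x + y) * (d + l) = (l + (x * l + y * d)) + (d + x * d + y * l) by ring.
apply: le_trans (lerD (lexx l) h) _; rewrite lerDl; exact: addr_ge0 (addr_ge0 d0 h1) h2.
Qed.

Lemma h1form_dense u (eta : R) : 0 < eta ->
  exists2 w, smooth (val w) & h1form (w - u) (w - u) <= eta.
Proof.
move=> eta0; have e0 : 0 < eta / 3 by rewrite divr_gt0.
have [phi [sphi p0 pD]] := H1_smooth_dense HL (h1P u) e0.
pose w := to_h1 (H1_smooth O sphi); exists w; first by rewrite val_to_h1.
have g v : axis v -> gradform v (w - u) (w - u) <= eta / 3.
  move=> av; rewrite -lee_fin -sqint_sub_wD//; apply: le_trans (pD v av).
  have Lu := wD_L2 av (h1P u); have Lw := wD_L2 av (h1P w).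
  have LD := L2_smooth O (smooth_D av sphi).
  have ae : {ae area, forall x, Omega x -> wD Omega v (val w) x - wD Omega v (val u) x = 'D_v phi x - wD Omega v (val u) x}.
    apply: (@filterS _ (almost_everywhere area) _ _ _ _ (wD_smooth O av sphi)) => x H Ox.
    by congr (_ - _); exact: H.
  by rewrite le_eqVlt; apply/orP; left; apply/eqP; exact (ae_eq_sqint mO (L2B mO Lw Lu).1 (L2B mO LD Lu).1 ae).
have l : l2form (w - u) (w - u) <= eta / 3.
  have L : L2 area Omega (val (w - u)) := H1_L2 (h1P _).
  rewrite -lee_fin; apply: le_trans p0; rewrite -(sqint_ip mO L) val_h1_sub; exact: lexx.
have -> : eta = eta / 3 + eta / 3 + eta / 3 by field.
rewrite /h1form; apply: lerD => //; rewrite /dirform; apply: lerD; apply: g; by [left|right].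
Qed.

Lemma eform_dense u (eta : R) : 0 < eta ->
  exists2 w, smooth (val w) & eform (u - w) (u - w) <= eta.
Proof.
move=> eta0; have [C C0 CP] := eform_le.
have C1 : 0 < C + 1 by rewrite ltr_wpDl.
have [w sw hw] := h1form_dense u (divr_gt0 eta0 C1); exists w => //.
have eP := eform_psd HL.
rewrite -(opprB w u) (formNl eP) (formNr eP) opprK; apply: le_trans (CP _) _.
apply: le_trans (ler_wpM2l C0 hw) _.
by rewrite mulrA ler_pdivrMr// mulrC mulrDr mulr1 lerDl ltW.
Qed.

Lemma boundary_uniform_continuity (f : R * R -> R) (omega : R) : continuous f -> 0 < omega ->
  exists2 delta : R, 0 < delta & forall x y, Gamma x -> Gamma y -> csq x delta y -> `|f x - f y| <= omega.
Proof.
move=> cf o0; have o2 : 0 < omega / 2 by rewrite divr_gt0.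
have ex x : exists e : R, 0 < e /\ forall y, csq x e y -> `|f x - f y| <= omega / 2.
  have /cvgrPdist_le/(_ _ o2) N := cf x.
  by have [e e0 eP] := nbhs_csq N; exists e.
have [e eP] := choice ex.
have nb x : Gamma x -> nbhs x (csq x (e x / 2)) by move=> _; apply: nbhs_of_csq; rewrite divr_gt0// (eP x).1.
have [s [_ sU]] := compact_cover_seq (@compact_boundary _ O) nb.
have e0 (i : 'I_(size s)) : 0 < e (tnth (in_tuple s) i) / 2 by rewrite divr_gt0// (eP _).1.
have [m m0 mle] := common_lower_bound e0; exists m => // y z Gy Gz [z1 z2].
have [x xs [x1 x2]] := sU y Gy.
have is_ : (index x s < size s)%N by rewrite index_mem.
have := mle (Ordinal is_); rewrite (tnth_nth x)/= nth_index// => mx.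
have hy : csq x (e x) y.
  by have := (eP x).1; split; [apply: le_trans x1 _|apply: le_trans x2 _]; lra.
have hz : csq x (e x) z.
  move: z1 z2 x1 x2 mx; rewrite /csq/= !ler_norml => /andP[? ?] /andP[? ?] /andP[? ?] /andP[? ?] ?.
  by split; apply/andP; split; lra.
have := (eP x).2 _ hy; have := (eP x).2 _ hz.
move: (f x) (f y) (f z) => a b c; rewrite !ler_norml => /andP[? ?] /andP[? ?].
by apply/andP; split; lra.
Qed.

Lemma bform_smooth rho w : measurable_fun (Gamma : set (arcT R)) rho -> smooth (val w) ->
  bform rho w w = ip arclength Gamma rho (fun x => val w x * val w x).
Proof.
move=> mr sw; have mt := (tr_L2 HL w).1; have ms := (L2_smooth_boundary HL sw).1.
apply: (ae_eq_Rintegral mG (measurable_funM (measurable_funM mr mt) mt) (measurable_funM mr (measurable_funM ms ms))).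
apply: (@filterS _ (almost_everywhere arclength) _ _ _ _ (trace_smooth HL sw)) => x H Gx.
have tE : trace Omega (val w) x = val w x by exact: H.
by rewrite /mul_fun /= tE mulrA.
Qed.

(** For smooth [w] the square of [w] is uniformly continuous on the boundary, so refining the cells
    gives convergence of the forms on smooth functions; these are dense for [eform], and all the
    forms are bounded by it. *)
Lemma approximating_sequence rho : weight O 1 rho -> exists S : nat -> set (arcT R),
  [/\ forall n, measurable (S n), forall n, S n `<=` Gamma,
      forall n, arclength (S n) = (\int[arclength]_(x in Gamma) rho x)%:E &
      forall u w, bform (\1_(S n)) u w @[n --> \oo] --> bform rho u w].
Proof.
move=> W; have d0 n : 0 < n.+1%:R^-1 :> R by rewrite invr_gt0.
have [S SP] := choice (fun n => approximating_set HL (d0 n) W).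
have mS n : measurable (S n) by have [] := SP n.
have SG n : S n `<=` Gamma by have [] := SP n.
have Wn n := weight_indic O (mS n).
have L1 : L2 arclength (Gamma : set (arcT R)) (fun=> 1) := L2_cst 1 mG Goo.
exists S; split=> // [n|].
  (* The constant 1 does not oscillate, so with [omega = 0] the total length is exact, not merely
     approximate. *)
  have [_ _ /(_ (fun=> 1) 0 L1)] := SP n.
  rewrite mul0r mulr0 => H.
  have /eqP : `|ip arclength Gamma (\1_(S n)) (fun=> 1) - ip arclength Gamma rho (fun=> 1)| == 0.
    by rewrite eq_le normr_ge0 andbT; apply: H => x y _ _ _; rewrite subrr normr0.
  move=> /eqP; rewrite normr_eq0 subr_eq0 => /eqP E.
  have one_r r : ip arclength Gamma r (fun=> 1) = \int[arclength]_(x in Gamma) r x.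
    by apply: eq_Rintegral => x _; rewrite mulr1.
  rewrite -one_r -E one_r /Rintegral (integral_indic arclength mG (mS n)) (setIidl (SG n)) fineK//.
  rewrite ge0_fin_numE ?measure_ge0//; apply: le_lt_trans Goo.
  by apply: le_measure => //; rewrite inE.
apply: (form_cvg_dense (K := 1) (D := fun w => smooth (val w)) ler01 (eform_psd HL) (bform_psd HL W)
  (fun n => bform_psd HL (Wn n)) (fun w => bform_le HL w ler01 W) (fun n w => bform_le HL w ler01 (Wn n)) eform_dense).
move=> w sw; rewrite (bform_smooth W.1 sw); under eq_fun do rewrite (bform_smooth (Wn _).1 sw).
set f := fun x => val w x * val w x.
have sf : smooth f := smoothM sw sw.
have fL : L2 arclength (Gamma : set (arcT R)) f := L2_smooth_boundary HL sf.
set G := fine (arclength (Gamma : set (arcT R))).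
have G0 : 0 <= G by exact: fine_ge0.
apply/cvgrPdist_le => eps eps0.
have o0 : 0 < eps / (2 * (G + 1)) by rewrite divr_gt0// mulr_gt0// ltr_wpDl.
have [delta delta0 osc] := boundary_uniform_continuity (smooth_continuous sf) o0.
have := near_infty_natSinv_lt (PosNum delta0); apply: filterS => n /= nd.
have [_ _ H] := SP n; rewrite distrC.
have osc' x y : Gamma x -> Gamma y -> csq x n.+1%:R^-1 y -> `|f x - f y| <= eps / (2 * (G + 1)).
  by move=> Gx Gy [h1 h2]; apply: osc => //; split; [exact: le_trans h1 (ltW nd)|exact: le_trans h2 (ltW nd)].
apply: le_trans (H _ _ fL osc') _; rewrite -/G.
have -> : 2 * (eps / (2 * (G + 1)) * G) = eps * (G / (G + 1)) by field; rewrite gt_eqF// ltr_wpDl.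
rewrite -[leRHS]mulr1 ler_pM2l// ler_pdivrMr ?ltr_wpDl// mul1r lerDl//.
Qed.

Lemma indic_admissible (alpha : R) S : admissible_sets Omega alpha S -> admissible Omega alpha (\1_S).
Proof.
move=> [mS SG aS]; split.
- split; first exact: measurable_indic.
  by exists 1; apply: aeW => x _; rewrite indicE; case: (x \in S); rewrite ?normr1 ?normr0.
- by apply: aeW => x _; rewrite indicE; case: (x \in S); rewrite ?lexx ?ler01.
- by rewrite (integral_indic arclength mG mS) (setIidl SG).
Qed.

Lemma approximation_by_sets (alpha : R) rho k : 0 < alpha -> admissible Omega alpha rho ->
  exists2 S : nat -> set (arcT R), forall n, admissible_sets Omega alpha (S n) &
    (fun n => steklov_neumann Omega (S n) k) @ \oo --> steklov Omega rho k.
Proof.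
move=> alpha0 [[mr _] r01 rint].
have rM : {ae arclength, forall x, Gamma x -> `|rho x| <= 1}.
  by apply: (@filterS _ (almost_everywhere arclength) _ _ _ _ r01) => x H /H /andP[h1 h2]; rewrite ger0_norm.
have r0 : {ae arclength, forall x, Gamma x -> 0 <= rho x}.
  by apply: (@filterS _ (almost_everywhere arclength) _ _ _ _ r01) => x H /H /andP[h1 h2].
have [rho' mr' [r'M rr']] := bounded_representative mr rM r0.
have W : weight O 1 rho' by split=> // x _; have := r'M x; rewrite normr1.
have -> : steklov Omega rho k = steklov Omega rho' k by apply: steklov_bform => u w; exact: bform_ae.
have rint' : (\int[arclength]_(x in Gamma) rho' x)%:E = (alpha%:E * arclength (Gamma : set (arcT R)))%E.
  rewrite -rint -(ae_eq_Rintegral mG mr mr' rr') /Rintegral fineK// rint fin_numM//.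
  by rewrite ge0_fin_numE ?measure_ge0.
have [S [mS SG aS bS]] := approximating_sequence W.
exists S; first by move=> n; split=> //; rewrite aS.
have Wn n := weight_indic O (mS n).
(* On a boundary of length 0 all weights define the same form and the sequence is constant;
   otherwise [alpha] and the length are nonzero, so no weight is degenerate. *)
have [G0|G0] := eqVneq (arclength (Gamma : set (arcT R))) 0%E.
  have Gn (P : arcT R -> Prop) : {ae arclength, forall x, Gamma x -> P x}.
    exists Gamma; split=> // x /not_implyP[]//.
  have -> : (fun n => steklov_neumann Omega (S n) k) = (fun=> steklov Omega rho' k).
    by apply/funext => n; apply: steklov_bform => u w; apply: (bform_ae HL _ _ (Wn n).1 mr'); exact: Gn.
  exact: cvg_cst.
have nz : bform rho' (one O) (one O) != 0.
  rewrite (bform_one HL W) -eqe rint' mule_eq0 eqe gt_eqF//=.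
have nzn n : bform (\1_(S n)) (one O) (one O) != 0.
  rewrite (bform_one HL (Wn n)) /Rintegral (integral_indic arclength mG (mS n)) (setIidl (SG n)) aS /=.
  by rewrite -(bform_one HL W).
exact (steklov_cvg HL Oc ler01 Wn W nzn nz bS).
Qed.

(** Indicators of admissible sets are admissible weights, which gives one inequality in each case;
    the other holds because each eigenvalue of a weight is a limit of eigenvalues of sets. *)
Lemma relaxation (alpha : R) k : 0 < alpha ->
  ereal_inf [set steklov Omega rho k | rho in admissible Omega alpha] =
  ereal_inf [set steklov_neumann Omega S k | S in admissible_sets Omega alpha] /\
  ereal_sup [set steklov_neumann Omega S k | S in admissible_sets Omega alpha] =
  ereal_sup [set steklov Omega rho k | rho in admissible Omega alpha].
Proof.
move=> a0.
have sub : [set steklov_neumann Omega S k | S in admissible_sets Omega alpha] `<=`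
    [set steklov Omega rho k | rho in admissible Omega alpha].
  by move=> _ [S AS <-]; exists (\1_S) => //; exact: indic_admissible.
split; apply/le_anti/andP; split.
- exact: ereal_inf_le_tmp.
- apply: le_ereal_inf_tmp => _ [rho Ar <-]; have [S AS cS] := approximation_by_sets k a0 Ar.
  apply: (@cvge_ge _ \oo _ _ _ _ _ _ cS); apply: nearW => n.
  by apply: ereal_inf_lbound; exists (S n).
- exact: ereal_sup_le.
- apply: ge_ereal_sup => _ [rho Ar <-]; have [S AS cS] := approximation_by_sets k a0 Ar.
  apply: (@cvge_le _ \oo _ _ _ _ _ _ cS); apply: nearW => n.
  by apply: ereal_sup_ubound; exists (S n).
Qed.

End Relaxation.

Lemma bounded_set_csq (R : realType) (A : set (R * R)) : bounded_set A -> exists r, A `<=` csq (0, 0) r.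
Proof.
move=> /pinfty_ex_gt0[M _ AM]; exists M => x /AM /=.
by rewrite prod_normE ge_max /csq/= !subr0 => /andP[].
Qed.

Theorem theorem1p3 (R : realType) (Omega : set (R * R))
  (Omega_bounded : bounded_set Omega)
  (Omega_open : open Omega)
  (Omega_connected : connected Omega)
  (Omega_lipschitz : lipschitz_boundary Omega)
  (boundary_connected : connected (boundary Omega)) :
  (forall (rho : arcT R -> R) (S : nat -> set (arcT R)),
    Linfty Omega rho ->
    (forall n, measurable (S n : set (arcT R))) ->
    (forall n, S n `<=` boundary Omega) ->
    (forall A : set (arcT R), measurable (A : set (arcT R)) -> A `<=` boundary Omega ->
      (fun n => arclength (A `&` S n)) @ \oo -->
      (\int[arclength]_(x in A) (rho x)%:E)%E) ->
    ~ ae_zero Omega rho ->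
    (forall n, ~ ae_zero Omega (\1_(S n))) ->
    weakstar_cvg Omega (fun n => \1_(S n)) rho /\
    forall k : nat,
      (fun n => steklov Omega (\1_(S n)) k) @ \oo --> steklov Omega rho k) /\
  (forall (k : nat) (alpha : R), (1 <= k)%N -> 0 < alpha <= 1 ->
    ereal_inf [set steklov Omega rho k | rho in admissible Omega alpha] =
    ereal_inf [set steklov_neumann Omega S k | S in admissible_sets Omega alpha]
    /\
    ereal_sup [set steklov_neumann Omega S k | S in admissible_sets Omega alpha] =
    ereal_sup [set steklov Omega rho k | rho in admissible Omega alpha]).
Proof.
have [r Or] := bounded_set_csq Omega_bounded.
pose O := BoundedDomain Omega_open Or.
split=> [rho S|k alpha _ /andP[a0 _]].
  exact: (weakstar_continuity (O := O) Omega_lipschitz Omega_connected).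
exact: (relaxation (O := O) Omega_lipschitz Omega_connected k a0).
Qed.
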